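(* If $(u_{j,0})$ is an orthonormal system in $L^2(\mathbb{R}^d)$, and for each $j$, $u_j$ denotes the solution on $\mathbb{R}^d\times\mathbb{R}$ of the free Schrödinger equation $2\pi i\,\partial_t u=\Delta u$ with initial datum $u_{j,0}$, then for weight functions $w$ on $\mathbb{R}^{d+1}$, $$\sum_j\left(\int_{\mathbb{R}^{d+1}}|u_j|^2w\right)^2\leq\|\rho^*w\|_{L^2(M)}^2,$$ where $$M=\bigcup_j\operatorname{supp}\big(W(u_{j,0},u_{j,0})\big)\subseteq\bigcup_j\big(\operatorname{supp}(u_{j,0})^\diamond\times\operatorname{supp}(\widehat{u}_{j,0})^\diamond\big),$$ and $E^\diamond=\frac12(E+E)$ is the midpoint set of a subset $E\subseteq\mathbb{R}^d$.
   Context: The Fourier transform is $\widehat f(\xi)=\int_{\mathbb{R}^d}f(x)e^{-2\pi i x\cdot\xi}\,\mathrm{d}x$. The classical Wigner distribution of $u_0\in L^2(\mathbb{R}^d)$ is $$W(u_0,u_0)(x,v)=\int_{\mathbb{R}^d}u_0\left(x+\frac y2\right)\overline{u_0\left(x-\frac y2\right)}e^{-2\pi i v\cdot y}\,\mathrm{d}y,\qquad (x,v)\in\mathbb{R}^d\times\mathbb{R}^d,$$ and $\operatorname{supp}$ denotes support. The operator $\rho^*$ is the (parametrised) space-time X-ray transform $$\rho^*w(x,v)=\int_{-\infty}^\infty w(x-tv,t)\,\mathrm{d}t,\qquad (x,v)\in\mathbb{R}^d\times\mathbb{R}^d.$$ The integral on the left-hand side is $\int_{\mathbb{R}^{d+1}}|u_j(x,t)|^2w(x,t)\,\mathrm{d}x\,\mathrm{d}t$,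 and $\|\rho^*w\|_{L^2(M)}^2=\int_M|\rho^*w(x,v)|^2\,\mathrm{d}x\,\mathrm{d}v$. Weight functions are general locally integrable functions, which may be taken in an appropriate class of test functions such as the Schwartz class.
   Formalization: The inequality uses ρ*w(x,2v) in place of ρ*w(x,v); w is real and either nonnegative locally integrable or Schwartz; supp W is placed in the union of products of closures of the midpoint sets, while {W≠0} lies in the union of the products themselves. *)

(* Defs.v *)
From HB Require Import structures.
From mathcomp Require Import all_boot all_order all_algebra.
From mathcomp Require Import all_classical all_reals all_analysis.
From mathcomp Require Import complex.

Set Implicit Arguments.
Unset Strict Implicit.
Unset Printing Implicit Defensive.

Import Order.TTheory GRing.Theory Num.Theory.
Import numFieldNormedType.Exports.

Local Open Scope classical_set_scope.
Local Open Scope ring_scope.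
Local Open Scope complex_scope.

(* The Borel sigma-algebra of R^n, generated by the coordinates. *)
Section measurable_rV.
Context {R : realType} (n : nat).

Let coord (i : 'I_n) (x : 'rV[R]_n) : measurableTypeR R := x 0 i.

Let rV_set0 : g_sigma_preimage coord set0.
Proof. exact: sigma_algebra0. Qed.

Let rV_setC A : g_sigma_preimage coord A -> g_sigma_preimage coord (~` A).
Proof. exact: sigma_algebraC. Qed.

Let rV_bigcup (F : (set 'rV[R]_n)^nat) :
  (forall i, g_sigma_preimage coord (F i)) ->
  g_sigma_preimage coord (\bigcup_i (F i)).
Proof. exact: sigma_algebra_bigcup. Qed.

HB.instance Definition _ := @isMeasurable.Build default_measure_display
  'rV[R]_n (g_sigma_preimage coord) rV_set0 rV_setC rV_bigcup.

Lemma measurable_rV_coord (i : 'I_n) :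
  measurable_fun [set: 'rV[R]_n] (fun x => x 0 i : measurableTypeR R).
Proof.
move=> _ Y mY; rewrite setTI; apply: sub_sigma_algebra => /=.
rewrite -bigcup_seq/=; exists i => /=; first by rewrite mem_index_enum.
by exists Y => //; rewrite setTI.
Qed.

Lemma measurable_fun_rVP d (T : measurableType d) (f : T -> 'rV[R]_n) :
  (forall i, measurable_fun [set: T] (fun x => f x 0 i : measurableTypeR R)) ->
  measurable_fun [set: T] f.
Proof.
move=> mf _ A mA; rewrite setTI.
have : g_sigma_preimage (fun i => coord i \o f) (f @^-1` A).
  by rewrite g_sigma_preimage_comp; exists A => //; rewrite setTI.
apply: smallest_sub; first exact: sigma_algebra_measurable.
rewrite -bigcup_seq => B [i _] [C mC <-]; exact: mf.
Qed.

End measurable_rV.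

Section lebesgue_rV.
Context {R : realType}.

Definition consrV n (z : measurableTypeR R * 'rV[R]_n) : 'rV[R]_n.+1 :=
  \row_i (if unlift ord0 i is Some j then z.2 0 j else z.1).

Definition unconsrV n (x : 'rV[R]_n.+1) : measurableTypeR R * 'rV[R]_n :=
  (x 0 ord0, \row_j x 0 (lift ord0 j)).

Lemma consrVK n : cancel (@consrV n) (@unconsrV n).
Proof.
move=> [t x]; rewrite /unconsrV /consrV mxE unlift_none; congr pair.
by apply/rowP => j; rewrite !mxE liftK.
Qed.

Lemma measurable_consrV n : measurable_fun setT (@consrV n).
Proof.
apply: measurable_fun_rVP => i.
case: (unliftP ord0 i) => [j ij|i0].
  rewrite (_ : (fun _ => _) = (fun x : 'rV[R]_n => x 0 j) \o snd).
    exact: measurableT_comp (measurable_rV_coord j) measurable_snd.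
  by apply/funext => z; rewrite /consrV mxE ij liftK.
rewrite (_ : (fun _ => _) = fst); first exact: measurable_fst.
by apply/funext => z; rewrite /consrV mxE i0 unlift_none.
Qed.

Lemma measurable_unconsrV n : measurable_fun setT (@unconsrV n).
Proof.
apply/measurable_fun_pairP; split; first exact: measurable_rV_coord.
apply: measurable_fun_rVP => i.
rewrite (_ : (fun _ => _) = (fun x : 'rV[R]_n.+1 => x 0 (lift ord0 i))).
  exact: measurable_rV_coord.
by apply/funext => x /=; rewrite mxE.
Qed.

Section cons.
Variables (n : nat) (m : {sigma_finite_measure set 'rV[R]_n -> \bar R}).

Definition lebesgue_cons : set 'rV[R]_n.+1 -> \bar R :=
  pushforward (lebesgue_measure \x m)%E (@consrV n).

Let lebesgue_cons0 : lebesgue_cons set0 = 0%E.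
Proof. by rewrite /lebesgue_cons /pushforward preimage_set0 measure0. Qed.

Let lebesgue_cons_ge0 A : (0 <= lebesgue_cons A)%E.
Proof. exact: (measure_ge0 (lebesgue_measure \x m)%E). Qed.

Let lebesgue_cons_sigma_additive : semi_sigma_additive lebesgue_cons.
Proof.
exact: (@measure_semi_sigma_additive _ _ _
  (measure_function_pushforward__canonical__measure_function_Measure
    (lebesgue_measure \x m)%E (@measurable_consrV n))).
Qed.

HB.instance Definition _ := isMeasure.Build _ _ _ lebesgue_cons
  lebesgue_cons0 lebesgue_cons_ge0 lebesgue_cons_sigma_additive.

Let lebesgue_cons_sigma_finite : sigma_finite setT lebesgue_cons.
Proof.
have /sigma_finiteP[F [FT ndF Foo]] := sigma_finiteT (@lebesgue_measure R).
have /sigma_finiteP[G [GT ndG Goo]] := sigma_finiteT m.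
exists (fun k => @unconsrV n @^-1` (F k `*` G k)).
  rewrite -preimage_bigcup (_ : \bigcup_k _ = setT) ?preimage_setT//.
  apply/seteqP; split => // -[t x] _.
  have [i _ Ft] : (\bigcup_k F k) t by rewrite -FT.
  have [j _ Gx] : (\bigcup_k G k) x by rewrite -GT.
  exists (maxn i j) => //; split.
  - by move: t Ft; exact/subsetPset/ndF/leq_maxl.
  - by move: x Gx; exact/subsetPset/ndG/leq_maxr.
move=> k; have [mF Fk] := Foo k; have [mG Gk] := Goo k; split.
  rewrite -[X in measurable X]setTI; apply: measurable_unconsrV => //.
  exact: measurableX.
rewrite /lebesgue_cons /pushforward -comp_preimage.
rewrite (_ : _ \o _ = id); last by apply/funext => z; exact: consrVK.
by rewrite preimage_id product_measure1E// lte_mul_pinfty// ge0_fin_numE.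
Qed.

HB.instance Definition _ := Measure_isSigmaFinite.Build _ _ _ lebesgue_cons
  lebesgue_cons_sigma_finite.

End cons.

Definition lebesgue_nil : set 'rV[R]_0 -> \bar R := \d_(0 : 'rV[R]_0).

HB.instance Definition _ := Measure.on lebesgue_nil.

Let lebesgue_nil_sigma_finite : sigma_finite setT lebesgue_nil.
Proof.
exists (fun=> setT); first by rewrite bigcup_const.
by move=> _; split=> //; rewrite /lebesgue_nil diracT ltry.
Qed.

HB.instance Definition _ := Measure_isSigmaFinite.Build _ _ _ lebesgue_nil
  lebesgue_nil_sigma_finite.

Fixpoint lebesgue_rV (n : nat) : {sigma_finite_measure set 'rV[R]_n -> \bar R} :=
  if n is n'.+1 then lebesgue_cons (lebesgue_rV n') else lebesgue_nil.

Lemma lebesgue_rV_box n (A : 'I_n -> set (measurableTypeR R)) :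
  (forall i, measurable (A i)) ->
  lebesgue_rV n [set x | forall i, A i (x 0 i)] =
  (\prod_(i < n) lebesgue_measure (A i))%E.
Proof.
elim: n A => [|n IH] A mA.
  by rewrite big_ord0 /= /lebesgue_nil diracE mem_set// => -[].
have mB : measurable [set x : 'rV[R]_n | forall j, A (lift ord0 j) (x 0 j)].
  rewrite (_ : [set x | _] = \bigcap_(i in [set: 'I_n])
      (fun x : 'rV[R]_n => x 0 i) @^-1` A (lift ord0 i)); last first.
    by apply/seteqP; split => x /= h i; [move=> _|]; exact: h.
  apply: fin_bigcap_measurable => // i _; rewrite -[X in measurable X]setTI.
  exact: measurable_rV_coord.
rewrite big_ord_recl -(IH (fun j => A (lift ord0 j)))// -product_measure1E//.
rewrite /= /lebesgue_cons /pushforward.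
congr (product_measure1 _ _ _); apply/seteqP; split => -[t x] /=.
  move=> h; split=> [|i]; first by have := h ord0; rewrite /consrV mxE unlift_none.
  by have := h (lift ord0 i); rewrite /consrV mxE liftK.
move=> [At Ax] i; rewrite /consrV mxE.
by case: unliftP => [j ->|->]; [exact: Ax|].
Qed.

End lebesgue_rV.
Arguments lebesgue_rV R n : clear implicits.

Section complex_integration.
Context {R : realType}.

Definition sqnormc (z : R[i]) : R := complex.Re z ^+ 2 + complex.Im z ^+ 2.

Definition expi (theta : R) : R[i] := cos theta +i* sin theta.

Context {d} {T : measurableType d} (mu : {measure set T -> \bar R}).

Definition cmeasurable (f : T -> R[i]) :=
  measurable_fun [set: T] (fun x => complex.Re (f x)) /\
  measurable_fun [set: T] (fun x => complex.Im (f x)).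

Definition cintegral (f : T -> R[i]) : R[i] :=
  (\int[mu]_x complex.Re (f x)) +i* (\int[mu]_x complex.Im (f x)).

Definition square_integrable (f : T -> R[i]) :=
  cmeasurable f /\ (\int[mu]_x (sqnormc (f x))%:E < +oo)%E.

Definition orthonormal_L2 (J : choiceType) (f : J -> T -> R[i]) :=
  (forall j, square_integrable (f j)) /\
  (forall j k, cintegral (fun x => f j x * conjc (f k x)) = (j == k)%:R).

End complex_integration.

Section smooth.
Context {R : realType} {V : normedModType R}.

Definition iter_derive (s : seq V) (f : V -> R) : V -> R :=
  foldr (fun v g x => 'D_v g x) f s.

Definition smooth (f : V -> R) := forall s : seq V,
  continuous (iter_derive s f) /\
  (forall x v, derivable (iter_derive s f) x v).

Definition test_function (f : V -> R) :=
  smooth f /\ compact (closure [set x | f x != 0]).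

Definition schwartz (f : V -> R) := smooth f /\
  forall (s : seq V) (k : nat), exists C : R,
    forall x, `|x| ^+ k * `|iter_derive s f x| <= C.

End smooth.

Section phase_space.
Context {R : realType} {d : nat}.
Implicit Types (f g : 'rV[R]_d -> R[i]) (E : set 'rV[R]_d).

Definition dot (x y : 'rV[R]_d) : R := \sum_(i < d) x 0 i * y 0 i.

Definition fourier f (xi : 'rV[R]_d) : R[i] :=
  cintegral (lebesgue_rV R d) (fun x => f x * expi (- (2 * pi * dot x xi))).

(* [g] represents the Fourier-Plancherel transform of [f]: it is the L^2 limit
   of the Fourier integrals of the truncations of [f] to the cubes [-n, n]^d
   (the norm on ['rV_d] is the sup norm). *)
Definition fourier_L2 f g :=
  square_integrable (lebesgue_rV R d) g /\
  (fun n : nat => \int[lebesgue_rV R d]_xi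
     (sqnormc (fourier (fun x => if `|x| <= n%:R then f x else 0) xi - g xi))%:E)%E
    @ \oo --> 0%E.

Definition wigner f g (x v : 'rV[R]_d) : R[i] :=
  cintegral (lebesgue_rV R d) (fun y =>
    f (x + 2^-1 *: y) * conjc (g (x - 2^-1 *: y)) * expi (- (2 * pi * dot v y))).

(* The support of an L^2 class: the complement of the largest open set on which
   [f] vanishes almost everywhere. *)
Definition esupp f : set 'rV[R]_d :=
  [set x | forall U, open U -> U x ->
     ~ (lebesgue_rV R d).-negligible (U `&` [set y | f y != 0])].

(* Not closed in general, even when [E] is. *)
Definition midpoints E : set 'rV[R]_d :=
  [set x | exists a b, [/\ E a, E b & x = 2^-1 *: (a + b)]].

End phase_space.

Section space_time.
Context {R : realType} {d : nat}.
Implicit Types (u : 'rV[R]_d * R -> R[i]) (w phi : 'rV[R]_d * R -> R).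

Definition dt phi (z : 'rV[R]_d * R) : R := 'D_(0 : 'rV[R]_d, 1 : R) phi z.

Definition dx (i : 'I_d) phi (z : 'rV[R]_d * R) : R :=
  'D_(delta_mx 0 i : 'rV[R]_d, 0 : R) phi z.

Definition laplacian phi (z : 'rV[R]_d * R) : R :=
  \sum_(i < d) dx i (dx i phi) z.

(* [u] is the solution in C(R; L^2(R^d)) of 2 pi i u_t = Delta u with datum
   [u0], the equation being understood in the sense of distributions on
   R^d x R: int u (2 pi i phi_t + Delta phi) = 0. Real test functions suffice
   by linearity. *)
Definition schrodinger_solution (u0 : 'rV[R]_d -> R[i]) u :=
  [/\ @cmeasurable _ _ ('rV[R]_d * measurableTypeR R)%type u,
      (forall t, square_integrable (lebesgue_rV R d) (fun x => u (x, t))),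
      (forall t0, (\int[lebesgue_rV R d]_x
         (sqnormc (u (x, t) - u (x, t0)))%:E)%E @[t --> t0] --> 0%E),
      {ae lebesgue_rV R d, forall x, u (x, 0) = u0 x} &
      forall phi, test_function phi ->
        cintegral (lebesgue_rV R d \x lebesgue_measure)%E
          (fun z => u z * (laplacian phi z +i* (2 * pi * dt phi z))) = 0].

(* Real weights. Nonnegative ones need only be locally integrable, all the
   integrals below then being defined in [0, +oo]; for sign-changing ones the
   integrals have to converge, hence the Schwartz class. *)
Definition weight w :=
  [/\ measurable_fun [set: 'rV[R]_d * measurableTypeR R] w,
      (forall K : set ('rV[R]_d * R), compact K ->
         (\int[lebesgue_rV R d \x lebesgue_measure]_(z in K) `|w z|%:E < +oo)%E) &
      (forall z, 0 <= w z) \/ schwartz w].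

(* Pitfall: a solution of 2 pi i u_t = Delta u satisfies
   W(u(t), u(t))(x, v) = W(u0, u0)(x + 2 t v, v), so that formally
   int |u|^2 w = int W(u0, u0)(x, v) (xray w x (2 v)) dx dv. *)
Definition xray w (x v : 'rV[R]_d) : \bar R :=
  (\int[lebesgue_measure]_t (w ((x - t *: v, t)%R))%:E)%E.

End space_time.

(* Main.v *)
(* With W_j the Wigner distribution of u_{j,0}, Moyal's identity turns
   orthonormality into the Bessel inequality int (sum_j c_j W_j)^2 <= sum_j c_j^2.
   The Wigner distribution of a solution is transported,
   W(u(t))(x, v) = W(u(0))(x + 2 t v, v), so c_j := int |u_j|^2 w equals
   int W_j X with X(x, v) = (xray w)(x, 2 v), an integral that only sees M. Hence
   sum_j c_j^2 = int_M (sum_j c_j W_j) X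
     <= (1/2) int (sum_j c_j W_j)^2 + (1/2) int_M X^2
     <= (1/2) sum_j c_j^2 + (1/2) int_M X^2.
   For the transport, a weak solution is tested against plane waves
   e^{-2 pi i (x.xi + t |xi|^2)} cut off at scale k: the commutator with the
   cut-off vanishes as k -> oo, so (u(t))^ (xi) e^{-2 pi i t |xi|^2} does not depend
   on t.
   The identity int |u|^2 w = int W X is only conditionally convergent in v; it is
   obtained as the limit e -> 0 of its regularization by the factor
   prod_i e^{-e |v_i|}, whose Fourier transform is a positive approximate identity. *)
From HB Require Import structures.
From mathcomp Require Import all_boot all_order all_algebra.
From mathcomp Require Import all_classical all_reals all_analysis.
From mathcomp Require Import measurable_realfun complex ring lra.
Require Import Defs.

Set Implicit Arguments.
Unset Strict Implicit.
Unset Printing Implicit Defensive.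

Import Order.TTheory GRing.Theory Num.Theory.
Import numFieldNormedType.Exports.

Local Open Scope classical_set_scope.
Local Open Scope ring_scope.
Local Open Scope complex_scope.

(** * Complex integrals *)

Section modulus.
Context {R : realType}.
Implicit Types z w : R[i].

(** The Fourier transform is available only as an absolutely convergent integral. Frequency-side
    statements are therefore made for truncated functions, comparing pairs of sequences that need
    not have a known limit there; only Wigner distributions, defined at every point for L2 data and
    continuous in it, pass to the limit. The commutator with the cut-off carries a factor [xi], so
    it is small only for [xi] in a fixed cube. Tightness in frequency is supplied separately: by
    Plancherel, the transforms of the truncations form a Cauchy sequence in L2. The regularizing
    kernel is a product of [e^{-|v_i|}] because its transform is a rational function that explicit
    primitives compute, and because its translates are bounded by multiples of itself. All exchanges
    of integrals are made for weights with product decay; a general nonnegative weight is an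
    increasing limit of such weights. Cauchy-Schwarz is replaced by weighted AM-GM inequalities,
    which make sense in the extended reals. As [J] may be uncountable, [M] need not be measurable:
    estimates are made for finite subfamilies, and the integral is monotone in its domain. *)

Definition cabs z : R := Num.sqrt (sqnormc z).

Lemma sqnormc_ge0 z : 0 <= sqnormc z.
Proof. by rewrite addr_ge0 ?sqr_ge0. Qed.

Lemma sqr_cabs z : cabs z ^+ 2 = sqnormc z.
Proof. by rewrite sqr_sqrtr ?sqnormc_ge0. Qed.

Lemma cabs_ge0 z : 0 <= cabs z.
Proof. exact: sqrtr_ge0. Qed.

Lemma cabsE z : cabs z = ComplexField.Normc.normc z.
Proof. by case: z. Qed.

Lemma cabsM z w : cabs (z * w) = cabs z * cabs w.
Proof. by rewrite !cabsE ComplexField.Normc.normcM. Qed.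

Lemma cabsD z w : cabs (z + w) <= cabs z + cabs w.
Proof. by rewrite !cabsE; exact: le_normcD. Qed.

Lemma cabsN z : cabs (- z) = cabs z.
Proof. by rewrite !cabsE normcN. Qed.

Lemma cabsB z w : cabs (z - w) = cabs (w - z).
Proof. by rewrite -cabsN opprB. Qed.

Lemma cabsJ z : cabs (conjc z) = cabs z.
Proof. by rewrite /cabs /sqnormc; case: z => a b /=; rewrite sqrrN. Qed.

Lemma cabs_real (x : R) : cabs x%:C = `|x|.
Proof. by rewrite /cabs /sqnormc /= expr0n addr0 sqrtr_sqr. Qed.

Lemma cabs0 : cabs 0 = 0.
Proof. by rewrite (cabs_real 0) normr0. Qed.

Lemma cabs_expi (x : R) : cabs (expi x) = 1.
Proof. by rewrite /cabs /sqnormc /= cos2Dsin2 sqrtr1. Qed.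

Lemma Re_le_cabs z : `|complex.Re z| <= cabs z.
Proof.
by rewrite -sqrtr_sqr ler_wsqrtr// lerDl sqr_ge0.
Qed.

Lemma Im_le_cabs z : `|complex.Im z| <= cabs z.
Proof.
by rewrite -sqrtr_sqr ler_wsqrtr// lerDr sqr_ge0.
Qed.

Lemma cabs_le z : cabs z <= `|complex.Re z| + `|complex.Im z|.
Proof.
rewrite -[leRHS]ger0_norm ?addr_ge0// -[leRHS]sqrtr_sqr ler_wsqrtr//.
by rewrite /sqnormc sqrrD !real_normK ?num_real// addrAC lerDl mulrn_wge0// mulr_ge0.
Qed.

Lemma sqnormcE z : (sqnormc z)%:C = z * conjc z.
Proof.
by case: z => a b; apply/eqP; rewrite eq_complex /sqnormc /=; apply/andP; split;
  apply/eqP; ring.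
Qed.

Lemma cabs_eq0 z : cabs z = 0 -> z = 0.
Proof. by rewrite cabsE; exact: ComplexField.Normc.eq0_normc. Qed.

Lemma expiD (a b : R) : expi (a + b) = expi a * expi b.
Proof.
by apply/eqP; rewrite eq_complex /= cosD sinD eqxx/= addrC; apply/eqP; ring.
Qed.

Lemma expi0 : expi 0 = 1 :> R[i].
Proof. by rewrite /expi cos0 sin0. Qed.

Lemma conjcM z w : conjc (z * w) = conjc z * conjc w.
Proof. exact: rmorphM. Qed.

Lemma conjc_expi (a : R) : conjc (expi a) = expi (- a).
Proof. by rewrite /expi cosN sinN. Qed.

Lemma sqnormcD_le z w : sqnormc (z + w) <= 2 * (sqnormc z + sqnormc w).
Proof.
case: z w => a b [c e]; rewrite /sqnormc /=.
have := sqr_ge0 (a - c); have := sqr_ge0 (b - e); rewrite !sqrrB !sqrrD; nra.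
Qed.

Lemma sqnormcM z w : sqnormc (z * w) = sqnormc z * sqnormc w.
Proof. by rewrite -!sqr_cabs cabsM exprMn. Qed.

End modulus.

Section cmeasurable.
Context {R : realType} {d} {T : measurableType d}.
Implicit Types f g : T -> R[i].

Lemma cmeasurable_cst (c : R[i]) : cmeasurable (fun _ : T => c).
Proof. by split; exact: measurable_cst. Qed.

Lemma cmeasurableD f g : cmeasurable f -> cmeasurable g ->
  cmeasurable (fun x => f x + g x).
Proof.
move=> [rf jf] [rg jg]; split.
  rewrite (_ : (fun _ => _) = (fun x => complex.Re (f x) + complex.Re (g x))).
    exact: measurable_funD.
  by apply/funext => x; rewrite raddfD.
rewrite (_ : (fun _ => _) = (fun x => complex.Im (f x) + complex.Im (g x))).
  exact: measurable_funD.
by apply/funext => x; rewrite raddfD.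
Qed.

Lemma cmeasurableM f g : cmeasurable f -> cmeasurable g ->
  cmeasurable (fun x => f x * g x).
Proof.
move=> [rf jf] [rg jg]; split.
  rewrite (_ : (fun _ => _) = (fun x => complex.Re (f x) * complex.Re (g x)
     - complex.Im (f x) * complex.Im (g x))).
    by apply: measurable_funB; exact: measurable_funM.
  by apply/funext => x; case: (f x) (g x) => ? ? [? ?].
rewrite (_ : (fun _ => _) = (fun x => complex.Re (f x) * complex.Im (g x)
     + complex.Im (f x) * complex.Re (g x))).
  by apply: measurable_funD; exact: measurable_funM.
by apply/funext => x; case: (f x) (g x) => ? ? [? ?].
Qed.

Lemma cmeasurable_conj f : cmeasurable f -> cmeasurable (fun x => conjc (f x)).
Proof.
move=> [rf jf]; split.
  rewrite (_ : (fun _ => _) = (fun x => complex.Re (f x)))//.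
  by apply/funext => x; case: (f x).
rewrite (_ : (fun _ => _) = (fun x => - complex.Im (f x))).
  exact: measurableT_comp.
by apply/funext => x; case: (f x).
Qed.

Lemma cmeasurableN f : cmeasurable f -> cmeasurable (fun x => - f x).
Proof.
move=> mf; rewrite (_ : (fun _ => _) = (fun x => (-1) * f x)).
  exact: cmeasurableM (cmeasurable_cst _) mf.
by apply/funext => x; rewrite mulN1r.
Qed.

Lemma cmeasurableB f g : cmeasurable f -> cmeasurable g ->
  cmeasurable (fun x => f x - g x).
Proof. by move=> mf mg; apply: cmeasurableD => //; exact: cmeasurableN. Qed.

Lemma cmeasurable_sum I (s : seq I) (h : I -> T -> R[i]) :
  (forall i, cmeasurable (h i)) -> cmeasurable (fun x => \sum_(i <- s) h i x).
Proof.
move=> mh; elim: s => [|i s IH].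
  by under eq_fun do rewrite big_nil; exact: cmeasurable_cst.
by under eq_fun do rewrite big_cons; exact: cmeasurableD.
Qed.

Lemma cmeasurable_real (r : T -> R) : measurable_fun setT r ->
  cmeasurable (fun x => (r x)%:C).
Proof. by move=> mr; split => //=; exact: measurable_cst. Qed.

Lemma cmeasurable_expi (r : T -> R) : measurable_fun setT r ->
  cmeasurable (fun x => expi (r x)).
Proof.
move=> mr; split => /=.
  apply: (measurableT_comp _ mr).
  by apply: continuous_measurable_fun; exact: continuous_cos.
apply: (measurableT_comp _ mr).
by apply: continuous_measurable_fun; exact: continuous_sin.
Qed.

Lemma cmeasurable_comp d' (T' : measurableType d') (h : T' -> T) f :
  measurable_fun setT h -> cmeasurable f -> cmeasurable (fun x => f (h x)).
Proof. by move=> mh [rf jf]; split; [exact: (measurableT_comp rf mh)|exact: (measurableT_comp jf mh)]. Qed.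

Lemma measurable_sqnormc f : cmeasurable f ->
  measurable_fun setT (fun x => sqnormc (f x)).
Proof. by move=> [rf jf]; apply: measurable_funD; exact: measurable_funX. Qed.

Lemma measurable_cabs f : cmeasurable f ->
  measurable_fun setT (fun x => cabs (f x)).
Proof.
move=> mf; apply: (measurableT_comp _ (measurable_sqnormc mf)).
by apply: continuous_measurable_fun; exact: sqrt_continuous.
Qed.

Lemma emeasurable_cabs f : cmeasurable f ->
  measurable_fun setT (fun x => (cabs (f x))%:E).
Proof. by move=> mf; apply/measurable_EFinP; exact: measurable_cabs. Qed.

Lemma emeasurable_sqnormc f : cmeasurable f ->
  measurable_fun setT (fun x => (sqnormc (f x))%:E).
Proof. by move=> mf; apply/measurable_EFinP; exact: measurable_sqnormc. Qed.

Lemma cmeasurable_neq0 f : cmeasurable f -> measurable [set x | f x != 0].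
Proof.
move=> mf; rewrite (_ : [set x | _] = [set x | sqnormc (f x) != 0]).
  rewrite -[X in measurable X]setTI.
  rewrite (_ : [set x | _] = (fun x => sqnormc (f x)) @^-1` ~` [set 0]).
    by apply: measurable_sqnormc => //; exact: measurableC.
  by apply/seteqP; split => x /= /eqP.
apply/seteqP; split => x /=; apply: contra_neq => f0.
  by apply: cabs_eq0; rewrite /cabs f0 sqrtr0.
by rewrite f0 /sqnormc /= expr0n addr0.
Qed.

End cmeasurable.

Section cintegral_theory.
Context {R : realType} {d} {T : measurableType d}.
Variable mu : {measure set T -> \bar R}.
Implicit Types f g : T -> R[i].

Definition cintegrable f :=
  cmeasurable f /\ (\int[mu]_x (cabs (f x))%:E < +oo)%E.

Lemma cintegrable_Re f : cintegrable f ->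
  mu.-integrable setT (EFin \o (fun x => complex.Re (f x))).
Proof.
move=> [mf foo]; apply/integrableP; split; first exact/measurable_EFinP/mf.1.
apply: le_lt_trans foo; apply: ge0_le_integral => //=.
- by apply/measurable_EFinP; apply: measurableT_comp => //; exact: mf.1.
- exact: emeasurable_cabs.
- by move=> x _; rewrite lee_fin Re_le_cabs.
Qed.

Lemma cintegrable_Im f : cintegrable f ->
  mu.-integrable setT (EFin \o (fun x => complex.Im (f x))).
Proof.
move=> [mf foo]; apply/integrableP; split; first exact/measurable_EFinP/mf.2.
apply: le_lt_trans foo; apply: ge0_le_integral => //=.
- by apply/measurable_EFinP; apply: measurableT_comp => //; exact: mf.2.
- exact: emeasurable_cabs.
- by move=> x _; rewrite lee_fin Im_le_cabs.
Qed.

Lemma cintegrable_ge0 (r : T -> R) : (forall x, 0 <= r x) ->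
  measurable_fun setT r -> (\int[mu]_x (r x)%:E < +oo)%E ->
  mu.-integrable setT (EFin \o r).
Proof.
move=> r0 mr roo; apply/integrableP; split; first exact/measurable_EFinP.
by under eq_integral do rewrite /= ger0_norm//.
Qed.

Lemma cintegrable_le f (r : T -> R) : cmeasurable f ->
  measurable_fun setT r -> (forall x, cabs (f x) <= r x) ->
  (\int[mu]_x (r x)%:E < +oo)%E -> cintegrable f.
Proof.
move=> mf mr fr roo; split => //; apply: le_lt_trans roo.
apply: ge0_le_integral => //=.
- by move=> x _; rewrite lee_fin cabs_ge0.
- exact: emeasurable_cabs.
- exact/measurable_EFinP.
- by move=> x _; rewrite lee_fin.
Qed.

Lemma cintegrableD f g : cintegrable f -> cintegrable g ->
  cintegrable (fun x => f x + g x).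
Proof.
move=> [mf foo] [mg goo]; apply: (@cintegrable_le _ (fun x => cabs (f x) + cabs (g x))).
- exact: cmeasurableD.
- by apply: measurable_funD; exact: measurable_cabs.
- by move=> x; exact: cabsD.
- under eq_integral do rewrite EFinD.
  rewrite ge0_integralD//=.
  + exact: lte_add_pinfty.
  + by move=> x _; rewrite lee_fin cabs_ge0.
  + exact: emeasurable_cabs.
  + by move=> x _; rewrite lee_fin cabs_ge0.
  + exact: emeasurable_cabs.
Qed.

Lemma cintegrableZl (c : R[i]) f : cintegrable f -> cintegrable (fun x => c * f x).
Proof.
move=> [mf foo]; split; first exact: cmeasurableM (cmeasurable_cst _) mf.
under eq_integral do rewrite cabsM EFinM.
rewrite ge0_integralZl//=.
- by rewrite lte_mul_pinfty ?lee_fin ?cabs_ge0.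
- exact: emeasurable_cabs.
- by move=> x _; rewrite lee_fin cabs_ge0.
- by rewrite lee_fin cabs_ge0.
Qed.

Lemma cintegrableN f : cintegrable f -> cintegrable (fun x => - f x).
Proof. by move=> /(cintegrableZl (-1)); under eq_fun do rewrite mulN1r. Qed.

Lemma cintegrableB f g : cintegrable f -> cintegrable g ->
  cintegrable (fun x => f x - g x).
Proof. by move=> mf mg; apply: cintegrableD => //; exact: cintegrableN. Qed.

Lemma cintegrable_sum I (s : seq I) (h : I -> T -> R[i]) :
  (forall i, cintegrable (h i)) -> cintegrable (fun x => \sum_(i <- s) h i x).
Proof.
move=> ih; elim: s => [|i s IH].
  under eq_fun do rewrite big_nil; split; first exact: cmeasurable_cst.
  by rewrite cabs0 integral0.
by under eq_fun do rewrite big_cons; exact: cintegrableD.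
Qed.

Lemma cintegrable_conj f : cintegrable f -> cintegrable (fun x => conjc (f x)).
Proof.
by move=> [mf foo]; split; [exact: cmeasurable_conj|under eq_integral do rewrite cabsJ].
Qed.

Lemma cintegralD f g : cintegrable f -> cintegrable g ->
  cintegral mu (fun x => f x + g x) = cintegral mu f + cintegral mu g.
Proof.
move=> If Ig; rewrite /cintegral.
rewrite (_ : (fun x => complex.Re (f x + g x)) =
   (fun x => complex.Re (f x) + complex.Re (g x))); last first.
  by apply/funext => x; rewrite raddfD.
rewrite (_ : (fun x => complex.Im (f x + g x)) =
   (fun x => complex.Im (f x) + complex.Im (g x))); last first.
  by apply/funext => x; rewrite raddfD.
by rewrite !RintegralD//;
  [exact: cintegrable_Im|exact: cintegrable_Im|exact: cintegrable_Re|exact: cintegrable_Re].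
Qed.

Lemma cintegralZl (c : R[i]) f : cintegrable f ->
  cintegral mu (fun x => c * f x) = c * cintegral mu f.
Proof.
case: c => a b If; rewrite /cintegral.
have Rf := cintegrable_Re If; have Jf := cintegrable_Im If.
have ZR k : mu.-integrable setT (EFin \o (fun x => k * complex.Re (f x))).
  exact: (integrableZl _ k Rf).
have ZI k : mu.-integrable setT (EFin \o (fun x => k * complex.Im (f x))).
  exact: (integrableZl _ k Jf).
rewrite (_ : (fun x => complex.Re ((a +i* b) * f x)) =
   (fun x => a * complex.Re (f x) - b * complex.Im (f x))); last first.
  by apply/funext => x; case: (f x).
rewrite (_ : (fun x => complex.Im ((a +i* b) * f x)) =
   (fun x => a * complex.Im (f x) + b * complex.Re (f x))); last first.
  by apply/funext => x; case: (f x).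
by rewrite RintegralB// RintegralD// !RintegralZl.
Qed.

Lemma cintegralN f : cintegrable f ->
  cintegral mu (fun x => - f x) = - cintegral mu f.
Proof.
move=> If; rewrite -mulN1r -cintegralZl//; congr cintegral.
by apply/funext => x; rewrite mulN1r.
Qed.

Lemma cintegralB f g : cintegrable f -> cintegrable g ->
  cintegral mu (fun x => f x - g x) = cintegral mu f - cintegral mu g.
Proof.
by move=> If Ig; rewrite cintegralD ?cintegralN//; exact: cintegrableN.
Qed.

Lemma cintegral0 : cintegral mu (fun=> 0) = 0.
Proof. by rewrite /cintegral /Rintegral integral0. Qed.

Lemma cintegral_sum I (s : seq I) (h : I -> T -> R[i]) :
  (forall i, cintegrable (h i)) ->
  cintegral mu (fun x => \sum_(i <- s) h i x) = \sum_(i <- s) cintegral mu (h i).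
Proof.
move=> ih; elim: s => [|i s IH].
  by under eq_fun do rewrite big_nil; rewrite big_nil cintegral0.
under eq_fun do rewrite big_cons; rewrite big_cons cintegralD// ?IH//.
exact: cintegrable_sum.
Qed.

Lemma cintegral_conj f : cintegrable f ->
  cintegral mu (fun x => conjc (f x)) = conjc (cintegral mu f).
Proof.
move=> If; rewrite /cintegral /=; congr Complex.
  by apply: eq_Rintegral => x _; case: (f x).
rewrite -[RHS]mulN1r -RintegralZl//; last exact: cintegrable_Im.
by apply: eq_Rintegral => x _; case: (f x) => a b /=; rewrite mulN1r.
Qed.

Lemma cintegral_real (r : T -> R) :
  cintegral mu (fun x => (r x)%:C) = (\int[mu]_x r x)%:C.
Proof. by rewrite /cintegral /= /Rintegral integral0. Qed.

(** A unimodular constant [c] rotates the integral onto the positive real axis. Its modulus is then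
    the integral of the real part of [c * f], which is bounded pointwise by [cabs (f x)]. *)
Lemma le_cabs_cintegral f : cmeasurable f ->
  ((cabs (cintegral mu f))%:E <= \int[mu]_x (cabs (f x))%:E)%E.
Proof.
move=> mf; have [foo|] := boolP (\int[mu]_x (cabs (f x))%:E < +oo)%E; last first.
  by rewrite -leNgt => /(le_trans _) -> //; rewrite leey.
have If : cintegrable f by [].
set I := cintegral mu f.
have [I0|I0] := eqVneq (cabs I) 0.
  by rewrite I0 integral_ge0// => x _; rewrite lee_fin cabs_ge0.
pose c := (cabs I)^-1%:C * conjc I.
have c1 : cabs c = 1.
  by rewrite cabsM cabsJ cabs_real ger0_norm ?invr_ge0 ?cabs_ge0// mulVf.
have cI : c * I = (cabs I)%:C.
  rewrite /c -mulrA (mulrC (conjc I)) -sqnormcE -sqr_cabs -rmorphM/=.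
  by rewrite expr2 mulrA mulVf// mul1r.
have Icf : cintegrable (fun x => c * f x) by exact: cintegrableZl.
have -> : cabs I = \int[mu]_x complex.Re (c * f x).
  by move: cI; rewrite -cintegralZl// => -[].
rewrite fineK; last exact: integrable_fin_num (cintegrable_Re Icf).
apply: le_trans (lee_abs _) _.
apply: le_trans (le_abse_integral _ _ _) _ => //.
  exact: measurable_int (cintegrable_Re Icf).
apply: ge0_le_integral => //=.
- apply/measurable_EFinP; apply: measurableT_comp => //.
  exact: (cmeasurableM (cmeasurable_cst _) mf).1.
- exact: emeasurable_cabs.
- by move=> x _; rewrite lee_fin (le_trans (Re_le_cabs _))// cabsM c1 mul1r.
Qed.

Lemma cabs_cintegral_le f (M : R) : cmeasurable f ->
  (\int[mu]_x (cabs (f x))%:E <= M%:E)%E -> cabs (cintegral mu f) <= M.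
Proof.
by move=> mf fM; rewrite -lee_fin; apply: le_trans (le_cabs_cintegral mf) fM.
Qed.

(** Convergence of complex quantities is always expressed by the real sequence [cabs (_ - _)]. The
    bound [g] passes to the pointwise limit, so [2 * g] dominates the differences and dominated
    convergence applies to their moduli. *)
Lemma cvg_cintegral (f_ : nat -> T -> R[i]) f (g : T -> R) :
  (forall n, cmeasurable (f_ n)) -> cmeasurable f ->
  (forall x, cabs (f_ n x - f x) @[n --> \oo] --> (0 : R)) ->
  measurable_fun setT g -> (forall n x, cabs (f_ n x) <= g x) ->
  (\int[mu]_x (g x)%:E < +oo)%E ->
  cabs (cintegral mu (f_ n) - cintegral mu f) @[n --> \oo] --> (0 : R).
Proof.
move=> mf_ mf ff mg fg goo.
have g0 x : 0 <= g x by exact: le_trans (cabs_ge0 _) (fg 0%N x).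
have fg' x : cabs (f x) <= g x.
  apply/ler_addgt0Pr => e e0.
  have [n _ /(_ n (leqnn n))] := (cvgr0Pnorm_lt _).1 (ff x) _ e0.
  rewrite ger0_norm ?cabs_ge0// => fe.
  rewrite -(subrK (f_ n x) (f x)) addrC (le_trans (cabsD _ _))// lerD//.
  by rewrite cabsB ltW.
have If n : cintegrable (f_ n) by exact: (cintegrable_le (r := g)).
have If' : cintegrable f by exact: (cintegrable_le (r := g)).
pose G x := (2 * g x)%:E.
pose s n := (\int[mu]_x `|(cabs (f_ n x - f x))%:E - 0|)%E.
have H : s n @[n --> \oo] --> 0%E.
  have h1 n : measurable_fun setT (fun x => (cabs (f_ n x - f x))%:E).
    by apply: emeasurable_cabs; exact: cmeasurableB.
  have h2 : measurable_fun [set: T] (cst 0 : T -> \bar R)%E by [].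
  have h3 : {ae mu, forall x, setT x ->
      (cabs (f_ n x - f x))%:E @[n --> \oo] --> (cst 0 : T -> \bar R)%E x}.
    apply: aeW => x _; apply/fine_cvgP; split; first exact: nearW.
    exact: ff.
  have h4 : mu.-integrable setT G.
    apply: cintegrable_ge0; first by move=> x; rewrite mulr_ge0.
      by apply: measurable_funM.
    under eq_integral do rewrite EFinM.
    rewrite ge0_integralZl//=; first by rewrite lte_mul_pinfty.
      exact/measurable_EFinP.
    by move=> x _; rewrite lee_fin.
  have h5 : {ae mu, forall x n, setT x ->
      (`|(cabs (f_ n x - f x))%:E| <= G x)%E}.
    apply: aeW => x n _ /=; rewrite lee_fin ger0_norm ?cabs_ge0//.
    by rewrite (le_trans (cabsD _ _))// cabsN mulr2n mulrDl !mul1r lerD.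
  by have [] := dominated_convergence measurableT h1 h2 h3 h4 h5.
have -> : (0 : R) = fine 0%E by [].
apply: (@squeeze_cvgr _ _ _ _ (fun=> 0) (fine \o s)); last 2 first.
- exact: cvg_cst.
- by apply: fine_cvg.
apply: nearW => n; rewrite cabs_ge0/= -cintegralB//.
rewrite -lee_fin fineK; last first.
  rewrite ge0_fin_numE; last by apply: integral_ge0 => x _; rewrite abse_ge0.
  rewrite /s; under eq_integral do rewrite sube0 gee0_abs ?lee_fin ?cabs_ge0//.
  by have [] := cintegrableB (If n) If'.
rewrite /s; under eq_integral do rewrite sube0 gee0_abs ?lee_fin ?cabs_ge0//.
by apply: le_cabs_cintegral; exact: cmeasurableB.
Qed.

End cintegral_theory.

(** * Fubini and Tonelli for complex integrands *)

Section fubini.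
Context {R : realType} {d1 d2} {T1 : measurableType d1} {T2 : measurableType d2}.
Variables (m1 : {sigma_finite_measure set T1 -> \bar R}).
Variables (m2 : {sigma_finite_measure set T2 -> \bar R}).
Implicit Types f : T1 * T2 -> R[i].

(** [fine] is measurable and sends infinite inner integrals to 0, so measurability in the parameter
    reduces to Tonelli for the positive and negative parts. *)
Lemma measurable_Rintegral2 (r : T1 * T2 -> R) : measurable_fun setT r ->
  measurable_fun setT (fun x => \int[m2]_y r (x, y)).
Proof.
move=> mr; apply: measurableT_comp => //; under eq_fun do rewrite integralE.
have mr' : measurable_fun setT (EFin \o r) by exact/measurable_EFinP.
apply: emeasurable_funB.
  apply: eq_measurable_fun (measurable_fun_fubini_tonelli_F (m2 := m2) _
    (measurable_funepos mr') (funepos_ge0 _)) => x _.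
  by apply: eq_integral => y _; rewrite !funeposE.
apply: eq_measurable_fun (measurable_fun_fubini_tonelli_F (m2 := m2) _
    (measurable_funeneg mr') (funeneg_ge0 _)) => x _.
  by apply: eq_integral => y _; rewrite !funenegE.
Qed.

Lemma measurable_Rintegral1 (r : T1 * T2 -> R) : measurable_fun setT r ->
  measurable_fun setT (fun y => \int[m1]_x r (x, y)).
Proof.
move=> mr; apply: measurableT_comp => //; under eq_fun do rewrite integralE.
have mr' : measurable_fun setT (EFin \o r) by exact/measurable_EFinP.
apply: emeasurable_funB.
  apply: eq_measurable_fun (measurable_fun_fubini_tonelli_G (m1 := m1) _
    (measurable_funepos mr') (funepos_ge0 _)) => x _.
  by apply: eq_integral => y _; rewrite !funeposE.
apply: eq_measurable_fun (measurable_fun_fubini_tonelli_G (m1 := m1) _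
    (measurable_funeneg mr') (funeneg_ge0 _)) => x _.
  by apply: eq_integral => y _; rewrite !funenegE.
Qed.

Lemma cmeasurable_cintegral2 f : cmeasurable f ->
  cmeasurable (fun x => cintegral m2 (fun y => f (x, y))).
Proof. by move=> [rf jf]; split; [exact: (measurable_Rintegral2 rf)|exact: (measurable_Rintegral2 jf)]. Qed.

Lemma cmeasurable_cintegral1 f : cmeasurable f ->
  cmeasurable (fun y => cintegral m1 (fun x => f (x, y))).
Proof. by move=> [rf jf]; split; [exact: (measurable_Rintegral1 rf)|exact: (measurable_Rintegral1 jf)]. Qed.

(** The inner real integral is [fine] of the extended one. The two agree wherever the section is
    integrable, hence almost everywhere, and this is enough for Fubini. *)
Lemma Rintegral12 (r : T1 * T2 -> R) : (m1 \x m2)%E.-integrable setT (EFin \o r) ->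
  \int[m1]_x \int[m2]_y r (x, y) = \int[(m1 \x m2)%E]_z r z.
Proof.
move=> ir; rewrite /Rintegral -integral12_prod_meas1//; congr fine.
apply: ae_eq_integral => //.
- apply/measurable_EFinP; apply: measurable_Rintegral2.
  by apply/measurable_EFinP; exact: measurable_int ir.
- exact: measurable_fubini_F ir.
- apply: filterS (ae_integrable1 ir) => x ix _ /=.
  by rewrite fineK//; exact: integrable_fin_num.
Qed.

Lemma Rintegral21 (r : T1 * T2 -> R) : (m1 \x m2)%E.-integrable setT (EFin \o r) ->
  \int[m2]_y \int[m1]_x r (x, y) = \int[(m1 \x m2)%E]_z r z.
Proof.
move=> ir; rewrite /Rintegral -integral21_prod_meas1//; congr fine.
apply: ae_eq_integral => //.
- apply/measurable_EFinP; apply: measurable_Rintegral1.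
  by apply/measurable_EFinP; exact: measurable_int ir.
- exact: measurable_fubini_G ir.
- apply: filterS (ae_integrable2 ir) => x ix _ /=.
  by rewrite fineK//; exact: integrable_fin_num.
Qed.

Lemma cintegral12 f : cintegrable (m1 \x m2)%E f ->
  cintegral m1 (fun x => cintegral m2 (fun y => f (x, y))) =
  cintegral (m1 \x m2)%E f.
Proof.
move=> If; rewrite /cintegral /= (Rintegral12 (cintegrable_Re If)).
by rewrite (Rintegral12 (cintegrable_Im If)).
Qed.

Lemma cintegral21 f : cintegrable (m1 \x m2)%E f ->
  cintegral m2 (fun y => cintegral m1 (fun x => f (x, y))) =
  cintegral (m1 \x m2)%E f.
Proof.
move=> If; rewrite /cintegral /= (Rintegral21 (cintegrable_Re If)).
by rewrite (Rintegral21 (cintegrable_Im If)).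
Qed.

Lemma cintegrable_tonelli12 f : cmeasurable f ->
  (\int[m1]_x \int[m2]_y (cabs (f (x, y)))%:E < +oo)%E ->
  cintegrable (m1 \x m2)%E f.
Proof.
move=> mf foo; split => //; rewrite (fubini_tonelli1 (fun z => (cabs (f z))%:E))//.
  exact: emeasurable_cabs.
by move=> x; rewrite lee_fin cabs_ge0.
Qed.

Lemma cintegrable_tonelli21 f : cmeasurable f ->
  (\int[m2]_y \int[m1]_x (cabs (f (x, y)))%:E < +oo)%E ->
  cintegrable (m1 \x m2)%E f.
Proof.
move=> mf foo; split => //; rewrite (fubini_tonelli2 (fun z => (cabs (f z))%:E))//.
  exact: emeasurable_cabs.
by move=> x; rewrite lee_fin cabs_ge0.
Qed.

Lemma cfubini f : cmeasurable f ->
  (\int[m1]_x \int[m2]_y (cabs (f (x, y)))%:E < +oo)%E ->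
  cintegral m1 (fun x => cintegral m2 (fun y => f (x, y))) =
  cintegral m2 (fun y => cintegral m1 (fun x => f (x, y))).
Proof.
move=> mf foo; have If := cintegrable_tonelli12 mf foo.
by rewrite cintegral12// cintegral21.
Qed.

End fubini.

(** * Affine changes of variables in the Lebesgue integral *)

Section transport.
Context {R : realType} {d1 d2} {X : measurableType d1} {Y : measurableType d2}.
Variables (mu : {measure set X -> \bar R}) (nu : {measure set Y -> \bar R}).
Variables (phi : X -> Y) (c : R).
Hypothesis mphi : measurable_fun setT phi.
Hypothesis c_ge0 : 0 <= c.

Lemma ge0_integral_transport :
  (forall A, measurable A -> mu (phi @^-1` A) = c%:E * nu A)%E ->
  forall f : Y -> \bar R, measurable_fun setT f -> (forall y, 0 <= f y)%E ->
  (\int[mu]_x f (phi x) = c%:E * \int[nu]_y f y)%E.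
Proof.
move=> cE f mf f0.
transitivity (\int[mu]_(x in phi @^-1` setT) (f \o phi) x)%E.
  by rewrite preimage_setT.
rewrite -(ge0_integral_pushforward mphi)//.
rewrite -(ge0_integral_mscale _ measurableT (NngNum c_ge0))//.
apply: eq_measure_integral => A mA _; exact: cE.
Qed.

(** A substitution is recorded by its effect on nonnegative measurable functions, with [c] in the
    role of an inverse Jacobian. Signed and complex integrals follow by splitting into positive and
    negative parts. *)
Hypothesis phiE : forall f : Y -> \bar R, measurable_fun setT f ->
  (forall y, 0 <= f y)%E -> (\int[mu]_x f (phi x) = c%:E * \int[nu]_y f y)%E.

Lemma cintegrable_transport (f : Y -> R[i]) :
  cintegrable nu f -> cintegrable mu (fun x => f (phi x)).
Proof.
move=> [mf foo]; split; first exact: cmeasurable_comp mf.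
rewrite (phiE (f := fun y => (cabs (f y))%:E)).
- by rewrite lte_mul_pinfty.
- exact: emeasurable_cabs.
- by move=> y; rewrite lee_fin cabs_ge0.
Qed.

Lemma Rintegral_transport (g : Y -> R) : nu.-integrable setT (EFin \o g) ->
  \int[mu]_x g (phi x) = c * \int[nu]_y g y.
Proof.
move=> ig; have mg : measurable_fun setT (EFin \o g) by exact: measurable_int ig.
have p : (\int[mu]_x ((EFin \o g) ^\+ (phi x)) = c%:E * \int[nu]_y (EFin \o g) ^\+ y)%E.
  by apply: (phiE (f := ((EFin \o g)^\+)%E)) => [|y]; [exact: measurable_funepos|rewrite funepos_ge0].
have n : (\int[mu]_x ((EFin \o g) ^\- (phi x)) = c%:E * \int[nu]_y (EFin \o g) ^\- y)%E.
  by apply: (phiE (f := ((EFin \o g)^\-)%E)) => [|y]; [exact: measurable_funeneg|rewrite funeneg_ge0].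
have fp := integrable_pos_fin_num measurableT ig.
have fn := integrable_neg_fin_num measurableT ig.
rewrite /Rintegral integralE [in RHS]integralE.
rewrite (_ : (\int[mu]_x (fun x0 => (g (phi x0))%:E)^\+ x)%E =
   (c%:E * \int[nu]_y (EFin \o g) ^\+ y)%E); last first.
  by rewrite -p; apply: eq_integral => x _; rewrite !funeposE.
rewrite (_ : (\int[mu]_x (fun x0 => (g (phi x0))%:E)^\- x)%E =
   (c%:E * \int[nu]_y (EFin \o g) ^\- y)%E); last first.
  by rewrite -n; apply: eq_integral => x _; rewrite !funenegE.
by rewrite -muleBr// ?fin_num_adde_defr// fineM// fin_numB fp fn.
Qed.

Lemma cintegral_transport (f : Y -> R[i]) : cintegrable nu f ->
  cintegral mu (fun x => f (phi x)) = c%:C * cintegral nu f.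
Proof.
move=> If; rewrite /cintegral (Rintegral_transport (cintegrable_Re If)).
rewrite (Rintegral_transport (cintegrable_Im If)).
by apply/eqP; rewrite eq_complex /= !mul0r subr0 addr0 !eqxx.
Qed.

End transport.

Section lebesgue1.
Context {R : realType}.
Local Notation mu := (@lebesgue_measure R).
Local Notation T := (measurableTypeR R).

Lemma ge0_integral_lebesgueD (a : R) (f : T -> \bar R) :
  measurable_fun setT f -> (forall y, 0 <= f y)%E ->
  (\int[mu]_x f (x + a)%R = \int[mu]_x f x)%E.
Proof.
move=> mf f0; have mD : measurable_fun setT (fun x : T => x + a : T).
  exact: measurable_funD.
rewrite (ge0_integral_transport (nu := mu) mD ler01)// ?mul1e//.
move=> A mA; rewrite mul1e; apply/esym.
(* Lebesgue measure is determined by its values on half-open intervals, so the image measure is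
   computed on those only. *)
apply: (lebesgue_measure_unique (mu :=
  measure_function_pushforward__canonical__measure_function_Measure mu mD)) => //.
move=> _ [[b c]] _ <- /=; rewrite /pushforward.
rewrite (_ : _ @^-1` _ = `]b - a, c - a]%classic); last first.
  by apply/seteqP; split => x /=; rewrite !in_itv/= ltrBlDr lerBrDr.
rewrite !lebesgue_measure_itv/= !lte_fin ltrD2r.
by case: ifP => // _; rewrite -!EFinB; congr EFin; ring.
Qed.

Lemma ge0_integral_lebesgueZ (a : R) (f : T -> \bar R) : 0 < a ->
  measurable_fun setT f -> (forall y, 0 <= f y)%E ->
  (\int[mu]_x f (a * x)%R = (a^-1)%:E * \int[mu]_x f x)%E.
Proof.
move=> a0 mf f0; have mM : measurable_fun setT (fun x : T => a * x : T).
  exact: measurable_funM.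
have ai0 : 0 <= a^-1 by rewrite invr_ge0 ltW.
rewrite (ge0_integral_transport (nu := mu) mM ai0)//.
move=> A mA.
pose m' : {measure set T -> \bar R} := mscale (NngNum (ltW a0))
  (measure_function_pushforward__canonical__measure_function_Measure mu mM).
have mE : mu A = m' A.
  apply: lebesgue_measure_unique => // _ [[b c]] _ <- /=.
  transitivity (a%:E * mu `](b / a)%R, (c / a)%R]%classic)%E; last first.
    congr (_ * mu _)%E; apply/seteqP; split => x /=;
      by rewrite !in_itv/= ltr_pdivrMr// ler_pdivlMr// !(mulrC a).
  rewrite !lebesgue_measure_itv/= !lte_fin ltr_pM2r ?invr_gt0//.
  case: ifP => [_|]; last by rewrite mule0.
  by rewrite -!EFinB -EFinM; congr EFin; field; rewrite gt_eqF.
transitivity ((a^-1)%:E * m' A)%E; last by congr (_ * _)%E; exact/esym.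
by rewrite /m' /mscale /pushforward /= muleA -EFinM mulVf ?gt_eqF// mul1e.
Qed.

Lemma ge0_integral_lebesgueN (f : T -> \bar R) :
  measurable_fun setT f -> (forall y, 0 <= f y)%E ->
  (\int[mu]_x f (- x)%R = \int[mu]_x f x)%E.
Proof.
move=> mf f0; have mN : measurable_fun setT (fun x : T => - x : T).
  exact: measurable_funN.
rewrite (ge0_integral_transport (nu := mu) mN ler01)// ?mul1e//.
by move=> A mA; rewrite mul1e -[RHS]lebesgue_measureN.
Qed.

End lebesgue1.

Section rV_measurable.
Context {R : realType} {d} {T : measurableType d} {n : nat}.
Implicit Types f g : T -> 'rV[R]_n.

Lemma measurable_coord f i : measurable_fun setT f ->
  measurable_fun setT (fun x => f x 0 i : measurableTypeR R).
Proof. move=> mf; exact: (measurableT_comp (measurable_rV_coord i) mf). Qed.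

Lemma measurable_rVD f g : measurable_fun setT f -> measurable_fun setT g ->
  measurable_fun setT (fun x => f x + g x).
Proof.
move=> mf mg; apply: measurable_fun_rVP => i; under eq_fun do rewrite mxE.
by apply: measurable_funD; exact: measurable_coord.
Qed.

Lemma measurable_rVN f : measurable_fun setT f ->
  measurable_fun setT (fun x => - f x).
Proof.
move=> mf; apply: measurable_fun_rVP => i; under eq_fun do rewrite mxE.
by apply: measurable_funN; exact: measurable_coord.
Qed.

Lemma measurable_rVB f g : measurable_fun setT f -> measurable_fun setT g ->
  measurable_fun setT (fun x => f x - g x).
Proof. by move=> mf mg; apply: measurable_rVD => //; exact: measurable_rVN. Qed.

Lemma measurable_rVZ (h : T -> R) f : measurable_fun setT h ->
  measurable_fun setT f -> measurable_fun setT (fun x => h x *: f x).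
Proof.
move=> mh mf; apply: measurable_fun_rVP => i; under eq_fun do rewrite mxE.
by apply: measurable_funM => //; exact: measurable_coord.
Qed.

Lemma measurable_dot f g : measurable_fun setT f -> measurable_fun setT g ->
  measurable_fun setT (fun x => dot (f x) (g x)).
Proof.
move=> mf mg; rewrite /dot.
apply: measurable_sum => i.
by apply: measurable_funM; exact: measurable_coord.
Qed.

End rV_measurable.

Section lebesgue_rV.
Context {R : realType}.
Local Notation leb := (lebesgue_rV R).

Lemma ge0_integral_rVS n (f : 'rV[R]_n.+1 -> \bar R) :
  measurable_fun setT f -> (forall y, 0 <= f y)%E ->
  (\int[leb n.+1]_x f x =
   \int[lebesgue_measure]_t \int[leb n]_x f (consrV (t, x)))%E.
Proof.
move=> mf f0.
rewrite /= /lebesgue_cons.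
transitivity (\int[(lebesgue_measure \x leb n)]_(x in @consrV R n @^-1` setT) (f \o @consrV R n) x)%E.
  exact: (ge0_integral_pushforward (@measurable_consrV R n)).
rewrite preimage_setT.
apply: (fubini_tonelli1 (f \o @consrV R n)) => [|z]; last exact: f0.
by apply: measurableT_comp => //; exact: measurable_consrV.
Qed.

Lemma consrVD n (z z' : measurableTypeR R * 'rV[R]_n) :
  consrV z + consrV z' = consrV (z.1 + z'.1, z.2 + z'.2).
Proof. by apply/rowP => i; rewrite !mxE; case: unliftP => [j|] _; rewrite ?mxE. Qed.

Lemma consrVZ n (c : R) (z : measurableTypeR R * 'rV[R]_n) :
  c *: consrV z = consrV (c * z.1, c *: z.2).
Proof. by apply/rowP => i; rewrite !mxE; case: unliftP => [j|] _; rewrite ?mxE. Qed.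

Lemma consrVN n (z : measurableTypeR R * 'rV[R]_n) :
  - consrV z = consrV (- z.1, - z.2).
Proof. by apply/rowP => i; rewrite !mxE; case: unliftP => [j|] _; rewrite ?mxE. Qed.

Lemma unconsrVK n : cancel (@unconsrV R n) (@consrV R n).
Proof. by move=> x; apply/rowP => i; rewrite !mxE; case: unliftP => [j|] ->; rewrite ?mxE. Qed.

Lemma measurable_rVS_comp n (f : 'rV[R]_n.+1 -> \bar R) :
  measurable_fun setT f -> measurable_fun setT (fun z => f (@consrV R n z)).
Proof. by move=> mf; exact: (measurableT_comp mf (@measurable_consrV R n)). Qed.

(** Induction on the dimension: [consrV] splits off the first coordinate, Tonelli separates the two
    integrations, and each is invariant. In dimension 0 the space is a single point. *)
Lemma ge0_integral_rVD n (a : 'rV[R]_n) (f : 'rV[R]_n -> \bar R) :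
  measurable_fun setT f -> (forall y, 0 <= f y)%E ->
  (\int[leb n]_x f (x + a)%R = \int[leb n]_x f x)%E.
Proof.
elim: n a f => [|n IH] a f mf f0.
  by apply: eq_integral => x _; rewrite [in RHS](thinmx0 x) (thinmx0 (x + a)).
have mfc := measurable_rVS_comp mf.
pose F (t : measurableTypeR R) : \bar R := (\int[leb n]_x f (consrV (t, x)))%E.
have mF : measurable_fun setT F := measurable_fun_fubini_tonelli_F _ mfc (fun z => f0 (consrV z)).
have F0 t : (0 <= F t)%E by exact: integral_ge0.
rewrite ge0_integral_rVS => [||y]; [|by apply: measurableT_comp mf _; apply: measurable_rVD|exact: f0].
rewrite (ge0_integral_rVS mf f0) -[RHS](ge0_integral_lebesgueD (unconsrV a).1 mF F0).
apply: eq_integral => t _.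
rewrite -[RHS](IH (unconsrV a).2 (fun x => f (consrV (t + (unconsrV a).1, x))))//; last first.
  exact: (measurableT_comp mfc).
by apply: eq_integral => x _; rewrite -{1}(unconsrVK a) consrVD.
Qed.

Lemma ge0_integral_rVZ n (a : R) (f : 'rV[R]_n -> \bar R) : 0 < a ->
  measurable_fun setT f -> (forall y, 0 <= f y)%E ->
  (\int[leb n]_x f (a *: x)%R = (a ^- n)%:E * \int[leb n]_x f x)%E.
Proof.
move=> a0; elim: n f => [|n IH] f mf f0.
  rewrite expr0 invr1 mul1e.
  by apply: eq_integral => x _; rewrite [in RHS](thinmx0 x) (thinmx0 (a *: x)).
have mfc := measurable_rVS_comp mf.
pose F (t : measurableTypeR R) : \bar R := (\int[leb n]_x f (consrV (t, x)))%E.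
have mF : measurable_fun setT F := measurable_fun_fubini_tonelli_F _ mfc (fun z => f0 (consrV z)).
have F0 t : (0 <= F t)%E by exact: integral_ge0.
rewrite ge0_integral_rVS => [||y]; [|by apply: measurableT_comp mf _; apply: measurable_rVZ|exact: f0].
rewrite (ge0_integral_rVS mf f0).
transitivity (\int[lebesgue_measure]_t ((a ^- n)%:E * F (a * t)%R))%E.
  apply: eq_integral => t _.
  rewrite -(IH (fun x => f (consrV (a * t, x))))//; last exact: (measurableT_comp mfc).
  by apply: eq_integral => x _; rewrite consrVZ.
have mFa : measurable_fun setT (fun t : measurableTypeR R => F (a * t)%R).
  by apply: (measurableT_comp mF); exact: measurable_funM.
have an0 : (0 <= (a ^- n)%:E)%E by rewrite lee_fin invr_ge0 exprn_ge0// ltW.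
rewrite (ge0_integralZl _ measurableT mFa (fun t _ => F0 (a * t)%R) an0).
by rewrite (ge0_integral_lebesgueZ a0 mF F0) muleA -EFinM exprS invfM mulrC.
Qed.

Lemma ge0_integral_rVN n (f : 'rV[R]_n -> \bar R) :
  measurable_fun setT f -> (forall y, 0 <= f y)%E ->
  (\int[leb n]_x f (- x)%R = \int[leb n]_x f x)%E.
Proof.
elim: n f => [|n IH] f mf f0.
  by apply: eq_integral => x _; rewrite [in RHS](thinmx0 x) (thinmx0 (- x)).
have mfc := measurable_rVS_comp mf.
pose F (t : measurableTypeR R) : \bar R := (\int[leb n]_x f (consrV (t, x)))%E.
have mF : measurable_fun setT F := measurable_fun_fubini_tonelli_F _ mfc (fun z => f0 (consrV z)).
have F0 t : (0 <= F t)%E by exact: integral_ge0.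
rewrite ge0_integral_rVS => [||y]; [|by apply: measurableT_comp mf _; apply: measurable_rVN|exact: f0].
rewrite (ge0_integral_rVS mf f0) -[RHS](ge0_integral_lebesgueN mF F0).
apply: eq_integral => t _.
rewrite -[RHS](IH (fun x => f (consrV (- t, x))))//; last first.
  exact: (measurableT_comp mfc).
by apply: eq_integral => x _; rewrite consrVN.
Qed.

End lebesgue_rV.

(** * The Laplace kernel and its Fourier transform *)

Section kernel1.
Context {R : realType}.
Local Notation mu := (@lebesgue_measure R).

Let E (x : R) := expR (- x).

(* Adding 1 makes the integrand nonnegative, so that the improper integral over
   the half-line can be computed from a primitive. *)
Lemma integral_expR_1Dcos (a : R) :
  (\int[mu]_x (expR (- `|x|) * (1 + cos (a * x)))%:E =
   (2 * (1 + (1 + a ^+ 2)^-1))%:E)%E.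
Proof.
have cos1_ge0 x : 0 <= 1 + cos (a * x).
  by rewrite -lerBlDl sub0r cos_geN1.
have cosM : continuous (fun x : R => cos (a * x)).
  move=> x; apply: continuous_comp; last exact: continuous_cos.
  exact: mulrl_continuous.
rewrite ge0_symfun_integralT; last 3 first.
- by move=> x; rewrite mulr_ge0 ?expR_ge0.
- move=> x; apply: cvgM; last first.
    by apply: cvgD; [exact: cvg_cst|exact: cosM].
  apply: continuous_comp; last exact: continuous_expR.
  by apply: cvgN; exact: norm_continuous.
- by move=> x /=; rewrite normrN mulrN cosN.
rewrite EFinM; congr (_ * _)%E.
rewrite -set_itvcy.
pose a1 := (1 + a ^+ 2)^-1.
have a10 : 1 + a ^+ 2 != 0 by rewrite gt_eqF// ltr_pwDl// sqr_ge0.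
pose F x := - E x + a1 * (E x * (a * sin (a * x) - cos (a * x))).
have dF (x : R) : is_derive x 1 F (E x * (1 + cos (a * x))).
  apply: is_derive_eq; rewrite /GRing.scale/=.
  by rewrite /a1 -/(E x); field.
transitivity (\int[mu]_(x in `[0%R, +oo[) (E x * (1 + cos (a * x)))%:E)%E.
  apply: eq_integral => x; rewrite inE/= in_itv/= andbT => x0.
  by rewrite ger0_norm.
rewrite (@ge0_continuous_FTC2y _ _ F _ 0).
- rewrite /F /E oppr0 expR0 mulr0 sin0 cos0 mulr0 sub0r mul1r sub0e -EFinN.
  by rewrite mulrN1 -opprD opprK.
- by move=> x _; rewrite mulr_ge0 ?expR_ge0.
- apply: continuous_subspaceT => x; apply: cvgM.
    apply: continuous_comp; last exact: continuous_expR.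
    exact: opp_continuous.
  by apply: cvgD; [exact: cvg_cst|exact: cosM].
- pose C := 1 + a1 * (`|a| + 1).
  have CE : C * E x @[x --> +oo] --> 0.
    by rewrite -(mulr0 C); apply: cvgM; [exact: cvg_cst|exact: cvgr_expR].
  apply: (@squeeze_cvgr _ _ _ _ (fun x => - (C * E x)) (fun x => C * E x)) => //; last first.
    by rewrite -oppr0; exact: cvgN.
  apply: nearW => x; rewrite -ler_norml /F /C mulrDl mul1r.
  rewrite (le_trans (ler_normD _ _))// normrN ger0_norm ?expR_ge0// lerD2l.
  have a1_ge0 : 0 <= a1 by rewrite invr_ge0 addr_ge0// sqr_ge0.
  rewrite normrM ger0_norm// -mulrA ler_wpM2l// normrM (ger0_norm (expR_ge0 _)) mulrC.
  rewrite ler_wpM2r ?expR_ge0// (le_trans (ler_normB _ _))// lerD ?cos_max// normrM.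
  by rewrite ler_piMr// sin_max.
- by move=> x _; exact: ex_derive.
- apply: cvg_at_right_filter; apply: differentiable_continuous.
  by apply/derivable1_diffP; exact: ex_derive.
- by move=> x _; rewrite derive1E derive_val.
Qed.

Lemma measurable_expRN_abs : measurable_fun setT (fun x : measurableTypeR R => expR (- `|x|)).
Proof. by apply: measurableT_comp => //; exact: measurableT_comp. Qed.

Lemma integral_expRN_abs : (\int[mu]_x (expR (- `|x|))%:E = 2%:E)%E.
Proof.
have H := integral_expR_1Dcos 0; move: H; rewrite expr0n addr0 invr1.
under eq_integral do rewrite mul0r cos0 mulrC EFinM.
rewrite ge0_integralZl//; last first.
  by apply: measurableT_comp => //; exact: measurable_expRN_abs.
move=> H.
have -> : (2%:E = (2^-1)%:E * (2 * (1 + 1))%:E :> \bar R)%E.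
  by rewrite -EFinM; congr EFin; field.
by rewrite -H muleA -EFinM mulVf// mul1e.
Qed.

Lemma cintegrable_laplace (a : R) :
  cintegrable mu (fun x => (expR (- `|x|))%:C * expi (- (a * x))).
Proof.
apply: (cintegrable_le (r := fun x : measurableTypeR R => expR (- `|x|))).
- apply: cmeasurableM; first exact: cmeasurable_real measurable_expRN_abs.
  by apply: cmeasurable_expi; apply: measurable_funN; exact: measurable_funM.
- exact: measurable_expRN_abs.
- by move=> x; rewrite cabsM cabs_expi mulr1 cabs_real ger0_norm// expR_ge0.
- by rewrite integral_expRN_abs ltry.
Qed.

(** The real part is the integral with [1 + cos] minus the integral of [expR (- |x|)]. The imaginary
    part is the integral of an odd function, hence equal to its own opposite. *)
Lemma fourier_laplace (a : R) :
  cintegral mu (fun x => (expR (- `|x|))%:C * expi (- (a * x))) =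
  (2 / (1 + a ^+ 2))%:C.
Proof.
set f := fun x : R => _.
have If : cintegrable mu f := cintegrable_laplace a.
have ReE x : complex.Re (f x) = expR (- `|x|) * (1 + cos (a * x)) - expR (- `|x|).
  by rewrite /f /= cosN; ring.
have ImE x : complex.Im (f x) = - (expR (- `|x|) * sin (a * x)).
  by rewrite /f /= sinN; ring.
have mE : mu.-integrable setT (EFin \o (fun x : R => expR (- `|x|))).
  apply: cintegrable_ge0; [by move=> x; exact: expR_ge0|exact: measurable_expRN_abs|].
  by rewrite integral_expRN_abs ltry.
have mE1 : mu.-integrable setT (EFin \o (fun x : R => expR (- `|x|) * (1 + cos (a * x)))).
  apply: cintegrable_ge0.
  - by move=> x; rewrite mulr_ge0 ?expR_ge0// -lerBlDl sub0r cos_geN1.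
  - apply: measurable_funM; first exact: measurable_expRN_abs.
    apply: measurable_funD => //; apply: measurableT_comp; last exact: measurable_funM.
    by apply: continuous_measurable_fun; exact: continuous_cos.
  - by rewrite integral_expR_1Dcos ltry.
rewrite /cintegral; congr Complex.
  under eq_Rintegral do rewrite ReE.
  rewrite RintegralB// /Rintegral integral_expR_1Dcos integral_expRN_abs /=.
  by field; rewrite gt_eqF// ltr_pwDl// sqr_ge0.
have odd : \int[mu]_x complex.Im (f (- x)) = \int[mu]_x complex.Im (f x).
  rewrite (Rintegral_transport (mu := mu) (nu := mu) (phi := fun x => - x : measurableTypeR R) (c := 1) _ (cintegrable_Im If)) ?mul1r//.
  by move=> g mg g0; rewrite mul1e ge0_integral_lebesgueN.
have oddN : \int[mu]_x complex.Im (f (- x)) = - \int[mu]_x complex.Im (f x).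
  rewrite -[RHS]mulN1r -RintegralZl//; last exact: cintegrable_Im.
  by apply: eq_Rintegral => x _; rewrite !ImE normrN mulrN sinN mulrN mulN1r.
by move: oddN; rewrite odd => /eqP; rewrite -addr_eq0 -mulr2n mulrn_eq0/= => /eqP.
Qed.

(** The transform of [expR (- |x|)] at angular frequency [2 pi y]; a probability density on the
    line. *)
Definition cauchy1 (y : R) : R := 2 / (1 + (2 * pi * y) ^+ 2).

Lemma cauchy1_ge0 y : 0 <= cauchy1 y.
Proof. by rewrite divr_ge0// addr_ge0// sqr_ge0. Qed.

Lemma cauchy1_le2 y : cauchy1 y <= 2.
Proof. by rewrite ler_pdivrMr ?ltr_pwDl ?sqr_ge0// ler_peMr// lerDl sqr_ge0. Qed.

Lemma measurable_oneDsqrV : measurable_fun setT (fun x : measurableTypeR R => (oneDsqr x)^-1).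
Proof.
by apply: continuous_measurable_fun; exact: continuous_oneDsqrV.
Qed.

Lemma integral_oneDsqrV : (\int[mu]_x ((oneDsqr x)^-1)%:E = pi%:E)%E.
Proof.
rewrite (@ge0_symfun_integralT R (fun x => (oneDsqr x)^-1)); last 3 first.
- by move=> x; rewrite invr_ge0.
- exact: continuous_oneDsqrV.
- by move=> x /=; rewrite /oneDsqr sqrrN.
by rewrite -set_itvcy integral0y_oneDsqr -EFinM; congr EFin; field.
Qed.

Lemma measurable_cauchy1 : measurable_fun setT (cauchy1 : measurableTypeR R -> R).
Proof.
apply: measurable_funM => //.
apply: (measurableT_comp (f := fun x : measurableTypeR R => (oneDsqr x)^-1)
   (g := fun y : measurableTypeR R => 2 * pi * y : measurableTypeR R)).
  exact: measurable_oneDsqrV.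
exact: measurable_funM.
Qed.

Lemma integral_cauchy1 : (\int[mu]_y (cauchy1 y)%:E = 1)%E.
Proof.
have pi2 : 0 < 2 * pi :> R by rewrite mulr_gt0// pi_gt0.
pose g (x : measurableTypeR R) : \bar R := (2 * (oneDsqr x)^-1)%:E.
have mg : measurable_fun setT g.
  by apply/measurable_EFinP; apply: measurable_funM => //; exact: measurable_oneDsqrV.
have g0 x : (0 <= g x)%E by rewrite lee_fin mulr_ge0// invr_ge0.
transitivity (\int[mu]_y g (2 * pi * y)%R)%E; first by apply: eq_integral.
rewrite (ge0_integral_lebesgueZ pi2 mg g0) /g.
under eq_integral do rewrite EFinM.
rewrite ge0_integralZl//.
- by rewrite integral_oneDsqrV -!EFinM mulVf// gt_eqF.
- by apply: measurableT_comp => //; exact: measurable_oneDsqrV.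
Qed.

End kernel1.

Section cintegrable_extra.
Context {R : realType}.

Lemma cintegrable_bddM d (T : measurableType d) (mu : {measure set T -> \bar R})
    (f h : T -> R[i]) (C : R) : cintegrable mu f -> cmeasurable h ->
  (forall x, cabs (h x) <= C) -> cintegrable mu (fun x => h x * f x).
Proof.
move=> [mf foo] mh hC.
have [/eqP T0|/set0P[x0 _]] := boolP ([set: T] == set0).
  split; first exact: cmeasurableM.
  by rewrite (_ : [set: _] = set0) ?integral_set0.
have C0 : 0 <= C by exact: le_trans (cabs_ge0 _) (hC x0).
apply: (cintegrable_le (r := fun x => C * cabs (f x))).
- exact: cmeasurableM.
- by apply: measurable_funM => //; exact: measurable_cabs.
- by move=> x; rewrite cabsM ler_wpM2r ?cabs_ge0.
- under eq_integral do rewrite EFinM.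
  rewrite ge0_integralZl//.
  + exact: lte_mul_pinfty.
  + exact: emeasurable_cabs.
  + by move=> x _; rewrite lee_fin cabs_ge0.
Qed.

Section prodM.
Context {d1 d2} {T1 : measurableType d1} {T2 : measurableType d2}.
Variables (m1 : {sigma_finite_measure set T1 -> \bar R}).
Variables (m2 : {sigma_finite_measure set T2 -> \bar R}).
Implicit Types (f : T1 -> R[i]) (g : T2 -> R[i]).

Lemma cintegrable_prodM f g : cintegrable m1 f -> cintegrable m2 g ->
  cintegrable (m1 \x m2)%E (fun z => f z.1 * g z.2).
Proof.
move=> [mf foo] [mg goo]; apply: cintegrable_tonelli12.
  by apply: cmeasurableM; exact: cmeasurable_comp.
rewrite /=; under eq_integral do under eq_integral do rewrite cabsM EFinM.
under eq_integral.
  move=> x _; rewrite ge0_integralZl//; last 3 first.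
  - exact: emeasurable_cabs.
  - by move=> y _; rewrite lee_fin cabs_ge0.
  - by rewrite lee_fin cabs_ge0.
  over.
rewrite /= ge0_integralZr//; last 3 first.
- exact: emeasurable_cabs.
- by move=> y _; rewrite lee_fin cabs_ge0.
- by apply: integral_ge0 => y _; rewrite lee_fin cabs_ge0.
rewrite lte_mul_pinfty//.
  by apply: integral_ge0 => y _; rewrite lee_fin cabs_ge0.
by rewrite ge0_fin_numE//; apply: integral_ge0 => y _; rewrite lee_fin cabs_ge0.
Qed.

Lemma cintegral_prodM f g : cintegrable m1 f -> cintegrable m2 g ->
  cintegral (m1 \x m2)%E (fun z => f z.1 * g z.2) =
  cintegral m1 f * cintegral m2 g.
Proof.
move=> If Ig; rewrite -cintegral12; last exact: cintegrable_prodM.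
rewrite mulrC -cintegralZl//; congr cintegral; apply/funext => x /=.
by rewrite cintegralZl// mulrC.
Qed.

End prodM.
End cintegrable_extra.

(** * Integrals of products of one-variable functions over ['rV_n] *)

Section product_integrals.
Context {R : realType}.
Local Notation leb := (lebesgue_rV R).
Local Notation T := (measurableTypeR R).

Lemma consrV0 n (z : T * 'rV[R]_n) : consrV z 0 ord0 = z.1.
Proof. by rewrite mxE unlift_none. Qed.

Lemma consrV_lift n (z : T * 'rV[R]_n) i : consrV z 0 (lift ord0 i) = z.2 0 i.
Proof. by rewrite mxE liftK. Qed.

Lemma measurable_prod_coord n (f : 'I_n -> T -> R) :
  (forall i, measurable_fun setT (f i)) ->
  measurable_fun setT (fun x : 'rV[R]_n => \prod_(i < n) f i (x 0 i)).
Proof.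
move=> mf; apply: measurable_prod => i _.
exact: (measurableT_comp (mf i) (measurable_rV_coord i)).
Qed.

Lemma ge0_integral_prod n (f : 'I_n -> T -> R) :
  (forall i, measurable_fun setT (f i)) -> (forall i t, 0 <= f i t) ->
  (\int[leb n]_x (\prod_(i < n) f i (x 0 i))%:E =
   \prod_(i < n) \int[lebesgue_measure]_t (f i t)%:E)%E.
Proof.
elim: n f => [|n IH] f mf f0.
  rewrite big_ord0; under eq_integral do rewrite big_ord0.
  by rewrite integral_cst// mul1e /= /lebesgue_nil diracT.
rewrite ge0_integral_rVS; last 2 first.
- by apply/measurable_EFinP; exact: measurable_prod_coord.
- by move=> x; rewrite lee_fin prodr_ge0.
pose g i := f (lift ord0 i).
have mg i : measurable_fun setT (g i) by exact: mf.
have g0 i t : 0 <= g i t by exact: f0.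
rewrite big_ord_recl -(IH g)//.
have P0 (x : 'rV[R]_n) : 0 <= \prod_(i < n) g i (x 0 i) by rewrite prodr_ge0.
have mP : measurable_fun setT (fun x : 'rV[R]_n => (\prod_(i < n) g i (x 0 i))%:E).
  by apply/measurable_EFinP; exact: measurable_prod_coord.
rewrite -ge0_integralZr//; last 3 first.
- by apply/measurable_EFinP; exact: mf.
- by move=> t _; rewrite lee_fin.
- by apply: integral_ge0 => x _; rewrite lee_fin.
apply: eq_integral => t _.
rewrite -ge0_integralZl//; last 2 first.
- by move=> x _; rewrite lee_fin.
- by rewrite lee_fin.
apply: eq_integral => x _; rewrite big_ord_recl consrV0 -EFinM.
by congr (_ * _)%:E; apply: eq_bigr => i _; rewrite consrV_lift.
Qed.

Lemma transport_consrV n (f : 'rV[R]_n.+1 -> \bar R) :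
  measurable_fun setT f -> (forall y, 0 <= f y)%E ->
  (\int[(lebesgue_measure \x leb n)%E]_z f (consrV z) = 1%:E * \int[leb n.+1]_y f y)%E.
Proof.
move=> mf f0; rewrite mul1e ge0_integral_rVS//.
exact: (fubini_tonelli1 (f \o @consrV R n) (measurable_rVS_comp mf) (fun z => f0 (consrV z))).
Qed.

Lemma cintegral_rVS n (f : 'rV[R]_n.+1 -> R[i]) : cintegrable (leb n.+1) f ->
  cintegral (leb n.+1) f =
  cintegral lebesgue_measure (fun t => cintegral (leb n) (fun x => f (consrV (t, x)))).
Proof.
move=> If; rewrite (cintegral12 (f := fun z => f (consrV z))); last first.
  exact: (cintegrable_transport (@measurable_consrV R n) ler01 (@transport_consrV n) If).
by rewrite (cintegral_transport (@transport_consrV n) If) mul1r.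
Qed.

Lemma cmeasurable_prod_coord n (f : 'I_n -> T -> R[i]) :
  (forall i, cmeasurable (f i)) ->
  cmeasurable (fun x : 'rV[R]_n => \prod_(i < n) f i (x 0 i)).
Proof.
move=> mf; elim: (index_enum _) => [|i s IH].
  by under eq_fun do rewrite big_nil; exact: cmeasurable_cst.
under eq_fun do rewrite big_cons; apply: cmeasurableM => //.
exact: (cmeasurable_comp (measurable_rV_coord i) (mf i)).
Qed.

Lemma cabs_prod I (s : seq I) (f : I -> R[i]) :
  cabs (\prod_(i <- s) f i) = \prod_(i <- s) cabs (f i).
Proof.
elim: s => [|i s IH]; last by rewrite !big_cons cabsM IH.
by rewrite !big_nil (cabs_real 1) normr1.
Qed.

Lemma prode_lty I (s : seq I) (f : I -> \bar R) : (forall i, 0 <= f i)%E ->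
  (forall i, f i < +oo)%E -> (\prod_(i <- s) f i < +oo)%E.
Proof.
move=> f0 foo; suff /andP[] : (0 <= \prod_(i <- s) f i < +oo)%E by [].
elim: s => [|i s /andP[s0 soo]]; first by rewrite big_nil lee01 ltry.
by rewrite big_cons mule_ge0// lte_mul_pinfty// ge0_fin_numE.
Qed.

Lemma cintegrable_prod n (f : 'I_n -> T -> R[i]) :
  (forall i, cintegrable lebesgue_measure (f i)) ->
  cintegrable (leb n) (fun x => \prod_(i < n) f i (x 0 i)).
Proof.
move=> If; split; first by apply: cmeasurable_prod_coord => i; exact: (If i).1.
under eq_integral do rewrite cabs_prod.
rewrite (ge0_integral_prod (f := fun i t => cabs (f i t))); last 2 first.
- by move=> i; apply: measurable_cabs; exact: (If i).1.
- by move=> i t; exact: cabs_ge0.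
apply: prode_lty => i; last exact: (If i).2.
by apply: integral_ge0 => t _; rewrite lee_fin cabs_ge0.
Qed.

Lemma cintegral_prod n (f : 'I_n -> T -> R[i]) :
  (forall i, cintegrable lebesgue_measure (f i)) ->
  cintegral (leb n) (fun x => \prod_(i < n) f i (x 0 i)) =
  \prod_(i < n) cintegral lebesgue_measure (f i).
Proof.
elim: n f => [|n IH] f If.
  rewrite big_ord0; under eq_fun do rewrite big_ord0.
  rewrite (cintegral_real (leb 0) (fun=> 1)) /Rintegral.
  have H := @ge0_integral_prod 0 (fun _ _ => 1) (fun _ => measurable_cst _) (fun _ _ => ler01).
  suff -> : (\int[leb 0]_x 1%:E = 1)%E by [].
  transitivity (\int[leb 0]_x (\prod_(i < 0) (1 : R))%:E)%E.
    by apply: eq_integral => x _; rewrite big_ord0.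
  by rewrite H big_ord0.
rewrite cintegral_rVS; last exact: cintegrable_prod.
rewrite big_ord_recl -(IH (fun i => f (lift ord0 i)))// mulrC -cintegralZl//.
congr cintegral; apply/funext => t.
rewrite mulrC -cintegralZl; last first.
  exact: (cintegrable_prod (f := fun i => f (lift ord0 i)) (fun i => If _)).
congr cintegral; apply/funext => x; rewrite big_ord_recl consrV0.
by congr (_ * _); apply: eq_bigr => i _; rewrite consrV_lift.
Qed.

End product_integrals.

Section kernels.
Context {R : realType} {n : nat}.
Local Notation leb := (lebesgue_rV R n).
Implicit Types (v y : 'rV[R]_n).

(** The product form reduces the integral and the Fourier transform to dimension one. The kernel is
    also strictly positive, so that functions can be divided by it. *)
Definition expker v : R := \prod_(i < n) expR (- `|v 0 i|).
Definition cauchyker y : R := \prod_(i < n) cauchy1 (y 0 i).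

Lemma expker_ge0 v : 0 <= expker v.
Proof. by apply: prodr_ge0 => i _; exact: expR_ge0. Qed.

Lemma expker_le1 v : expker v <= 1.
Proof.
rewrite /expker -expR_sum -[leRHS]expR0 ler_expR.
by apply: sumr_le0 => i _; rewrite oppr_le0.
Qed.

Lemma measurable_expker : measurable_fun setT expker.
Proof.
exact: (measurable_prod_coord (f := fun _ t => expR (- `|t|))
  (fun _ => measurable_expRN_abs)).
Qed.

Lemma integral_expker_lty : (\int[leb]_v (expker v)%:E < +oo)%E.
Proof.
rewrite (ge0_integral_prod (f := fun _ t => expR (- `|t|))); last 2 first.
- by move=> i; exact: measurable_expRN_abs.
- by move=> i t; exact: expR_ge0.
by apply: prode_lty => i; rewrite integral_expRN_abs ?ltry// lee_fin.
Qed.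

Lemma cauchyker_ge0 y : 0 <= cauchyker y.
Proof. by apply: prodr_ge0 => i _; exact: cauchy1_ge0. Qed.

Lemma measurable_cauchyker : measurable_fun setT cauchyker.
Proof.
exact: (measurable_prod_coord (f := fun _ t => cauchy1 t)
  (fun _ => @measurable_cauchy1 R)).
Qed.

Lemma integral_cauchyker : (\int[leb]_v (cauchyker v)%:E = 1)%E.
Proof.
rewrite (ge0_integral_prod (f := fun _ t => cauchy1 t)); last 2 first.
- by move=> i; exact: measurable_cauchy1.
- by move=> i t; exact: cauchy1_ge0.
by rewrite big1// => i _; exact: integral_cauchy1.
Qed.

Lemma expi_sum I (s : seq I) (f : I -> R) :
  expi (\sum_(i <- s) f i) = \prod_(i <- s) expi (f i).
Proof.
elim: s => [|i s IH]; last by rewrite !big_cons expiD IH.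
by rewrite !big_nil expi0.
Qed.

Let expkerE v y : (expker v)%:C * expi (- (2 * pi * dot v y)) =
  \prod_(i < n) ((expR (- `|v 0 i|))%:C * expi (- (2 * pi * y 0 i * v 0 i))).
Proof.
rewrite big_split/= -rmorph_prod -expi_sum; congr (_ * expi _).
rewrite /dot mulr_sumr -sumrN; apply: eq_bigr => i _.
by rewrite -!mulrA (mulrC (y 0 i)).
Qed.

Lemma fourier_expker y :
  cintegral leb (fun v => (expker v)%:C * expi (- (2 * pi * dot v y))) =
  (cauchyker y)%:C.
Proof.
under eq_fun do rewrite expkerE.
rewrite (cintegral_prod (f := fun i t => (expR (- `|t|))%:C * expi (- (2 * pi * y 0 i * t)))).
  rewrite rmorph_prod; apply: eq_bigr => i _; exact: fourier_laplace.
by move=> i; exact: cintegrable_laplace.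
Qed.

Lemma expker_gt0 v : 0 < expker v.
Proof. by apply: prodr_gt0 => i _; exact: expR_gt0. Qed.

Lemma cvg_expkerD x v : expker (x + k.+1%:R^-1 *: v) @[k --> \oo] --> expker x.
Proof.
have E (i : 'I_n) : expR (- `|x 0 i + k.+1%:R^-1 * v 0 i|) @[k --> \oo] -->
    expR (- `|x 0 i|).
  apply: (@continuous_cvg _ _ _ _ _ _ (@expR R)); first exact: continuous_expR.
  apply: cvgN; apply: cvg_norm; rewrite -[X in _ --> X]addr0.
  apply: cvgD; first exact: cvg_cst.
  rewrite -[X in _ --> X](mul0r (v 0 i)); apply: cvgM; last exact: cvg_cst.
  exact: cvg_harmonic.
rewrite /expker; elim: (index_enum _) => [|i s IH].
  by rewrite big_nil; under eq_fun do rewrite big_nil; exact: cvg_cst.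
have H : expR (- `|x 0 i + k.+1%:R^-1 * v 0 i|) *
    \prod_(i <- s) expR (- `|(x + k.+1%:R^-1 *: v) 0 i|) @[k --> \oo] -->
    expR (- `|x 0 i|) * \prod_(i <- s) expR (- `|x 0 i|).
  exact: cvgM (E i) IH.
by rewrite big_cons; under eq_fun do rewrite big_cons !mxE.
Qed.

Lemma cvg_expker v : expker (k.+1%:R^-1 *: v) @[k --> \oo] --> (1 : R).
Proof.
have e1 : expker 0 = 1.
  by rewrite /expker big1// => i _; rewrite mxE normr0 oppr0 expR0.
have := @cvg_expkerD 0 v; rewrite e1.
by under eq_fun do rewrite add0r.
Qed.

Lemma measurable_expkerV : measurable_fun setT (fun v => (expker v)^-1).
Proof.
rewrite (_ : (fun v => _) = (fun v => \prod_(i < n) expR `|v 0 i|)).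
  apply: (measurable_prod_coord (f := fun _ t => expR `|t|)) => _.
  by apply: measurableT_comp => //; exact: measurableT_comp.
apply/funext => v; rewrite /expker -prodfV; apply: eq_bigr => i _.
by rewrite expRN invrK.
Qed.

(** The triangle inequality for [|x_i|]: a bounded shift multiplies the kernel by a bounded factor.
    This gives an integrable majorant for all translates of the kernel by [a *: v] with [a] in
    [[0, 1]]. *)
Lemma expkerD_le x v (a : R) : 0 <= a <= 1 ->
  expker (x + a *: v) <= (expker v)^-1 * expker x.
Proof.
move=> /andP[a0 a1]; rewrite /expker -prodfV -big_split/=; apply: ler_prod => i _.
rewrite expR_ge0/= -expRN opprK -expRD ler_expR !mxE lerNl opprB lerBlDl.
rewrite -[X in `|X|](addrK (a * v 0 i)) (le_trans (ler_normB _ _))//.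
by rewrite [leRHS]addrC lerD2l normrM ger0_norm// ler_piMl.
Qed.

Lemma transport_rVZ (a : R) : 0 < a -> forall f : 'rV[R]_n -> \bar R,
  measurable_fun setT f -> (forall y, 0 <= f y)%E ->
  (\int[leb]_x f (a *: x)%R = (a ^- n)%:E * \int[leb]_x f x)%E.
Proof. by move=> a0 f mf f0; exact: ge0_integral_rVZ. Qed.

Lemma transport_rVD (a : 'rV[R]_n) : forall f : 'rV[R]_n -> \bar R,
  measurable_fun setT f -> (forall y, 0 <= f y)%E ->
  (\int[leb]_x f (x + a)%R = 1%:E * \int[leb]_x f x)%E.
Proof. by move=> f mf f0; rewrite mul1e ge0_integral_rVD. Qed.

Lemma cintegral_rVZ (a : R) (f : 'rV[R]_n -> R[i]) : 0 < a -> cintegrable leb f ->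
  cintegral leb (fun x => f (a *: x)) = (a ^- n)%:C * cintegral leb f.
Proof. by move=> a0 If; exact: (cintegral_transport (transport_rVZ a0) If). Qed.

Lemma cintegrable_rVZ (a : R) (f : 'rV[R]_n -> R[i]) : 0 < a -> cintegrable leb f ->
  cintegrable leb (fun x => f (a *: x)).
Proof.
move=> a0 If; apply: (cintegrable_transport _ _ (transport_rVZ a0) If).
  exact: measurable_rVZ.
by rewrite invr_ge0 exprn_ge0// ltW.
Qed.

Lemma cintegral_rVD (a : 'rV[R]_n) (f : 'rV[R]_n -> R[i]) : cintegrable leb f ->
  cintegral leb (fun x => f (x + a)) = cintegral leb f.
Proof. by move=> If; rewrite (cintegral_transport (transport_rVD a) If) mul1r. Qed.

Lemma cintegrable_rVD (a : 'rV[R]_n) (f : 'rV[R]_n -> R[i]) : cintegrable leb f ->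
  cintegrable leb (fun x => f (x + a)).
Proof.
move=> If; apply: (cintegrable_transport _ ler01 (transport_rVD a) If).
exact: measurable_rVD.
Qed.

Lemma dotZl (a : R) v y : dot (a *: v) y = a * dot v y.
Proof. by rewrite /dot mulr_sumr; apply: eq_bigr => i _; rewrite mxE mulrA. Qed.

Lemma dotC v y : dot v y = dot y v.
Proof. by apply: eq_bigr => i _; rewrite mulrC. Qed.

Lemma dotZr (a : R) v y : dot v (a *: y) = a * dot v y.
Proof. by rewrite dotC dotZl dotC. Qed.

Lemma dotDl u v y : dot (u + v) y = dot u y + dot v y.
Proof. by rewrite /dot -big_split; apply: eq_bigr => i _; rewrite mxE mulrDl. Qed.

Lemma dotDr u v y : dot u (v + y) = dot u v + dot u y.
Proof. by rewrite dotC dotDl !(dotC u). Qed.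

Lemma dotNl v y : dot (- v) y = - dot v y.
Proof. by rewrite -scaleN1r dotZl mulN1r. Qed.

Lemma dotNr v y : dot v (- y) = - dot v y.
Proof. by rewrite dotC dotNl dotC. Qed.

Lemma cintegrable_expker y :
  cintegrable leb (fun v => (expker v)%:C * expi (- (2 * pi * dot v y))).
Proof.
apply: (cintegrable_le (r := expker)).
- apply: cmeasurableM; first exact: cmeasurable_real measurable_expker.
  apply: cmeasurable_expi; apply: measurable_funN; apply: measurable_funM => //.
  exact: measurable_dot.
- exact: measurable_expker.
- by move=> v; rewrite cabsM cabs_expi mulr1 cabs_real ger0_norm// expker_ge0.
- exact: integral_expker_lty.
Qed.

Lemma fourier_expkerZ (a : R) y : 0 < a ->
  cintegral leb (fun v => (expker (a *: v))%:C * expi (- (2 * pi * dot v y))) =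
  (a ^- n * cauchyker (a^-1 *: y))%:C.
Proof.
move=> a0; rewrite rmorphM/= -fourier_expker -(cintegral_rVZ a0); last first.
  exact: cintegrable_expker.
congr cintegral; apply/funext => v.
by rewrite dotZl dotZr (mulrA a) mulfV ?mul1r ?gt_eqF.
Qed.

End kernels.

(** * Square-integrable functions *)

Section ereal_cvg0.
Context {R : realType}.

Lemma cvge0P (s : nat -> \bar R) : (forall k, 0 <= s k)%E ->
  (forall e : R, 0 < e -> \forall k \near \oo, (s k <= e%:E)%E) <->
  s k @[k --> \oo] --> 0%E.
Proof.
move=> s0; split=> [H|H e e0]; last first.
  have /fine_cvgP[fs ds] := H.
  have de : \forall k \near \oo, `|fine (s k)| < e.
    by apply: ((cvgr0Pnorm_lt _).1 ds _ e0).
  apply: filterS2 fs de => k fk /ltW; rewrite ger0_norm ?fine_ge0//.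
  by rewrite -lee_fin fineK.
apply/fine_cvgP; split.
  apply: filterS (H 1 ltr01) => k sk.
  by rewrite ge0_fin_numE// (le_lt_trans sk) ?ltry.
apply/cvgr0Pnorm_le => e e0.
apply: filterS (H e e0) => k sk /=.
rewrite ger0_norm ?fine_ge0// -lee_fin fineK// ge0_fin_numE//.
by rewrite (le_lt_trans sk) ?ltry.
Qed.

Lemma cvge0_le (s r : nat -> \bar R) : (forall k, 0 <= s k <= r k)%E ->
  r k @[k --> \oo] --> 0%E -> s k @[k --> \oo] --> 0%E.
Proof.
move=> sr r0; have s0 k : (0 <= s k)%E by have /andP[] := sr k.
apply/cvge0P => // e e0; apply: filterS ((cvge0P _).2 r0 e e0) => [k|k].
  by apply: le_trans; have /andP[] := sr k.
by have /andP[+ +] := sr k; exact: le_trans.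
Qed.

Lemma cvge0D (s r : nat -> \bar R) : s k @[k --> \oo] --> 0%E ->
  r k @[k --> \oo] --> 0%E -> (s k + r k)%E @[k --> \oo] --> 0%E.
Proof. by move=> s0 r0; rewrite -[X in _ --> X](adde0 0%E); exact: cvgeD. Qed.

Lemma cvge0Zl (c : R) (s : nat -> \bar R) : s k @[k --> \oo] --> 0%E ->
  (c%:E * s k)%E @[k --> \oo] --> 0%E.
Proof. by move=> s0; rewrite -[X in _ --> X](mule0 c%:E); exact: cvgeZl. Qed.

End ereal_cvg0.

Section sqdist.
Context {R : realType} {d} {T : measurableType d} (mu : {measure set T -> \bar R}).
Implicit Types f g : T -> R[i].

(** The squared L2 distance. Keeping the square avoids roots of extended reals, at the price of a
    factor 2 in the triangle inequality. *)
Definition sqdist f g : \bar R := (\int[mu]_x (sqnormc (f x - g x))%:E)%E.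

Lemma sqdist_ge0 f g : (0 <= sqdist f g)%E.
Proof. by apply: integral_ge0 => x _; rewrite lee_fin sqnormc_ge0. Qed.

Lemma sqdistxx f : sqdist f f = 0%E.
Proof.
rewrite /sqdist; under eq_integral do rewrite subrr -sqr_cabs cabs0 expr0n.
by rewrite integral0.
Qed.

Lemma sqdistC f g : sqdist f g = sqdist g f.
Proof.
by apply: eq_integral => x _; rewrite -!sqr_cabs cabsB.
Qed.

Lemma le_integral_sqnormcD f g : cmeasurable f -> cmeasurable g ->
  (\int[mu]_x (sqnormc (f x + g x))%:E <= 2%:E * \int[mu]_x (sqnormc (f x))%:E
    + 2%:E * \int[mu]_x (sqnormc (g x))%:E)%E.
Proof.
move=> mf mg; rewrite -muleDr//; last first.
  by apply: ge0_adde_def; rewrite inE; apply: integral_ge0 => x _; rewrite lee_fin sqnormc_ge0.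
rewrite -ge0_integralD//; last 4 first.
- by move=> x _; rewrite lee_fin sqnormc_ge0.
- exact: emeasurable_sqnormc.
- by move=> x _; rewrite lee_fin sqnormc_ge0.
- exact: emeasurable_sqnormc.
rewrite -ge0_integralZl//; last 2 first.
- by apply: emeasurable_funD; exact: emeasurable_sqnormc.
- by move=> x _; rewrite -EFinD lee_fin addr_ge0 ?sqnormc_ge0.
apply: ge0_le_integral => //.
- by move=> x _; rewrite lee_fin sqnormc_ge0.
- by apply: emeasurable_sqnormc; exact: cmeasurableD.
- apply: emeasurable_funM => //.
  by apply: emeasurable_funD; exact: emeasurable_sqnormc.
- by move=> x _; rewrite -EFinD -EFinM lee_fin sqnormcD_le.
Qed.

Lemma sqdist_triangle f g h : cmeasurable f -> cmeasurable g -> cmeasurable h ->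
  (sqdist f h <= 2%:E * sqdist f g + 2%:E * sqdist g h)%E.
Proof.
move=> mf mg mh.
have := le_integral_sqnormcD (cmeasurableB mf mg) (cmeasurableB mg mh).
by under eq_integral do rewrite subrKA.
Qed.

Lemma cvg_sqdist (f_ : nat -> T -> R[i]) f (r : T -> R) :
  (forall n, cmeasurable (f_ n)) -> cmeasurable f ->
  {ae mu, forall x, cabs (f_ n x - f x) @[n --> \oo] --> (0 : R)} ->
  measurable_fun setT r -> (forall n x, sqnormc (f_ n x - f x) <= r x) ->
  (\int[mu]_x (r x)%:E < +oo)%E ->
  sqdist (f_ n) f @[n --> \oo] --> 0%E.
Proof.
move=> mf_ mf ff mr fr roo.
have h1 n : measurable_fun setT (fun x => (sqnormc (f_ n x - f x))%:E).
  by apply: emeasurable_sqnormc; exact: cmeasurableB.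
have h2 : measurable_fun [set: T] (cst 0 : T -> \bar R)%E by [].
have h3 : {ae mu, forall x, setT x ->
    (sqnormc (f_ n x - f x))%:E @[n --> \oo] --> (cst 0 : T -> \bar R)%E x}.
  apply: filterS ff => x /= ff _; apply/fine_cvgP; split; first exact: nearW.
  rewrite -[X in _ --> X](mulr0 0) /=.
  have H : cabs (f_ n x - f x) * cabs (f_ n x - f x) @[n --> \oo] --> (0 * 0 : R).
    exact: cvgM.
  by under eq_fun do rewrite -sqr_cabs expr2.
pose G x := (r x)%:E.
have h4 : mu.-integrable setT G.
  by apply: cintegrable_ge0 => // x; exact: le_trans (sqnormc_ge0 _) (fr 0%N x).
have h5 : {ae mu, forall x n, setT x -> (`|(sqnormc (f_ n x - f x))%:E| <= G x)%E}.
  by apply: aeW => x n _ /=; rewrite lee_fin ger0_norm ?sqnormc_ge0.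
have [_ _] := dominated_convergence measurableT h1 h2 h3 h4 h5.
by rewrite integral0.
Qed.

End sqdist.

(** * Continuity of translations in L2 *)

Section translation_continuity.
Import HBNNSimple.
Context {R : realType} {n : nat}.
Local Notation V := 'rV[R]_n.
Local Notation leb := (lebesgue_rV R n).
Implicit Types (f g : V -> R[i]) (A : set V).
Variable y : V.

Let sh (k : nat) (x : V) : V := x + k.+1%:R^-1 *: y.

Let msh k : measurable_fun setT (sh k).
Proof. exact: measurable_rVD. Qed.

(** The sequence of shifts [y / (k + 1)] matches the regularization scales [1 / (k + 1)]. The class
    is linear and closed in L2, so it is enough that it contain a generating family. *)
Let tcont f := cmeasurable f /\
  sqdist leb (fun x => f (sh k x)) f @[k --> \oo] --> 0%E.

Let sqdist_sh k f g : cmeasurable f -> cmeasurable g ->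
  sqdist leb (fun x => f (sh k x)) (fun x => g (sh k x)) = sqdist leb f g.
Proof.
move=> mf mg; rewrite /sqdist /sh.
rewrite (ge0_integral_rVD _ (f := fun x => (sqnormc (f x - g x))%:E))//.
  by apply: emeasurable_sqnormc; exact: cmeasurableB.
by move=> x; rewrite lee_fin sqnormc_ge0.
Qed.

Let tcontD f g : tcont f -> tcont g -> tcont (fun x => f x + g x).
Proof.
move=> [mf tf] [mg tg]; split; first exact: cmeasurableD.
apply: (@cvge0_le _ _ (fun k => 2%:E * sqdist leb (fun x => f (sh k x)) f +
   2%:E * sqdist leb (fun x => g (sh k x)) g)%E); last first.
  by apply: cvge0D; exact: cvge0Zl.
move=> k; rewrite sqdist_ge0 /=.
have mfs := cmeasurable_comp (msh k) mf; have mgs := cmeasurable_comp (msh k) mg.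
have := le_integral_sqnormcD leb (cmeasurableB mfs mf) (cmeasurableB mgs mg).
apply: le_trans; apply: ge0_le_integral => //.
- by move=> x _; rewrite lee_fin sqnormc_ge0.
- by apply: emeasurable_sqnormc; apply: cmeasurableB; exact: cmeasurableD.
- by apply: emeasurable_sqnormc; apply: cmeasurableD; exact: cmeasurableB.
- by move=> x _; rewrite addrACA opprD.
Qed.

Let tcontZ (c : R[i]) f : tcont f -> tcont (fun x => c * f x).
Proof.
move=> [mf tf]; split; first exact: cmeasurableM (cmeasurable_cst _) mf.
apply: (@cvge0_le _ _ (fun k => (sqnormc c)%:E * sqdist leb (fun x => f (sh k x)) f)%E).
  move=> k; rewrite sqdist_ge0 /= /sqdist -ge0_integralZl//; last 3 first.
  - apply: emeasurable_sqnormc; apply: cmeasurableB => //.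
    exact: cmeasurable_comp (msh k) mf.
  - by move=> x _; rewrite lee_fin sqnormc_ge0.
  - by rewrite lee_fin sqnormc_ge0.
  rewrite le_eqVlt; apply/orP; left; apply/eqP; apply: eq_integral => x _.
  by rewrite -mulrBr sqnormcM EFinM.
exact: cvge0Zl.
Qed.

Let tcont_sum I (s : seq I) (h : I -> V -> R[i]) : (forall i, tcont (h i)) ->
  tcont (fun x => \sum_(i <- s) h i x).
Proof.
move=> th; elim: s => [|i s IH]; last first.
  by under eq_fun do rewrite big_cons; exact: tcontD.
under eq_fun do rewrite big_nil; split; first exact: cmeasurable_cst.
rewrite /sqdist subrr (_ : sqnormc 0 = 0); last by rewrite -sqr_cabs cabs0 expr0n.
by rewrite integral0; exact: cvg_cst.
Qed.

Let tcont_closure f : cmeasurable f ->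
  (exists g_ : nat -> V -> R[i], (forall j, tcont (g_ j)) /\
    sqdist leb (g_ j) f @[j --> \oo] --> 0%E) -> tcont f.
Proof.
move=> mf [g_ [tg gf]]; split=> //; apply/cvge0P => [k|e e0]; first exact: sqdist_ge0.
(* Two triangle inequalities multiply [e / 16] by [2 + 4 + 4 = 10]. *)
have e16 : 0 < e / 16 by rewrite divr_gt0.
have [j _ /(_ j (leqnn j)) gj] := (cvge0P (fun _ => sqdist_ge0 _ _ _)).2 gf _ e16.
have [mg tgj] := tg j.
have := (cvge0P (fun _ => sqdist_ge0 _ _ _)).2 tgj _ e16.
apply: filterS => k gk.
have mfs := cmeasurable_comp (msh k) mf; have mgs := cmeasurable_comp (msh k) mg.
apply: le_trans (sqdist_triangle _ mfs mgs mf) _.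
rewrite sqdist_sh// sqdistC.
apply: (@le_trans _ _ (2%:E * (e / 16)%:E + 2%:E * (2%:E * (e / 16)%:E + 2%:E * (e / 16)%:E))%E).
  apply: leeD; first by rewrite lee_pmul2l.
  rewrite lee_pmul2l//; apply: le_trans (sqdist_triangle _ mgs mg mf) _.
  by apply: leeD; rewrite lee_pmul2l.
rewrite -!(EFinM, EFinD) lee_fin; lra.
Qed.

(* Half-spaces belong to this intersection-stable class, which therefore generates
   the Borel sets; continuity of translations then follows from a
   lambda-system argument, without density of continuous functions. *)
Let G : set (set V) := [set A | measurable A /\
  {ae leb, forall x, \forall k \near \oo, A (sh k x) <-> A x}].

Let G_setI : setI_closed G.
Proof.
move=> A B [mA aA] [mB aB]; split; first exact: measurableI.
apply: filterS2 aA aB => x Ax Bx; apply: filterS2 Ax Bx => k [a a'] [b b'].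
by split=> -[? ?]; split; auto.
Qed.

Lemma negligible_hyperplane (i : 'I_n) (c : R) :
  leb.-negligible [set x : V | x 0 i = c].
Proof.
pose A (j : 'I_n) : set (measurableTypeR R) := if j == i then [set c] else setT.
have mA j : measurable (A j) by rewrite /A; case: ifP.
exists [set x : V | forall j, A j (x 0 j)]; split.
- rewrite (_ : [set x | _] = \bigcap_(j in [set: 'I_n]) (fun x : V => x 0 j) @^-1` A j).
    apply: fin_bigcap_measurable => // j _; rewrite -[X in measurable X]setTI.
    exact: measurable_rV_coord.
  by apply/seteqP; split => x /= h j => [_|]; exact: h.
(* Side [i] has length 0 and the others are infinite; the product vanishes by the convention
   [0 * +oo = 0]. *)
- rewrite lebesgue_rV_box// (bigD1 i)//= {1}/A eqxx lebesgue_measure_set1.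
  by rewrite mul0e.
- by move=> x /= xc j; rewrite /A; case: eqP => [->|].
Qed.

(** Away from the boundary hyperplane, which is negligible, being inside or outside is an open
    condition and survives small shifts. *)
Let G_half (i : 'I_n) (c : R) : G [set x : V | x 0 i < c].
Proof.
split.
  rewrite -[X in measurable X]setTI.
  rewrite (_ : [set x | _] = (fun x : V => x 0 i : measurableTypeR R) @^-1` `]-oo, c[%classic).
    by apply: measurable_rV_coord.
  by apply/seteqP; split=> x /=; rewrite in_itv.
apply: negligibleS (negligible_hyperplane i c) => x /=.
apply: contra_notP => /eqP xc.
have shx : x 0 i + k.+1%:R^-1 * y 0 i @[k --> \oo] --> x 0 i + 0 * y 0 i.
  apply: cvgD; first exact: cvg_cst.
  by apply: cvgM; [exact: cvg_harmonic|exact: cvg_cst].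
rewrite mul0r addr0 in shx.
have [xc'|xc'] := ltP (x 0 i) c.
  have : \forall k \near \oo, x 0 i + k.+1%:R^-1 * y 0 i < c.
    by apply: (cvgr_lt _ shx).
  by apply: filterS => k; rewrite /sh !mxE => ->.
have {}xc' : c < x 0 i by rewrite lt_neqAle eq_sym xc.
have : \forall k \near \oo, x 0 i + k.+1%:R^-1 * y 0 i > c.
  by apply: (cvgr_gt _ shx).
by apply: filterS => k /ltW ck; rewrite /sh !mxE; split; rewrite ltNge ?ck// (ltW xc').
Qed.

Let G_gen : (@measurable _ V) = <<s G >>.
Proof.
rewrite eqEsubset; split; last first.
  by apply: smallest_sub; [exact: sigma_algebra_measurable|move=> A []].
apply: smallest_sub; first exact: smallest_sigma_algebra.
rewrite -bigcup_seq => A [i _] [B mB <-]; rewrite setTI.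
pose VG := g_sigma_algebraType G.
have mi : measurable_fun [set: VG] (fun x : VG => (x : V) 0 i : measurableTypeR R).
  apply: (measurability _ (RGenInftyO.measurableE R)) => _ [_ [c ->] <-].
  apply: sub_sigma_algebra; rewrite setTI.
  rewrite (_ : _ @^-1` _ = [set x : V | x 0 i < c]); first exact: G_half.
  by apply/seteqP; split=> x /=; rewrite in_itv.
by have := mi measurableT B mB; rewrite setTI.
Qed.

(** The factor [expker] puts the indicator of every measurable set in L2, even when the set has
    infinite measure; the lambda-system has to contain the whole space. *)
Let rho A (x : V) : R := expker x * \1_A x.

Let rho_bound A x : 0 <= rho A x <= expker x.
Proof.
by rewrite /rho mulr_ge0 ?expker_ge0//= ler_piMr ?expker_ge0.
Qed.

Let measurable_rho A : measurable A -> cmeasurable (fun x => (rho A x)%:C).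
Proof.
move=> mA; apply: cmeasurable_real; apply: measurable_funM.
  exact: measurable_expker.
exact: measurable_indic.
Qed.

Let sqnormc_real (a b : R) : sqnormc (a%:C - b%:C) = (a - b) ^+ 2.
Proof. by rewrite /sqnormc /= subrr expr0n addr0. Qed.

Let sqnormc_rho_le (a b c x : R) : 0 <= a <= c -> 0 <= b <= c -> 0 <= c <= x ->
  (a - b) ^+ 2 <= x * c.
Proof. by move=> /andP[? ?] /andP[? ?] /andP[? ?]; nra. Qed.

Let tcont_rhoG A : G A -> tcont (fun x => (rho A x)%:C).
Proof.
move=> [mA aA]; split; first exact: measurable_rho.
(* The shifts have parameter in [[0, 1]], so by [expkerD_le] all translates of [expker] are below
   [C * expker] with [C] the inverse of [expker y]. *)
have a01 k : 0 <= (k.+1%:R^-1 : R) <= 1 by rewrite invr_ge0 ler0n invf_le1// ler1n.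
pose C := (expker y)^-1 : R.
have C1 : 1 <= C by rewrite /C -[leLHS]invr1 lef_pV2 ?posrE ?expker_gt0// expker_le1.
have C0 : 0 <= C by exact: le_trans C1.
apply: (cvg_sqdist (r := fun x => C * (C * expker x))).
- by move=> k; exact: (cmeasurable_comp (msh k) (measurable_rho mA)).
- exact: measurable_rho.
- apply: filterS aA => x Ax.
  have H : `|expker (sh k x) - expker x| @[k --> \oo] --> (0 : R).
    rewrite -(@normr0 R R) -(subrr (expker x)); apply: cvg_norm.
    by apply: cvgB; [exact: cvg_expkerD|exact: cvg_cst].
  apply: (@squeeze_cvgr _ _ _ _ (fun=> 0) (fun k => `|expker (sh k x) - expker x|)) => //; last exact: cvg_cst.
  apply: filterS Ax => k Axk; rewrite cabs_ge0/= -rmorphB cabs_real /rho !indicE.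
  have -> : (sh k x \in A) = (x \in A) by apply/idP/idP; rewrite !inE => /Axk.
  by rewrite -mulrBl normrM ler_piMr//; case: (_ \in _); rewrite ?normr1 ?normr0.
- by apply: measurable_funM => //; apply: measurable_funM => //; exact: measurable_expker.
- move=> k x; rewrite sqnormc_real.
  have /andP[r0 r1] := rho_bound A x; have /andP[s0 s1] := rho_bound A (sh k x).
  apply: sqnormc_rho_le.
  + by rewrite s0/= (le_trans s1)// expkerD_le.
  + by rewrite r0/= (le_trans r1)// ler_peMl ?expker_ge0.
  + by rewrite mulr_ge0 ?expker_ge0//= ler_piMr// expker_le1.
- under eq_integral do rewrite mulrA EFinM.
  rewrite ge0_integralZl//.
  + by rewrite lte_mul_pinfty// ?integral_expker_lty// lee_fin mulr_ge0.
  + by apply/measurable_EFinP; exact: measurable_expker.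
  + by move=> x _; rewrite lee_fin expker_ge0.
  + by rewrite lee_fin mulr_ge0.
Qed.

Let tcont_rho A : measurable A -> tcont (fun x => (rho A x)%:C).
Proof.
rewrite G_gen.
suff : <<s G >> `<=` [set A | measurable A /\ tcont (fun x => (rho A x)%:C)].
  by move=> H /H[].
apply: (lambda_system_subset G_setI) => //; last first.
  by move=> B GB; split; [case: GB|exact: tcont_rhoG].
split => //.
- split=> //; apply: tcont_rhoG; split => //.
  by apply: aeW => x; apply: nearW.
- move=> B B' B'B [mB tB] [mB' tB']; split; first exact: measurableD.
  have := tcontD tB (tcontZ (-1) tB'); congr tcont; apply/funext => x.
  rewrite mulN1r -rmorphB /rho -mulrBr !indicE; congr (_ * _)%:C.
  rewrite in_setD; have [xB'|xB'] := boolP (x \in B'); last by rewrite subr0 andbT.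
  have -> : x \in B by apply/mem_set/B'B/set_mem.
  by rewrite subrr.
- move=> F ndF HF; have mU : measurable (\bigcup_i F i).
    by apply: bigcup_measurable => i _; have [] := HF i.
  split => //; apply: tcont_closure; first exact: measurable_rho.
  exists (fun j x => (rho (F j) x)%:C); split; first by move=> j; have [] := HF j.
  apply: (cvg_sqdist (r := fun x => 1 * expker x)).
  + by move=> j; apply: measurable_rho; have [] := HF j.
  + exact: measurable_rho.
  + apply: aeW => x; apply: cvg_near_cst.
    have [[m _ Fmx]|nF] := pselect ((\bigcup_i F i) x); last first.
      apply: nearW => j; rewrite /rho !indicE !memNset ?subrr ?cabs0//.
      by move=> Fjx; apply: nF; exists j.
    exists m => // j /= mj.
    have Fjx : F j x by move: x Fmx; exact/subsetPset/ndF.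
    rewrite /rho !indicE !mem_set ?subrr ?cabs0//; by exists m.
  + by apply: measurable_funM => //; exact: measurable_expker.
  + move=> j x; rewrite sqnormc_real; apply: sqnormc_rho_le; rewrite ?rho_bound//.
    by rewrite expker_ge0 expker_le1.
  + by under eq_integral do rewrite mul1r; exact: integral_expker_lty.
Qed.

(** Simple functions are used to approximate [h = f / expker] from below instead of [f]. Multiplied
    back by [expker] they are finite combinations of the functions [rho A], and they stay below [f],
    which dominates the convergence in L2. *)
Let tcont_ge0 (f : V -> R) : measurable_fun setT f -> (forall x, 0 <= f x) ->
  (\int[leb]_x (f x ^+ 2)%:E < +oo)%E -> tcont (fun x => (f x)%:C).
Proof.
move=> mf f0 foo.
pose h x := f x / expker x.
have mh : measurable_fun setT h.
  by apply: measurable_funM => //; exact: measurable_expkerV.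
have mhe : measurable_fun setT (EFin \o h) by exact/measurable_EFinP.
have h0 x : (0 <= (EFin \o h) x)%E by rewrite lee_fin divr_ge0// expker_ge0.
pose h_ := nnsfun_approx measurableT mhe.
have ch x : h_ k x @[k --> \oo] --> h x.
  by have /fine_cvgP[_] := cvg_nnsfun_approx measurableT mhe (fun x _ => h0 x) (x := x) I.
have hh k x : h_ k x <= h x.
  rewrite -lee_fin nnsfun_approxE; exact: (le_approx k (fun x _ => h0 x) I).
apply: tcont_closure; first exact: cmeasurable_real.
exists (fun k x => (expker x * h_ k x)%:C); split.
  move=> k.
  pose A c := h_ k @^-1` [set c].
  have mA c : measurable (A c) by exact: measurable_funPTI.
  have := tcont_sum (finmap.enum_fset (fset_set (range (h_ k)))) (fun c : R => tcontZ c%:C (tcont_rho (mA c))).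
  congr tcont; apply/funext => x.
  rewrite (fimfunE (h_ k) x) fsbig_finite//= mulr_sumr rmorph_sum.
  by apply: eq_bigr => c _; rewrite -rmorphM /rho mulrCA.
apply: (cvg_sqdist (r := fun x => f x ^+ 2)).
- move=> k; apply: cmeasurable_real; apply: measurable_funM => //.
  exact: measurable_expker.
- exact: cmeasurable_real.
- apply: aeW => x; under eq_fun do rewrite -rmorphB cabs_real.
  rewrite -(@normr0 R R) -(subrr (f x)); apply: cvg_norm.
  apply: cvgB; last exact: cvg_cst.
  rewrite -[X in _ --> X](@divfK _ (expker x)) ?gt_eqF ?expker_gt0// mulrC.
  by apply: cvgM; [exact: cvg_cst|exact: ch].
- by apply: measurable_funX.
- move=> k x; rewrite sqnormc_real -[leLHS]sqrrN ler_sqr ?nnegrE ?opprB ?subr_ge0//.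
    by rewrite lerBlDl lerDr mulr_ge0// expker_ge0.
  by rewrite mulrC -ler_pdivlMr ?expker_gt0//; exact: hh.
- exact: foo.
Qed.

Lemma cvg_translation f : square_integrable leb f ->
  sqdist leb (fun x => f (x + k.+1%:R^-1 *: y)) f @[k --> \oo] --> 0%E.
Proof.
move=> [[rf jf] foo].
have H (r : V -> R) : measurable_fun setT r -> (forall x, r x ^+ 2 <= sqnormc (f x)) ->
    tcont (fun x => (r x)%:C).
  move=> mr rfx.
  have K (q : V -> R) : measurable_fun setT q -> (forall x, q x ^+ 2 <= sqnormc (f x)) ->
      tcont (fun x => (Num.max (q x) 0)%:C).
    move=> mq qf; apply: tcont_ge0.
    - exact: measurable_maxr.
    - by move=> x; rewrite le_max lexx orbT.
    - apply: le_lt_trans foo; apply: ge0_le_integral => //.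
      + by move=> x _; rewrite lee_fin sqr_ge0.
      + by apply/measurable_EFinP; apply: measurable_funX; exact: measurable_maxr.
      + exact: emeasurable_sqnormc.
      + move=> x _; rewrite lee_fin (le_trans _ (qf x))// maxEle.
        by case: ifP => // _; rewrite expr0n sqr_ge0.
  have := tcontD (K r mr rfx) (tcontZ (-1) (K (fun x => - r x) _ _)).
  have -> : (fun x => (Num.max (r x) 0)%:C + -1 * (Num.max (- r x) 0)%:C) = fun x => (r x)%:C.
    apply/funext => x; rewrite mulN1r -rmorphB; congr (_%:C).
    by rewrite !maxEle oppr_le0; case: (leP (r x) 0) => [r0|r0];
      [case: (leP 0 (r x)) => [r0'|]; [have -> : r x = 0 by lra|];lra|rewrite ltW//; lra].
  apply.
    exact: measurable_funN.
  by move=> x; rewrite sqrrN.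
have : tcont (fun x => (complex.Re (f x))%:C + 'i%C * (complex.Im (f x))%:C).
  apply: tcontD; last apply: tcontZ; apply: H => // x; rewrite /sqnormc.
    by rewrite lerDl sqr_ge0.
  by rewrite lerDr sqr_ge0.
rewrite (_ : (fun x => _) = f); first by case.
by apply/funext => x; rewrite -complexE.
Qed.

End translation_continuity.

(** * Products and limits of square-integrable functions *)

Section L2.
Context {R : realType} {d} {T : measurableType d} (mu : {measure set T -> \bar R}).
Implicit Types f g : T -> R[i].
Local Notation L2 := (square_integrable mu).

Lemma integral_sqnormc_ge0 f : (0 <= \int[mu]_x (sqnormc (f x))%:E)%E.
Proof. by apply: integral_ge0 => x _; rewrite lee_fin sqnormc_ge0. Qed.

Lemma integral_cabs_ge0 f : (0 <= \int[mu]_x (cabs (f x))%:E)%E.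
Proof. by apply: integral_ge0 => x _; rewrite lee_fin cabs_ge0. Qed.

(** This weighted AM-GM inequality stands in for Cauchy-Schwarz, which is its optimization over [l].
    It holds in the extended reals without any discussion of infinite values. *)
Lemma integral_cabsM_le (l : R) f g : 0 < l -> cmeasurable f -> cmeasurable g ->
  (\int[mu]_x (cabs (f x * g x))%:E <= (l / 2)%:E * \int[mu]_x (sqnormc (f x))%:E
     + (l^-1 / 2)%:E * \int[mu]_x (sqnormc (g x))%:E)%E.
Proof.
move=> l0 mf mg.
have l20 : 0 <= l / 2 by rewrite divr_ge0// ltW.
have l20' : 0 <= l^-1 / 2 by rewrite divr_ge0// invr_ge0 ltW.
rewrite -!ge0_integralZl//; first last.
- by move=> x _; rewrite lee_fin sqnormc_ge0.
- exact: emeasurable_sqnormc.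
- by move=> x _; rewrite lee_fin sqnormc_ge0.
- exact: emeasurable_sqnormc.
rewrite -ge0_integralD//; first last.
- by apply: emeasurable_funM => //; exact: emeasurable_sqnormc.
- by move=> x _; rewrite -EFinM lee_fin mulr_ge0 ?sqnormc_ge0.
- by apply: emeasurable_funM => //; exact: emeasurable_sqnormc.
- by move=> x _; rewrite -EFinM lee_fin mulr_ge0 ?sqnormc_ge0.
apply: ge0_le_integral => //.
- by move=> x _; rewrite lee_fin cabs_ge0.
- by apply: emeasurable_cabs; exact: cmeasurableM.
- by apply: emeasurable_funD; apply: emeasurable_funM => //; exact: emeasurable_sqnormc.
move=> x _; rewrite -!EFinM -EFinD lee_fin cabsM -!sqr_cabs.
rewrite -subr_ge0.
have -> : l / 2 * cabs (f x) ^+ 2 + l^-1 / 2 * cabs (g x) ^+ 2 - cabs (f x) * cabs (g x)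
  = l^-1 / 2 * (l * cabs (f x) - cabs (g x)) ^+ 2 by field; rewrite gt_eqF.
by rewrite mulr_ge0// sqr_ge0.
Qed.

Lemma L2_cintegrableM f g : L2 f -> L2 g -> cintegrable mu (fun x => f x * g x).
Proof.
move=> [mf foo] [mg goo]; split; first exact: cmeasurableM.
apply: le_lt_trans (integral_cabsM_le ltr01 mf mg) _.
by apply: lte_add_pinfty; rewrite lte_mul_pinfty// lee_fin divr_ge0// invr_ge0.
Qed.

Lemma L2_conj f : L2 f -> L2 (fun x => conjc (f x)).
Proof.
move=> [mf foo]; split; first exact: cmeasurable_conj.
by under eq_integral do rewrite -sqr_cabs cabsJ sqr_cabs.
Qed.

Lemma L2_le f (r : T -> R) : cmeasurable f -> measurable_fun setT r ->
  (forall x, sqnormc (f x) <= r x) -> (\int[mu]_x (r x)%:E < +oo)%E -> L2 f.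
Proof.
move=> mf mr fr roo; split => //; apply: le_lt_trans roo.
apply: ge0_le_integral => //.
- by move=> x _; rewrite lee_fin sqnormc_ge0.
- exact: emeasurable_sqnormc.
- exact/measurable_EFinP.
- by move=> x _; rewrite lee_fin.
Qed.

Lemma L2_bddM f h (C : R) : L2 f -> cmeasurable h -> (forall x, sqnormc (h x) <= C) ->
  L2 (fun x => h x * f x).
Proof.
move=> [mf foo] mh hC; have [/eqP T0|/set0P[x0 _]] := boolP ([set: T] == set0).
  split; first exact: cmeasurableM.
  by rewrite (_ : [set: _] = set0) ?integral_set0.
have C0 : 0 <= C := le_trans (sqnormc_ge0 _) (hC x0).
apply: (@L2_le _ (fun x => C * sqnormc (f x))).
- exact: cmeasurableM.
- by apply: measurable_funM => //; exact: measurable_sqnormc.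
- by move=> x; rewrite sqnormcM ler_wpM2r ?sqnormc_ge0.
- under eq_integral do rewrite EFinM.
  rewrite ge0_integralZl//.
  + by rewrite lte_mul_pinfty.
  + exact: emeasurable_sqnormc.
  + by move=> x _; rewrite lee_fin sqnormc_ge0.
Qed.

Lemma L2_B f g : L2 f -> L2 g -> L2 (fun x => f x - g x).
Proof.
move=> [mf foo] [mg goo]; split; first exact: cmeasurableB.
apply: le_lt_trans (le_integral_sqnormcD mu mf (cmeasurableN mg)) _.
under [X in (_ + 2%:E * X)%E]eq_integral do rewrite -sqr_cabs cabsN sqr_cabs.
by apply: lte_add_pinfty; rewrite lte_mul_pinfty.
Qed.

Lemma cvg_integral_cabsM (u_ g_ : nat -> T -> R[i]) (G : R) :
  (forall k, cmeasurable (u_ k)) -> (forall k, cmeasurable (g_ k)) ->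
  (forall k, \int[mu]_x (sqnormc (g_ k x))%:E <= G%:E)%E ->
  (\int[mu]_x (sqnormc (u_ k x))%:E)%E @[k --> \oo] --> 0%E ->
  (\int[mu]_x (cabs (u_ k x * g_ k x))%:E)%E @[k --> \oo] --> 0%E.
Proof.
move=> mu_ mg gG u0; apply/cvge0P => [k|e e0]; first exact: integral_cabs_ge0.
have G0 : 0 <= G by rewrite -lee_fin (le_trans _ (gG 0%N))// integral_sqnormc_ge0.
(* The weight [l = (G + 1) / e] makes the term in [G] at most [e / 2]; the added 1 covers [G = 0].
   The smallness asked of [u_ k] makes the other term at most [e / 2]. *)
have l0 : 0 < (G + 1) / e by rewrite divr_gt0// ltr_wpDl.
have e'0 : 0 < e / ((G + 1) / e) by rewrite divr_gt0.
have := (cvge0P (fun k => integral_sqnormc_ge0 (u_ k))).2 u0 _ e'0.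
apply: filterS => k uk.
apply: le_trans (integral_cabsM_le l0 (mu_ k) (mg k)) _.
apply: (@le_trans _ _ ((((G + 1) / e) / 2)%:E * (e / ((G + 1) / e))%:E +
  ((((G + 1) / e)^-1) / 2)%:E * G%:E)%E).
  by apply: leeD; rewrite lee_pmul2l// lte_fin divr_gt0// invr_gt0.
rewrite -!EFinM -EFinD lee_fin.
have -> : (G + 1) / e / 2 * (e / ((G + 1) / e)) = e / 2.
  by field; rewrite !gt_eqF// ltr_wpDl.
have -> : ((G + 1) / e)^-1 / 2 * G = e / 2 * (G / (G + 1)).
  by field; rewrite !gt_eqF// ltr_wpDl.
have : e / 2 * (G / (G + 1)) <= e / 2.
  by rewrite ler_piMr ?divr_ge0 ?ltW// ltr_pdivrMr ?ltr_wpDl// mul1r ltrDl.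
lra.
Qed.

(** From [u v - a b = (u - a) (v - b) + (u - a) b + (v - b) a]. The comparison functions may vary
    with [k] as long as their energies stay bounded, so that two sequences without known limits can
    be compared. *)
Lemma cvg_cintegralM2 (u_ v_ a_ b_ : nat -> T -> R[i]) (M : R) :
  (forall k, L2 (u_ k)) -> (forall k, L2 (v_ k)) ->
  (forall k, L2 (a_ k)) -> (forall k, L2 (b_ k)) ->
  (forall k, \int[mu]_x (sqnormc (a_ k x))%:E <= M%:E)%E ->
  (forall k, \int[mu]_x (sqnormc (b_ k x))%:E <= M%:E)%E ->
  sqdist mu (u_ k) (a_ k) @[k --> \oo] --> 0%E ->
  sqdist mu (v_ k) (b_ k) @[k --> \oo] --> 0%E ->
  cabs (cintegral mu (fun x => u_ k x * v_ k x) -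
        cintegral mu (fun x => a_ k x * b_ k x)) @[k --> \oo] --> (0 : R).
Proof.
move=> Lu_ Lv_ Lu Lv aM bM du dv.
pose a k := (\int[mu]_x (cabs ((u_ k x - a_ k x) * (v_ k x - b_ k x)))%:E)%E.
pose b k := (\int[mu]_x (cabs ((u_ k x - a_ k x) * b_ k x))%:E)%E.
pose c k := (\int[mu]_x (cabs ((v_ k x - b_ k x) * a_ k x))%:E)%E.
have mdu k : cmeasurable (fun x => u_ k x - a_ k x) by exact: (L2_B (Lu_ k) (Lu k)).1.
have mdv k : cmeasurable (fun x => v_ k x - b_ k x) by exact: (L2_B (Lv_ k) (Lv k)).1.
have b0 : b k @[k --> \oo] --> 0%E.
  by apply: cvg_integral_cabsM bM du => // k; exact: (Lv k).1.
have c0 : c k @[k --> \oo] --> 0%E.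
  by apply: cvg_integral_cabsM aM dv => // k; exact: (Lu k).1.
have a0 : a k @[k --> \oo] --> 0%E.
  apply: (@cvge0_le _ _ (fun k => (1 / 2)%:E * sqdist mu (u_ k) (a_ k) +
      (1^-1 / 2)%:E * sqdist mu (v_ k) (b_ k))%E); last first.
    by apply: cvge0D; exact: cvge0Zl.
  by move=> k; rewrite integral_cabs_ge0/=; exact: integral_cabsM_le.
have abc : (a k + b k + c k)%E @[k --> \oo] --> 0%E.
  by apply: cvge0D => //; exact: cvge0D.
suff : (cabs (cintegral mu (fun x => u_ k x * v_ k x) -
    cintegral mu (fun x => a_ k x * b_ k x)))%:E @[k --> \oo] --> 0%E.
  by move=> /fine_cvgP[].
apply: cvge0_le abc => k; rewrite lee_fin cabs_ge0/=.
have Iuv := L2_cintegrableM (Lu k) (Lv k).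
have Iuv_ := L2_cintegrableM (Lu_ k) (Lv_ k).
rewrite -cintegralB//; apply: le_trans (le_cabs_cintegral _ _) _.
  exact: (cintegrableB Iuv_ Iuv).1.
have mA : cmeasurable (fun x => (u_ k x - a_ k x) * (v_ k x - b_ k x)) by exact: cmeasurableM.
have mB : cmeasurable (fun x => (u_ k x - a_ k x) * b_ k x).
  by apply: cmeasurableM => //; exact: (Lv k).1.
have mC : cmeasurable (fun x => (v_ k x - b_ k x) * a_ k x).
  by apply: cmeasurableM => //; exact: (Lu k).1.
rewrite /a /b /c -!ge0_integralD//; first last.
all: try by exact: emeasurable_cabs.
all: try by move=> x _; rewrite lee_fin cabs_ge0.
- by apply: emeasurable_funD; exact: emeasurable_cabs.
- by move=> x _; rewrite -EFinD lee_fin addr_ge0 ?cabs_ge0.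
apply: ge0_le_integral => //.
- by move=> x _; rewrite lee_fin cabs_ge0.
- by apply: emeasurable_cabs; exact: (cintegrableB Iuv_ Iuv).1.
- apply: emeasurable_funD; last exact: emeasurable_cabs.
  by apply: emeasurable_funD; exact: emeasurable_cabs.
move=> x _; rewrite -!EFinD lee_fin.
have -> : u_ k x * v_ k x - a_ k x * b_ k x = (u_ k x - a_ k x) * (v_ k x - b_ k x) +
  (u_ k x - a_ k x) * b_ k x + (v_ k x - b_ k x) * a_ k x by ring.
by apply: le_trans (cabsD _ _) _; rewrite lerD2r cabsD.
Qed.

Lemma cvg_cintegralM (u_ v_ : nat -> T -> R[i]) u v :
  (forall k, L2 (u_ k)) -> (forall k, L2 (v_ k)) -> L2 u -> L2 v ->
  sqdist mu (u_ k) u @[k --> \oo] --> 0%E ->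
  sqdist mu (v_ k) v @[k --> \oo] --> 0%E ->
  cabs (cintegral mu (fun x => u_ k x * v_ k x) - cintegral mu (fun x => u x * v x))
    @[k --> \oo] --> (0 : R).
Proof.
move=> Lu_ Lv_ Lu Lv.
apply: (cvg_cintegralM2 (a_ := fun=> u) (b_ := fun=> v)
  (M := fine (\int[mu]_x (sqnormc (u x))%:E) + fine (\int[mu]_x (sqnormc (v x))%:E))) => // _.
- rewrite -[leLHS]fineK ?ge0_fin_numE ?integral_sqnormc_ge0//; last by case: Lu.
  by rewrite lee_fin lerDl fine_ge0// integral_sqnormc_ge0.
- rewrite -[leLHS]fineK ?ge0_fin_numE ?integral_sqnormc_ge0//; last by case: Lv.
  by rewrite lee_fin lerDr fine_ge0// integral_sqnormc_ge0.
Qed.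

Lemma cvg_cabs_unique (s : nat -> R[i]) (a b : R[i]) :
  cabs (s k - a) @[k --> \oo] --> (0 : R) ->
  cabs (s k - b) @[k --> \oo] --> (0 : R) -> a = b.
Proof.
move=> sa sb; apply/eqP; rewrite -subr_eq0; apply/eqP/cabs_eq0/eqP.
rewrite eq_le cabs_ge0 andbT; apply/ler_addgt0Pr => e e0; rewrite add0r.
have e20 : 0 < e / 2 by rewrite divr_gt0.
have na : \forall k \near \oo, `|cabs (s k - a)| < e / 2 by apply: ((cvgr0Pnorm_lt _).1 sa).
have nb : \forall k \near \oo, `|cabs (s k - b)| < e / 2 by apply: ((cvgr0Pnorm_lt _).1 sb).
have [k []] : exists k, `|cabs (s k - a)| < e / 2 /\ `|cabs (s k - b)| < e / 2.
  have [k _ /(_ k (leqnn k)) h] := filterI na nb; by exists k.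
rewrite !ger0_norm ?cabs_ge0// => ka kb.
have -> : a - b = - (s k - a) + (s k - b) by ring.
by rewrite (le_trans (cabsD _ _))// cabsN; lra.
Qed.

End L2.

Section sfprod.
Context {R : realType} {d1 d2} {T1 : measurableType d1} {T2 : measurableType d2}.
Variables (m1 : {sigma_finite_measure set T1 -> \bar R}).
Variables (m2 : {sigma_finite_measure set T2 -> \bar R}).

(* [m1 \x m2], with a sigma-finite structure so that products can be
   iterated. *)
Definition sfprod : set (T1 * T2) -> \bar R := (m1 \x m2)%E.

HB.instance Definition _ := Measure.on sfprod.

Let sfprod_sigma_finite : sigma_finite setT sfprod.
Proof.
have /sigma_finiteP[F [FT ndF Foo]] := sigma_finiteT m1.
have /sigma_finiteP[G [GT ndG Goo]] := sigma_finiteT m2.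
exists (fun k => F k `*` G k) => [|k].
  apply/seteqP; split => // -[x y] _.
  have [i _ Fx] : (\bigcup_k F k) x by rewrite -FT.
  have [j _ Gy] : (\bigcup_k G k) y by rewrite -GT.
  exists (i + j)%N => //; split.
    by move: x Fx; exact/subsetPset/ndF/leq_addr.
  by move: y Gy; exact/subsetPset/ndG/leq_addl.
have [mF Fk] := Foo k; have [mG Gk] := Goo k; split; first exact: measurableX.
by rewrite /sfprod product_measure1E// lte_mul_pinfty// ge0_fin_numE.
Qed.

HB.instance Definition _ := Measure_isSigmaFinite.Build _ _ _ sfprod
  sfprod_sigma_finite.

End sfprod.

Section fubini_inner.
Context {R : realType} {d1 d2} {T1 : measurableType d1} {T2 : measurableType d2}.
Variables (m1 : {sigma_finite_measure set T1 -> \bar R}).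
Variables (m2 : {sigma_finite_measure set T2 -> \bar R}).

Lemma cintegrable_cintegral1 (f : T1 * T2 -> R[i]) : cintegrable (m1 \x m2)%E f ->
  cintegrable m2 (fun y => cintegral m1 (fun x => f (x, y))).
Proof.
move=> [mf foo]; split; first exact: cmeasurable_cintegral1.
apply: le_lt_trans foo; rewrite (fubini_tonelli2 (fun z => (cabs (f z))%:E)); last 2 first.
- exact: emeasurable_cabs.
- by move=> z; rewrite lee_fin cabs_ge0.
apply: ge0_le_integral => //.
- by move=> x _; rewrite lee_fin cabs_ge0.
- by apply: emeasurable_cabs; exact: cmeasurable_cintegral1.
- apply: (measurable_fun_fubini_tonelli_G (fun z => (cabs (f z))%:E)) => [|z].
    exact: emeasurable_cabs.
  by rewrite lee_fin cabs_ge0.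
- move=> x _; apply: le_cabs_cintegral.
  by apply: (cmeasurable_comp (f := f) _ mf); exact: pair2_measurable.
Qed.

End fubini_inner.

(** * The Fourier transform *)

Section fourier_L1.
Context {R : realType} {n : nat}.
Local Notation V := 'rV[R]_n.
Local Notation leb := (lebesgue_rV R n).
Implicit Types (f g : V -> R[i]) (x y z xi : V).

Lemma cintegrable_phase d (T : measurableType d) (mu : {measure set T -> \bar R})
    (f : T -> R[i]) (h : T -> R) :
  cintegrable mu f -> measurable_fun setT h ->
  cintegrable mu (fun t => f t * expi (h t)).
Proof.
move=> If mh; under eq_fun do rewrite mulrC.
apply: (cintegrable_bddM (C := 1)) => //; first exact: cmeasurable_expi.
by move=> t; rewrite cabs_expi.
Qed.

Lemma measurable_dotr xi : measurable_fun setT (fun x => dot x xi).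
Proof. exact: measurable_dot. Qed.

Lemma cintegrable_fourier f xi : cintegrable leb f ->
  cintegrable leb (fun x => f x * expi (- (2 * pi * dot x xi))).
Proof.
move=> If; apply: cintegrable_phase => //; apply: measurable_funN.
by apply: measurable_funM => //; exact: measurable_dotr.
Qed.

Lemma cmeasurable_fourier f : cmeasurable f -> cmeasurable (fourier f).
Proof.
move=> mf; rewrite /fourier.
apply: (cmeasurable_cintegral2 leb (f := fun z : V * V => f z.2 * expi (- (2 * pi * dot z.2 z.1)))).
apply: cmeasurableM; first exact: cmeasurable_comp mf.
apply: cmeasurable_expi; apply: measurable_funN; apply: measurable_funM => //.
exact: measurable_dot.
Qed.

Lemma cauchyker_le y : cauchyker y <= 2 ^+ n.
Proof.
rewrite /cauchyker -[n in leRHS]card_ord -prodr_const; apply: ler_prod => i _.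
by rewrite cauchy1_ge0 cauchy1_le2.
Qed.

Lemma L2_rVD f x : square_integrable leb f ->
  square_integrable leb (fun y => f (y + x)).
Proof.
move=> [mf foo]; split; first by apply: cmeasurable_comp mf; exact: measurable_rVD.
rewrite (ge0_integral_rVD x (f := fun y => (sqnormc (f y))%:E))//.
  exact: emeasurable_sqnormc.
by move=> y; rewrite lee_fin sqnormc_ge0.
Qed.

Lemma correlation_le f g x : square_integrable leb f -> square_integrable leb g ->
  cabs (cintegral leb (fun y => f (y + x) * conjc (g y))) <=
  fine ((1 / 2)%:E * \int[leb]_x (sqnormc (f x))%:E +
        (1 / 2)%:E * \int[leb]_x (sqnormc (g x))%:E)%E.
Proof.
move=> Lf Lg; have Lfx := L2_rVD x Lf; have Lgc := L2_conj Lg.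
rewrite -lee_fin fineK; last first.
  rewrite ge0_fin_numE; first by apply: lte_add_pinfty; rewrite lte_mul_pinfty//; [case: Lf|case: Lg].
  by rewrite adde_ge0// mule_ge0// ?integral_sqnormc_ge0// lee_fin.
apply: le_trans (le_cabs_cintegral _ _) _; first exact: (L2_cintegrableM Lfx Lgc).1.
apply: le_trans (integral_cabsM_le _ ltr01 Lfx.1 Lgc.1) _.
rewrite invr1 (ge0_integral_rVD x (f := fun y => (sqnormc (f y))%:E))//.
- by under [X in (_ + _ * X <= _)%E]eq_integral do rewrite -sqr_cabs cabsJ sqr_cabs.
- exact: emeasurable_sqnormc Lf.1.
- by move=> y; rewrite lee_fin sqnormc_ge0.
Qed.

Lemma cintegrable_expkerZ (e : R) : 0 < e ->
  cintegrable leb (fun xi => (expker (e *: xi))%:C).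
Proof.
move=> e0; apply: (cintegrable_rVZ (f := fun v => (expker v)%:C)) => //.
split; first exact: cmeasurable_real measurable_expker.
under eq_integral do rewrite cabs_real ger0_norm ?expker_ge0//.
exact: integral_expker_lty.
Qed.

Section bilinear.
Variables (f g : V -> R[i]) (e : R).
Hypotheses (If : cintegrable leb f) (Ig : cintegrable leb g) (e0 : 0 < e).
Hypotheses (Lf : square_integrable leb f) (Lg : square_integrable leb g).

Let Igc : cintegrable leb (fun y => conjc (g y)).
Proof. exact: cintegrable_conj. Qed.

Let K z : R := e ^- n * cauchyker (e^-1 *: z).

Let mK : measurable_fun setT K.
Proof.
apply: measurable_funM => //; apply: (measurableT_comp measurable_cauchyker).
exact: measurable_rVZ.
Qed.

Let K_ge0 z : 0 <= K z.
Proof. by rewrite mulr_ge0 ?cauchyker_ge0// invr_ge0 exprn_ge0// ltW. Qed.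

Let K_le z : K z <= e ^- n * 2 ^+ n.
Proof. by rewrite ler_wpM2l ?cauchyker_le// invr_ge0 exprn_ge0// ltW. Qed.

Let B (p : V * V) : R[i] := f p.1 * conjc (g p.2).

Let IB : cintegrable (sfprod leb leb) B.
Proof. exact: (cintegrable_prodM If Igc). Qed.

Let phase (xi : V) (p : V * V) : R := - (2 * pi * dot xi (p.1 - p.2)).

Let F (z : V * (V * V)) : R[i] := (expker (e *: z.1))%:C * B z.2 * expi (phase z.1 z.2).

Let Iexpker : cintegrable leb (fun xi => (expker (e *: xi))%:C).
Proof. exact: cintegrable_expkerZ. Qed.

Let IF : cintegrable (leb \x sfprod leb leb)%E F.
Proof.
apply: cintegrable_phase; first exact: (cintegrable_prodM Iexpker IB).
apply: measurable_funN; apply: measurable_funM => //.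
apply: measurable_dot => //; apply: measurable_rVB.
  exact: (measurableT_comp measurable_fst measurable_snd).
exact: (measurableT_comp measurable_snd measurable_snd).
Qed.

Let fourier_prodE xi : fourier f xi * conjc (fourier g xi) =
  cintegral (sfprod leb leb) (fun p => B p * expi (phase xi p)).
Proof.
rewrite /fourier -cintegral_conj; last exact: cintegrable_fourier.
rewrite -cintegral_prodM; last 2 first.
- exact: cintegrable_fourier.
- by apply: cintegrable_conj; exact: cintegrable_fourier.
congr cintegral; apply/funext => p /=.
rewrite conjcM conjc_expi opprK mulrACA -expiD; congr (_ * expi _).
by rewrite /phase (dotC xi) dotDl dotNl; ring.
Qed.

Let BK : cintegrable (sfprod leb leb) (fun p => (K (p.1 - p.2))%:C * B p).
Proof.
apply: (cintegrable_bddM (C := e ^- n * 2 ^+ n)); first exact: IB.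
  apply: cmeasurable_real; apply: (measurableT_comp mK).
  exact: measurable_rVB.
by move=> p; rewrite cabs_real ger0_norm.
Qed.

Let H (z : V * V) : R[i] := (K z.2)%:C * (f (z.1 + z.2) * conjc (g z.1)).

Let mH : cmeasurable H.
Proof.
apply: cmeasurableM.
  apply: cmeasurable_real; exact: (measurableT_comp mK measurable_snd).
apply: cmeasurableM.
  apply: cmeasurable_comp If.1; exact: measurable_rVD.
by apply: cmeasurable_conj; apply: cmeasurable_comp Ig.1.
Qed.

Let IH : cintegrable (sfprod leb leb) H.
Proof.
apply: cintegrable_tonelli12 => //=.
under eq_integral => y _.
  rewrite [X in integral _ _ X](_ : _ =
     (fun z => (cabs ((K (z + y - y))%:C * B (z + y, y)))%:E)); last first.
    by apply/funext => z; rewrite addrK /H /B /= addrC.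
  rewrite (ge0_integral_rVD y (f := fun x => (cabs ((K (x - y))%:C * B (x, y)))%:E)); last 2 first.
  - apply: emeasurable_cabs; have [mBK _] := BK.
    apply: (cmeasurable_comp (f := fun p => (K (p.1 - p.2))%:C * B p) (h := fun x => (x, y))) => //.
  - by move=> x; rewrite lee_fin cabs_ge0.
  over.
have [mBK] := BK.
by rewrite (fubini_tonelli2 (fun p : V * V => (cabs ((K (p.1 - p.2))%:C * B p))%:E))//=;
  [exact: emeasurable_cabs|move=> p; rewrite lee_fin cabs_ge0].
Qed.

(** The product of the two transforms is an integral over pairs [(x, y)] with phase [xi . (x - y)].
    Integrating [xi] against [expker (e xi)] gives the Cauchy kernel of width [e] at [x - y], and
    [x = y + e z] gives the right-hand side. *)
Lemma fourier_bilinear :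
  cintegral leb (fun xi => (expker (e *: xi))%:C * (fourier f xi * conjc (fourier g xi))) =
  cintegral leb (fun z => (cauchyker z)%:C *
    cintegral leb (fun y => f (y + e *: z) * conjc (g y))).
Proof.
transitivity (cintegral leb (fun xi => cintegral (sfprod leb leb) (fun p => F (xi, p)))).
  congr cintegral; apply/funext => xi; rewrite fourier_prodE -cintegralZl.
    by congr cintegral; apply/funext => p; rewrite /F /= mulrA.
  apply: cintegrable_phase; first exact: IB.
  apply: measurable_funN; apply: measurable_funM => //.
  by apply: measurable_dot => //; exact: measurable_rVB.
(* After the exchange the [xi]-integral is innermost and is the known transform of the kernel. *)
rewrite cintegral12// -(cintegral21 (m2 := sfprod leb leb))//.
transitivity (cintegral (sfprod leb leb) (fun p => (K (p.1 - p.2))%:C * B p)).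
  congr cintegral; apply/funext => p; rewrite /F /=.
  under eq_fun do rewrite (mulrC _ (B p)) -mulrA.
  rewrite cintegralZl; last first.
    apply: cintegrable_phase => //; apply: measurable_funN.
    by apply: measurable_funM => //; exact: measurable_dotr.
  by rewrite fourier_expkerZ// mulrC.
rewrite -(cintegral21 (m1 := leb) (m2 := leb) BK)/=.
transitivity (cintegral leb (fun y => cintegral leb (fun z => H (y, z)))).
  congr cintegral; apply/funext => y; rewrite /B /=.
  rewrite -(cintegral_rVD y (f := fun x => (K (x - y))%:C * (f x * conjc (g y)))); last first.
    apply: (cintegrable_bddM (C := e ^- n * 2 ^+ n)).
    - by under eq_fun do rewrite mulrC; exact: cintegrableZl.
    - apply: cmeasurable_real; apply: (measurableT_comp mK).
      exact: measurable_rVB.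
    - by move=> p; rewrite cabs_real ger0_norm.
  by congr cintegral; apply/funext => z; rewrite addrK /H /= (addrC z).
transitivity (cintegral leb (fun z => cintegral leb (fun y => H (y, z)))).
  exact: (etrans (cintegral12 IH) (esym (cintegral21 IH))).
pose Phi z := cintegral leb (fun y => f (y + z) * conjc (g y)).
pose G z := (cauchyker (e^-1 *: z))%:C * Phi z.
have HE z : cintegral leb (fun x => H (x, z)) = (K z)%:C * Phi z.
  rewrite /H /= cintegralZl//; apply: L2_cintegrableM; last exact: L2_conj.
  exact: L2_rVD.
have en0 : e ^+ n != 0 by rewrite expf_neq0// gt_eqF.
have GE z : G z = (e ^+ n)%:C * ((K z)%:C * Phi z).
  by rewrite /G /K mulrA -rmorphM mulrA mulfV// mul1r.
have IG : cintegrable leb G.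
  rewrite (_ : G = fun z => (e ^+ n)%:C * cintegral leb (fun x => H (x, z))).
    have I1 : cintegrable leb (fun z => cintegral leb (fun x => H (x, z))) :=
      cintegrable_cintegral1 IH.
    exact: cintegrableZl.
  by apply/funext => z; rewrite HE GE.
(* The Jacobian of the dilation cancels the factor [e ^- n] in [K]. *)
transitivity (cintegral leb (fun z => G (e *: z))).
  rewrite cintegral_rVZ// -cintegralZl//; congr cintegral; apply/funext => z.
  by rewrite HE GE mulrA -rmorphM mulVf// mul1r.
by congr cintegral; apply/funext => z; rewrite /G scalerA mulVf ?gt_eqF// scale1r.
Qed.

End bilinear.

(** In the regularized identity every autocorrelation of [f] is at most its energy and the Cauchy
    kernel has mass 1, so the bound is uniform in the scale. Monotone convergence then removes the
    factor [expker]. When the energy is infinite there is nothing to prove. *)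
Lemma plancherel_le f : cintegrable leb f ->
  (\int[leb]_xi (sqnormc (fourier f xi))%:E <= \int[leb]_x (sqnormc (f x))%:E)%E.
Proof.
move=> If; have [foo|] := boolP (\int[leb]_x (sqnormc (f x))%:E < +oo)%E; last first.
  by rewrite -leNgt => /(le_trans _) -> //; rewrite leey.
have Lf : square_integrable leb f by split=> //; exact: If.1.
have mF : cmeasurable (fourier f) by apply: cmeasurable_fourier; exact: If.1.
pose M := fine (\int[leb]_x (sqnormc (f x))%:E)%E.
have ME : (\int[leb]_x (sqnormc (f x))%:E)%E = M%:E.
  by rewrite fineK// ge0_fin_numE// integral_sqnormc_ge0.
have M0 : 0 <= M by rewrite fine_ge0// integral_sqnormc_ge0.
pose C := fine (\int[leb]_x (cabs (f x))%:E)%E.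
have FC xi : cabs (fourier f xi) <= C.
  rewrite -lee_fin fineK; last first.
    by rewrite ge0_fin_numE ?integral_cabs_ge0//; case: If.
  apply: le_trans (le_cabs_cintegral _ _) _; first exact: (cintegrable_fourier xi If).1.
  by under eq_integral do rewrite cabsM cabs_expi mulr1.
pose a k : R := k.+1%:R^-1.
have a0 k : 0 < a k by rewrite invr_gt0.
pose s k (xi : V) : \bar R := (expker (a k *: xi) * sqnormc (fourier f xi))%:E.
have ms k : measurable_fun setT (s k).
  apply/measurable_EFinP; apply: measurable_funM; last exact: measurable_sqnormc.
  by apply: (measurableT_comp measurable_expker); exact: measurable_rVZ.
have s0 k xi : (0 <= s k xi)%E by rewrite lee_fin mulr_ge0 ?expker_ge0 ?sqnormc_ge0.
have sM k : (\int[leb]_xi s k xi <= M%:E)%E.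
  have Ie : cintegrable leb (fun xi => (expker (a k *: xi))%:C * (fourier f xi * conjc (fourier f xi))).
    under eq_fun do rewrite mulrC.
    apply: (cintegrable_bddM (C := C * C)).
    - exact: cintegrable_expkerZ.
    - by apply: cmeasurableM => //; exact: cmeasurable_conj.
    - by move=> xi; rewrite cabsM cabsJ ler_pM ?cabs_ge0.
  have sE xi : (expker (a k *: xi))%:C * (fourier f xi * conjc (fourier f xi)) =
      (expker (a k *: xi) * sqnormc (fourier f xi))%:C.
    by rewrite -sqnormcE -rmorphM.
  have Is : (\int[leb]_xi s k xi < +oo)%E.
    case: Ie => _; under eq_integral do rewrite sE cabs_real ger0_norm ?mulr_ge0 ?expker_ge0 ?sqnormc_ge0//.
    by [].
  rewrite -(@fineK _ (integral _ _ _)); last first.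
    by rewrite ge0_fin_numE//; exact: integral_ge0.
  rewrite lee_fin.
  have -> : fine (\int[leb]_xi s k xi)%E = cabs (cintegral leb (fun xi =>
      (expker (a k *: xi))%:C * (fourier f xi * conjc (fourier f xi)))).
    rewrite (_ : (fun xi => _ * _) = fun xi => (expker (a k *: xi) * sqnormc (fourier f xi))%:C); last first.
      by apply/funext => xi; exact: sE.
    rewrite cintegral_real cabs_real ger0_norm//; apply: Rintegral_ge0 => xi _.
    by rewrite mulr_ge0 ?expker_ge0 ?sqnormc_ge0.
  rewrite fourier_bilinear//; apply: cabs_cintegral_le.
    apply: cmeasurableM; first exact: cmeasurable_real measurable_cauchyker.
    apply: (cmeasurable_cintegral2 leb (f := fun z : V * V => f (z.2 + a k *: z.1) * conjc (f z.2))).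
    apply: cmeasurableM; last by apply: cmeasurable_conj; exact: cmeasurable_comp If.1.
    apply: cmeasurable_comp If.1; apply: measurable_rVD => //.
    exact: measurable_rVZ.
  apply: (@le_trans _ _ (\int[leb]_z ((cauchyker z)%:E * M%:E))%E).
    apply: ge0_le_integral => //.
    - by move=> z _; rewrite lee_fin cabs_ge0.
    - apply: emeasurable_cabs.
      apply: cmeasurableM; first exact: cmeasurable_real measurable_cauchyker.
      apply: (cmeasurable_cintegral2 leb (f := fun z : V * V => f (z.2 + a k *: z.1) * conjc (f z.2))).
      apply: cmeasurableM; last by apply: cmeasurable_conj; exact: cmeasurable_comp If.1.
      apply: cmeasurable_comp If.1; apply: measurable_rVD => //.
      exact: measurable_rVZ.
    - by apply/measurable_EFinP; apply: measurable_funM => //; exact: measurable_cauchyker.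
    - move=> z _; rewrite -EFinM lee_fin cabsM cabs_real ger0_norm ?cauchyker_ge0//.
      rewrite ler_wpM2l ?cauchyker_ge0//.
      have := correlation_le (a k *: z) Lf Lf; rewrite ME -!EFinM -EFinD /=.
      by have -> : 1 / 2 * M + 1 / 2 * M = M by field.
  rewrite ge0_integralZr//; last 2 first.
  - by apply/measurable_EFinP; exact: measurable_cauchyker.
  - by move=> z _; rewrite lee_fin cauchyker_ge0.
  by rewrite integral_cauchyker mul1e.
rewrite ME.
have cs : (\int[leb]_xi s k xi)%E @[k --> \oo] --> (\int[leb]_xi (sqnormc (fourier f xi))%:E)%E.
  have -> : (\int[leb]_xi (sqnormc (fourier f xi))%:E = \int[leb]_xi limn (s ^~ xi))%E.
    apply: eq_integral => xi _; apply/esym/cvg_lim => //.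
    apply: cvg_EFin; first exact: nearW.
    rewrite -[X in _ --> X]mul1r; apply: cvgM; last exact: cvg_cst.
    exact: cvg_expker.
  apply: cvg_monotone_convergence => //.
  move=> xi _ k l kl; rewrite lee_fin ler_wpM2r ?sqnormc_ge0//.
  rewrite /expker; apply: ler_prod => i _; rewrite expR_ge0/= ler_expR lerN2 !mxE !normrM.
  rewrite ler_wpM2r// !ger0_norm ?(ltW (a0 _))// lef_pV2 ?posrE ?ltr0n//.
  by rewrite ler_nat ltnS.
apply: cvge_to_le cs _; exact: nearW.
Qed.

Lemma square_integrable_fourier f : cintegrable leb f -> square_integrable leb f ->
  square_integrable leb (fourier f).
Proof.
move=> If [mf foo]; split; first exact: cmeasurable_fourier.
exact: le_lt_trans (plancherel_le If) foo.
Qed.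

(** Both sides are limits of the regularized identity. On the frequency side [plancherel_le]
    provides the integrable majorant; on the other side the shifted correlation tends to the inner
    product by continuity of translations. *)
Lemma parseval f g : cintegrable leb f -> cintegrable leb g ->
  square_integrable leb f -> square_integrable leb g ->
  cintegral leb (fun xi => fourier f xi * conjc (fourier g xi)) =
  cintegral leb (fun x => f x * conjc (g x)).
Proof.
move=> If Ig Lf Lg.
have LF := square_integrable_fourier If Lf; have LG := square_integrable_fourier Ig Lg.
have IFG := L2_cintegrableM LF (L2_conj LG).
pose a k : R := k.+1%:R^-1.
have a0 k : 0 < a k by rewrite invr_gt0.
pose s k := cintegral leb (fun xi => (expker (a k *: xi))%:C * (fourier f xi * conjc (fourier g xi))).
apply: (@cvg_cabs_unique _ s).
- apply: (cvg_cintegral (g := fun xi => cabs (fourier f xi * conjc (fourier g xi)))).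
  + move=> k; apply: cmeasurableM; last exact: IFG.1.
    apply: cmeasurable_real; apply: (measurableT_comp measurable_expker).
    exact: measurable_rVZ.
  + exact: IFG.1.
  + move=> xi; under eq_fun do rewrite -[X in _ - X]mul1r -mulrBl cabsM -(rmorphB _ _ 1) cabs_real.
    rewrite -(mul0r (cabs (fourier f xi * conjc (fourier g xi)))).
    apply: cvgM; last exact: cvg_cst.
    rewrite -(@normr0 R R) -(subrr (1 : R)); apply: cvg_norm; apply: cvgB; last exact: cvg_cst.
    exact: cvg_expker.
  + by apply: measurable_cabs; exact: IFG.1.
  + move=> k xi; rewrite cabsM cabs_real ger0_norm ?expker_ge0// ler_piMl ?cabs_ge0//.
    exact: expker_le1.
  + exact: IFG.2.
- pose Phi k z := cintegral leb (fun y => f (y + a k *: z) * conjc (g y)).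
  pose c := cintegral leb (fun x => f x * conjc (g x)).
  have sE : s = fun k => cintegral leb (fun z => (cauchyker z)%:C * Phi k z).
    by apply/funext => k; exact: fourier_bilinear.
  have cE : c = cintegral leb (fun z => (cauchyker z)%:C * c).
    under eq_fun do rewrite mulrC; rewrite cintegralZl; last first.
      split; first exact: cmeasurable_real measurable_cauchyker.
      under eq_integral do rewrite cabs_real ger0_norm ?cauchyker_ge0//.
      by rewrite integral_cauchyker ltry.
    by rewrite cintegral_real /Rintegral integral_cauchyker mulr1.
  rewrite (_ : (fun k => cabs _) = fun k => cabs (cintegral leb (fun z => (cauchyker z)%:C * Phi k z)
     - cintegral leb (fun z => (cauchyker z)%:C * c))); last first.
    by apply/funext => k; rewrite -cE sE.
  pose M := fine ((1 / 2)%:E * \int[leb]_x (sqnormc (f x))%:E + (1 / 2)%:E * \int[leb]_x (sqnormc (g x))%:E)%E.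
  have mPhi k : cmeasurable (Phi k).
    apply: (cmeasurable_cintegral2 leb (f := fun z : V * V => f (z.2 + a k *: z.1) * conjc (g z.2))).
    apply: cmeasurableM; last by apply: cmeasurable_conj; exact: cmeasurable_comp Ig.1.
    apply: cmeasurable_comp If.1; apply: measurable_rVD => //.
    exact: measurable_rVZ.
  apply: (cvg_cintegral (g := fun z => cauchyker z * M)).
  + by move=> k; apply: cmeasurableM => //; exact: cmeasurable_real measurable_cauchyker.
  + apply: cmeasurableM; last exact: cmeasurable_cst.
    exact: cmeasurable_real measurable_cauchyker.
  + move=> z; under eq_fun do rewrite -mulrBr cabsM.
    rewrite -(mulr0 (cabs (cauchyker z)%:C)); apply: cvgM; first exact: cvg_cst.
    apply: cvg_cintegralM => //.
    * by move=> k; exact: L2_rVD.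
    * by move=> k; exact: L2_conj.
    * exact: L2_conj.
    * exact: cvg_translation.
    * by under eq_fun do rewrite sqdistxx; exact: cvg_cst.
  + by apply: measurable_funM => //; exact: measurable_cauchyker.
  + move=> k z; rewrite cabsM cabs_real ger0_norm ?cauchyker_ge0//.
    rewrite ler_wpM2l ?cauchyker_ge0//; exact: correlation_le.
  + under eq_integral do rewrite EFinM.
    rewrite ge0_integralZr//.
    * by rewrite integral_cauchyker mul1e ltry.
    * by apply/measurable_EFinP; exact: measurable_cauchyker.
    * by move=> z _; rewrite lee_fin cauchyker_ge0.
    * by rewrite lee_fin fine_ge0// adde_ge0// mule_ge0// ?integral_sqnormc_ge0 ?lee_fin.
Qed.

End fourier_L1.

(** * Wigner distributions *)

Section affine.
Context {R : realType} {n : nat}.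
Local Notation V := 'rV[R]_n.
Local Notation leb := (lebesgue_rV R n).
Implicit Types (f g : V -> R[i]) (x y v xi : V).

Lemma transport_affine (c : R) x : c != 0 -> forall F : V -> \bar R,
  measurable_fun setT F -> (forall y, 0 <= F y)%E ->
  (\int[leb]_y F (x + c *: y)%R = (`|c| ^- n)%:E * \int[leb]_y F y)%E.
Proof.
move=> c0 F mF F0.
have mFx : measurable_fun setT (fun z : V => F (z + x)).
  by apply: (measurableT_comp mF); exact: measurable_rVD.
have nc0 : 0 < `|c| by rewrite normr_gt0.
have pos : (\int[leb]_y F (x + `|c| *: y)%R = (`|c| ^- n)%:E * \int[leb]_y F y)%E.
  rewrite -(ge0_integral_rVD x mF F0) -(ge0_integral_rVZ nc0 mFx)//.
  by apply: eq_integral => y _; rewrite addrC.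
have [cp|cn] := leP 0 c; first by move: pos; rewrite (ger0_norm cp).
rewrite -pos -[RHS](ge0_integral_rVN (f := fun y => F (x + `|c| *: y)))//.
  by apply: eq_integral => y _; rewrite ltr0_norm// scaleNr scalerN opprK.
by apply: (measurableT_comp mF); apply: measurable_rVD => //; exact: measurable_rVZ.
Qed.

Lemma measurable_affine (c : R) x : measurable_fun setT (fun y : V => x + c *: y).
Proof. by apply: measurable_rVD => //; exact: measurable_rVZ. Qed.

Lemma cintegral_affine (c : R) x f : c != 0 -> cintegrable leb f ->
  cintegral leb (fun y => f (x + c *: y)) = (`|c| ^- n)%:C * cintegral leb f.
Proof. by move=> c0 If; exact: (cintegral_transport (transport_affine x c0) If). Qed.

Lemma cintegrable_affine (c : R) x f : c != 0 -> cintegrable leb f ->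
  cintegrable leb (fun y => f (x + c *: y)).
Proof.
move=> c0 If; apply: (cintegrable_transport _ _ (transport_affine x c0) If).
  exact: measurable_affine.
by rewrite invr_ge0 exprn_ge0.
Qed.

Lemma integral_sqnormc_affine (c : R) x f : c != 0 -> cmeasurable f ->
  (\int[leb]_y (sqnormc (f (x + c *: y)))%:E =
   (`|c| ^- n)%:E * \int[leb]_y (sqnormc (f y))%:E)%E.
Proof.
move=> c0 mf; apply: (transport_affine x c0 (F := fun y => (sqnormc (f y))%:E)).
  exact: emeasurable_sqnormc.
by move=> y; rewrite lee_fin sqnormc_ge0.
Qed.

Lemma sqdist_affine (c : R) x f g : c != 0 -> cmeasurable f -> cmeasurable g ->
  sqdist leb (fun y => f (x + c *: y)) (fun y => g (x + c *: y)) =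
  ((`|c| ^- n)%:E * sqdist leb f g)%E.
Proof.
move=> c0 mf mg.
exact: (integral_sqnormc_affine x c0 (cmeasurableB mf mg)).
Qed.

Lemma L2_affine (c : R) x f : c != 0 -> square_integrable leb f ->
  square_integrable leb (fun y => f (x + c *: y)).
Proof.
move=> c0 [mf foo]; split.
  by apply: cmeasurable_comp mf; exact: measurable_affine.
by rewrite integral_sqnormc_affine// lte_mul_pinfty// lee_fin invr_ge0 exprn_ge0.
Qed.

Lemma L2_phase d (T : measurableType d) (mu : {measure set T -> \bar R})
    (f0 : T -> R[i]) (h : T -> R) : square_integrable mu f0 ->
  measurable_fun setT h -> square_integrable mu (fun t => f0 t * expi (h t)).
Proof.
move=> Lf mh; under eq_fun do rewrite mulrC.
apply: (L2_bddM (C := 1)) => //; first exact: cmeasurable_expi.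
by move=> t; rewrite -sqr_cabs cabs_expi expr1n.
Qed.

End affine.

Section wigner_theory.
Context {R : realType} {n : nat}.
Local Notation V := 'rV[R]_n.
Local Notation leb := (lebesgue_rV R n).
Local Notation L2 := (square_integrable leb).
Implicit Types (f g : V -> R[i]) (x y v xi : V).

Let half0 : 2^-1 != 0 :> R. Proof. by rewrite invr_eq0. Qed.
Let Nhalf0 : - 2^-1 != 0 :> R. Proof. by rewrite oppr_eq0. Qed.

(** With the phase absorbed here, the Wigner distribution at a fixed point is a bilinear pairing of
    two L2 functions of [y]. Writing [- 2^-1] as a scalar makes both factors affine
    substitutions. *)
Let wr f x v y : R[i] := conjc (f (x + (- 2^-1) *: y)) * expi (- (2 * pi * dot v y)).

Lemma wignerE f x v : wigner f f x v =
  cintegral leb (fun y => f (x + 2^-1 *: y) *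
    (conjc (f (x + (- 2^-1) *: y)) * expi (- (2 * pi * dot v y)))).
Proof.
by congr cintegral; apply/funext => y; rewrite -mulrA scaleNr.
Qed.

Let Ll f x : L2 f -> L2 (fun y => f (x + 2^-1 *: y)).
Proof. exact: L2_affine. Qed.

Let Lr f x v : L2 f -> L2 (wr f x v).
Proof.
move=> Lf; apply: L2_phase; first by apply: L2_conj; exact: L2_affine.
apply: measurable_funN; apply: measurable_funM => //; exact: measurable_dot.
Qed.

Let sqnormc_wr f x v y : sqnormc (wr f x v y) = sqnormc (f (x + (- 2^-1) *: y)).
Proof. by rewrite -!sqr_cabs cabsM cabs_expi mulr1 cabsJ. Qed.

Lemma cintegrable_wigner f x v : L2 f ->
  cintegrable leb (fun y => f (x + 2^-1 *: y) * conjc (f (x - 2^-1 *: y)) *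
     expi (- (2 * pi * dot v y))).
Proof.
move=> Lf; have := L2_cintegrableM (Ll x Lf) (Lr x v Lf).
by congr cintegrable; apply/funext => y; rewrite /wr scaleNr mulrA.
Qed.

(** Both L2 factors depend on the function through affine substitutions, which multiply squared
    distances by a constant. Neither sequence has to converge, which is how it is used on the
    frequency side. *)
Lemma cvg_wigner2 (f_ g_ : nat -> V -> R[i]) (M : R) x v :
  (forall k, L2 (f_ k)) -> (forall k, L2 (g_ k)) ->
  (forall k, \int[leb]_x (sqnormc (g_ k x))%:E <= M%:E)%E ->
  sqdist leb (f_ k) (g_ k) @[k --> \oo] --> 0%E ->
  cabs (wigner (f_ k) (f_ k) x v - wigner (g_ k) (g_ k) x v) @[k --> \oo] --> (0 : R).
Proof.
move=> Lf Lg gM fg; under eq_fun do rewrite !wignerE.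
have m2 (c : R) : 0 <= `|c| ^- n by rewrite invr_ge0 exprn_ge0.
apply: (cvg_cintegralM2 (u_ := fun k y => f_ k (x + 2^-1 *: y))
  (v_ := fun k => wr (f_ k) x v) (a_ := fun k y => g_ k (x + 2^-1 *: y))
  (b_ := fun k => wr (g_ k) x v) (M := `|2^-1| ^- n * M)).
- by move=> k; exact: Ll.
- by move=> k; exact: Lr.
- by move=> k; exact: Ll.
- by move=> k; exact: Lr.
- move=> k; rewrite integral_sqnormc_affine//; last exact: (Lg k).1.
  by rewrite EFinM lee_wpmul2l// lee_fin.
- move=> k; under eq_integral do rewrite sqnormc_wr.
  rewrite integral_sqnormc_affine//; last exact: (Lg k).1.
  by rewrite normrN EFinM lee_wpmul2l// lee_fin.
- under eq_fun => k do rewrite (sqdist_affine _ _ (Lf k).1 (Lg k).1)//.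
  exact: cvge0Zl.
- rewrite (_ : (fun k => _) = fun k => ((`|2^-1| ^- n)%:E * sqdist leb (f_ k) (g_ k))%E).
    exact: cvge0Zl.
  apply/funext => k; rewrite -normrN -(sqdist_affine x Nhalf0 (Lf k).1 (Lg k).1).
  apply: eq_integral => y _; rewrite /wr -mulrBl sqnormcM -[X in _ * X]sqr_cabs.
  by rewrite cabs_expi expr1n mulr1 -(rmorphB conjc) -!sqr_cabs cabsJ.
Qed.

Lemma cvg_wigner (f_ : nat -> V -> R[i]) f x v : (forall k, L2 (f_ k)) -> L2 f ->
  sqdist leb (f_ k) f @[k --> \oo] --> 0%E ->
  cabs (wigner (f_ k) (f_ k) x v - wigner f f x v) @[k --> \oo] --> (0 : R).
Proof.
move=> Lf_ Lf; apply: (cvg_wigner2 (g_ := fun=> f)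
   (M := fine (\int[leb]_x (sqnormc (f x))%:E)%E)) => // _.
by rewrite fineK// ge0_fin_numE ?integral_sqnormc_ge0//; case: Lf.
Qed.

Lemma wigner_ae_eq f g x v : L2 f -> L2 g -> {ae leb, forall x, f x = g x} ->
  wigner f f x v = wigner g g x v.
Proof.
move=> Lf Lg fg; apply: (@cvg_cabs_unique _ (fun=> wigner f f x v)).
  by under eq_fun do rewrite subrr cabs0; exact: cvg_cst.
apply: (cvg_wigner (f_ := fun=> f)) => //.
suff -> : sqdist leb f g = 0%E by exact: cvg_cst.
rewrite -(sqdistxx leb g); apply: ae_eq_integral => //.
- by apply: emeasurable_sqnormc; apply: cmeasurableB; [exact: Lf.1|exact: Lg.1].
- by apply: emeasurable_sqnormc; apply: cmeasurableB; exact: Lg.1.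
- by apply: filterS fg => t ->.
Qed.

Lemma cabs_wigner_le f x v : L2 f ->
  cabs (wigner f f x v) <= `|2^-1| ^- n * fine (\int[leb]_x (sqnormc (f x))%:E)%E.
Proof.
move=> Lf; rewrite wignerE; apply: cabs_cintegral_le.
  exact: (L2_cintegrableM (Ll x Lf) (Lr x v Lf)).1.
apply: le_trans (integral_cabsM_le _ ltr01 (Ll x Lf).1 (Lr x v Lf).1) _.
under [X in (_ + _ * X <= _)%E]eq_integral do rewrite sqnormc_wr.
rewrite !integral_sqnormc_affine//; try exact: Lf.1.
rewrite normrN -[in leLHS](@fineK _ (\int[leb]_x (sqnormc (f x))%:E)%E); last first.
  by rewrite ge0_fin_numE ?integral_sqnormc_ge0//; case: Lf.
rewrite -!EFinM -EFinD lee_fin; set F := fine _; set c := `|_| ^- _.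
by rewrite le_eqVlt; apply/orP; left; apply/eqP; field.
Qed.

Lemma cmeasurable_wigner_int f : cmeasurable f ->
  cmeasurable (fun z : (V * V) * V => f (z.1.1 + 2^-1 *: z.2) *
    conjc (f (z.1.1 - 2^-1 *: z.2)) * expi (- (2 * pi * dot z.1.2 z.2))).
Proof.
move=> mf.
have m11 : measurable_fun setT (fun z : (V * V) * V => z.1.1).
  exact: (measurableT_comp measurable_fst measurable_fst).
have m12 : measurable_fun setT (fun z : (V * V) * V => z.1.2).
  exact: (measurableT_comp measurable_snd measurable_fst).
have m2 : measurable_fun setT (fun z : (V * V) * V => 2^-1 *: z.2).
  exact: measurable_rVZ.
apply: cmeasurableM; first apply: cmeasurableM.
- by apply: cmeasurable_comp mf; exact: measurable_rVD.
- by apply: cmeasurable_conj; apply: cmeasurable_comp mf; exact: measurable_rVB.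
- apply: cmeasurable_expi; apply: measurable_funN; apply: measurable_funM => //.
  exact: measurable_dot.
Qed.

Lemma cmeasurable_wigner f : cmeasurable f ->
  cmeasurable (fun z : V * V => wigner f f z.1 z.2).
Proof.
by move=> mf; exact: (cmeasurable_cintegral2 leb (cmeasurable_wigner_int mf)).
Qed.

(** Parseval in the variable [y], applied to the two factors [a] and [b] of the integrand. Each has
    as its transform a modulated dilation of [fourier f], and a last substitution recognizes a
    Wigner integral. *)
Lemma wigner_fourier f x v : cintegrable leb f -> L2 f ->
  wigner f f x v = wigner (fourier f) (fourier f) v (- x).
Proof.
move=> If Lf.
pose a y := f (x + 2^-1 *: y) * expi (- (2 * pi * dot v y)).
pose b y := f (x + (- 2^-1) *: y).
have mph : measurable_fun setT (fun y => - (2 * pi * dot v y)).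
  by apply: measurable_funN; apply: measurable_funM => //; exact: measurable_dot.
have Ia : cintegrable leb a by apply: cintegrable_phase => //; exact: cintegrable_affine.
have Ib : cintegrable leb b by exact: cintegrable_affine.
have La : L2 a by apply: L2_phase => //; exact: L2_affine.
have Lb : L2 b by exact: L2_affine.
have half2 : `|2^-1 : R| ^- n = 2 ^+ n by rewrite ger0_norm// exprVn invrK.
have aE eta : fourier a eta = (2 ^+ n)%:C * (expi (2 * pi * (2 * dot (v + eta) x)) *
    fourier f (2 *: (v + eta))).
  rewrite /fourier -[X in _ = _ * X]cintegralZl; last exact: cintegrable_fourier.
  rewrite -half2 -(cintegral_affine x half0); last first.
    by apply: cintegrableZl; exact: cintegrable_fourier.
  congr cintegral; apply/funext => y.
  rewrite /a -mulrA -expiD mulrCA -expiD; congr (_ * expi _).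
  by rewrite !(dotDl, dotDr, dotZl, dotZr, dotC y, dotC x); field.
have bE eta : fourier b eta = (2 ^+ n)%:C * (expi (- (2 * pi * (2 * dot eta x))) *
    fourier f (- (2 *: eta))).
  rewrite /fourier -[X in _ = _ * X]cintegralZl; last exact: cintegrable_fourier.
  rewrite -half2 -(normrN 2^-1) -(cintegral_affine x Nhalf0); last first.
    by apply: cintegrableZl; exact: cintegrable_fourier.
  congr cintegral; apply/funext => y.
  rewrite /b mulrCA -expiD; congr (_ * expi _).
  by rewrite !(dotDl, dotDr, dotNl, dotNr, dotZl, dotZr, dotC y, dotC x); field.
have -> : wigner f f x v = cintegral leb (fun y => a y * conjc (b y)).
  rewrite wignerE; congr cintegral; apply/funext => y; rewrite /a /b.
  by rewrite mulrA mulrAC.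
rewrite -parseval//.
have LF := square_integrable_fourier If Lf.
have four0 : 4 != 0 :> R by [].
pose G xi := fourier f (v + 2^-1 *: xi) * conjc (fourier f (v - 2^-1 *: xi)) *
  expi (- (2 * pi * dot (- x) xi)).
have IG : cintegrable leb G by exact: cintegrable_wigner.
(* With [xi = 2 v + 4 eta] the points [v + xi / 2] and [v - xi / 2] are [2 (v + eta)] and [- 2 eta].
   The Jacobian [4 ^ n] is the product of the factors [2 ^ n] from [aE] and [bE]. *)
transitivity ((4 ^+ n)%:C * cintegral leb (fun eta => G (2 *: v + 4 *: eta))).
  rewrite -cintegralZl; last exact: cintegrable_affine.
  congr cintegral; apply/funext => eta; rewrite aE bE /G.
  rewrite !conjcM conjc_expi opprK conjc_real.
  have -> : v + 2^-1 *: (2 *: v + 4 *: eta) = 2 *: (v + eta).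
    by apply/rowP => i; rewrite !mxE; field.
  have -> : v - 2^-1 *: (2 *: v + 4 *: eta) = - (2 *: eta).
    by apply/rowP => i; rewrite !mxE; field.
  have -> : - (2 * pi * dot (- x) (2 *: v + 4 *: eta)) =
      2 * pi * (2 * dot (v + eta) x) + 2 * pi * (2 * dot eta x).
    by rewrite !(dotDl, dotDr, dotNl, dotNr, dotZl, dotZr, dotC x); ring.
  have -> : (4 ^+ n)%:C = (2 ^+ n)%:C * (2 ^+ n)%:C :> R[i].
    by rewrite -rmorphM -exprMn; congr ((_ ^+ _)%:C); ring.
  rewrite expiD; ring.
rewrite cintegral_affine// ger0_norm// mulrA -rmorphM mulfV ?expf_neq0// mul1r.
by [].
Qed.

End wigner_theory.

(** * The Bessel inequality for Wigner distributions *)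

Section shear.
Context {R : realType} {n : nat}.
Local Notation V := 'rV[R]_n.
Local Notation leb := (lebesgue_rV R n).

Lemma half_half : 2^-1 + 2^-1 = 1 :> R. Proof. by field. Qed.

(** The map has Jacobian 1 and is obtained from two translations: shifting [x] by [y / 2] leads to
    the pair [(x + y, x)], and for fixed [x] a shift in [y] leads to independent variables. *)
Lemma ge0_integral_shear (F : V * V -> \bar R) :
  measurable_fun setT F -> (forall z, 0 <= F z)%E ->
  (\int[leb]_x \int[leb]_y F ((x + 2^-1 *: y)%R, (x - 2^-1 *: y)%R) =
   \int[(leb \x leb)%E]_z F z)%E.
Proof.
move=> mF F0.
pose S (z : V * V) := (z.1 + 2^-1 *: z.2, z.1 - 2^-1 *: z.2).
have mS : measurable_fun setT S.
  have mh : measurable_fun setT (fun z : V * V => 2^-1 *: z.2) by exact: measurable_rVZ.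
  by apply/measurable_fun_pairP; split; [exact: measurable_rVD|exact: measurable_rVB].
pose T (z : V * V) := (z.1 + z.2, z.1).
have mT : measurable_fun setT T.
  by apply/measurable_fun_pairP; split; [exact: measurable_rVD|exact: measurable_fst].
have mFS : measurable_fun setT (fun z => F (S z)) by exact: (measurableT_comp mF).
have mFT : measurable_fun setT (fun z => F (T z)) by exact: (measurableT_comp mF).
rewrite (fubini_tonelli (fun z => F (S z)))//=.
transitivity (\int[leb]_y \int[leb]_x F (T (x, y)))%E.
  apply: eq_integral => y _.
  have mFy : measurable_fun setT (fun x : V => F ((x + 2^-1 *: y)%R, (x - 2^-1 *: y)%R)).
    apply: (measurableT_comp mFS (f := fun z => F (S z)) (g := fun x => (x, y))).
    exact: pair2_measurable.
  rewrite -(ge0_integral_rVD (2^-1 *: y) mFy)//.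
  apply: eq_integral => x _; rewrite /T /= addrK -addrA -scalerDl half_half scale1r.
  by [].
have FT := fubini_tonelli (m1 := leb) (m2 := leb) (fun z => F (T z)) mFT (fun z => F0 (T z)).
rewrite -FT (fubini_tonelli2 F mF F0) /fubini_G.
apply: eq_integral => x _; rewrite /T /=.
rewrite -(ge0_integral_rVD x (f := fun a => F (a, x)))//.
  by apply: eq_integral => y _; rewrite addrC.
apply: (measurableT_comp mF); exact: pair2_measurable.
Qed.

End shear.

Section bessel.
Context {R : realType} {n : nat} {J : choiceType}.
Local Notation V := 'rV[R]_n.
Local Notation leb := (lebesgue_rV R n).
Variable f : J -> V -> R[i].
Hypothesis orthf : orthonormal_L2 leb f.
Variables (s : seq J) (c : J -> R).
Hypothesis uniq_s : uniq s.

Let Lf j : square_integrable leb (f j). Proof. exact: orthf.1. Qed.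

(** The integral kernel of the operator that is diagonal in the system [f] with eigenvalues [c j];
    the next integral is its squared Hilbert-Schmidt norm. *)
Let K (z : V * V) : R[i] := \sum_(j <- s) (c j)%:C * (f j z.1 * conjc (f j z.2)).

Let cmeasurable_K : cmeasurable K.
Proof.
apply: cmeasurable_sum => j; apply: cmeasurableM; first exact: cmeasurable_cst.
apply: cmeasurableM; first by apply: cmeasurable_comp (Lf j).1.
by apply: cmeasurable_conj; apply: cmeasurable_comp (Lf j).1.
Qed.

Let A j k (x : V) := f j x * conjc (f k x).

Let IA j k : cintegrable leb (A j k).
Proof. by apply: L2_cintegrableM => //; exact: L2_conj. Qed.

Let sqnormc_K z : (sqnormc (K z))%:C =
  \sum_(j <- s) \sum_(k <- s) (c j * c k)%:C * (A j k z.1 * A k j z.2).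
Proof.
rewrite sqnormcE /K rmorph_sum big_distrl /=; apply: eq_bigr => j _.
rewrite big_distrr /=; apply: eq_bigr => k _.
rewrite !conjcM conjc_real conjcK /A rmorphM/=; ring.
Qed.

(** Expanding the square separates the variables into products of inner products of [f j] and [f k],
    of which orthonormality keeps the diagonal. As [s] has no repetition, each index contributes one
    diagonal term. *)
Lemma integral_sqnormc_kernel :
  (\int[(leb \x leb)%E]_z (sqnormc (K z))%:E = (\sum_(j <- s) c j ^+ 2)%:E)%E.
Proof.
have IAA j k : cintegrable (leb \x leb)%E
    (fun z => (c j * c k)%:C * (A j k z.1 * A k j z.2)).
  by apply: cintegrableZl; exact: cintegrable_prodM.
have IS j : cintegrable (leb \x leb)%E
    (fun z => \sum_(k <- s) (c j * c k)%:C * (A j k z.1 * A k j z.2)).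
  exact: cintegrable_sum.
have IK : cintegrable (leb \x leb)%E (fun z => (sqnormc (K z))%:C).
  by under eq_fun do rewrite sqnormc_K; exact: cintegrable_sum.
have foo : (\int[(leb \x leb)%E]_z (sqnormc (K z))%:E < +oo)%E.
  case: IK => _; under eq_integral do rewrite cabs_real ger0_norm ?sqnormc_ge0//.
  by [].
rewrite -[LHS]fineK; last by rewrite ge0_fin_numE// integral_sqnormc_ge0.
congr EFin; apply: (@complexI R); rewrite -[LHS]cintegral_real.
under eq_fun do rewrite sqnormc_K.
rewrite cintegral_sum// rmorph_sum/=.
rewrite big_seq [RHS]big_seq; apply: eq_bigr => j js.
rewrite cintegral_sum// (bigD1_seq j)//= big1 ?addr0; last first.
  move=> k kj; rewrite cintegralZl; last exact: cintegrable_prodM.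
  by rewrite cintegral_prodM// orthf.2 eq_sym (negbTE kj) mul0r mulr0.
rewrite cintegralZl; last exact: cintegrable_prodM.
by rewrite cintegral_prodM// orthf.2 eqxx !mulr1 expr2.
Qed.

(** For fixed [x] the combination of Wigner distributions is the Fourier transform in [y] of the
    sheared kernel. That function of [y] is integrable for every [x], so [plancherel_le] applies
    slice by slice, and the shear preserves the integral of the kernel. *)
Lemma bessel_wigner :
  (\int[(leb \x leb)%E]_z
     (sqnormc (\sum_(j <- s) (c j)%:C * wigner (f j) (f j) z.1 z.2))%:E <=
   (\sum_(j <- s) c j ^+ 2)%:E)%E.
Proof.
rewrite -integral_sqnormc_kernel.
rewrite -(ge0_integral_shear (F := fun z => (sqnormc (K z))%:E)); last 2 first.
- exact: emeasurable_sqnormc.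
- by move=> z; rewrite lee_fin sqnormc_ge0.
have mW : cmeasurable (fun z : V * V =>
    \sum_(j <- s) (c j)%:C * wigner (f j) (f j) z.1 z.2).
  apply: cmeasurable_sum => j; apply: cmeasurableM; first exact: cmeasurable_cst.
  exact: cmeasurable_wigner (Lf j).1.
pose g x y := K (x + 2^-1 *: y, x - 2^-1 *: y).
have Ig x : cintegrable leb (g x).
  apply: cintegrable_sum => j; apply: cintegrableZl => /=.
  have := cintegrable_wigner x 0 (Lf j); congr cintegrable; apply/funext => y.
  by rewrite -[0](scale0r (0 : V)) dotZl mul0r mulr0 oppr0 expi0 mulr1.
have gE x v : fourier (g x) v = \sum_(j <- s) (c j)%:C * wigner (f j) (f j) x v.
  rewrite /fourier /wigner.
  rewrite (_ : (fun y => _) = fun y => \sum_(j <- s) (c j)%:C *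
    (f j (x + 2^-1 *: y) * conjc (f j (x - 2^-1 *: y)) * expi (- (2 * pi * dot v y)))).
    rewrite cintegral_sum; last first.
      by move=> j; apply: cintegrableZl; exact: cintegrable_wigner.
    by apply: eq_bigr => j _; rewrite cintegralZl//; exact: cintegrable_wigner.
  apply/funext => y; rewrite /g /K big_distrl /=; apply: eq_bigr => j _.
  by rewrite dotC -mulrA.
rewrite (fubini_tonelli1 (fun z : V * V => (sqnormc (\sum_(j <- s) (c j)%:C * wigner (f j) (f j) z.1 z.2))%:E)); last 2 first.
- exact: emeasurable_sqnormc mW.
- by move=> z; rewrite lee_fin sqnormc_ge0.
apply: ge0_le_integral => //.
- by move=> x _; apply: integral_ge0 => y _; rewrite lee_fin sqnormc_ge0.
- apply: (measurable_fun_fubini_tonelli_F (fun z : V * V => (sqnormc _)%:E)).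
    exact: emeasurable_sqnormc mW.
  by move=> z; rewrite lee_fin sqnormc_ge0.
- apply: (measurable_fun_fubini_tonelli_F
    (fun z : V * V => (sqnormc (K (z.1 + 2^-1 *: z.2, z.1 - 2^-1 *: z.2)))%:E)).
    apply: emeasurable_sqnormc; apply: cmeasurable_comp cmeasurable_K.
    have mh : measurable_fun setT (fun z : V * V => 2^-1 *: z.2) by exact: measurable_rVZ.
    by apply/measurable_fun_pairP; split; [exact: measurable_rVD|exact: measurable_rVB].
  by move=> z; rewrite lee_fin sqnormc_ge0.
- move=> x _; rewrite /fubini_F; under eq_integral do rewrite -gE.
  exact: plancherel_le (Ig x).
Qed.

End bessel.

(** * Smooth cut-offs *)

Section contD.
Context {R : realType} {V : normedModType R}.
Implicit Types f g : V -> R.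

(* Unlike [smooth], this recursion differentiates first and is therefore stable
   under products by induction on [n]. *)
Fixpoint contD (n : nat) f : Prop :=
  if n is n'.+1 then [/\ continuous f, (forall x v, derivable f x v) &
    forall v, contD n' (fun x => 'D_v f x)]
  else continuous f.

Lemma contD_le n f : contD n.+1 f -> contD n f.
Proof.
elim: n f => [|n IH] f; first by case.
by move=> [cf df Df]; split=> // v; apply: IH; exact: Df.
Qed.

Lemma contD_smooth f : (forall n, contD n f) -> smooth f.
Proof.
move=> cf s; elim/last_ind: s f cf => [|s v IH] f cf.
  by have [c dc _] := cf 1; split.
rewrite /iter_derive foldr_rcons; apply: IH => n.
by have [_ _] := cf n.+1; exact.
Qed.

Lemma continuous_cstf (c : R) : continuous (fun _ : V => c).
Proof. by move=> x; exact: cvg_cst. Qed.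

Lemma contD_cst n (c : R) : contD n (fun _ : V => c).
Proof.
elim: n c => [|n IH] c; first exact: continuous_cstf.
split=> [|x v|v]; [exact: continuous_cstf|exact: derivable_cst|].
have -> : 'D_v (fun _ : V => c) = fun=> 0 by apply/funext => x; exact: derive_cst.
exact: IH.
Qed.

Lemma contDD n f g : contD n f -> contD n g -> contD n (fun x => f x + g x).
Proof.
elim: n f g => [|n IH] f g; first by move=> cf cg x; apply: cvgD; [exact: cf|exact: cg].
move=> [cf df Df] [cg dg Dg]; split.
- by move=> x; apply: cvgD; [exact: cf|exact: cg].
- by move=> x v; exact: (derivableD (df x v) (dg x v)).
- move=> v; rewrite (_ : (fun x => _) = fun x => 'D_v f x + 'D_v g x).
    by apply: IH; [exact: Df|exact: Dg].
  by apply/funext => x; exact: (deriveD (df x v) (dg x v)).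
Qed.

Lemma contDM n f g : contD n f -> contD n g -> contD n (fun x => f x * g x).
Proof.
elim: n f g => [|n IH] f g; first by move=> cf cg x; apply: cvgM; [exact: cf|exact: cg].
move=> Cf Cg; have Cf' := contD_le Cf; have Cg' := contD_le Cg.
move: Cf Cg => [cf df Df] [cg dg Dg]; split.
- by move=> x; apply: cvgM; [exact: cf|exact: cg].
- by move=> x v; exact: (derivableM (df x v) (dg x v)).
- move=> v; rewrite (_ : (fun x => _) = fun x => f x * 'D_v g x + g x * 'D_v f x).
    by apply: contDD; apply: IH => //; [exact: Dg|exact: Df].
  by apply/funext => x; exact: (deriveM (df x v) (dg x v)).
Qed.

Lemma contDZ n (c : R) f : contD n f -> contD n (fun x => c * f x).
Proof. by move=> cf; apply: contDM => //; exact: contD_cst. Qed.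

Lemma contDB n f g : contD n f -> contD n g -> contD n (fun x => f x - g x).
Proof.
move=> cf cg; under eq_fun do rewrite -mulN1r.
by apply: contDD => //; exact: contDZ.
Qed.

Lemma contDV n f : (forall x, f x != 0) -> contD n f -> contD n (fun x => (f x)^-1).
Proof.
move=> f0; elim: n => [|n IH] Cf.
  by move=> x; apply: cvgV => //; exact: Cf.
have Cf' := contD_le Cf; move: Cf => [cf df Df]; split.
- by move=> x; apply: cvgV => //; exact: cf.
- by move=> x v; exact: (derivableV (f0 x) (df x v)).
- move=> v; rewrite (_ : (fun x => _) = fun x => - 1 * ((f x)^-1 * (f x)^-1) * 'D_v f x).
    by apply: contDM; [apply: contDZ; apply: contDM; exact: IH|exact: Df].
  apply/funext => x; rewrite (deriveV (f0 x) (df x v)).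
  by rewrite mulN1r -invfM -expr2.
Qed.

Lemma contD_prod n I (s : seq I) (P : pred I) (f : I -> V -> R) :
  (forall i, contD n (f i)) -> contD n (fun x => \prod_(i <- s | P i) f i x).
Proof.
move=> cf; elim: s => [|i s IH].
  by under eq_fun do rewrite big_nil; exact: contD_cst.
under eq_fun do rewrite big_cons; case: (P i) => //.
exact: contDM.
Qed.

End contD.

Section contD_comp.
Context {R : realType} {V U : normedModType R}.
Variables (L : V -> U).
Hypothesis linL : forall (k : R) v x, L (k *: v + x) = k *: L v + L x.
Hypothesis cL : continuous L.

Let diffq (h : U -> R) x v :
  (fun k : R => k^-1 *: ((h \o L) (k *: v + x) - (h \o L) x)) =
  (fun k : R => k^-1 *: (h (k *: L v + L x) - h (L x))).
Proof. by apply/funext => k; rewrite /comp linL. Qed.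

Lemma contD_linear n (h : U -> R) : contD n h -> contD n (h \o L).
Proof.
elim: n h => [|n IH] h.
  by move=> ch x; apply: continuous_comp; [exact: cL|exact: ch].
move=> [ch dh Dh]; split.
- by move=> x; apply: continuous_comp; [exact: cL|exact: ch].
- by move=> x v; have := dh (L x) (L v); rewrite /derivable -diffq.
- move=> v; rewrite (_ : (fun x => _) = (fun u => 'D_(L v) h u) \o L).
    by apply: IH; exact: Dh.
  by apply/funext => x /=; rewrite /derive diffq.
Qed.

End contD_comp.

Section contD_real.
Context {R : realType}.
Implicit Types f g : R -> R.

Lemma is_derive_dir f (x v df : R) : is_derive x 1 f df -> is_derive x v f (v * df).
Proof.
move=> [d1 <-]; have df1 : differentiable f x by apply/derivable1_diffP.
have dv : derivable f x v by exact: diff_derivable.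
apply: (DeriveDef dv); rewrite !deriveE//.
by rewrite -[v in LHS]mulr1 -[v * 1]/(v *: (1 : R)) linearZ.
Qed.

Lemma contD_is_derive n f g : (forall x : R, is_derive x 1 f (g x)) ->
  contD n g -> contD n.+1 f.
Proof.
move=> fg cg.
have fv x v : is_derive x v f (v * g x) by exact: is_derive_dir.
split.
- move=> x; apply: differentiable_continuous; apply/derivable1_diffP.
  by have [] := fg x.
- by move=> x v; have [] := fv x v.
- move=> v; rewrite (_ : (fun x => _) = fun x => v * g x); first exact: contDZ.
  by apply/funext => x; have [_ ->] := fv x v.
Qed.

Lemma contD_trig n : contD n (@cos R) /\ contD n (@sin R).
Proof.
elim: n => [|n [IHc IHs]].
  by split; [exact: continuous_cos|exact: continuous_sin].
split.
  apply: (contD_is_derive (g := fun x => - sin x)) => //.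
  by under eq_fun do rewrite -mulN1r; exact: contDZ.
exact: (contD_is_derive (g := cos)).
Qed.

Lemma contD_shift n (b : R) f : contD n f -> contD n (fun s => f (s + b)).
Proof.
have diffq (h : R -> R) x v :
  (fun k : R => k^-1 *: (h (k *: v + x + b) - h (x + b))) =
  (fun k : R => k^-1 *: (h (k *: v + (x + b)) - h (x + b))).
  by apply/funext => k /=; rewrite addrA.
have cc (h : R -> R) : continuous h -> continuous (fun s => h (s + b)).
  move=> ch x; apply: (continuous_comp (f := fun s => s + b)); last exact: ch.
  by apply: cvgD; [exact: cvg_id|exact: cvg_cst].
elim: n f => [|n IH] f; first exact: cc.
move=> [cf df Df]; split; first exact: cc.
- by move=> x v; have := df (x + b) v; rewrite /derivable -diffq.
- move=> v; rewrite (_ : (fun x => _) = (fun s => (fun u => 'D_v f u) (s + b))).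
    exact: (IH (fun u => 'D_v f u) (Df v)).
  by apply/funext => x /=; rewrite /derive diffq.
Qed.

Lemma contD_scale n (c : R) f : contD n f -> contD n (fun s => f (c * s)).
Proof.
have cc : continuous (fun s : R => c * s).
  by move=> x; apply: cvgM; [exact: cvg_cst|exact: cvg_id].
apply: (contD_linear (L := fun s => c * s)) => // k v x.
by rewrite /GRing.scale/= mulrDr mulrCA.
Qed.

End contD_real.

Section flat.
Context {R : realType}.

(* The factor [s ^- k] makes the family stable under differentiation. *)
Definition flat (k : nat) (s : R) : R := if 0 < s then s ^- k * expR (- s^-1) else 0.

Lemma flat_le0 k s : s <= 0 -> flat k s = 0.
Proof. by rewrite /flat leNgt => /negbTE ->. Qed.

Lemma flat_ge0 k s : 0 <= flat k s.
Proof.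
rewrite /flat; case: ifP => // s0.
by rewrite mulr_ge0 ?expR_ge0// invr_ge0 exprn_ge0// ltW.
Qed.

Lemma flat_gt0 k s : 0 < s -> 0 < flat k s.
Proof. by move=> s0; rewrite /flat s0 mulr_gt0 ?expR_gt0// invr_gt0 exprn_gt0. Qed.

(** One term of the exponential series at [1 / s] bounds [e^{1/s}] below by [s^{-(k+2)} / (k+2)!].
    The power is chosen to leave [s ^ 2], which makes the derivative at 0 vanish. *)
Lemma flat_le_sqr k s : flat k s <= (k.+2)`!%:R * s ^+ 2.
Proof.
rewrite /flat; case: ifP => [s0|_]; last by rewrite mulr_ge0// sqr_ge0.
rewrite expRN; have i0 : 0 <= s^-1 by rewrite invr_ge0 ltW.
have h := expR_ge1Dxn k.+1 i0.
have h2 : s ^- k.+2 / (k.+2)`!%:R <= expR s^-1.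
  by apply: le_trans h; rewrite -exprVn lerDr.
have f0 : 0 < (k.+2)`!%:R :> R by rewrite ltr0n fact_gt0.
rewrite ler_pdivrMr ?expR_gt0//.
apply: (@le_trans _ _ ((k.+2)`!%:R * s ^+ 2 * (s ^- k.+2 / (k.+2)`!%:R))); last first.
  by rewrite ler_wpM2l// mulr_ge0// sqr_ge0.
have sn0 : s != 0 by rewrite gt_eqF.
rewrite le_eqVlt; apply/orP; left; apply/eqP.
rewrite -addn2 exprD invfM; field.
by rewrite sn0 gt_eqF// expf_neq0.
Qed.

Lemma is_derive_flat k (x : R) :
  is_derive x 1 (flat k) (flat k.+2 x - k%:R * flat k.+1 x).
Proof.
have [x0|x0|->] := ltgtP x 0.
- rewrite !flat_le0 ?(ltW x0)// mulr0 subr0.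
  apply: (@near_eq_is_derive _ _ _ (cst 0)).
  near=> y; rewrite flat_le0// ltW//; near: y; exact: lt_nbhsl.
- have xn0 : x != 0 by rewrite gt_eqF.
  pose iv := fun s : R => s^-1.
  have dV : is_derive x 1 iv (- x ^- 2).
    have dx : derivable (@id R) x 1 by exact: derivable_id.
    apply: (DeriveDef (derivableV (f := id) xn0 dx)).
    by rewrite (deriveV (f := id) xn0 dx) derive_id /GRing.scale/= mulr1.
  have dE : is_derive x 1 (expR \o (- iv)) (expR (- x^-1) * (- - x ^- 2)).
    by apply: is_derive1_comp.
  have dP : is_derive x 1 (iv ^+ k) ((k%:R * x^-1 ^+ k.-1) *: (- x ^- 2)).
    exact: is_deriveX.
  have dM : is_derive x 1 ((iv ^+ k) * (expR \o (- iv)))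
      (flat k.+2 x - k%:R * flat k.+1 x).
    apply: (is_derive_eq (is_deriveM dP dE)).
    rewrite !fctE /flat x0 /GRing.scale /= /iv.
    case: (k) => [|m]; rewrite ?mul0r ?subr0 ?addr0 ?mulr0 ?expr0 ?invr1 ?mul1r ?opprK//=.
      by rewrite addr0 mulrC.
    by rewrite -!exprVn !exprS; ring.
  apply: near_eq_is_derive dM.
  near=> y; rewrite /flat ifT; last by near: y; exact: lt_nbhsr.
  by rewrite /iv !fctE exprVn.
- rewrite !flat_le0// mulr0 subr0.
  (* By [flat_le_sqr] the difference quotient at 0 is at most [(k+2)! |h|]. *)
  have cv : (fun h : R => h^-1 *: (flat k (h *: 1 + 0) - flat k 0)) h @[h --> 0^'] --> (0 : R).
    apply/cvgr0Pnorm_lt => e e0.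
    have f0 : 0 < (k.+2)`!%:R :> R by rewrite ltr0n fact_gt0.
    have he : 0 < e / (k.+2)`!%:R by rewrite divr_gt0.
    near=> h.
    have h0 : h != 0 by near: h; exact: nbhs_dnbhs_neq.
    have hlt : `|h| < e / (k.+2)`!%:R by near: h; exact: dnbhs0_lt.
    rewrite addr0 [h *: 1]mulr1 (flat_le0 k (lexx 0)) subr0 normrM normfV.
    rewrite (ger0_norm (flat_ge0 _ _)) mulrC ltr_pdivrMr ?normr_gt0//.
    apply: le_lt_trans (flat_le_sqr k h) _.
    rewrite -real_normK ?num_real// expr2 mulrA ltr_pM2r ?normr_gt0//.
    by rewrite mulrC -ltr_pdivlMr.
  by apply: DeriveDef; [apply/cvg_ex; exists 0|exact: cvg_lim].
Unshelve. all: by end_near. Qed.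

Lemma contD_flat n k : contD n (flat k).
Proof.
elim: n k => [|n IH] k.
  move=> x; apply: differentiable_continuous; apply/derivable1_diffP.
  by have [] := is_derive_flat k x.
apply: (contD_is_derive (is_derive_flat k)).
by apply: contDB => //; exact: contDZ.
Qed.

End flat.

Section smooth1.
Context {R : realType}.
Implicit Types f g : R -> R.

Definition smooth1 f := forall n, contD n f.
Definition deriv1 f : R -> R := fun x => 'D_1 f x.

Lemma smooth1_is_derive f (x : R) : smooth1 f -> is_derive x 1 f (deriv1 f x).
Proof. by move=> /(_ 1)[_ df _]; apply: DeriveDef. Qed.

Lemma smooth1_deriv f : smooth1 f -> smooth1 (deriv1 f).
Proof. by move=> sf n; have [_ _] := sf n.+1; exact. Qed.

Lemma smooth1_continuous f : smooth1 f -> continuous f.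
Proof. by move=> sf; exact: (sf 0). Qed.

Lemma smooth1_measurable f : smooth1 f ->
  measurable_fun setT (f : measurableTypeR R -> R).
Proof. by move=> /smooth1_continuous; exact: continuous_measurable_fun. Qed.

Lemma deriv1_loc f (x c : R) : (\forall y \near x, f y = c) -> deriv1 f x = 0.
Proof.
move=> fc; rewrite /deriv1 (@near_eq_derive _ _ _ f (cst c))//.
exact: derive_cst.
Qed.

Lemma deriv1_eq0 f (a b c : R) : (forall x, a < x < b -> f x = c) ->
  forall x, a < x < b -> deriv1 f x = 0.
Proof.
move=> fc x /andP[ax xb]; apply: (@deriv1_loc _ _ c).
near=> y; apply: fc; apply/andP; split; near: y; [exact: lt_nbhsr|exact: lt_nbhsl].
Unshelve. all: by end_near. Qed.

Lemma smooth1_supp_bounded f (a : R) : continuous f -> (forall x, a < `|x| -> f x = 0) ->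
  exists C, forall x, `|f x| <= C.
Proof.
move=> cf f0.
have /compact_bounded[M [_ MP]] : compact (f @` `[- a, a]).
  apply: continuous_compact; last exact: segment_compact.
  exact: continuous_subspaceT.
exists (Num.max 0 (M + 1)) => x; rewrite le_max.
have [xa|/f0 ->] := leP `|x| a; last by rewrite normr0 lexx.
apply/orP; right; apply: (MP (M + 1)); first by rewrite ltrDl.
by exists x => //=; rewrite in_itv/= -ler_norml.
Qed.

Lemma deriv1_supp f (a : R) : (forall x, a < `|x| -> f x = 0) ->
  forall x, a < `|x| -> deriv1 f x = 0.
Proof.
move=> f0 x ax; apply: (@deriv1_loc _ _ 0).
near=> y; apply: f0; near: y.
have : `|y| @[y --> x] --> `|x| by exact: norm_continuous.
by move=> /cvgr_gt; apply.
Unshelve. all: by end_near. Qed.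

(** A smooth transition between 0 and 1. The denominator is positive because [s] and [1 - s] cannot
    both be nonpositive. *)
Definition step (s : R) : R := flat 0 s / (flat 0 s + flat 0 (1 - s)).

Lemma step_den_gt0 (s : R) : 0 < flat 0 s + flat 0 (1 - s).
Proof.
have [s0|s0] := ltP 0 s; first by rewrite ltr_wpDr ?flat_ge0// flat_gt0.
rewrite ltr_wpDl ?flat_ge0// flat_gt0//; lra.
Qed.

Lemma smooth1_step : smooth1 step.
Proof.
move=> n; apply: contDM; first exact: contD_flat.
apply: contDV; first by move=> s; rewrite gt_eqF// step_den_gt0.
apply: contDD; first exact: contD_flat.
under eq_fun => s do rewrite addrC -mulN1r.
exact: contD_scale (contD_shift 1 (contD_flat n 0)).
Qed.

Lemma step_le0 (s : R) : s <= 0 -> step s = 0.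
Proof. by move=> s0; rewrite /step flat_le0// mul0r. Qed.

Lemma step_ge1 (s : R) : 1 <= s -> step s = 1.
Proof.
move=> s1; have := step_den_gt0 s; rewrite /step.
rewrite (flat_le0 0 (s := 1 - s)) ?addr0; last lra.
by move=> p; rewrite divff// gt_eqF.
Qed.

Lemma step01 (s : R) : 0 <= step s <= 1.
Proof.
have p := step_den_gt0 s; rewrite /step divr_ge0 ?flat_ge0 ?(ltW p)//=.
by rewrite ler_pdivrMr// mul1r lerDl flat_ge0.
Qed.

Lemma dstep_lt0 (s : R) : s < 0 -> deriv1 step s = 0.
Proof.
move=> s0; apply: (@deriv1_eq0 _ (s - 1) 0 0) => [x /andP[_ x0]|].
  by rewrite step_le0// ltW.
by rewrite s0 andbT; lra.
Qed.

Lemma dstep_gt1 (s : R) : 1 < s -> deriv1 step s = 0.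
Proof.
move=> s1; apply: (@deriv1_eq0 _ 1 (s + 1) 1) => [x /andP[x1 _]|].
  by rewrite step_ge1// ltW.
by rewrite s1 /=; lra.
Qed.

Lemma dstep_bounded : exists C : R, forall s, `|deriv1 step s| <= C.
Proof.
apply: (@smooth1_supp_bounded _ 1).
  exact: smooth1_continuous (smooth1_deriv smooth1_step).
move=> x; rewrite ltr_normr => /orP[|x1]; first exact: dstep_gt1.
by apply: dstep_lt0; lra.
Qed.

Local Notation mu := (@lebesgue_measure R).

Lemma dstep_restrict : deriv1 step = (deriv1 step) \_ `[0, 1].
Proof.
apply/funext => s; rewrite patchE; case: ifPn => // /negP.
rewrite inE /= in_itv/= => h.
have [s0|s0] := ltP s 0; first exact: dstep_lt0.
have [s1|s1] := ltP 1 s; first exact: dstep_gt1.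
by case: h; rewrite s0 s1.
Qed.

(** The derivative of [step] lives on [[0, 1]], where the fundamental theorem applies. Its
    rescalings serve as approximate Dirac masses in time. *)
Lemma integral_dstep : \int[mu]_s deriv1 step s = 1.
Proof.
rewrite dstep_restrict -Rintegral_mkcond /Rintegral.
rewrite (continuous_FTC2 (F := step) ltr01).
- by rewrite step_ge1// step_le0// sube0.
- apply: continuous_subspaceT.
  exact: smooth1_continuous (smooth1_deriv smooth1_step).
- split.
  + by move=> x _; have [] := smooth1_is_derive x smooth1_step.
  + by apply: cvg_at_right_filter; exact: smooth1_continuous smooth1_step _.
  + by apply: cvg_at_left_filter; exact: smooth1_continuous smooth1_step _.
- by move=> x _; rewrite derive1E.
Qed.

Lemma dstep_integrable : cintegrable mu (fun s => (deriv1 step s)%:C).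
Proof.
have [C hC] := dstep_bounded.
have C0 : 0 <= C by apply: le_trans (hC 0).
apply: (@cintegrable_le _ _ _ mu _ (fun s => C * \1_(`[0, 1]%classic) s)).
- exact: cmeasurable_real (smooth1_measurable (smooth1_deriv smooth1_step)).
- by apply: measurable_funM.
- move=> s; rewrite cabs_real dstep_restrict patchE indicE; case: ifPn => _.
    by rewrite mulr1.
  by rewrite normr0 mulr0.
- under eq_integral do rewrite EFinM.
  rewrite ge0_integralZl//; last first.
    by apply/measurable_EFinP.
  have -> : (\int[mu]_x (\1_(`[0%R, 1%R]%classic) x)%:E = 1)%E.
    rewrite integral_indic// setIT.
    by have := @lebesgue_measure_itv R `[0, 1]%R; rewrite /= lte01 sube0.
  by rewrite mule1 ltry.
Qed.

Definition cut (s : R) : R := step (s + 2) - step (s - 1).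

Lemma smooth1_cut : smooth1 cut.
Proof.
by move=> n; apply: contDB; apply: contD_shift; exact: smooth1_step.
Qed.

Lemma cut_norm_le1 (s : R) : `|cut s| <= 1.
Proof.
have /andP[a0 a1] := step01 (s + 2); have /andP[b0 b1] := step01 (s - 1).
by rewrite /cut ler_norml; apply/andP; split; lra.
Qed.

Lemma cut_eq1 (s : R) : `|s| <= 1 -> cut s = 1.
Proof.
rewrite ler_norml => /andP[a b]; rewrite /cut step_ge1 ?step_le0 ?subr0//; lra.
Qed.

Lemma cut_eq0 (s : R) : 2 < `|s| -> cut s = 0.
Proof.
rewrite ltr_normr /cut => /orP[s0|s0].
  by rewrite !step_ge1 ?subrr//; lra.
by rewrite !step_le0 ?subrr//; lra.
Qed.

Lemma cut_derivs_bounded : exists C : R, 0 <= C /\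
  forall s, `|deriv1 cut s| <= C /\ `|deriv1 (deriv1 cut) s| <= C.
Proof.
have s1 := smooth1_deriv smooth1_cut; have s2 := smooth1_deriv s1.
have [C1 h1] := smooth1_supp_bounded (smooth1_continuous s1) (deriv1_supp cut_eq0).
have [C2 h2] := smooth1_supp_bounded (smooth1_continuous s2)
  (deriv1_supp (deriv1_supp cut_eq0)).
exists (Num.max C1 C2); split; first by rewrite le_max (le_trans _ (h1 0)).
by move=> s; split; [apply: le_trans (h1 s) _|apply: le_trans (h2 s) _]; rewrite le_max lexx ?orbT.
Qed.

End smooth1.

(** * Localization to cubes and tightness *)

Section L2_tools.
Context {R : realType}.

Lemma sqnormc0 : sqnormc (0 : R[i]) = 0.
Proof. by rewrite /sqnormc/= expr0n/= addr0. Qed.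

Lemma sqnormc_real (x : R) : sqnormc x%:C = x ^+ 2.
Proof. by rewrite /sqnormc/= expr0n/= addr0. Qed.

Lemma sqnormcN (z : R[i]) : sqnormc (- z) = sqnormc z.
Proof. by rewrite -!sqr_cabs cabsN. Qed.

Lemma sqnormcB_le (z w : R[i]) : sqnormc (z - w) <= 2 * (sqnormc z + sqnormc w).
Proof. by rewrite -(sqnormcN w); exact: sqnormcD_le. Qed.

Lemma sqnormc_expi (a : R) : sqnormc (expi a) = 1.
Proof. by rewrite -sqr_cabs cabs_expi expr1n. Qed.

Lemma sqnormc_sum_le I (s : seq I) (a : I -> R[i]) :
  sqnormc (\sum_(i <- s) a i) <= 2 ^+ size s * \sum_(i <- s) sqnormc (a i).
Proof.
elim: s => [|i s IH]; first by rewrite !big_nil sqnormc0 mulr0.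
rewrite !big_cons /= exprS; apply: le_trans (sqnormcD_le _ _) _.
have p : 1 <= 2 ^+ size s :> R by apply: exprn_ege1; rewrite ler1n.
have q := sqnormc_ge0 (a i).
rewrite -mulrA ler_pM2l// mulrDr lerD//.
by rewrite ler_peMl.
Qed.

(** Recovers the Cauchy-Schwarz form from the weighted inequalities: [l = X / a] turns the first
    term into [X / 2], which is absorbed on the left. *)
Lemma le_sqr_of_AMGM (X a : R) (Y : \bar R) : 0 <= X -> 0 < a -> (0 <= Y)%E ->
  (forall l : R, (0 < l)%R -> X%:E <= (l / 2)%:E * a%:E + (l^-1 / 2)%:E * Y)%E ->
  ((X ^+ 2)%:E <= a%:E * Y)%E.
Proof.
move=> X0 a0 Y0 h; case: Y Y0 h => [y|_ _|//]; last first.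
  by rewrite gt0_muley ?lte_fin// leey.
rewrite lee_fin => y0 h; rewrite -EFinM lee_fin.
move: X0; rewrite le_eqVlt => /orP[/eqP <-|X0]; first by rewrite expr0n/= mulr_ge0// ltW.
have := h (X / a) (divr_gt0 X0 a0).
rewrite -!EFinM -EFinD lee_fin => {}h.
have -> : X ^+ 2 = 2 * X * (X - X / a / 2 * a) by field; rewrite gt_eqF.
have -> : a * y = 2 * X * ((X / a)^-1 / 2 * y) by field; rewrite !gt_eqF.
by rewrite ler_pM2l ?mulr_gt0// lerBlDl.
Qed.

Context {n : nat}.
Local Notation V := 'rV[R]_n.
Local Notation leb := (lebesgue_rV R n).

Definition cube (K : R) : set V := [set x | forall i, `|x 0 i| <= K].

Lemma measurable_cube K : measurable (cube K).
Proof.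
rewrite (_ : cube K = \bigcap_(i in [set: 'I_n])
    (fun x : V => x 0 i) @^-1` `[- K, K]%classic); last first.
  apply/seteqP; split => x h i => [_|].
    by rewrite /= in_itv/= -ler_norml; exact: h.
  by have := h i Logic.I; rewrite /= in_itv/= -ler_norml.
apply: fin_bigcap_measurable => // i _; rewrite -[X in measurable X]setTI.
exact: measurable_rV_coord.
Qed.

Lemma L2_box (h : V -> R) (C A : R) : measurable_fun setT h ->
  (forall x, `|h x| <= C) -> (forall (x : V) i, A < `|x 0 i| -> h x = 0) ->
  square_integrable leb (fun x => (h x)%:C).
Proof.
move=> mh hC hA; have CA0 : 0 <= C ^+ 2 * expR A ^+ n.
  by apply: mulr_ge0; [exact: sqr_ge0|rewrite exprn_ge0 ?expR_ge0].
(* On the cube of half-side [A] the kernel [expker] is at least [expR (- A) ^ n], so this multiple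
   of it dominates and no volume has to be computed. *)
apply: (L2_le (r := fun x => C ^+ 2 * expR A ^+ n * expker x)).
- exact: cmeasurable_real.
- by apply: measurable_funM => //; exact: measurable_expker.
- move=> x; rewrite sqnormc_real.
  have [xA|/existsNP[i /negP]] := pselect (forall i, `|x 0 i| <= A); last first.
    rewrite -ltNge => /hA ->; rewrite expr0n/=.
    by apply: mulr_ge0; [exact: CA0|exact: expker_ge0].
  have C0 : 0 <= C by apply: le_trans (hC x).
  rewrite -mulrA -[leLHS]mulr1 ler_pM ?sqr_ge0//.
    by rewrite -real_normK ?num_real// ler_pXn2r ?nnegrE.
  rewrite -[n in expR A ^+ n]card_ord -prodr_const /expker -big_split/=.
  elim/big_ind : _ => // [a b a1 b1|i _]; first by rewrite -[leLHS]mulr1 ler_pM.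
  by rewrite -expRD -expR0 ler_expR subr_ge0.
- under eq_integral do rewrite EFinM.
  rewrite ge0_integralZl//.
  + by rewrite lte_mul_pinfty ?integral_expker_lty// lee_fin.
  + by apply/measurable_EFinP; exact: measurable_expker.
  + by move=> x _; rewrite lee_fin expker_ge0.
Qed.

Lemma integral_cube_cvg (f : V -> \bar R) : measurable_fun setT f ->
  (forall x, 0 <= f x)%E ->
  (\int[leb]_x (f x * (\1_(cube k%:R) x)%:E))%E @[k --> \oo] --> (\int[leb]_x f x)%E.
Proof.
move=> mf f0.
have mi k : measurable_fun setT (fun x : V => (\1_(cube k%:R) x : R)).
  exact: measurable_indic (measurable_cube _).
have -> : (\int[leb]_x f x =
    \int[leb]_x limn (fun k => f x * (\1_(cube k%:R) x)%:E))%E.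
  apply: eq_integral => x _; apply/esym/cvg_lim => //.
  apply: cvg_near_cst; near=> k; rewrite indicE mem_set ?mule1//= => i.
  apply: le_trans (_ : \sum_(j < n) `|x 0 j| <= _).
    by rewrite (bigD1 i)//= lerDl sumr_ge0.
  near: k; exact: nbhs_infty_ger.
apply: cvg_monotone_convergence => //.
- by move=> k; apply: emeasurable_funM => //; apply/measurable_EFinP.
- by move=> k x _; rewrite mule_ge0// lee_fin.
- move=> x _ k l kl; rewrite lee_wpmul2l// lee_fin.
  rewrite !indicE ler_nat; case: (boolP (x \in cube k%:R)) => // /set_mem xk.
  rewrite mem_set// => i; apply: le_trans (xk i) _.
  by rewrite ler_nat.
Unshelve. all: by end_near. Qed.

(** Fix [m] with [g_ m] small. On a given cube the mass of [f_ m] is controlled by its distance to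
    [f_ k] and by the local mass of [f_ k], with [k] chosen late depending on the cube. The
    resulting bound does not see the cube, which can then exhaust the space. *)
Lemma tight_cvg (f_ : nat -> V -> R[i]) (g_ : nat -> \bar R) :
  (forall k, cmeasurable (f_ k)) ->
  (forall k m, sqdist leb (f_ k) (f_ m) <= g_ k + g_ m)%E ->
  (forall k, 0 <= g_ k)%E -> g_ k @[k --> \oo] --> 0%E ->
  (forall K : nat, (\int[leb]_x ((sqnormc (f_ k x))%:E * (\1_(cube K%:R) x)%:E))%E
      @[k --> \oo] --> 0%E) ->
  (\int[leb]_x (sqnormc (f_ k x))%:E)%E @[k --> \oo] --> 0%E.
Proof.
move=> mf fg g0 gcvg locf; apply/cvge0P => [k|e e0]; first exact: integral_sqnormc_ge0.
(* The bound on each cube is [2 (e/8 + e/8) + 2 (e/8)], which is below [e]. *)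
have e8 : 0 < e / 8 by rewrite divr_gt0.
have nearg : \forall k \near \oo, (g_ k <= (e / 8)%:E)%E.
  by apply: (cvge0P g0).2.
near=> m.
have gm : (g_ m <= (e / 8)%:E)%E by near: m.
have mi K : measurable_fun setT (fun x : V => (\1_(cube K) x : R)).
  exact: measurable_indic (measurable_cube _).
have i0 K (x : V) : (0 <= (\1_(cube K) x : R)%:E)%E by rewrite lee_fin.
have ms k : measurable_fun setT (fun x => (sqnormc (f_ k x))%:E) by exact: emeasurable_sqnormc.
have bK (K : nat) : (\int[leb]_x ((sqnormc (f_ m x))%:E * (\1_(cube K%:R) x)%:E) <= e%:E)%E.
  have nearl : \forall k \near \oo, (\int[leb]_x ((sqnormc (f_ k x))%:E *
      (\1_(cube K%:R) x)%:E) <= (e / 8)%:E)%E.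
    apply: (cvge0P _).2 => // k; apply: integral_ge0 => x _.
    by rewrite mule_ge0// lee_fin sqnormc_ge0.
  near \oo => k.
  have gk : (g_ k <= (e / 8)%:E)%E by near: k.
  have lk : (\int[leb]_x ((sqnormc (f_ k x))%:E * (\1_(cube K%:R) x)%:E) <= (e / 8)%:E)%E.
    by near: k.
  apply: (@le_trans _ _ (2%:E * sqdist leb (f_ m) (f_ k) + 2%:E * \int[leb]_x
     ((sqnormc (f_ k x))%:E * (\1_(cube K%:R) x)%:E))%E).
    have mD : measurable_fun setT (fun x => (sqnormc (f_ m x - f_ k x))%:E).
      by apply: emeasurable_sqnormc; exact: cmeasurableB.
    have mkK : measurable_fun setT (fun x => ((sqnormc (f_ k x))%:E * (\1_(cube K%:R) x)%:E)%E).
      by apply: emeasurable_funM => //; exact/measurable_EFinP.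
    have p1 x : (0 <= (sqnormc (f_ m x - f_ k x))%:E)%E by rewrite lee_fin sqnormc_ge0.
    have p2 x : (0 <= (sqnormc (f_ k x))%:E * (\1_(cube K%:R) x)%:E)%E.
      by rewrite mule_ge0// lee_fin sqnormc_ge0.
    have <- : (\int[leb]_x (2%:E * (sqnormc (f_ m x - f_ k x))%:E) =
        2%:E * sqdist leb (f_ m) (f_ k))%E by rewrite ge0_integralZl.
    have <- : (\int[leb]_x (2%:E * ((sqnormc (f_ k x))%:E * (\1_(cube K%:R) x)%:E)) =
        2%:E * \int[leb]_x ((sqnormc (f_ k x))%:E * (\1_(cube K%:R) x)%:E))%E.
      by rewrite ge0_integralZl.
    rewrite -ge0_integralD//; last 4 first.
    - by move=> x _; rewrite mule_ge0.
    - exact: emeasurable_funM.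
    - by move=> x _; rewrite mule_ge0.
    - exact: emeasurable_funM.
    apply: ge0_le_integral => //.
    - by move=> x _; rewrite mule_ge0// lee_fin sqnormc_ge0.
    - by apply: emeasurable_funM => //; apply/measurable_EFinP.
    - by apply: emeasurable_funD; exact: emeasurable_funM.
    - move=> x _; rewrite -!EFinM -EFinD lee_fin.
      have := sqnormcD_le (f_ m x - f_ k x) (f_ k x); rewrite subrK.
      have := sqnormc_ge0 (f_ m x - f_ k x); have := sqnormc_ge0 (f_ k x).
      by rewrite indicE; case: (_ \in _); rewrite ?mulr1 ?mulr0 => ? ? ?; lra.
  have -> : e = 2 * (e / 8 + e / 8) + 2 * (e / 8) + e / 4 by field.
  apply: (@le_trans _ _ (2 * (e / 8 + e / 8) + 2 * (e / 8))%:E); last first.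
    by rewrite lee_fin lerDl divr_ge0// ltW.
  have -> : ((2 * (e / 8 + e / 8) + 2 * (e / 8))%:E =
      2%:E * (e / 8 + e / 8)%:E + 2%:E * (e / 8)%:E)%E by rewrite -!EFinM -EFinD.
  apply: leeD; apply: lee_wpmul2l => //.
  by apply: le_trans (fg _ _) _; rewrite EFinD leeD.
apply: cvge_to_le (integral_cube_cvg (ms m) _) _ => [x|].
  by rewrite lee_fin sqnormc_ge0.
exact: nearW.
Unshelve. all: by end_near. Qed.

End L2_tools.

Section wave_derivatives.
Context {R : realType}.

Lemma is_derive_cos_affine (a b x : R) :
  is_derive x 1 (fun s => cos (a * s + b)) (- (a * sin (a * x + b))).
Proof.
have -> : - (a * sin (a * x + b)) = - sin (a * x + b) * a by ring.
apply: (is_derive1_comp (f := cos) (g := fun s => a * s + b)).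
by apply: is_derive_eq; rewrite /GRing.scale/= mulr1 addr0.
Qed.

Lemma is_derive_sin_affine (a b x : R) :
  is_derive x 1 (fun s => sin (a * s + b)) (a * cos (a * x + b)).
Proof.
rewrite mulrC; apply: (is_derive1_comp (f := sin) (g := fun s => a * s + b)).
by apply: is_derive_eq; rewrite /GRing.scale/= mulr1 addr0.
Qed.

Lemma is_derive_cosM (f : R -> R) (a b x df : R) : is_derive x 1 f df ->
  is_derive x 1 (fun s => f s * cos (a * s + b))
    (df * cos (a * x + b) - a * f x * sin (a * x + b)).
Proof.
move=> df0; have dc := is_derive_cos_affine a b x.
apply: (is_derive_eq (is_deriveM df0 dc)).
by rewrite /GRing.scale/=; ring.
Qed.

Lemma is_derive_sinM (f : R -> R) (a b x df : R) : is_derive x 1 f df ->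
  is_derive x 1 (fun s => f s * sin (a * s + b))
    (df * sin (a * x + b) + a * f x * cos (a * x + b)).
Proof.
move=> df0; have dc := is_derive_sin_affine a b x.
apply: (is_derive_eq (is_deriveM df0 dc)).
by rewrite /GRing.scale/=; ring.
Qed.

Lemma deriv1_cosM (f : R -> R) (a b : R) : smooth1 f ->
  deriv1 (fun s => f s * cos (a * s + b)) =
  fun s => deriv1 f s * cos (a * s + b) - a * f s * sin (a * s + b).
Proof.
move=> sf; apply/funext => x.
by have [_ h] := is_derive_cosM a b (smooth1_is_derive x sf); exact: h.
Qed.

Lemma deriv1_deriv1_cosM (f : R -> R) (a b : R) : smooth1 f ->
  deriv1 (deriv1 (fun s => f s * cos (a * s + b))) =
  fun s => deriv1 (deriv1 f) s * cos (a * s + b) - 2 * a * deriv1 f s * sin (a * s + b)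
     - a ^+ 2 * f s * cos (a * s + b).
Proof.
move=> sf; rewrite deriv1_cosM//; apply/funext => x.
have d1 := is_derive_cosM a b (smooth1_is_derive x (smooth1_deriv sf)).
have d2 := is_derive_sinM a b (smooth1_is_derive x sf).
have d3 : is_derive x 1 (fun s => a * (f s * sin (a * s + b)))
    (a * (deriv1 f x * sin (a * x + b) + a * f x * cos (a * x + b))).
  exact: is_deriveZ.
have [_] := is_deriveB d1 d3; rewrite /deriv1 => h.
rewrite (_ : (fun s => _ - _) = (fun s : R => 'D_1 f s * cos (a * s + b)) -
   (fun s => a * (f s * sin (a * s + b)))).
  by rewrite h; ring.
by apply/funext => s; rewrite !fctE mulrA.
Qed.

(** A directional derivative only sees the restriction to a line, so the partial derivatives below
    become derivatives of explicit one-variable functions. *)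
Lemma derive_line (V : normedModType R) (f : V -> R) (F : R -> R) (v z : V) (s : R) :
  (forall h : R, f (h *: v + z) = F (h + s)) -> 'D_v f z = deriv1 F s.
Proof.
move=> fF; rewrite /deriv1 /derive.
have -> : (fun h : R => h^-1 *: ((f \o shift z) (h *: v) - f z)) =
    (fun h => h^-1 *: ((F \o shift s) (h *: 1) - F s)); last by [].
apply/funext => h /=; rewrite fF [h *: 1]mulr1.
by have := fF 0; rewrite scale0r !add0r => ->.
Qed.

Lemma smooth1_scale (c : R) f : smooth1 f -> smooth1 (fun s => c * f s).
Proof. by move=> sf n; apply: contDZ. Qed.

Lemma smooth1_dilate (c : R) f : smooth1 f -> smooth1 (fun s => f (c * s)).
Proof. by move=> sf n; apply: contD_scale. Qed.

Lemma smooth1_cosM (f : R -> R) (a b : R) : smooth1 f ->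
  smooth1 (fun s => f s * cos (a * s + b)).
Proof.
move=> sf n; apply: contDM => //.
exact: contD_scale (contD_shift b (contD_trig n).1).
Qed.

Lemma deriv1_scale (c : R) f : smooth1 f ->
  deriv1 (fun s => c * f s) = fun s => c * deriv1 f s.
Proof.
move=> sf; apply/funext => x; have d := smooth1_is_derive x sf.
have dc : is_derive x 1 (fun s => c * f s) (c * deriv1 f x) by exact: is_deriveZ.
by have [_ <-] := dc.
Qed.

Lemma deriv1_dilate (c : R) f : smooth1 f ->
  deriv1 (fun s => f (c * s)) = fun s => c * deriv1 f (c * s).
Proof.
move=> sf; apply/funext => x; have d := smooth1_is_derive (c * x) sf.
have dc : is_derive x 1 (fun s : R => c * s) c.
  by apply: is_derive_eq; rewrite /GRing.scale/= mulr1.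
have [_] := is_derive1_comp d dc; rewrite mulrC => <-.
by [].
Qed.

Lemma deriv1_affine (c b : R) f : smooth1 f ->
  deriv1 (fun s => f (c * s + b)) = fun s => c * deriv1 f (c * s + b).
Proof.
move=> sf; apply/funext => x; have d := smooth1_is_derive (c * x + b) sf.
have dc : is_derive x 1 (fun s : R => c * s + b) c.
  by apply: is_derive_eq; rewrite /GRing.scale/= mulr1 addr0.
have [_] := is_derive1_comp (g := fun s : R => c * s + b) d dc; rewrite mulrC => <-.
by [].
Qed.

End wave_derivatives.

(** * Cut-off plane waves as test functions *)

Section wave_test.
Context {R : realType} {n : nat}.
Local Notation V := 'rV[R]_n.
Implicit Types (x xi : V) (z : V * R).
Variable k : nat.

Let ck : R := k.+1%:R^-1.
Let cutk (s : R) : R := cut (ck * s).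

Definition box_cut x : R := \prod_(i < n) cut (k.+1%:R^-1 * x 0 i).

Let rest i x : R := \prod_(j < n | j != i) cutk (x 0 j).

(** This and [ddbox_cut] are the first and second partial derivatives of [box_cut] in direction [i];
    only the factor of coordinate [i] is differentiated. *)
Definition dbox_cut i x : R := deriv1 cutk (x 0 i) * rest i x.
Definition ddbox_cut i x : R := deriv1 (deriv1 cutk) (x 0 i) * rest i x.

Let smooth1_cutk : smooth1 cutk.
Proof. exact: smooth1_dilate smooth1_cut. Qed.

Let box_cutE i x : box_cut x = cutk (x 0 i) * rest i x.
Proof. by rewrite /box_cut (bigD1 i). Qed.

(** The plane wave [e^{-i wphase}] is annihilated by [2 pi i d/dt + laplacian], since both parts
    produce [4 pi^2 |xi|^2] with opposite signs. *)
Definition wphase xi z : R := 2 * pi * (dot z.1 xi + z.2 * dot xi xi).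

(** Test functions are real, so the complex wave is assembled from two of them: [b = 0] gives the
    cosine and [b = - pi / 2] the sine of the phase. *)
Definition wave_test (eta : R -> R) xi (b : R) z : R :=
  box_cut z.1 * eta z.2 * cos (wphase xi z + b).

Variables (eta : R -> R) (xi : V) (b : R).
Hypothesis smooth1_eta : smooth1 eta.

Lemma wphaseD (h : R) (v z : V * R) : wphase xi (h *: v + z) = h * wphase xi v + wphase xi z.
Proof.
by rewrite /wphase/= dotDl dotZl /GRing.scale/=; ring.
Qed.

Lemma dot_delta i x : dot (delta_mx 0 i) x = x 0 i.
Proof.
rewrite /dot (bigD1 i)//= big1 ?addr0 ?mxE ?eqxx ?mul1r// => j ji.
by rewrite mxE (negbTE ji) andbF mul0r.
Qed.

Lemma dt_wave_test z : dt (wave_test eta xi b) z =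
  box_cut z.1 * (deriv1 eta z.2 * cos (wphase xi z + b)
    - 2 * pi * dot xi xi * eta z.2 * sin (wphase xi z + b)).
Proof.
pose a := 2 * pi * dot xi xi; pose c := 2 * pi * dot z.1 xi + b.
have E s : 2 * pi * (dot z.1 xi + s * dot xi xi) + b = a * s + c.
  by rewrite /a /c; ring.
rewrite /dt (derive_line (F := fun s => box_cut z.1 * (eta s * cos (a * s + c))) (s := z.2)).
  rewrite deriv1_scale ?deriv1_cosM//; last first.
    exact: smooth1_cosM.
  by rewrite /wphase E.
move=> h; rewrite /wave_test -E /wphase /= scaler0 add0r [h *: 1]mulr1.
by rewrite mulrA.
Qed.

Let along i z := fun s : R => (rest i z.1 * eta z.2) *
  (cutk s * cos (2 * pi * xi 0 i * s + (wphase xi z - 2 * pi * xi 0 i * z.1 0 i + b))).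

Let dx_along (f : V * R -> R) (F : V * R -> R -> R) i :
  (forall z, f z = F z (z.1 0 i)) ->
  (forall z (h : R), F (h *: (delta_mx 0 i, 0) + z) = F z) ->
  dx i f = fun z => deriv1 (F z) (z.1 0 i).
Proof.
move=> fF FF; apply/funext => z; apply: derive_line => h.
by rewrite fF FF /= !mxE !eqxx mulr1.
Qed.

(** The function [along i z] depends on [z] only through quantities unaffected by coordinate [i],
    the phase having its [i]-th contribution subtracted. Hence the second partial derivative is the
    second derivative of the same one-variable function. *)
Let along_shift i z (h : R) : along i (h *: (delta_mx 0 i, 0) + z) = along i z.
Proof.
apply/funext => s; rewrite /along wphaseD /=.
have -> : rest i (h *: delta_mx 0 i + z.1) = rest i z.1.
  by apply: eq_bigr => j ji; rewrite !mxE (negbTE ji) andbF mulr0 add0r.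
have -> : h *: (0 : R) + z.2 = z.2 by rewrite scaler0 add0r.
rewrite !mxE !eqxx /= mulr1 /wphase/= dot_delta mul0r addr0.
by congr (_ * (_ * cos _)); ring.
Qed.

Lemma laplacian_wave_test z : laplacian (wave_test eta xi b) z =
  eta z.2 * ((\sum_(i < n) ddbox_cut i z.1) * cos (wphase xi z + b)
    - 4 * pi * (\sum_(i < n) xi 0 i * dbox_cut i z.1) * sin (wphase xi z + b))
  - (2 * pi) ^+ 2 * dot xi xi * eta z.2 * box_cut z.1 * cos (wphase xi z + b).
Proof.
have smA i z' : smooth1 (along i z').
  by apply: smooth1_scale; exact: smooth1_cosM.
have dxE i : dx i (dx i (wave_test eta xi b)) =
    fun z => deriv1 (deriv1 (along i z)) (z.1 0 i).
  have -> : dx i (wave_test eta xi b) = fun z => deriv1 (along i z) (z.1 0 i).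
    apply: dx_along => [z'|]; last exact: along_shift.
    rewrite /along /wave_test (box_cutE i).
    have -> : 2 * pi * xi 0 i * z'.1 0 i + (wphase xi z' - 2 * pi * xi 0 i * z'.1 0 i + b)
      = wphase xi z' + b by ring.
    by ring.
  rewrite (dx_along (F := fun z => deriv1 (along i z)))// => z' h.
  by rewrite along_shift.
rewrite /laplacian; under eq_bigr => i _.
  rewrite dxE /along.
  rewrite deriv1_scale; last exact: smooth1_cosM.
  rewrite deriv1_scale; last by apply: smooth1_deriv; exact: smooth1_cosM.
  rewrite deriv1_deriv1_cosM//.
  have -> : 2 * pi * xi 0 i * z.1 0 i + (wphase xi z - 2 * pi * xi 0 i * z.1 0 i + b)
      = wphase xi z + b by ring.
  rewrite (_ : _ * _ = eta z.2 * cos (wphase xi z + b) * ddbox_cut i z.1 +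
    (- 4 * pi * eta z.2 * sin (wphase xi z + b)) * (xi 0 i * dbox_cut i z.1) +
    (- (2 * pi) ^+ 2 * eta z.2 * box_cut z.1 * cos (wphase xi z + b)) * (xi 0 i * xi 0 i)).
    over.
  by rewrite /ddbox_cut /dbox_cut (box_cutE i); ring.
by rewrite !big_split /= -!mulr_sumr -/(dot xi xi); ring.
Qed.

Lemma continuous_coord1 i : continuous (fun z : V * R => z.1 0 i).
Proof.
move=> z; apply: (@continuous_comp _ _ _ (@fst V R) (fun x : V => x 0 i) z).
  exact: cvg_fst.
exact: coord_continuous.
Qed.

Lemma contD_coord m i : contD m (fun z : V * R => cutk (z.1 0 i)).
Proof.
apply: (contD_linear (L := fun z : V * R => z.1 0 i)); last exact: smooth1_cutk.
- by move=> h v x; rewrite !mxE.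
- exact: continuous_coord1.
Qed.

Lemma continuous_wphase : continuous (wphase xi).
Proof.
move=> z; rewrite /wphase; apply: cvgM; first exact: cvg_cst.
apply: cvgD; last by apply: cvgM; [exact: cvg_snd|exact: cvg_cst].
rewrite /dot; move: z; apply: continuous_big => [|i _ z].
  by move=> z; exact: add_continuous.
apply: cvgM; last exact: cvg_cst.
exact: continuous_coord1.
Qed.

Lemma test_function_wave (a : R) : (forall s, a < `|s| -> eta s = 0) ->
  test_function (wave_test eta xi b).
Proof.
move=> eta0; split.
  apply: contD_smooth => m; apply: contDM; first apply: contDM.
  - exact: contD_prod (contD_coord m).
  - apply: (contD_linear (L := @snd V R)) => //.
    by move=> z; exact: cvg_snd.
  - exact: (contD_linear wphaseD continuous_wphase (contD_shift b (contD_trig m).1)).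
pose B := [set x : V | forall i, `[- (2 * k.+1%:R), 2 * k.+1%:R]%classic (x ord0 i)].
have cB : compact B.
  by apply: (@rV_compact R n (fun=> `[- (2 * k.+1%:R), 2 * k.+1%:R]%classic)) => i; exact: segment_compact.
have cC : compact (B `*` `[- a, a]%classic).
  by apply: compact_setX => //; exact: segment_compact.
apply: (subclosed_compact _ cC); first exact: closed_closure.
have clC := compact_closed (@norm_hausdorff _ _) cC.
rewrite ((closure_id _).1 clC).
apply: closureS => -[x t] /= ne0; split => /=.
- move=> i /=; rewrite in_itv/= -ler_norml leNgt; apply/negP => xi2.
  move/eqP: ne0; apply; rewrite /wave_test (box_cutE i) /cutk cut_eq0 ?mul0r//=.
  rewrite normrM /ck ger0_norm ?invr_ge0// mulrC ltr_pdivlMr ?ltr0n//.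
- rewrite in_itv/= -ler_norml leNgt; apply/negP => ta.
  by move/eqP: ne0; apply; rewrite /wave_test /= eta0// mulr0 mul0r.
Qed.

End wave_test.

Section box_cut_theory.
Context {R : realType} {n : nat}.
Local Notation V := 'rV[R]_n.
Implicit Types (x : V).

Let ck (k : nat) : R := k.+1%:R^-1.

Let ck_gt0 k : 0 < ck k. Proof. by rewrite invr_gt0. Qed.

Let ck_le1 k : ck k <= 1.
Proof. by rewrite invf_le1 ?ltr0n// ler1n. Qed.

Let norm_prod_cut k (P : pred 'I_n) x :
  `|\prod_(j < n | P j) cut (ck k * x 0 j)| <= 1.
Proof.
rewrite normr_prod; apply: prodr_ile1 => i _.
by rewrite normr_ge0 cut_norm_le1.
Qed.

Lemma box_cut_norm_le1 k x : `|box_cut k x| <= 1.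
Proof. exact: norm_prod_cut. Qed.

Let dil_gt k x i : 2 * k.+1%:R < `|x 0 i| -> 2 < `|ck k * x 0 i|.
Proof.
rewrite normrM (ger0_norm (ltW (ck_gt0 k))) -(ltr_pM2l (ck_gt0 k)).
by rewrite mulrCA /ck mulVf ?mulr1.
Qed.

Lemma box_cut_supp k x i : 2 * k.+1%:R < `|x 0 i| -> box_cut k x = 0.
Proof. by move=> /dil_gt h; rewrite /box_cut (bigD1 i)//= cut_eq0// mul0r. Qed.

Let dcutk k (s : R) :
  deriv1 (fun s => cut (ck k * s)) s = ck k * deriv1 cut (ck k * s).
Proof. by rewrite deriv1_dilate//; exact: smooth1_cut. Qed.

Let ddcutk k (s : R) : deriv1 (deriv1 (fun s => cut (ck k * s))) s =
  ck k * (ck k * deriv1 (deriv1 cut) (ck k * s)).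
Proof.
have s1 := smooth1_deriv (@smooth1_cut R).
rewrite (deriv1_dilate _ smooth1_cut) (deriv1_scale _ (smooth1_dilate _ s1)).
by rewrite (deriv1_dilate _ s1).
Qed.

(** Each derivative of the dilated cut-off brings out a factor [1 / (k + 1)] and the remaining
    factors are at most 1. Second derivatives give the square of that factor, estimated by the
    factor itself. *)
Lemma dbox_cut_bound : exists C : R, 0 <= C /\ forall k i x,
  `|dbox_cut k i x| <= C * k.+1%:R^-1 /\ `|ddbox_cut k i x| <= C * k.+1%:R^-1.
Proof.
have [C [C0 hC]] := @cut_derivs_bounded R; exists C; split => // k i x.
have [h1 h2] := hC (ck k * x 0 i).
have p1 := norm_prod_cut k (fun j => j != i) x.
have c0 := ltW (ck_gt0 k).
rewrite /dbox_cut /ddbox_cut dcutk ddcutk !normrM (ger0_norm c0).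
split; rewrite -[leRHS]mulr1 ler_pM ?mulr_ge0//.
  by rewrite mulrC ler_wpM2r.
rewrite [leRHS]mulrC ler_wpM2l// -[leRHS]mul1r ler_pM//.
Qed.

Lemma dbox_cut_supp k i x j : 2 * k.+1%:R < `|x 0 j| ->
  dbox_cut k i x = 0 /\ ddbox_cut k i x = 0.
Proof.
move=> /dil_gt h; rewrite /dbox_cut /ddbox_cut dcutk ddcutk.
have [ij|ji] := eqVneq j i; last by rewrite (bigD1 j)//= cut_eq0// !mul0r !mulr0.
rewrite -ij (deriv1_supp cut_eq0)// (deriv1_supp (deriv1_supp cut_eq0))//.
by rewrite !mulr0 !mul0r.
Qed.

Lemma measurable_box_cut k : measurable_fun setT (box_cut k : V -> R).
Proof.
apply: (measurable_prod_coord (f := fun _ s => cut (ck k * s))) => i.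
exact: smooth1_measurable (smooth1_dilate _ smooth1_cut).
Qed.

Let measurable_rest k i : measurable_fun setT
  (fun x : V => \prod_(j < n | j != i) cut (ck k * x 0 j)).
Proof.
rewrite (_ : (fun x : V => _) =
    fun x => \prod_(j < n) (if j != i then cut (ck k * x 0 j) else 1)); last first.
  by apply/funext => x; rewrite big_mkcond.
apply: (measurable_prod_coord (f := fun j s => if j != i then cut (ck k * s) else 1)) => j.
case: (j != i) => //.
exact: smooth1_measurable (smooth1_dilate _ smooth1_cut).
Qed.

Lemma measurable_dbox_cut k i : measurable_fun setT (dbox_cut k i : V -> R).
Proof.
apply: measurable_funM; last exact: measurable_rest.
apply: (measurableT_comp (f := deriv1 _ : measurableTypeR R -> R)).
  by apply: smooth1_measurable; apply: smooth1_deriv; exact: smooth1_dilate smooth1_cut.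
exact: measurable_rV_coord.
Qed.

Lemma measurable_ddbox_cut k i : measurable_fun setT (ddbox_cut k i : V -> R).
Proof.
apply: measurable_funM; last exact: measurable_rest.
apply: (measurableT_comp (f := deriv1 (deriv1 _) : measurableTypeR R -> R)).
  apply: smooth1_measurable; do 2!apply: smooth1_deriv.
  exact: smooth1_dilate smooth1_cut.
exact: measurable_rV_coord.
Qed.

Lemma box_cut_near1 x : \forall k \near \oo, box_cut k x = 1.
Proof.
near=> k; rewrite /box_cut big1// => i _; apply: cut_eq1.
rewrite normrM ger0_norm ?(ltW (ck_gt0 k))// mulrC ler_pdivrMr// mul1r.
apply: le_trans (_ : \sum_(j < n) `|x 0 j| <= _).
  by rewrite (bigD1 i)//= lerDl sumr_ge0.
apply: (@le_trans _ _ k%:R); last by rewrite ler_nat.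
near: k; exact: nbhs_infty_ger.
Unshelve. all: by end_near. Qed.

Lemma L2_box_cut k : square_integrable (lebesgue_rV R n) (fun x => (box_cut k x)%:C).
Proof.
apply: (L2_box (C := 1) (A := 2 * k.+1%:R)); first exact: measurable_box_cut.
  exact: box_cut_norm_le1.
exact: box_cut_supp.
Qed.

Lemma L2_dbox_cut k i : square_integrable (lebesgue_rV R n) (fun x => (dbox_cut k i x)%:C).
Proof.
have [C [_ hC]] := dbox_cut_bound.
apply: (L2_box (C := C * k.+1%:R^-1) (A := 2 * k.+1%:R)); first exact: measurable_dbox_cut.
  by move=> x; have [] := hC k i x.
by move=> x j h; have [] := dbox_cut_supp i h.
Qed.

Lemma L2_ddbox_cut k i : square_integrable (lebesgue_rV R n) (fun x => (ddbox_cut k i x)%:C).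
Proof.
have [C [_ hC]] := dbox_cut_bound.
apply: (L2_box (C := C * k.+1%:R^-1) (A := 2 * k.+1%:R)); first exact: measurable_ddbox_cut.
  by move=> x; have [] := hC k i x.
by move=> x j h; have [] := dbox_cut_supp i h.
Qed.

End box_cut_theory.

(** * Wave coefficients of a weak solution *)

Section L2_sum.
Context {R : realType} {d} {T : measurableType d} (mu : {measure set T -> \bar R}).

Lemma L2_Zl (c : R[i]) (f : T -> R[i]) : square_integrable mu f ->
  square_integrable mu (fun x => c * f x).
Proof.
move=> Lf; apply: (L2_bddM (h := fun=> c) (C := sqnormc c)) => //.
Qed.

Lemma L2_D (f g : T -> R[i]) : square_integrable mu f -> square_integrable mu g ->
  square_integrable mu (fun x => f x + g x).
Proof.
move=> Lf Lg; have Ng := L2_Zl (- 1) Lg.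
by have := L2_B Lf Ng; under eq_fun do rewrite mulN1r opprK.
Qed.

Lemma L2_0 : square_integrable mu (fun=> 0 : R[i]).
Proof.
split; first exact: cmeasurable_cst.
by under eq_integral do rewrite sqnormc0; rewrite integral0.
Qed.

Lemma L2_sum I (s : seq I) (f : I -> T -> R[i]) :
  (forall i, square_integrable mu (f i)) ->
  square_integrable mu (fun x => \sum_(i <- s) f i x).
Proof.
move=> Lf; elim: s => [|i s IH].
  by under eq_fun do rewrite big_nil; exact: L2_0.
by under eq_fun do rewrite big_cons; exact: L2_D.
Qed.

End L2_sum.

Section weak_equation.
Context {R : realType} {n : nat}.
Local Notation V := 'rV[R]_n.
Local Notation leb := (lebesgue_rV R n).
Local Notation Leb := (@lebesgue_measure R).
Local Notation T := (measurableTypeR R).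
Implicit Types (xi : V) (t : R).

Variable u : V * R -> R[i].
Hypothesis mu : @cmeasurable _ _ (V * T)%type u.
Hypothesis Lu : forall t, square_integrable leb (fun x => u (x, t)).
Hypothesis cu : forall t0, (\int[leb]_x
  (sqnormc (u (x, t) - u (x, t0)))%:E)%E @[t --> t0] --> 0%E.

(** Continuity in L2 bounds the energy near each time, and compactness of [[- A, A]], in
    near-covering form with the bound as the parameter tending to infinity, makes one bound work on
    the whole interval. *)
Lemma energy_bounded (A : R) : exists M : R, 0 <= M /\ forall t, `|t| <= A ->
  (\int[leb]_x (sqnormc (u (x, t)))%:E <= M%:E)%E.
Proof.
have := (compact_near_coveringP _).1 (@segment_compact R (- A) A).
move=> /(_ R (+oo%R) (fun M t => (\int[leb]_x (sqnormc (u (x, t)))%:E <= M%:E)%E)).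
move=> /(_ _ _) h; have {}h : \forall M \near +oo%R, forall t, `|t| <= A ->
    (\int[leb]_x (sqnormc (u (x, t)))%:E <= M%:E)%E.
  apply: filterS (h _) => [M hM t tA|t0 _].
    by apply: hM; rewrite /= in_itv/= -ler_norml.
  have E0 : (\int[leb]_x (sqnormc (u (x, t0)))%:E)%E \is a fin_num.
    by rewrite ge0_fin_numE ?integral_sqnormc_ge0//; case: (Lu t0).
  have near1 : \forall t \near t0,
      (\int[leb]_x (sqnormc (u (x, t) - u (x, t0)))%:E <= 1)%E.
    have /fine_cvgP[fin cvg0] := cu t0.
    have d1 : \forall t \near t0, `|fine (\int[leb]_x
        (sqnormc (u (x, t) - u (x, t0)))%:E)%E| < 1.
      by apply: ((cvgr0Pnorm_lt _).1 cvg0 _ ltr01).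
    apply: filterS2 fin d1 => t ft /ltW; rewrite ger0_norm; last first.
      by rewrite fine_ge0// integral_ge0// => x _; rewrite lee_fin sqnormc_ge0.
    by rewrite -lee_fin fineK.
  near=> t M => /=.
  apply: (@le_trans _ _ (2%:E * \int[leb]_x (sqnormc (u (x, t) - u (x, t0)))%:E +
     2%:E * \int[leb]_x (sqnormc (u (x, t0)))%:E)%E).
    have mt s : cmeasurable (fun x => u (x, s)) by have [] := Lu s.
    have := le_integral_sqnormcD leb (cmeasurableB (mt t) (mt t0)) (mt t0).
    by under eq_integral do rewrite subrK.
  apply: (@le_trans _ _ (2%:E * 1 + 2%:E * \int[leb]_x (sqnormc (u (x, t0)))%:E)%E).
    by rewrite leeD2r// lee_wpmul2l//; near: t.
  rewrite mule1 -(fineK E0) -EFinM -EFinD lee_fin.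
  near: M; apply: nbhs_pinfty_ge; exact: num_real.
near (+oo%R : set_system R) => M; exists M; split.
  by near: M; exact: nbhs_pinfty_ge.
by near: M.
Unshelve. all: by end_near. Qed.

Let mut t : cmeasurable (fun x => u (x, t)). Proof. exact: (Lu t).1. Qed.

Let mu_prod : @cmeasurable _ _ (V * T)%type u := mu.

Lemma measurable_wphaseN xi t : measurable_fun setT (fun x : V => - wphase xi (x, t)).
Proof.
rewrite /wphase/=; apply: measurable_funN; apply: measurable_funM => //.
by apply: measurable_funD => //; exact: measurable_dot.
Qed.

Section term.
Variables (p : V -> R) (q : R -> R) (h : V * R -> R[i]) (c : R[i]) (A C : R).
Hypothesis Lp : square_integrable leb (fun x => (p x)%:C).
Hypothesis mq : measurable_fun setT (q : T -> R).
Hypothesis qC : forall t, `|q t| <= C.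
Hypothesis qA : forall t, A < `|t| -> q t = 0.
Hypothesis mh : @cmeasurable _ _ (V * T)%type h.
Hypothesis h1 : forall z, cabs (h z) <= 1.

(** Every term of the weak equation has this shape: a spatial cut-off [p] in L2, a bounded temporal
    cut-off [q] and an oscillation [h] of modulus at most 1. For [|t| <= A] the product of [u] and
    [p] has bounded integral by [energy_bounded]; outside, [q] vanishes. *)
Lemma cintegrable_term :
  cintegrable (leb \x Leb)%E (fun z => u z * (c * (p z.1 * q z.2)%:C * h z)).
Proof.
have C0 : 0 <= C := le_trans (normr_ge0 _) (qC 0).
rewrite (_ : (fun z => _) =
    fun z => c * (u z * (p z.1)%:C * ((q z.2)%:C * h z))); last first.
  by apply/funext => z; rewrite rmorphM/=; ring.
apply: cintegrableZl; apply: cintegrable_tonelli21.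
  have [mp _] := Lp.
  apply: cmeasurableM; apply: cmeasurableM => //.
    exact: (cmeasurable_comp measurable_fst mp).
  exact: (cmeasurable_comp measurable_snd (cmeasurable_real mq)).
have [M [M0 hM]] := energy_bounded A.
have Pfin : (\int[leb]_x (sqnormc (p x)%:C)%:E)%E \is a fin_num.
  by rewrite ge0_fin_numE ?integral_sqnormc_ge0//; case: Lp.
pose P := fine (\int[leb]_x (sqnormc (p x)%:C)%:E)%E.
have P0 : 0 <= P by rewrite fine_ge0// integral_sqnormc_ge0.
pose D : R := C * (1 / 2 * M + 1 / 2 * P).
have D0 : 0 <= D by rewrite mulr_ge0// addr_ge0// mulr_ge0.
apply: (@le_lt_trans _ _ (\int[Leb]_t (D * \1_(`[(- A)%R, A]%classic) t)%:E)%E).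
  apply: ge0_le_integral => //.
  - by move=> t _; apply: integral_ge0 => x _; rewrite lee_fin cabs_ge0.
  - apply: (measurable_fun_fubini_tonelli_G
      (fun z : V * T => (cabs (u z * (p z.1)%:C * ((q z.2)%:C * h z)))%:E)).
      apply: emeasurable_cabs; have [mp _] := Lp.
      apply: cmeasurableM; apply: cmeasurableM => //.
        exact: (cmeasurable_comp measurable_fst mp).
      exact: (cmeasurable_comp measurable_snd (cmeasurable_real mq)).
    by move=> z; rewrite lee_fin cabs_ge0.
  - by apply/measurable_EFinP; apply: measurable_funM.
  move=> t _; have [tA|tA] := leP `|t| A; last first.
    under eq_integral do rewrite /= (qA tA) mul0r mulr0 cabs0.
    by rewrite integral0 lee_fin mulr_ge0.
  rewrite indicE mem_set ?mulr1; last by rewrite /= in_itv/= -ler_norml.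
  apply: (@le_trans _ _ (\int[leb]_x (C%:E * (cabs (u (x, t) * (p x)%:C))%:E))%E).
    have mup : cmeasurable (fun x => u (x, t) * (p x)%:C).
      by apply: cmeasurableM => //; have [] := Lp.
    apply: ge0_le_integral => //.
    - by move=> x _; rewrite lee_fin cabs_ge0.
    - apply: emeasurable_cabs; apply: cmeasurableM => //.
      apply: cmeasurableM; first exact: (cmeasurable_cst (q t)%:C).
      apply: (cmeasurable_comp (f := h : V * T -> R[i]) (h := fun x => (x, t : T))) => //.
    - by apply: emeasurable_funM => //; exact: emeasurable_cabs.
    - move=> x _; rewrite -EFinM lee_fin /= cabsM mulrC ler_wpM2r ?cabs_ge0//.
      by rewrite cabsM cabs_real -[leRHS]mulr1 ler_pM ?cabs_ge0.
  have mp : cmeasurable (fun x => (p x)%:C) by have [] := Lp.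
  rewrite ge0_integralZl//; last 2 first.
  - by apply: emeasurable_cabs; exact: cmeasurableM.
  - by move=> x _; rewrite lee_fin cabs_ge0.
  rewrite /D EFinM lee_wpmul2l// EFinD !EFinM.
  apply: le_trans (integral_cabsM_le leb ltr01 (mut t) mp) _.
  rewrite invr1 /P fineK// leeD2r// lee_wpmul2l ?lee_fin//.
  by apply: hM.
under eq_integral do rewrite EFinM.
rewrite ge0_integralZl//; last by apply/measurable_EFinP.
rewrite lte_mul_pinfty ?lee_fin// integral_indic// setIT.
have := @lebesgue_measure_itv R `[- A, A]%R; rewrite /= => ->.
by case: ifP => // _; rewrite -EFinB ltry.
Qed.

End term.

Section test_identity.
Variables (k : nat) (xi : V).

(* The commutator of the equation with the cut-off; it only involves derivatives of
   the cut-off. *)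
Definition drift (x : V) : R[i] :=
  (\sum_(i < n) ddbox_cut k i x) +i* (- (4 * pi * \sum_(i < n) xi 0 i * dbox_cut k i x)).

(** Up to the phase [expi (- chirp t xi)] this is the Fourier transform of [u (_, t) * e] at [xi];
    for the full solution it would be constant in time. *)
Definition wave_coef (e : V -> R[i]) t : R[i] :=
  cintegral leb (fun x => u (x, t) * (e x * expi (- wphase xi (x, t)))).

Let L2_sumr (f : 'I_n -> V -> R) (c : 'I_n -> R) :
  (forall i, square_integrable leb (fun x => (f i x)%:C)) ->
  square_integrable leb (fun x => (\sum_(i < n) c i * f i x)%:C).
Proof.
move=> Lf; rewrite (_ : (fun x => _) = fun x => \sum_(i < n) (c i)%:C * (f i x)%:C).
  by apply: L2_sum => i; exact: L2_Zl.
by apply/funext => x; rewrite rmorph_sum; apply: eq_bigr => i _; rewrite rmorphM.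
Qed.

Let LS : square_integrable leb (fun x => (\sum_(i < n) ddbox_cut k i x)%:C).
Proof.
have := L2_sumr (fun=> 1) (L2_ddbox_cut k).
by under eq_fun do under eq_bigr do rewrite mul1r.
Qed.

Let LD : square_integrable leb (fun x => (\sum_(i < n) xi 0 i * dbox_cut k i x)%:C).
Proof. exact: (L2_sumr (fun i => xi 0 i) (L2_dbox_cut k)). Qed.

Lemma L2_drift : square_integrable leb drift.
Proof.
rewrite (_ : drift = fun x => (\sum_(i < n) ddbox_cut k i x)%:C -
   (0 +i* (4 * pi)) * (\sum_(i < n) xi 0 i * dbox_cut k i x)%:C).
  by apply: L2_B => //; exact: L2_Zl.
by apply/funext => x; apply/eqP; rewrite eq_complex /=; apply/andP; split; apply/eqP; ring.
Qed.

Variables (eta : R -> R) (a : R).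
Hypothesis smooth1_eta : smooth1 eta.
Hypothesis eta0 : forall t, a < `|t| -> eta t = 0.
Hypothesis weak : forall phi, test_function phi ->
  cintegral (leb \x Leb)%E
    (fun z => u z * (laplacian phi z +i* (2 * pi * dt phi z))) = 0.

Let L (b : R) z : R[i] := laplacian (wave_test k eta xi b) z +i*
   (2 * pi * dt (wave_test k eta xi b) z).

Let mph (b : R) : measurable_fun setT (fun z : V * T => wphase xi z + b).
Proof.
apply: measurable_funD => //; rewrite /wphase; apply: measurable_funM => //.
apply: measurable_funD; first exact: measurable_dot.
exact: measurable_funM.
Qed.

Let integrable_uL b : cintegrable (leb \x Leb)%E (fun z => u z * L b z).
Proof.
have [C0 hC0] := smooth1_supp_bounded (smooth1_continuous smooth1_eta) eta0.
have s1 := smooth1_deriv smooth1_eta; have eta1 := deriv1_supp eta0.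
have [C1 hC1] := smooth1_supp_bounded (smooth1_continuous s1) eta1.
have m0 := smooth1_measurable smooth1_eta; have m1 := smooth1_measurable s1.
have mc : @cmeasurable _ _ (V * T)%type (fun z => (cos (wphase xi z + b))%:C).
  by have [h _] := cmeasurable_expi (mph b); exact: cmeasurable_real.
have ms : @cmeasurable _ _ (V * T)%type (fun z => (sin (wphase xi z + b))%:C).
  by have [_ h] := cmeasurable_expi (mph b); exact: cmeasurable_real.
have c1 z : cabs (cos (wphase xi z + b))%:C <= 1 by rewrite cabs_real cos_max.
have s1' z : cabs (sin (wphase xi z + b))%:C <= 1 by rewrite cabs_real sin_max.
have I1 := cintegrable_term 1 LS m0 hC0 eta0 mc c1.
have I2 := cintegrable_term (- (4 * pi))%:C LD m0 hC0 eta0 ms s1'.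
have I3 := cintegrable_term (- ((2 * pi) ^+ 2 * dot xi xi))%:C (L2_box_cut k) m0 hC0 eta0 mc c1.
have I4 := cintegrable_term (0 +i* (2 * pi)) (L2_box_cut k) m1 hC1 eta1 mc c1.
have I5 := cintegrable_term (0 +i* (- ((2 * pi) ^+ 2 * dot xi xi))) (L2_box_cut k) m0 hC0 eta0 ms s1'.
have := cintegrableD (cintegrableD (cintegrableD (cintegrableD I1 I2) I3) I4) I5.
congr cintegrable; apply/funext => z; rewrite -!mulrDr; congr (_ * _).
rewrite /L laplacian_wave_test// dt_wave_test//.
by apply/eqP; rewrite eq_complex /=; apply/andP; split; apply/eqP; ring.
Qed.

(** Since [cos - i sin = expi (- wphase)], this combination is the adjoint operator applied to the
    cut-off complex wave. The terms without a derivative of a cut-off cancel. *)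
Let wave_identity z : L 0 z - (0 +i* 1) * L (- (pi / 2)) z =
  (drift z.1 * (eta z.2)%:C + (0 +i* (2 * pi)) * (box_cut k z.1 * deriv1 eta z.2)%:C)
    * expi (- wphase xi z).
Proof.
rewrite /L !laplacian_wave_test// !dt_wave_test// addr0.
rewrite cosB sinB cos_pihalf sin_pihalf /drift /expi cosN sinN.
by apply/eqP; rewrite eq_complex /=; apply/andP; split; apply/eqP; ring.
Qed.

(** The weak form, tested against [eta], of the differential equation [2 pi i G' = H] in time, with
    [G] the coefficient for [box_cut] and [H] the one for the commutator [drift]. *)
Lemma wave_coef_weak :
  cintegral Leb (fun t => ((0 +i* (2 * pi)) * (deriv1 eta t)%:C) *
    wave_coef (fun x => (box_cut k x)%:C) t) =
  - cintegral Leb (fun t => (eta t)%:C * wave_coef drift t).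
Proof.
have [C0 hC0] := smooth1_supp_bounded (smooth1_continuous smooth1_eta) eta0.
have s1 := smooth1_deriv smooth1_eta; have eta1 := deriv1_supp eta0.
have [C1 hC1] := smooth1_supp_bounded (smooth1_continuous s1) eta1.
have m0 := smooth1_measurable smooth1_eta; have m1 := smooth1_measurable s1.
have me : @cmeasurable _ _ (V * T)%type (fun z => expi (- wphase xi z)).
  apply: cmeasurable_expi; apply: measurable_funN.
  by have := mph 0; under eq_fun do rewrite addr0.
have e1 z : cabs (expi (- wphase xi z)) <= 1 by rewrite cabs_expi.
have J1 := cintegrable_term 1 LS m0 hC0 eta0 me e1.
have J2 := cintegrable_term (0 +i* (- (4 * pi))) LD m0 hC0 eta0 me e1.
have J3 := cintegrable_term (0 +i* (2 * pi)) (L2_box_cut k) m1 hC1 eta1 me e1.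
pose Q1 z := u z * (drift z.1 * (eta z.2)%:C * expi (- wphase xi z)).
pose Q2 z := u z * ((0 +i* (2 * pi)) * (box_cut k z.1 * deriv1 eta z.2)%:C * expi (- wphase xi z)).
have IQ1 : cintegrable (leb \x Leb)%E Q1.
  have := cintegrableD J1 J2; congr cintegrable; apply/funext => z.
  rewrite /Q1 -mulrDr; congr (_ * _); rewrite -mulrDl; congr (_ * _).
  by apply/eqP; rewrite eq_complex /=; apply/andP; split; apply/eqP; ring.
have IQ2 : cintegrable (leb \x Leb)%E Q2 by [].
have sum0 : cintegral (leb \x Leb)%E Q1 + cintegral (leb \x Leb)%E Q2 = 0.
  rewrite -cintegralD//.
  transitivity (cintegral (leb \x Leb)%E (fun z => u z * L 0 z - (0 +i* 1) * (u z * L (- (pi / 2)) z))).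
    congr cintegral; apply/funext => z.
    by rewrite mulrCA -mulrBr wave_identity /Q1 /Q2; ring.
  rewrite (cintegralB (integrable_uL 0) (cintegrableZl _ (integrable_uL _))).
  rewrite (cintegralZl _ (integrable_uL _)).
  have w0 : cintegral (leb \x Leb)%E (fun z => u z * L 0 z) = 0.
    by apply: weak; exact: test_function_wave eta0.
  have w1 : cintegral (leb \x Leb)%E (fun z => u z * L (- (pi / 2)) z) = 0.
    by apply: weak; exact: test_function_wave eta0.
  apply: etrans (congr2 (fun p q => p - (0 +i* 1) * q) w0 w1) _.
  by rewrite mulr0 subrr.
have E2 : cintegral Leb (fun t => ((0 +i* (2 * pi)) * (deriv1 eta t)%:C) *
    wave_coef (fun x => (box_cut k x)%:C) t) = cintegral (leb \x Leb)%E Q2.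
  rewrite -cintegral21//; congr cintegral; apply/funext => t.
  rewrite /wave_coef -cintegralZl.
    by congr cintegral; apply/funext => x; rewrite /Q2 /= rmorphM/=; ring.
  apply: L2_cintegrableM => //; apply: L2_phase; first exact: L2_box_cut.
  exact: measurable_wphaseN.
have E1 : cintegral Leb (fun t => (eta t)%:C * wave_coef drift t) =
    cintegral (leb \x Leb)%E Q1.
  rewrite -cintegral21//; congr cintegral; apply/funext => t.
  rewrite /wave_coef -cintegralZl.
    by congr cintegral; apply/funext => x; rewrite /Q1 /=; ring.
  apply: L2_cintegrableM => //; apply: L2_phase; first exact: L2_drift.
  exact: measurable_wphaseN.
by rewrite E1 E2; apply/eqP; rewrite -addr_eq0 addrC sum0.
Qed.

End test_identity.

End weak_equation.

Section lebesgue1_tools.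
Context {R : realType}.
Local Notation Leb := (@lebesgue_measure R).
Local Notation T := (measurableTypeR R).

Lemma transport_affine1 (c a : R) : 0 < c -> forall f : T -> \bar R,
  measurable_fun setT f -> (forall y, 0 <= f y)%E ->
  (\int[Leb]_x f (c * x + a)%R = (c^-1)%:E * \int[Leb]_x f x)%E.
Proof.
move=> c0 f mf f0.
have mfa : measurable_fun setT (fun x : T => f (x + a)%R).
  by apply: (measurableT_comp mf); exact: measurable_funD.
rewrite (ge0_integral_lebesgueZ (f := fun x => f (x + a)%R))//.
by rewrite ge0_integral_lebesgueD.
Qed.

Lemma cintegral_affine1 (c a : R) (f : T -> R[i]) : 0 < c -> cintegrable Leb f ->
  cintegral Leb (fun x => f (c * x + a)) = (c^-1)%:C * cintegral Leb f.
Proof.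
by move=> c0 If; exact: (cintegral_transport (transport_affine1 a c0) If).
Qed.

Lemma integral_cst_itv (C a b : R) : 0 <= C ->
  (\int[Leb]_t (C * \1_(`[a, b]%classic) t)%:E < +oo)%E.
Proof.
move=> C0; under eq_integral do rewrite EFinM.
rewrite ge0_integralZl//; last by apply/measurable_EFinP.
rewrite lte_mul_pinfty ?lee_fin// integral_indic// setIT.
have := @lebesgue_measure_itv R `[a, b]%R; rewrite /= => ->.
by case: ifP => // _; rewrite -EFinB ltry.
Qed.

Lemma cintegrable_itv (f : T -> R[i]) (C a b : R) : cmeasurable f ->
  (forall t, a <= t <= b -> cabs (f t) <= C) -> (forall t, ~~ (a <= t <= b) -> f t = 0) ->
  cintegrable Leb f.
Proof.
move=> mf fC f0; apply: (@cintegrable_le _ _ _ Leb _ (fun t => `|C| * \1_(`[a, b]%classic) t)).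
- by [].
- exact: measurable_funM.
- move=> t; rewrite indicE; have [tab|tab] := boolP (a <= t <= b).
    rewrite mem_set ?mulr1; last by rewrite /= in_itv.
    exact: le_trans (fC _ tab) (ler_norm _).
  by rewrite f0// cabs0 mulr_ge0.
- exact: integral_cst_itv.
Qed.

Lemma cvg_expi (s : nat -> R) (a : R) : s k @[k --> \oo] --> a ->
  cabs (expi (s k) - expi a) @[k --> \oo] --> (0 : R).
Proof.
move=> sa.
have h : `|cos (s k) - cos a| + `|sin (s k) - sin a| @[k --> \oo] --> (0 : R).
  have hc : cos (s k) - cos a @[k --> \oo] --> (0 : R).
    rewrite -[X in _ --> X](subrr (cos a)); apply: cvgB; last exact: cvg_cst.
    exact: (cvg_comp _ _ sa (@continuous_cos R a)).
  have hs : sin (s k) - sin a @[k --> \oo] --> (0 : R).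
    rewrite -[X in _ --> X](subrr (sin a)); apply: cvgB; last exact: cvg_cst.
    exact: (cvg_comp _ _ sa (@continuous_sin R a)).
  have h : `|cos (s k) - cos a| + `|sin (s k) - sin a| @[k --> \oo] --> `|0 : R| + `|0 : R|.
    by apply: cvgD; exact: cvg_norm.
  by move: h; rewrite !normr0 addr0.
apply: (squeeze_cvgr _ (cvg_cst 0) h); apply: nearW => k.
by rewrite cabs_ge0 /= cabs_le.
Qed.

Lemma cvg_cabsMl (c l : R[i]) (s_ : nat -> R[i]) :
  cabs (s_ k - l) @[k --> \oo] --> (0 : R) ->
  cabs (c * s_ k - c * l) @[k --> \oo] --> (0 : R).
Proof.
move=> sl; have h : cabs c * cabs (s_ k - l) @[k --> \oo] --> cabs c * 0.
  by apply: cvgM => //; exact: cvg_cst.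
rewrite mulr0 in h.
have -> : (fun k => cabs (c * s_ k - c * l)) = fun k => cabs c * cabs (s_ k - l).
  by apply/funext => k; rewrite -mulrBr cabsM.
exact: h.
Qed.

Lemma cvg_cabsB (X Y : nat -> R[i]) (x y : R[i]) :
  cabs (X k - x) @[k --> \oo] --> (0 : R) -> cabs (Y k - y) @[k --> \oo] --> (0 : R) ->
  cabs (X k - Y k) @[k --> \oo] --> cabs (x - y).
Proof.
move=> Xx Yy.
have h : cabs (X k - x) + cabs (Y k - y) @[k --> \oo] --> (0 : R) + 0 by apply: cvgD.
rewrite addr0 in h.
apply/cvgrPdist_le => e e0.
have hn : \forall k \near \oo, `|cabs (X k - x) + cabs (Y k - y)| < e.
  by apply: ((cvgr0Pnorm_lt _).1 h).
apply: filterS hn => k; rewrite ger0_norm ?addr_ge0 ?cabs_ge0// => he.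
apply: le_trans (ltW he).
have t1 : cabs (x - y) <= cabs (X k - Y k) + (cabs (X k - x) + cabs (Y k - y)).
  have -> : x - y = (X k - Y k) + (- (X k - x) + (Y k - y)) by ring.
  apply: le_trans (cabsD _ _) _; rewrite lerD2l.
  by apply: le_trans (cabsD _ _) _; rewrite cabsN.
have t2 : cabs (X k - Y k) <= cabs (x - y) + (cabs (X k - x) + cabs (Y k - y)).
  have -> : X k - Y k = (x - y) + ((X k - x) + (- (Y k - y))) by ring.
  apply: le_trans (cabsD _ _) _; rewrite lerD2l.
  by apply: le_trans (cabsD _ _) _; rewrite cabsN.
by rewrite ler_norml; apply/andP; split; lra.
Qed.

Lemma deriv1_B (f g : R -> R) : smooth1 f -> smooth1 g ->
  deriv1 (fun s => f s - g s) = fun s => deriv1 f s - deriv1 g s.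
Proof.
move=> sf sg; apply/funext => x.
have df := smooth1_is_derive x sf; have dg := smooth1_is_derive x sg.
have [_ h] := is_deriveB df dg; exact: h.
Qed.

End lebesgue1_tools.

(** * Increments in time of the wave coefficients *)

Section fundamental.
Context {R : realType} {n : nat}.
Local Notation V := 'rV[R]_n.
Local Notation leb := (lebesgue_rV R n).
Local Notation Leb := (@lebesgue_measure R).
Local Notation T := (measurableTypeR R).
Implicit Types (xi : V) (t : R).

Variable u : V * R -> R[i].
Hypothesis mu : @cmeasurable _ _ (V * T)%type u.
Hypothesis Lu : forall t, square_integrable leb (fun x => u (x, t)).
Hypothesis cu : forall t0, (\int[leb]_x
  (sqnormc (u (x, t) - u (x, t0)))%:E)%E @[t --> t0] --> 0%E.

Lemma cmeasurable_wave_coef xi (e : V -> R[i]) : cmeasurable e ->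
  @cmeasurable _ _ T (wave_coef u xi e).
Proof.
move=> me; apply: (cmeasurable_cintegral1 leb
  (f := fun z : V * T => u z * (e z.1 * expi (- wphase xi z)))).
apply: cmeasurableM => //; apply: cmeasurableM.
  exact: (cmeasurable_comp measurable_fst me).
apply: cmeasurable_expi; apply: measurable_funN; rewrite /wphase.
apply: measurable_funM => //; apply: measurable_funD; first exact: measurable_dot.
exact: measurable_funM.
Qed.

Let L2_wave xi (e : V -> R[i]) t : square_integrable leb e ->
  square_integrable leb (fun x => e x * expi (- wphase xi (x, t))).
Proof. by move=> Le; apply: L2_phase => //; exact: measurable_wphaseN. Qed.

Lemma wave_coef_bounded xi (e : V -> R[i]) (A : R) : square_integrable leb e ->
  exists B, 0 <= B /\ forall t, `|t| <= A -> cabs (wave_coef u xi e t) <= B.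
Proof.
move=> Le; have [M [M0 hM]] := energy_bounded Lu cu A.
have Pfin : (\int[leb]_x (sqnormc (e x))%:E)%E \is a fin_num.
  by rewrite ge0_fin_numE ?integral_sqnormc_ge0//; case: Le.
pose P := fine (\int[leb]_x (sqnormc (e x))%:E)%E.
have P0 : 0 <= P by rewrite fine_ge0// integral_sqnormc_ge0.
exists (1 / 2 * M + 1 / 2 * P); split; first by rewrite addr_ge0// mulr_ge0.
move=> t tA; apply: cabs_cintegral_le.
  by apply: cmeasurableM; [exact: (Lu t).1|exact: (L2_wave xi t Le).1].
apply: le_trans (integral_cabsM_le leb ltr01 (Lu t).1 (L2_wave xi t Le).1) _.
rewrite EFinD !EFinM invr1; apply: leeD; rewrite lee_wpmul2l//; first exact: hM.
rewrite /P fineK//; under eq_integral do rewrite sqnormcM sqnormc_expi mulr1.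
exact: lexx.
Qed.

(** Both factors of the pairing converge in L2: the solution by assumption, and the modulated
    profile by dominated convergence with majorant [4 |e|^2]. *)
Lemma cvg_wave_coef xi (e : V -> R[i]) (s : nat -> R) t : square_integrable leb e ->
  s k @[k --> \oo] --> t ->
  cabs (wave_coef u xi e (s k) - wave_coef u xi e t) @[k --> \oo] --> (0 : R).
Proof.
move=> Le st; apply: cvg_cintegralM => //; try by move=> k; exact: L2_wave.
- exact: L2_wave.
- exact: (cvg_comp _ _ st (cu t)).
- apply: (cvg_sqdist (r := fun x => 4 * sqnormc (e x))).
  + by move=> k; exact: (L2_wave _ _ Le).1.
  + exact: (L2_wave _ _ Le).1.
  + apply: aeW => x.
    have h : cabs (expi (- wphase xi (x, s j)) - expi (- wphase xi (x, t))) @[j --> \oo] --> (0 : R).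
      apply: cvg_expi; apply: cvgN; rewrite /wphase/=; apply: cvgM; first exact: cvg_cst.
      apply: cvgD; first exact: cvg_cst.
      by apply: cvgM => //; exact: cvg_cst.
    exact: (@cvg_cabsMl R _ _ (fun j => expi (- wphase xi (x, s j))) h).
  + by apply: measurable_funM => //; apply: measurable_sqnormc; have [] := Le.
  + move=> k x; apply: le_trans (sqnormcB_le _ _) _.
    by rewrite !sqnormcM !sqnormc_expi !mulr1; lra.
  + under eq_integral do rewrite EFinM.
    rewrite ge0_integralZl//.
    * by rewrite lte_mul_pinfty//; have [] := Le.
    * by apply: emeasurable_sqnormc; have [] := Le.
    * by move=> x _; rewrite lee_fin sqnormc_ge0.
Qed.

Variables (k : nat) (xi : V).
Hypothesis weak : forall phi, test_function phi ->
  cintegral (leb \x Leb)%E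
    (fun z => u z * (laplacian phi z +i* (2 * pi * dt phi z))) = 0.

Let G := wave_coef u xi (fun x => (box_cut k x)%:C).
Let H := wave_coef u xi (drift k xi).

Let mG : @cmeasurable _ _ T G.
Proof. by apply: cmeasurable_wave_coef; have [] := @L2_box_cut R n k. Qed.

Let mH : @cmeasurable _ _ T H.
Proof. by apply: cmeasurable_wave_coef; have [] := @L2_drift R n k xi. Qed.

(** A smooth step over [[a, a + 1 / (m + 1)]]. Its width is at most 1, which is why the cruder
    endpoints [a + 1] and [b + 1] give bounds uniform in [m]. *)
Let ramp (m : nat) (a s : R) := step (m.+1%:R * s + - (m.+1%:R * a)).

Let smooth_ramp m a : smooth1 (ramp m a).
Proof. by move=> j; exact: contD_scale (contD_shift _ (smooth1_step j)). Qed.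

Let deriv1_ramp m a s : deriv1 (ramp m a) s =
  m.+1%:R * deriv1 step (m.+1%:R * s + - (m.+1%:R * a)).
Proof. by rewrite (deriv1_affine _ _ smooth1_step). Qed.

Let ramp_le m a s : s <= a -> ramp m a s = 0.
Proof. by move=> sa; rewrite /ramp step_le0// subr_le0 ler_pM2l ?ltr0n. Qed.

Let ramp_ge m a s : a + 1 <= s -> ramp m a s = 1.
Proof.
move=> sa; rewrite /ramp step_ge1// -mulrBr -[leLHS]mulr1 ler_pM//; last lra.
by rewrite ler1n.
Qed.

(* the limit as m -> oo of the derivative of [ramp m a] is a Dirac mass at [a] *)
Let cvg_ramp (a : R) :
  cabs (cintegral Leb (fun t => (deriv1 (ramp m a) t)%:C * G t) - G a)
    @[m --> \oo] --> (0 : R).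
Proof.
have [B [B0 hB]] := wave_coef_bounded xi (`|a| + 1) (L2_box_cut k).
have [D hD] := @dstep_bounded R.
have D0 : 0 <= D := le_trans (normr_ge0 _) (hD 0).
have Lst m : 1 <= m.+1%:R :> R by rewrite ler1n.
have m0 (m : nat) : 0 < m.+1%:R :> R by rewrite ltr0n.
pose f m (t : T) := (deriv1 step (m.+1%:R * t + - (m.+1%:R * a)))%:C * G t.
have mds m : @cmeasurable _ _ T (fun t => (deriv1 step (m.+1%:R * t + - (m.+1%:R * a)))%:C).
  apply: cmeasurable_real.
  apply: (measurableT_comp (smooth1_measurable (smooth1_deriv smooth1_step))).
  by apply: measurable_funD => //; exact: measurable_funM.
have If m : cintegrable Leb (f m).
  apply: (@cintegrable_itv _ _ (D * B) a (a + 1)).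
  - exact: cmeasurableM.
  - move=> t /andP[t1 t2]; rewrite cabsM cabs_real ler_pM ?cabs_ge0//.
    apply: hB; rewrite ler_norml; apply/andP; split.
      by have := ler_norm (- a); rewrite normrN; lra.
    by have := ler_norm a; lra.
  - move=> t; rewrite negb_and -!ltNge => /orP[ta|ta]; rewrite /f.
      by rewrite dstep_lt0 ?mul0r// subr_lt0 ltr_pM2l.
    rewrite dstep_gt1 ?mul0r// -mulrBr.
    apply: (@lt_le_trans _ _ (t - a)); first lra.
    by rewrite ler_peMl//; lra.
have fE m : cintegral Leb (fun t => (deriv1 (ramp m a) t)%:C * G t) =
    cintegral Leb (fun s => (deriv1 step s)%:C * G (m.+1%:R^-1 * s + a)).
  transitivity ((m.+1%:R)%:C * cintegral Leb (f m)).
    rewrite -cintegralZl//; congr cintegral; apply/funext => t.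
    by rewrite deriv1_ramp rmorphM/= mulrA.
  have := cintegral_affine1 (c := m.+1%:R^-1) a _ (If m); rewrite invrK => <-; last first.
    by rewrite invr_gt0.
  apply: (congr1 (cintegral Leb)); apply/funext => s.
  have sE : m.+1%:R * (m.+1%:R^-1 * s + a) + - (m.+1%:R * a) = s.
    by rewrite mulrDr mulrA divff ?gt_eqF// mul1r addrK.
  by rewrite /f sE.
have GaE : G a = cintegral Leb (fun s => (deriv1 step s)%:C * G a).
  under eq_fun do rewrite mulrC.
  by rewrite cintegralZl ?cintegral_real ?integral_dstep ?mulr1//; exact: dstep_integrable.
have -> : (fun m => cabs (cintegral Leb (fun t => (deriv1 (ramp m a) t)%:C * G t) - G a)) =
    fun m => cabs (cintegral Leb (fun s => (deriv1 step s)%:C * G (m.+1%:R^-1 * s + a)) -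
      cintegral Leb (fun s => (deriv1 step s)%:C * G a)).
  by apply/funext => m; rewrite fE -GaE.
have mdst : @cmeasurable _ _ T (fun s => (deriv1 step s)%:C).
  by apply: cmeasurable_real; exact: (smooth1_measurable (smooth1_deriv smooth1_step)).
apply: (@cvg_cintegral _ _ _ Leb (fun m s => (deriv1 step s)%:C * G (m.+1%:R^-1 * s + a))
  (fun s => (deriv1 step s)%:C * G a) (fun s => D * B * \1_(`[0%R, 1%R]%classic) s)).
- move=> m; apply: (cmeasurableM mdst); apply: (cmeasurable_comp _ mG).
  by apply: measurable_funD => //; exact: measurable_funM.
- exact: (cmeasurableM mdst (cmeasurable_cst _)).
- move=> s; apply: (@cvg_cabsMl R _ _ (fun m => G (m.+1%:R^-1 * s + a))).
  apply: cvg_wave_coef; first exact: L2_box_cut.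
  have h : m.+1%:R^-1 * s + a @[m --> \oo] --> 0 * s + a.
    apply: cvgD; last exact: cvg_cst.
    by apply: cvgM; [exact: cvg_harmonic|exact: cvg_cst].
  by rewrite mul0r add0r in h.
- exact: measurable_funM.
- move=> m s; rewrite cabsM cabs_real dstep_restrict patchE indicE; case: ifPn => [|_].
    rewrite inE /= in_itv/= => /andP[s0 s1]; rewrite mulr1 ler_pM ?cabs_ge0//.
    have i0 : 0 <= m.+1%:R^-1 * s by rewrite mulr_ge0// invr_ge0.
    have i1 : m.+1%:R^-1 * s <= 1.
      by rewrite -[leRHS]mulr1 ler_pM ?invr_ge0// invf_le1.
    by apply: hB; apply: le_trans (ler_normD _ _) _; rewrite addrC lerD2l ger0_norm.
  by rewrite normr0 mul0r mulr0.
- by apply: integral_cst_itv; rewrite mulr_ge0.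
Qed.

(** The weak equation is tested with [ramp m a - ramp m b], a smoothed indicator of [[a, b]] that
    lives in [[a, b + 1]] and has modulus at most 1. As [m] grows, the derivatives of the ramps
    evaluate [G] at [a] and at [b]. *)
Lemma wave_coef_diff (a b : R) : a < b ->
  ((2 * pi * cabs (G b - G a))%:E <=
   \int[Leb]_t (\1_(`[a, (b + 1)%R]%classic) t * cabs (H t))%:E)%E.
Proof.
move=> ab; pose eta m s := ramp m a s - ramp m b s.
have smooth_eta m : smooth1 (eta m) by move=> j; exact: contDB (smooth_ramp m a j) (smooth_ramp m b j).
pose A := `|a| + `|b| + 1.
have eta0 m t : A < `|t| -> eta m t = 0.
  have na := ler_norm a; have nb := ler_norm b.
  have na' := ler_norm (- a); have nb' := ler_norm (- b).
  rewrite !normrN in na' nb'.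
  rewrite ltr_normr /eta => /orP[tA|tA]; rewrite /A in tA.
    by rewrite !ramp_ge ?subrr//; lra.
  by rewrite !ramp_le ?subrr//; lra.
have eta_le1 m t : `|eta m t| <= \1_(`[a, (b + 1)%R]%classic) t.
  rewrite indicE; case: (boolP (t \in _)) => [_|/negP tab].
    have /andP[r1 r2] := step01 (m.+1%:R * t + - (m.+1%:R * a)).
    have /andP[r3 r4] := step01 (m.+1%:R * t + - (m.+1%:R * b)).
    have h : `|ramp m a t - ramp m b t| <= 1.
      by rewrite ler_norml; apply/andP; split; rewrite /ramp; lra.
    exact: h.
  have : ~~ (a <= t <= b + 1) by apply/negP => h; apply: tab; rewrite inE /= in_itv.
  rewrite negb_and -!ltNge => /orP[ta|tb]; rewrite /eta.
    by rewrite !ramp_le ?subrr ?normr0//; lra.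
  by rewrite !ramp_ge ?subrr ?normr0//; lra.
have mH1 : measurable_fun setT (fun t : T => \1_(`[a, (b + 1)%R]%classic) t * cabs (H t)).
  by apply: measurable_funM => //; exact: measurable_cabs.
have IG c m : cintegrable Leb (fun t => (deriv1 (ramp m c) t)%:C * G t).
  have [B [B0 hB]] := wave_coef_bounded xi (`|c| + 1) (L2_box_cut k).
  have [D hD] := @dstep_bounded R.
  have p0 : 0 < m.+1%:R :> R by rewrite ltr0n.
  have p1 : 1 <= m.+1%:R :> R by rewrite ler1n.
  apply: (@cintegrable_itv _ _ (m.+1%:R * D * B) c (c + 1)).
  - apply: cmeasurableM => //; apply: cmeasurable_real.
    exact: smooth1_measurable (smooth1_deriv (smooth_ramp m c)).
  - move=> t /andP[t1 t2]; rewrite cabsM cabs_real ler_pM ?cabs_ge0//.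
      by rewrite deriv1_ramp normrM (ger0_norm (ltW p0)) ler_pM2l.
    apply: hB; rewrite ler_norml; apply/andP; split.
      by have := ler_norm (- c); rewrite normrN; lra.
    by have := ler_norm c; lra.
  - move=> t; rewrite negb_and -!ltNge => /orP[ta|ta]; rewrite deriv1_ramp.
      by rewrite dstep_lt0 ?mulr0 ?mul0r// subr_lt0 ltr_pM2l.
    rewrite dstep_gt1 ?mulr0 ?mul0r// -mulrBr.
    apply: (@lt_le_trans _ _ (t - c)); first lra.
    by rewrite ler_peMl//; lra.
have key m : ((2 * pi * cabs (cintegral Leb (fun t => (deriv1 (ramp m a) t)%:C * G t)
     - cintegral Leb (fun t => (deriv1 (ramp m b) t)%:C * G t)))%:E <=
   \int[Leb]_t (\1_(`[a, (b + 1)%R]%classic) t * cabs (H t))%:E)%E.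
  have := wave_coef_weak mu Lu cu k xi (smooth_eta m) (eta0 m) weak.
  have -> : cintegral Leb (fun t => (0 +i* (2 * pi)) * (deriv1 (eta m) t)%:C *
      wave_coef u xi (fun x => (box_cut k x)%:C) t) =
    (0 +i* (2 * pi)) * (cintegral Leb (fun t => (deriv1 (ramp m a) t)%:C * G t)
     - cintegral Leb (fun t => (deriv1 (ramp m b) t)%:C * G t)).
    rewrite -cintegralB// -cintegralZl; last exact: cintegrableB.
    congr cintegral; apply/funext => t.
    by rewrite (deriv1_B (smooth_ramp m a) (smooth_ramp m b)) rmorphB/= -mulrA mulrBl.
  move=> /(congr1 cabs); rewrite cabsM cabsN.
  have -> : cabs ((0 : R) +i* (2 * pi)) = 2 * pi.
    rewrite /cabs /sqnormc/= expr0n/= add0r sqrtr_sqr ger0_norm//.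
    by rewrite mulr_ge0// pi_ge0.
  move=> ->.
  have me : @cmeasurable _ _ T (fun t => (eta m t)%:C * H t).
    apply: cmeasurableM => //; apply: cmeasurable_real.
    exact: smooth1_measurable.
  apply: le_trans (le_cabs_cintegral Leb me) _.
  apply: ge0_le_integral => //.
  - by move=> t _; rewrite lee_fin cabs_ge0.
  - exact: emeasurable_cabs.
  - exact/measurable_EFinP.
  - by move=> t _; rewrite lee_fin cabsM cabs_real ler_wpM2r ?cabs_ge0.
have lim : (2 * pi * cabs (cintegral Leb (fun t => (deriv1 (ramp m a) t)%:C * G t)
     - cintegral Leb (fun t => (deriv1 (ramp m b) t)%:C * G t)))%:E @[m --> \oo]
   --> (2 * pi * cabs (G b - G a))%:E.
  apply: cvg_EFin; first exact: nearW.
  rewrite (cabsB (G b)).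
  apply: (@cvgM _ _ \oo _ (fun=> 2 * pi)); first exact: cvg_cst.
  exact: (@cvg_cabsB R _ _ _ _ (cvg_ramp a) (cvg_ramp b)).
by apply: cvge_to_le lim _; exact: nearW.
Qed.

End fundamental.

(** * Propagation of the Wigner distribution *)

Section propagation.
Context {R : realType} {n : nat}.
Local Notation V := 'rV[R]_n.
Local Notation leb := (lebesgue_rV R n).
Local Notation Leb := (@lebesgue_measure R).
Local Notation T := (measurableTypeR R).
Implicit Types (xi x v : V) (t : R).

Lemma plancherel (f : V -> R[i]) : cintegrable leb f -> square_integrable leb f ->
  (\int[leb]_xi (sqnormc (fourier f xi))%:E = \int[leb]_x (sqnormc (f x))%:E)%E.
Proof.
move=> If Lf; have LF := square_integrable_fourier If Lf.
have E (h : V -> R[i]) : cintegral leb (fun x => h x * conjc (h x)) =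
    (\int[leb]_x sqnormc (h x))%:C.
  by under eq_fun do rewrite -sqnormcE; rewrite cintegral_real.
have := parseval If If Lf Lf; rewrite !E => /(@complexI R) h.
rewrite -[LHS]fineK ?ge0_fin_numE ?integral_sqnormc_ge0//; last by case: LF.
rewrite -[RHS]fineK ?ge0_fin_numE ?integral_sqnormc_ge0//; last by case: Lf.
by congr EFin.
Qed.

Definition chirp t xi : R := 2 * pi * (t * dot xi xi).

Lemma measurable_chirp t : measurable_fun setT (fun xi => chirp t xi).
Proof. by do 2!apply: measurable_funM => //; exact: measurable_dot. Qed.

(** The difference [|v + y/2|^2 - |v - y/2|^2] equals [2 v . y]: on the Wigner side a quadratic
    phase becomes a linear one, hence a translation by [2 t v]. *)
Lemma wigner_chirp (g : V -> R[i]) t x v :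
  wigner (fun xi => g xi * expi (chirp t xi)) (fun xi => g xi * expi (chirp t xi)) v (- x) =
  wigner g g v (- (x + (2 * t) *: v)).
Proof.
congr cintegral; apply/funext => y.
rewrite conjcM conjc_expi.
rewrite (_ : _ * expi (chirp t (v + 2^-1 *: y)) * _ * _ = g (v + 2^-1 *: y) *
  conjc (g (v - 2^-1 *: y)) * (expi (chirp t (v + 2^-1 *: y)) *
  expi (- chirp t (v - 2^-1 *: y)) * expi (- (2 * pi * dot (- x) y)))); last by ring.
rewrite -!expiD; congr (_ * expi _); rewrite /chirp.
by rewrite !(dotDl, dotDr, dotNl, dotNr, dotZl, dotZr) (dotC y v); field.
Qed.

Variable u : V * R -> R[i].
Hypothesis mu : @cmeasurable _ _ (V * T)%type u.
Hypothesis Lu : forall t, square_integrable leb (fun x => u (x, t)).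
Hypothesis cu : forall t0, (\int[leb]_x
  (sqnormc (u (x, t) - u (x, t0)))%:E)%E @[t --> t0] --> 0%E.
Hypothesis weak : forall phi, test_function phi ->
  cintegral (leb \x Leb)%E
    (fun z => u z * (laplacian phi z +i* (2 * pi * dt phi z))) = 0.

Let fcut k t x : R[i] := u (x, t) * (box_cut k x)%:C.

Let I_fcut k t : cintegrable leb (fcut k t).
Proof. by apply: L2_cintegrableM => //; exact: L2_box_cut. Qed.

Let sqnormc_cut_le k t x : sqnormc (fcut k t x) <= sqnormc (u (x, t)).
Proof.
rewrite sqnormcM sqnormc_real -[leRHS]mulr1 ler_wpM2l ?sqnormc_ge0//.
rewrite -real_normK ?num_real// -[leRHS](expr1n _ 2) ler_pXn2r ?nnegrE//.
exact: box_cut_norm_le1.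
Qed.

Let L_fcut k t : square_integrable leb (fcut k t).
Proof.
apply: (L2_le (r := fun x => sqnormc (u (x, t)))).
- exact: (I_fcut k t).1.
- by apply: measurable_sqnormc; exact: (Lu t).1.
- exact: sqnormc_cut_le.
- exact: (Lu t).2.
Qed.

Let cut_energy_le k t : (\int[leb]_x (sqnormc (fcut k t x))%:E <=
  \int[leb]_x (sqnormc (u (x, t)))%:E)%E.
Proof.
apply: ge0_le_integral => //.
- by move=> x _; rewrite lee_fin sqnormc_ge0.
- by apply: emeasurable_sqnormc; exact: (L_fcut k t).1.
- by apply: emeasurable_sqnormc; exact: (Lu t).1.
- by move=> x _; rewrite lee_fin.
Qed.

Let cvg_fcut t : sqdist leb (fcut k t) (fun x => u (x, t)) @[k --> \oo] --> 0%E.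
Proof.
apply: (cvg_sqdist (r := fun x => 4 * sqnormc (u (x, t)))).
- by move=> k; exact: (L_fcut k t).1.
- exact: (Lu t).1.
- apply: aeW => x; apply: cvg_near_cst; apply: filterS (box_cut_near1 x) => k.
  by rewrite /fcut => ->; rewrite mulr1 subrr cabs0.
- by apply: measurable_funM => //; apply: measurable_sqnormc; exact: (Lu t).1.
- move=> k x; apply: le_trans (sqnormcB_le _ _) _.
  by have := sqnormc_cut_le k t x; lra.
- under eq_integral do rewrite EFinM.
  rewrite ge0_integralZl//.
  + by rewrite lte_mul_pinfty//; exact: (Lu t).2.
  + by apply: emeasurable_sqnormc; exact: (Lu t).1.
  + by move=> x _; rewrite lee_fin sqnormc_ge0.
Qed.

Lemma wave_coefE xi (e : V -> R[i]) t : square_integrable leb e ->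
  wave_coef u xi e t = expi (- chirp t xi) * fourier (fun x => u (x, t) * e x) xi.
Proof.
move=> Le; rewrite /wave_coef /fourier -cintegralZl.
  congr cintegral; apply/funext => x.
  rewrite (_ : expi (- chirp t xi) * _ = u (x, t) * (e x *
    (expi (- chirp t xi) * expi (- (2 * pi * dot x xi))))); last by ring.
  by rewrite -expiD /chirp /wphase/=; congr (_ * (_ * expi _)); ring.
by apply: cintegrable_fourier; exact: L2_cintegrableM.
Qed.

(** The transform of the truncated solution with the free evolution undone. The aim is that its
    dependence on [t] disappears in L2 as [k] grows. *)
Let S k t xi := wave_coef u xi (fun x => (box_cut k x)%:C) t.

Let SE k t xi : S k t xi = expi (- chirp t xi) * fourier (fcut k t) xi.
Proof. exact: wave_coefE (L2_box_cut k). Qed.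

Let mS k t : cmeasurable (S k t).
Proof.
rewrite (_ : S k t = fun xi => expi (- chirp t xi) * fourier (fcut k t) xi).
  apply: cmeasurableM; last by apply: cmeasurable_fourier; exact: (L_fcut k t).1.
  by apply: cmeasurable_expi; apply: measurable_funN; exact: measurable_chirp.
by apply/funext => xi; exact: SE.
Qed.

Let sqnormcB_S k m t xi :
  sqnormc (S k t xi - S m t xi) = sqnormc (fourier (fun x => fcut k t x - fcut m t x) xi).
Proof.
rewrite !SE -mulrBr sqnormcM sqnormc_expi mul1r; congr sqnormc.
rewrite /fourier -cintegralB; [|exact: cintegrable_fourier..].
by congr cintegral; apply/funext => x; rewrite mulrBl.
Qed.

Let sqdist_S k m t : (sqdist leb (S k t) (S m t) <=
  2%:E * sqdist leb (fcut k t) (fun x => u (x, t)) +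
  2%:E * sqdist leb (fcut m t) (fun x => u (x, t)))%E.
Proof.
rewrite /sqdist; under eq_integral do rewrite sqnormcB_S.
apply: le_trans (plancherel_le _) _; first exact: cintegrableB.
rewrite [X in (_ <= _ + 2%:E * X)%E]sqdistC.
apply: sqdist_triangle; [exact: (L_fcut k t).1|exact: (Lu t).1|exact: (L_fcut m t).1].
Qed.

Lemma cmeasurable_drift_coef k :
  @cmeasurable _ _ (V * T)%type (fun z => wave_coef u z.1 (drift k z.1) z.2).
Proof.
pose D (z : (V * T) * V) := drift k z.1.1 z.2.
have m1 : measurable_fun setT (fun z : (V * T) * V => z.1.1).
  exact: (measurableT_comp measurable_fst measurable_fst).
have m12 : measurable_fun setT (fun z : (V * T) * V => z.1.2).
  exact: (measurableT_comp measurable_snd measurable_fst).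
apply: (cmeasurable_cintegral2 leb (f := fun z : (V * T) * V =>
  u (z.2, z.1.2) * (D z * expi (- wphase z.1.1 (z.2, z.1.2))))).
apply: cmeasurableM; last apply: cmeasurableM.
- apply: (cmeasurable_comp (f := u : V * T -> R[i]) (h := fun z : (V * T) * V => (z.2, z.1.2))) => //.
  exact: measurable_fun_pair.
- split.
    apply: measurable_sum => i; apply: (measurableT_comp (measurable_ddbox_cut k i)).
    exact: measurable_snd.
  apply: measurable_funN; apply: measurable_funM => //; apply: measurable_sum => i.
  apply: measurable_funM; first exact: measurable_coord.
  by apply: (measurableT_comp (measurable_dbox_cut k i)).
- apply: cmeasurable_expi; apply: measurable_funN; rewrite /wphase/=.
  apply: measurable_funM => //; apply: measurable_funD; first exact: measurable_dot.
  by apply: measurable_funM => //; exact: measurable_dot.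
Qed.

Let box_energy (p : V -> R) (C : R) t : measurable_fun setT p ->
  square_integrable leb (fun x => (p x)%:C) -> (forall x, `|p x| <= C) ->
  (\int[leb]_xi (sqnormc (fourier (fun x => u (x, t) * (p x)%:C) xi))%:E <=
   (C ^+ 2)%:E * \int[leb]_x (sqnormc (u (x, t)))%:E)%E.
Proof.
move=> mp Lp pC; apply: le_trans (plancherel_le _) _.
  exact: L2_cintegrableM.
rewrite -ge0_integralZl//; last 3 first.
- by apply: emeasurable_sqnormc; exact: (Lu t).1.
- by move=> x _; rewrite lee_fin sqnormc_ge0.
- by rewrite lee_fin sqr_ge0.
apply: ge0_le_integral => //.
- by move=> x _; rewrite lee_fin sqnormc_ge0.
- by apply: emeasurable_sqnormc; apply: cmeasurableM; [exact: (Lu t).1|exact: Lp.1].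
- by apply: emeasurable_funM => //; apply: emeasurable_sqnormc; exact: (Lu t).1.
- move=> x _; rewrite -EFinM lee_fin sqnormcM sqnormc_real mulrC ler_wpM2r ?sqnormc_ge0//.
  have C0 : 0 <= C := le_trans (normr_ge0 _) (pC x).
  by rewrite -real_normK ?num_real// ler_pXn2r ?nnegrE.
Qed.

(** Each component of the commutator is a transform of [u] times a derivative of the cut-off, of
    size [1 / (k + 1)], so Plancherel bounds its energy. The factor [xi] in front of the first
    derivatives is bounded only on the cube, hence the restriction. *)
Lemma drift_energy (K : nat) : exists D, 0 <= D /\ forall k t,
  (\int[leb]_xi ((sqnormc (wave_coef u xi (drift k xi) t))%:E * (\1_(cube K%:R) xi)%:E) <=
   (D * k.+1%:R^-1)%:E * \int[leb]_x (sqnormc (u (x, t)))%:E)%E.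
Proof.
have [C [C0 hC]] := @dbox_cut_bound R n.
(* The largest value on the cube of the squared modulus of the coefficient [- 4 pi i xi_i]. *)
pose c : R := (4 * pi * K%:R) ^+ 2.
have c0 : 0 <= c by exact: sqr_ge0.
(* The factor [2 ^ n] comes from squaring a sum of [n] terms, [n] counts these terms, the 2 splits
   each into its two parts, and [1 + c] adds their weights. *)
pose D : R := 2 ^+ n * (n%:R * (2 * (1 + c) * C ^+ 2)).
have D0 : 0 <= D by rewrite !mulr_ge0 ?exprn_ge0 ?addr_ge0 ?sqr_ge0.
exists D; split => // k t.
pose A i xi := fourier (fun x => u (x, t) * (ddbox_cut k i x)%:C) xi.
pose B i xi := fourier (fun x => u (x, t) * (dbox_cut k i x)%:C) xi.
have LA i := L2_ddbox_cut k i : square_integrable leb _.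
have LB i := L2_dbox_cut k i : square_integrable leb _.
have IA i : cintegrable leb (fun x => u (x, t) * (ddbox_cut k i x)%:C).
  exact: L2_cintegrableM.
have IB i : cintegrable leb (fun x => u (x, t) * (dbox_cut k i x)%:C).
  exact: L2_cintegrableM.
have mA i : cmeasurable (A i) by apply: cmeasurable_fourier; exact: (IA i).1.
have mB i : cmeasurable (B i) by apply: cmeasurable_fourier; exact: (IB i).1.
have HE xi : wave_coef u xi (drift k xi) t = expi (- chirp t xi) *
    \sum_(i < n) (A i xi + (0 +i* (- (4 * pi * xi 0 i))) * B i xi).
  rewrite wave_coefE; last exact: L2_drift.
  congr (_ * _); rewrite /fourier.
  rewrite (_ : (fun x => _) = fun x => \sum_(i < n)
    (u (x, t) * (ddbox_cut k i x)%:C * expi (- (2 * pi * dot x xi)) +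
     (0 +i* (- (4 * pi * xi 0 i))) *
     (u (x, t) * (dbox_cut k i x)%:C * expi (- (2 * pi * dot x xi))))).
    rewrite cintegral_sum; last first.
      by move=> i; apply: cintegrableD; [|apply: cintegrableZl]; exact: cintegrable_fourier.
    apply: eq_bigr => i _; rewrite cintegralD; last 2 first.
    - exact: cintegrable_fourier.
    - by apply: cintegrableZl; exact: cintegrable_fourier.
    by rewrite cintegralZl//; exact: cintegrable_fourier.
  apply/funext => x.
  have -> : drift k xi x = \sum_(i < n) ((ddbox_cut k i x)%:C +
      (0 +i* (- (4 * pi * xi 0 i))) * (dbox_cut k i x)%:C).
    rewrite big_split /= -rmorph_sum /=.
    have -> : \sum_(i < n) (0 +i* (- (4 * pi * xi 0 i))) * (dbox_cut k i x)%:C =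
        (0 +i* (- (4 * pi))) * (\sum_(i < n) xi 0 i * dbox_cut k i x)%:C :> R[i].
      rewrite rmorph_sum mulr_sumr; apply: eq_bigr => i _.
      by apply/eqP; rewrite eq_complex /=; apply/andP; split; apply/eqP; ring.
    by apply/eqP; rewrite eq_complex /=; apply/andP; split; apply/eqP; ring.
  rewrite mulr_sumr mulr_suml; apply: eq_bigr => i _; ring.
set E := (\int[leb]_x (sqnormc (u (x, t)))%:E)%E.
have EA i : (\int[leb]_xi (sqnormc (A i xi))%:E <= ((C * k.+1%:R^-1) ^+ 2)%:E * E)%E.
  by apply: box_energy => //; [exact: measurable_ddbox_cut|move=> x; have [] := hC k i x].
have EB i : (\int[leb]_xi (sqnormc (B i xi))%:E <= ((C * k.+1%:R^-1) ^+ 2)%:E * E)%E.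
  by apply: box_energy => //; [exact: measurable_dbox_cut|move=> x; have [] := hC k i x].
have E0 : (0 <= E)%E by exact: integral_sqnormc_ge0.
clearbody A B E.
have mcB i : measurable_fun setT (fun xi => (c%:E * (sqnormc (B i xi))%:E)%E).
  by apply: emeasurable_funM; [exact: measurable_cst|exact: emeasurable_sqnormc (mB i)].
have mAB i : measurable_fun setT
    (fun xi => ((sqnormc (A i xi))%:E + c%:E * (sqnormc (B i xi))%:E)%E).
  by apply: emeasurable_funD; [exact: emeasurable_sqnormc (mA i)|exact: mcB].
have mcAB i : measurable_fun setT (fun xi => ((2 ^+ n * 2)%:E *
    ((sqnormc (A i xi))%:E + c%:E * (sqnormc (B i xi))%:E))%E).
  by apply: emeasurable_funM; [exact: measurable_cst|exact: mAB].
have sA i xi : (0 <= (sqnormc (A i xi))%:E)%E by rewrite lee_fin sqnormc_ge0.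
have sB i xi : (0 <= (sqnormc (B i xi))%:E)%E by rewrite lee_fin sqnormc_ge0.
have sAB i xi : (0 <= (sqnormc (A i xi))%:E + c%:E * (sqnormc (B i xi))%:E)%E.
  by rewrite adde_ge0// mule_ge0// lee_fin.
have q0 : (0 <= (2 ^+ n * 2 : R)%:E)%E by rewrite lee_fin mulr_ge0 ?exprn_ge0.
apply: (@le_trans _ _ (\int[leb]_xi (\sum_(i < n) (2 ^+ n * 2)%:E *
   ((sqnormc (A i xi))%:E + c%:E * (sqnormc (B i xi))%:E)))%E).
  apply: ge0_le_integral => //.
  - by move=> xi _; rewrite mule_ge0// lee_fin sqnormc_ge0.
  - apply: emeasurable_funM; last first.
      by apply/measurable_EFinP; exact: measurable_indic (measurable_cube _).
    apply: emeasurable_sqnormc.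
    apply: (cmeasurable_comp (f := fun z : V * T => wave_coef u z.1 (drift k z.1) z.2)
      (h := fun xi => (xi, t : T))) => //.
    exact: cmeasurable_drift_coef.
  - by apply: emeasurable_sum => i; exact: mcAB.
  - move=> xi _; rewrite indicE; case: (boolP (xi \in cube K%:R)) => [|_]; last first.
      by rewrite mule0; apply: sume_ge0 => i _; apply: mule_ge0 => //; exact: sAB.
    move=> /set_mem xiK; rewrite mule1.
    rewrite (_ : (\sum_(i < n) _)%R = (\sum_(i < n) (2 ^+ n * 2 *
        (sqnormc (A i xi) + c * sqnormc (B i xi))))%:E); last first.
      by rewrite -sumEFin; apply: eq_bigr => i _; rewrite [RHS]EFinM (EFinD (sqnormc (A i xi))) (EFinM c).
    rewrite lee_fin HE sqnormcM sqnormc_expi mul1r.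
    apply: le_trans (sqnormc_sum_le _ _) _.
    rewrite -[index_enum _]enumT size_enum_ord mulr_sumr; apply: ler_sum => i _.
    rewrite -[leRHS]mulrA ler_pM2l ?exprn_gt0//; apply: le_trans (sqnormcD_le _ _) _.
    rewrite ler_pM2l// lerD2l sqnormcM ler_wpM2r ?sqnormc_ge0//.
    rewrite /sqnormc /= expr0n/= add0r sqrrN /c -[leLHS]real_normK ?num_real//.
    have p0 : 0 <= 4 * pi :> R by rewrite mulr_ge0// pi_ge0.
    rewrite ler_pXn2r ?nnegrE ?(mulr_ge0, pi_ge0)//.
    by rewrite normrM ger0_norm// ler_wpM2l.
rewrite ge0_integral_sum; last 3 first.
- by [].
- exact: mcAB.
- by move=> i xi _; apply: mule_ge0 => //; exact: sAB.
have k0 : 0 <= k.+1%:R^-1 :> R by rewrite invr_ge0.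
have k1 : k.+1%:R^-1 <= 1 :> R by rewrite invf_le1 ?ltr0n// ler1n.
apply: (@le_trans _ _ (\sum_(i < n) (2 ^+ n * 2 * ((1 + c) * (C * k.+1%:R^-1) ^+ 2))%:E * E)%E).
  apply: lee_sum => i _; rewrite ge0_integralZl; last 4 first.
  - by [].
  - exact: mAB.
  - by move=> xi _; exact: sAB.
  - exact: q0.
  rewrite (EFinM (2 ^+ n * 2)) -[leRHS]muleA lee_wpmul2l//.
  rewrite ge0_integralD; last 5 first.
  - by [].
  - by move=> xi _; exact: sA.
  - exact: emeasurable_sqnormc (mA i).
  - by move=> xi _; apply: mule_ge0; [rewrite lee_fin|exact: sB].
  - exact: mcB.
  rewrite ge0_integralZl; last 4 first.
  - by [].
  - exact: emeasurable_sqnormc (mB i).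
  - by move=> xi _; exact: sB.
  - by rewrite lee_fin.
  have := sqr_ge0 (C * k.+1%:R^-1); move: EA EB; set q := (C * _) ^+ 2 => EA EB qq.
  rewrite mulrDl mul1r (EFinD q) ge0_muleDl; last 2 first.
  - by rewrite lee_fin.
  - by rewrite lee_fin mulr_ge0.
  rewrite (EFinM c) -muleA.
  by apply: leeD; [exact: EA|apply: lee_wpmul2l => //; exact: EB].
rewrite -ge0_sume_distrl; last first.
  by move=> i _; rewrite lee_fin !mulr_ge0 ?exprn_ge0 ?addr_ge0 ?sqr_ge0.
rewrite lee_wpmul2r// sumEFin lee_fin sumr_const card_ord -[leLHS]mulr_natl.
rewrite (_ : D * _ = n%:R * (2 ^+ n * 2 * ((1 + c) * (C ^+ 2 * k.+1%:R^-1)))); last first.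
  by rewrite /D; ring.
rewrite ler_wpM2l// ler_wpM2l ?mulr_ge0 ?exprn_ge0// ler_wpM2l ?addr_ge0//.
by rewrite exprMn ler_wpM2l ?sqr_ge0// expr2 -[leRHS]mulr1 ler_wpM2l.
Qed.

Let subrACA (p q r s : R[i]) : p - q - (r - s) = p - r - (q - s).
Proof. by ring. Qed.

Section increment.
Variables (a b : R).
Hypothesis ab : a < b.

Local Notation I := (`[a, (b + 1)%R]%classic).
Let L : R := b + 1 - a.
Let L0 : 0 < L. Proof. by rewrite /L subr_gt0 (lt_trans ab)// ltrDl. Qed.

Let integral_I : (\int[Leb]_t ((\1_I t : R)%:E) = L%:E)%E.
Proof.
rewrite integral_indic// setIT.
have := @lebesgue_measure_itv R `[a, b + 1]%R; rewrite /= lte_fin.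
by rewrite -EFinB ifT// (lt_trans ab)// ltrDl.
Qed.

Let Y k xi := (\int[Leb]_t (\1_I t * sqnormc (wave_coef u xi (drift k xi) t))%:E)%E.

Let mdrift k xi : @cmeasurable _ _ T (fun t => wave_coef u xi (drift k xi) t).
Proof. by apply: cmeasurable_wave_coef => //; have [] := @L2_drift R n k xi. Qed.

(** Cauchy-Schwarz in time on an interval of length [L], applied to the bound of [wave_coef_diff].
    The indicator is inserted twice, so that both factors are supported in the interval. *)
Let increment_le k xi :
  (((2 * pi * cabs (S k b xi - S k a xi)) ^+ 2)%:E <= L%:E * Y k xi)%E.
Proof.
apply: le_sqr_of_AMGM => //.
- by rewrite !mulr_ge0 ?pi_ge0 ?cabs_ge0.
- by apply: integral_ge0 => t _; rewrite lee_fin mulr_ge0 ?sqnormc_ge0.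
move=> l l0; have := @wave_coef_diff R n u mu Lu cu k xi weak a b ab.
move=> /le_trans; apply.
have mI : @cmeasurable _ _ T (fun t => ((\1_I t : R))%:C) by exact: cmeasurable_real.
have mIH : @cmeasurable _ _ T (fun t => (\1_I t)%:C * wave_coef u xi (drift k xi) t).
  exact: cmeasurableM.
have II (t : T) : (\1_I t : R) * \1_I t = \1_I t.
  by rewrite indicE; case: (_ \in _); rewrite ?mulr1 ?mulr0.
have := integral_cabsM_le Leb l0 mI mIH.
under eq_integral do rewrite mulrA -rmorphM/= II cabsM cabs_real ger0_norm//.
under [X in (_ <= _ * X + _)%E -> _]eq_integral do rewrite sqnormc_real expr2 II.
under [X in (_ <= _ + _ * X)%E -> _]eq_integral do rewrite sqnormcM sqnormc_real expr2 II.
by rewrite integral_I.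
Qed.

(** Tonelli puts the [xi]-integral inside, where [drift_energy] applies at each fixed time; the
    energy is bounded over the bounded time interval. *)
Let integral_Y (K : nat) : exists D : R, 0 <= D /\ forall k,
  (\int[leb]_xi (Y k xi * (\1_(cube K%:R) xi)%:E) <= (D * k.+1%:R^-1)%:E)%E.
Proof.
have [M [M0 hM]] := energy_bounded Lu cu (`|a| + `|b| + 1).
have [D [D0 hD]] := drift_energy K.
exists (L * (D * M)); split; first by rewrite !mulr_ge0// ltW.
move=> k.
have mcube : measurable_fun setT (fun xi : V => (\1_(cube K%:R) xi : R)).
  exact: measurable_indic (measurable_cube _).
pose F (z : V * T) : \bar R := (\1_I z.2 * (sqnormc (wave_coef u z.1 (drift k z.1) z.2)
   * \1_(cube K%:R) z.1))%:E.
have F0 z : (0 <= F z)%E by rewrite lee_fin !mulr_ge0 ?sqnormc_ge0.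
have mF : measurable_fun setT F.
  apply/measurable_EFinP; apply: measurable_funM.
    by apply: (measurableT_comp (f := \1_I : T -> R)).
  apply: measurable_funM; last exact: (measurableT_comp mcube measurable_fst).
  by apply: measurable_sqnormc; exact: cmeasurable_drift_coef.
have -> : (\int[leb]_xi (Y k xi * (\1_(cube K%:R) xi)%:E) =
    \int[leb]_xi \int[Leb]_t F (xi, t))%E.
  apply: eq_integral => xi _; rewrite -ge0_integralZr//.
  - by apply: eq_integral => t _; rewrite /F /= -EFinM mulrA.
  - apply/measurable_EFinP; apply: measurable_funM => //.
    exact: measurable_sqnormc.
  - by move=> t _; rewrite lee_fin mulr_ge0 ?sqnormc_ge0.
have FT := fubini_tonelli (m1 := leb) (m2 := Leb) F mF F0.
rewrite FT; apply: (@le_trans _ _ (\int[Leb]_t ((D * k.+1%:R^-1 * M)%:E * (\1_I t : R)%:E))%E).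
  apply: ge0_le_integral => //.
  - by move=> t _; apply: integral_ge0.
  - exact: (measurable_fun_fubini_tonelli_G F mF F0).
  - by apply: emeasurable_funM => //; apply/measurable_EFinP.
  move=> t _; rewrite /F /= indicE; have [/set_mem tI|_] := boolP (t \in I); last first.
    by under eq_integral do rewrite mul0r; rewrite integral0 mule0.
  rewrite mule1; under eq_integral do rewrite mul1r EFinM.
  apply: le_trans (hD k t) _; rewrite (EFinM (D * k.+1%:R^-1) M) lee_wpmul2l//.
    by rewrite lee_fin mulr_ge0// invr_ge0.
  apply: hM; move: tI; rewrite /= in_itv/= => /andP[t1 t2].
  have na := ler_norm (- a); have nb := ler_norm b; rewrite normrN in na.
  have a0 := normr_ge0 a; have b0 := normr_ge0 b.
  by rewrite ler_norml; apply/andP; split; lra.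
rewrite ge0_integralZl//; last 2 first.
- by apply/measurable_EFinP.
- by rewrite lee_fin !mulr_ge0// invr_ge0.
by rewrite integral_I -EFinM lee_fin le_eqVlt; apply/orP; left; apply/eqP; ring.
Qed.

Let local_increment (K : nat) :
  (\int[leb]_xi ((sqnormc (S k b xi - S k a xi))%:E * (\1_(cube K%:R) xi)%:E))%E
    @[k --> \oo] --> 0%E.
Proof.
have [D [D0 hD]] := integral_Y K.
have p0 : 0 < (2 * pi) ^+ 2 :> R by rewrite exprn_gt0// mulr_gt0// pi_gt0.
pose q : R := ((2 * pi) ^+ 2)^-1 * L.
have q0 : 0 <= q by rewrite mulr_ge0 ?invr_ge0 ?(ltW L0)// ltW.
have mcube : measurable_fun setT (fun xi : V => (\1_(cube K%:R) xi : R)).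
  exact: measurable_indic (measurable_cube _).
have mY k : measurable_fun setT (Y k).
  apply: (measurable_fun_fubini_tonelli_F (m2 := Leb) (fun z : V * T =>
     (\1_I z.2 * sqnormc (wave_coef u z.1 (drift k z.1) z.2))%:E)).
    apply/measurable_EFinP; apply: measurable_funM.
      by apply: (measurableT_comp (f := \1_I : T -> R)).
    by apply: measurable_sqnormc; exact: cmeasurable_drift_coef.
  by move=> z; rewrite lee_fin mulr_ge0 ?sqnormc_ge0.
have Y0 k xi : (0 <= Y k xi)%E.
  by apply: integral_ge0 => t _; rewrite lee_fin mulr_ge0 ?sqnormc_ge0.
apply: (cvge0_le (r := fun k => (q * D * k.+1%:R^-1)%:E)) => [k|]; last first.
  apply: cvg_EFin; first exact: nearW.
  have h : q * D * k.+1%:R^-1 @[k --> \oo] --> q * D * 0.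
    by apply: cvgM; [exact: cvg_cst|exact: cvg_harmonic].
  by rewrite mulr0 in h.
apply/andP; split.
  by apply: integral_ge0 => xi _; rewrite mule_ge0// lee_fin sqnormc_ge0.
apply: (@le_trans _ _ (\int[leb]_xi (q%:E * (Y k xi * (\1_(cube K%:R) xi)%:E)))%E).
  apply: ge0_le_integral => //.
  - by move=> xi _; rewrite mule_ge0// lee_fin sqnormc_ge0.
  - apply: emeasurable_funM; last by apply/measurable_EFinP.
    by apply: emeasurable_sqnormc; exact: cmeasurableB.
  - apply: emeasurable_funM => //; apply: emeasurable_funM => //.
    by apply/measurable_EFinP.
  - move=> xi _; rewrite muleA lee_wpmul2r ?lee_fin//.
    have := increment_le k xi; rewrite exprMn sqr_cabs => h.
    rewrite -(@lee_pmul2l _ ((2 * pi) ^+ 2)%:E) ?lte_fin//.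
    rewrite -EFinM; apply: le_trans h _.
    by rewrite muleA -EFinM /q mulrA mulfV ?gt_eqF// mul1r.
rewrite ge0_integralZl//; last 2 first.
- by apply: emeasurable_funM => //; apply/measurable_EFinP.
- by move=> xi _; rewrite mule_ge0// lee_fin.
by rewrite -mulrA (EFinM q) lee_wpmul2l ?lee_fin.
Qed.

(** The commutator estimate gives convergence on every frequency cube only. Plancherel compares the
    increments at levels [k] and [m] by the truncation errors at the two times, and [tight_cvg]
    upgrades this to the whole space. *)
Lemma cvg_increment : sqdist leb (S k b) (S k a) @[k --> \oo] --> 0%E.
Proof.
pose h t k := sqdist leb (fcut k t) (fun x => u (x, t)).
have h0 t k : (0 <= h t k)%E by exact: sqdist_ge0.
apply: (tight_cvg (f_ := fun k xi => S k b xi - S k a xi)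
  (g_ := fun k => (4%:E * h a k + 4%:E * h b k)%E)) => //.
- by move=> k; exact: cmeasurableB.
- move=> k m.
  have -> : sqdist leb (fun xi => S k b xi - S k a xi) (fun xi => S m b xi - S m a xi) =
    sqdist leb (fun xi => S k b xi - S m b xi) (fun xi => S k a xi - S m a xi).
    by apply: eq_integral => xi _; rewrite subrACA.
  apply: (@le_trans _ _ (2%:E * sqdist leb (S k b) (S m b) + 2%:E * sqdist leb (S k a) (S m a))%E).
    apply: le_trans (sqdist_triangle leb (g := fun=> 0) _ _ _) _; try exact: cmeasurableB.
      exact: cmeasurable_cst.
    apply: leeD; rewrite lee_wpmul2l// /sqdist.
      by under eq_integral do rewrite subr0.
    by under eq_integral do rewrite sub0r sqnormcN.
  have E (p q r s : \bar R) : (0 <= p -> 0 <= q -> 0 <= r -> 0 <= s ->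
      2%:E * (2%:E * p + 2%:E * q) + 2%:E * (2%:E * r + 2%:E * s) =
      4%:E * r + 4%:E * p + (4%:E * s + 4%:E * q))%E.
    move=> p0 q0 r0 s0; rewrite !ge0_muleDr ?mule_ge0// !muleA -!EFinM.
    have -> : 2 * 2 = 4 :> R by ring.
    by rewrite addeC addeACA.
  rewrite -E//; apply: leeD; rewrite lee_wpmul2l//; exact: sqdist_S.
- by move=> k; rewrite adde_ge0// mule_ge0.
- exact: (@cvge0D _ _ _ (@cvge0Zl _ 4 _ (cvg_fcut a)) (@cvge0Zl _ 4 _ (cvg_fcut b))).
Qed.

End increment.

Let cvg_S t t' : sqdist leb (S k t) (S k t') @[k --> \oo] --> 0%E.
Proof.
have [tt|tt|->] := ltgtP t t'; last first.
- by under eq_fun do rewrite sqdistxx; exact: cvg_cst.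
- exact: cvg_increment.
- by under eq_fun do rewrite sqdistC; exact: cvg_increment.
Qed.

Let sqnormc_S k t xi : sqnormc (S k t xi) = sqnormc (fourier (fcut k t) xi).
Proof. by rewrite SE sqnormcM sqnormc_expi mul1r. Qed.

Let energy_S k t : (\int[leb]_xi (sqnormc (S k t xi))%:E =
  \int[leb]_x (sqnormc (fcut k t x))%:E)%E.
Proof. by under eq_integral do rewrite sqnormc_S; exact: plancherel. Qed.

(** A bound uniform in time replaces exact conservation: passing from [u (_, t)] to its truncation,
    and from [S k t] to [S k 0], costs a factor 2 each. The error terms vanish in the limit. *)
Lemma energy_le t : (\int[leb]_x (sqnormc (u (x, t)))%:E <=
  4%:E * \int[leb]_x (sqnormc (u (x, 0)))%:E)%E.
Proof.
set E0 := (\int[leb]_x (sqnormc (u (x, 0)))%:E)%E.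
have E00 : (0 <= E0)%E by exact: integral_sqnormc_ge0.
have fE : E0 \is a fin_num by rewrite ge0_fin_numE//; case: (Lu 0).
have splitD (f g : V -> R[i]) : cmeasurable f -> cmeasurable g ->
    (\int[leb]_x (sqnormc (f x))%:E <=
     2%:E * sqdist leb f g + 2%:E * \int[leb]_x (sqnormc (g x))%:E)%E.
  move=> mf mg; have := le_integral_sqnormcD leb (cmeasurableB mf mg) mg.
  by under eq_integral do rewrite subrK.
have key k : (\int[leb]_x (sqnormc (u (x, t)))%:E <=
    2%:E * sqdist leb (fcut k t) (fun x => u (x, t)) +
    4%:E * sqdist leb (S k t) (S k 0) + 4%:E * E0)%E.
  apply: le_trans (splitD _ (fcut k t) (Lu t).1 (L_fcut k t).1) _.
  rewrite sqdistC -addeA leeD2l// -energy_S.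
  apply: (@le_trans _ _ (2%:E * (2%:E * sqdist leb (S k t) (S k 0) + 2%:E * E0))%E).
    rewrite lee_wpmul2l//; apply: le_trans (splitD _ (S k 0) (mS k t) (mS k 0)) _.
    by rewrite leeD2l// lee_wpmul2l// energy_S; exact: cut_energy_le.
  rewrite ge0_muleDr ?mule_ge0 ?sqdist_ge0// !muleA -!EFinM.
  by have -> : 2 * 2 = 4 :> R by ring.
have lim : (2%:E * sqdist leb (fcut k t) (fun x => u (x, t)) +
    4%:E * sqdist leb (S k t) (S k 0))%E @[k --> \oo] --> 0%E.
  exact: (@cvge0D _ _ _ (@cvge0Zl _ 2 _ (cvg_fcut t)) (@cvge0Zl _ 4 _ (cvg_S t 0))).
have fE4 : (4%:E * E0)%E \is a fin_num by rewrite fin_numM.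
apply/lee_addgt0Pr => e e0.
have : \forall k \near \oo, (2%:E * sqdist leb (fcut k t) (fun x => u (x, t)) +
    4%:E * sqdist leb (S k t) (S k 0) <= e%:E)%E.
  apply: (cvge0P _).2 => // k.
  by rewrite adde_ge0// mule_ge0// sqdist_ge0.
move=> /filter_ex[k hk]; apply: le_trans (key k) _.
by rewrite addeC leeD2l.
Qed.

(** For truncated data both Wigner distributions are rewritten on the frequency side, where the
    shift by [2 t v] is the effect of the chirp. The transforms at times [t] and 0 then differ, up
    to the chirp, by an L2 error tending to 0. *)
Lemma wigner_propagation t x v :
  wigner (fun y => u (y, t)) (fun y => u (y, t)) x v =
  wigner (fun y => u (y, 0)) (fun y => u (y, 0)) (x + (2 * t) *: v) v.
Proof.
pose Wt k := wigner (fcut k t) (fcut k t) x v.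
pose W0 k := wigner (fcut k 0) (fcut k 0) (x + (2 * t) *: v) v.
have c1 : cabs (Wt k - wigner (fun y => u (y, t)) (fun y => u (y, t)) x v) @[k --> \oo] --> (0 : R).
  by apply: cvg_wigner => //; exact: cvg_fcut.
have c2 : cabs (W0 k - wigner (fun y => u (y, 0)) (fun y => u (y, 0)) (x + (2 * t) *: v) v)
    @[k --> \oo] --> (0 : R).
  by apply: cvg_wigner => //; exact: cvg_fcut.
pose P k xi := fourier (fcut k 0) xi * expi (chirp t xi).
have LF k s : square_integrable leb (fourier (fcut k s)) by exact: square_integrable_fourier.
have LP k : square_integrable leb (P k) by apply: L2_phase => //; exact: measurable_chirp.
have sP k xi : sqnormc (P k xi) = sqnormc (fourier (fcut k 0) xi).
  by rewrite sqnormcM sqnormc_expi mulr1.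
(* No limit of the transforms is available, so two moving sequences are compared; their distance is
   that of [S k t] and [S k 0], because the chirp has modulus 1. *)
have c3 : cabs (wigner (fourier (fcut k t)) (fourier (fcut k t)) v (- x) -
    wigner (P k) (P k) v (- x)) @[k --> \oo] --> (0 : R).
  apply: (cvg_wigner2 (M := fine (\int[leb]_x (sqnormc (u (x, 0)))%:E)%E)) => //.
    move=> k; under eq_integral do rewrite sP.
    rewrite fineK; last first.
      by rewrite ge0_fin_numE ?integral_sqnormc_ge0//; exact: (Lu 0).2.
    by rewrite plancherel//; exact: cut_energy_le.
  have E k : sqdist leb (fourier (fcut k t)) (P k) = sqdist leb (S k t) (S k 0).
    apply: eq_integral => xi _; congr (_%:E).
    rewrite -[LHS]mul1r -(sqnormc_expi (- chirp t xi)) -sqnormcM mulrBr -SE /P.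
    rewrite mulrCA -expiD addNr expi0 mulr1 (SE k 0).
    have -> : chirp 0 xi = 0 by rewrite /chirp mul0r mulr0.
    by rewrite oppr0 expi0 mul1r.
  by under eq_fun do rewrite E; exact: cvg_S.
have WtE k : Wt k = wigner (fourier (fcut k t)) (fourier (fcut k t)) v (- x).
  exact: wigner_fourier.
have W0E k : W0 k = wigner (P k) (P k) v (- x).
  by rewrite /W0 wigner_fourier// -wigner_chirp.
have c3' : cabs (Wt k - W0 k) @[k --> \oo] --> (0 : R).
  by under eq_fun do rewrite WtE W0E.
have := @cvg_cabsB R _ _ _ _ c1 c2.
move=> c4; have := cvg_unique _ c3' c4; move=> /(_ _ _)/esym h.
by apply/eqP; rewrite -subr_eq0; apply/eqP/cabs_eq0; apply: h.
Qed.

End propagation.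

(** * Pairing a weight with the density of a solution *)

Section regularization.
Context {R : realType} {n : nat}.
Local Notation V := 'rV[R]_n.
Local Notation leb := (lebesgue_rV R n).
Implicit Types (x v z : V).

Variables (f : V -> R[i]) (h : V -> R) (H : R).
Hypothesis Lf : square_integrable leb f.
Hypothesis mh : measurable_fun setT h.
Hypothesis hH : forall x, `|h x| <= H.
Hypothesis Ih : cintegrable leb (fun x => (h x)%:C).

Let M := fine (\int[leb]_x (sqnormc (f x))%:E)%E.
Let ME : (\int[leb]_x (sqnormc (f x))%:E)%E = M%:E.
Proof. by rewrite fineK// ge0_fin_numE ?integral_sqnormc_ge0//; case: Lf. Qed.
Let M0 : 0 <= M. Proof. by rewrite fine_ge0// integral_sqnormc_ge0. Qed.
Let H0 : 0 <= H. Proof. exact: le_trans (normr_ge0 _) (hH 0). Qed.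
Let mf : cmeasurable f. Proof. exact: Lf.1. Qed.

(** Integrating [v] first turns the phase into the Cauchy kernel of width [e] in [y], and [y = e z]
    moves the scale into the arguments of [f]. *)
Lemma smoothed_wigner (e : R) x : 0 < e ->
  cintegral leb (fun v => (expker (e *: v))%:C * wigner f f x v) =
  cintegral leb (fun z => (cauchyker z)%:C *
    (f (x + (e / 2) *: z) * conjc (f (x - (e / 2) *: z)))).
Proof.
move=> e0.
pose g y := f (x + 2^-1 *: y) * conjc (f (x - 2^-1 *: y)).
have Ig : cintegrable leb g.
  have := cintegrable_wigner x 0 Lf; congr cintegrable; apply/funext => y.
  by rewrite -[0](scale0r (0 : V)) dotZl mul0r mulr0 oppr0 expi0 mulr1.
have IE := cintegrable_expkerZ (n := n) e0.
transitivity (cintegral leb (fun v => cintegral leb (fun y =>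
    (expker (e *: v))%:C * g y * expi (- (2 * pi * dot v y))))).
  congr cintegral; apply/funext => v; rewrite /wigner -cintegralZl; last exact: cintegrable_wigner.
  by congr cintegral; apply/funext => y; rewrite mulrA.
rewrite (cfubini (f := fun p : V * V => (expker (e *: p.1))%:C * g p.2 *
    expi (- (2 * pi * dot p.1 p.2)))); last 2 first.
- apply: cmeasurableM; first apply: cmeasurableM.
  + exact: (cmeasurable_comp measurable_fst IE.1).
  + exact: (cmeasurable_comp measurable_snd Ig.1).
  + apply: cmeasurable_expi; apply: measurable_funN; apply: measurable_funM => //.
    exact: measurable_dot.
- have [_ foo] := cintegrable_prodM IE Ig.
  apply: le_lt_trans foo.
  rewrite (fubini_tonelli1 (fun z : V * V => (cabs ((expker (e *: z.1))%:C * g z.2))%:E)); last 2 first.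
  + apply: emeasurable_cabs; apply: cmeasurableM.
      exact: (cmeasurable_comp measurable_fst IE.1).
    exact: (cmeasurable_comp measurable_snd Ig.1).
  + by move=> z; rewrite lee_fin cabs_ge0.
  rewrite le_eqVlt; apply/orP; left; apply/eqP; apply: eq_integral => v _.
  by apply: eq_integral => y _; rewrite /= [in LHS]cabsM cabs_expi mulr1.
transitivity (cintegral leb (fun y => (e ^- n * cauchyker (e^-1 *: y))%:C * g y)).
  congr cintegral; apply/funext => y /=; rewrite -fourier_expkerZ//.
  rewrite [RHS]mulrC -cintegralZl; last by apply: cintegrable_phase => //; apply: measurable_funN;
    apply: measurable_funM => //; exact: measurable_dotr.
  by congr cintegral; apply/funext => v; ring.
pose F y := (cauchyker (e^-1 *: y))%:C * g y.
have IF : cintegrable leb F.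
  apply: (cintegrable_bddM (C := 2 ^+ n)) => //.
    apply: cmeasurable_real; apply: (measurableT_comp measurable_cauchyker).
    exact: measurable_rVZ.
  by move=> y; rewrite cabs_real ger0_norm ?cauchyker_ge0// cauchyker_le.
transitivity ((e ^- n)%:C * cintegral leb F).
  by rewrite -cintegralZl//; congr cintegral; apply/funext => y; rewrite rmorphM/= -mulrA.
rewrite -(cintegral_rVZ e0 IF); congr cintegral; apply/funext => y.
by rewrite /F /g !scalerA mulVf ?gt_eqF// scale1r (mulrC _ e).
Qed.

(** A weighted autocorrelation of [f]; at [e = 0] it would be the integral of [h |f|^2], the
    quantity to be recovered. *)
Definition pair_corr (e : R) z : R[i] := cintegral leb (fun x =>
  (h x)%:C * (f (x + (e / 2) *: z) * conjc (f (x - (e / 2) *: z)))).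

Let L2_shift a : square_integrable leb (fun x => f (x + a)).
Proof. exact: L2_rVD. Qed.

Let energy_shift a : (\int[leb]_x (sqnormc (f (x + a)))%:E)%E = M%:E.
Proof.
rewrite -ME (ge0_integral_rVD a (f := fun x => (sqnormc (f x))%:E))//.
  exact: emeasurable_sqnormc.
by move=> x; rewrite lee_fin sqnormc_ge0.
Qed.

Let corr_le a b : (\int[leb]_x (cabs ((h x)%:C * (f (x + a) * conjc (f (x + b)))))%:E <=
  (H * M)%:E)%E.
Proof.
have ma := (L2_shift a).1; have mb := (L2_shift b).1.
apply: (@le_trans _ _ (\int[leb]_x (H%:E * (cabs (f (x + a) * conjc (f (x + b))))%:E))%E).
  apply: ge0_le_integral => //.
  - by move=> x _; rewrite lee_fin cabs_ge0.
  - apply: emeasurable_cabs; apply: cmeasurableM; first exact: cmeasurable_real.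
    by apply: cmeasurableM => //; exact: cmeasurable_conj.
  - apply: emeasurable_funM => //; apply: emeasurable_cabs.
    by apply: cmeasurableM => //; exact: cmeasurable_conj.
  - by move=> x _; rewrite -EFinM lee_fin cabsM cabs_real ler_wpM2r ?cabs_ge0.
rewrite ge0_integralZl//; last 2 first.
- apply: emeasurable_cabs.
  by apply: cmeasurableM => //; exact: cmeasurable_conj.
- by move=> x _; rewrite lee_fin cabs_ge0.
rewrite EFinM lee_wpmul2l//.
apply: le_trans (integral_cabsM_le leb ltr01 ma (cmeasurable_conj mb)) _.
under [X in (_ + _ * X <= _)%E]eq_integral do rewrite -sqr_cabs cabsJ sqr_cabs.
rewrite !energy_shift -!EFinM -EFinD lee_fin invr1 le_eqVlt; apply/orP; left.
by apply/eqP; field.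
Qed.

Let m_integrand (e : R) : cmeasurable (fun p : V * V =>
  (h p.1)%:C * (f (p.1 + (e / 2) *: p.2) * conjc (f (p.1 - (e / 2) *: p.2)))).
Proof.
have ms : measurable_fun setT (fun p : V * V => (e / 2) *: p.2) by exact: measurable_rVZ.
apply: cmeasurableM.
  by apply: cmeasurable_real; exact: (measurableT_comp mh measurable_fst).
apply: cmeasurableM; last apply: cmeasurable_conj; apply: cmeasurable_comp mf.
  exact: measurable_rVD.
exact: measurable_rVB.
Qed.

Lemma cmeasurable_pair_corr e : cmeasurable (pair_corr e).
Proof. exact: (cmeasurable_cintegral1 leb (m_integrand e)). Qed.

Lemma pair_corr_le e z : cabs (pair_corr e z) <= H * M.
Proof.
apply: cabs_cintegral_le; last exact: (corr_le ((e / 2) *: z) (- ((e / 2) *: z))).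
apply: (cmeasurable_comp (h := fun x => (x, z)) _ (m_integrand e)).
exact: pair2_measurable.
Qed.

(** At positive scale everything converges absolutely: the Wigner distribution is bounded, [h] is
    integrable in [x] and the kernel in [v]. Hence [smoothed_wigner] may be integrated against [h]
    and the order exchanged once more. *)
Lemma smoothed_density (e : R) : 0 < e ->
  cintegral leb (fun v => cintegral leb (fun x =>
    (expker (e *: v))%:C * wigner f f x v * (h x)%:C)) =
  cintegral leb (fun z => (cauchyker z)%:C * pair_corr e z).
Proof.
move=> e0.
have mW := cmeasurable_wigner mf.
have IE := cintegrable_expkerZ (n := n) e0.
pose B : R := `|2^-1| ^- n * M.
have WB x v : cabs (wigner f f x v) <= B by exact: cabs_wigner_le.
have B0 : 0 <= B by exact: le_trans (cabs_ge0 _) (WB 0 0).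
pose F (p : V * V) := wigner f f p.2 p.1 * ((expker (e *: p.1))%:C * (h p.2)%:C).
have IF : cintegrable (leb \x leb)%E F.
  apply: (cintegrable_bddM (C := B)); first exact: cintegrable_prodM IE Ih.
    apply: (cmeasurable_comp (h := fun p : V * V => (p.2, p.1)) _ mW).
    exact: measurable_swap.
  by move=> p; exact: WB.
transitivity (cintegral leb (fun v => cintegral leb (fun x => F (v, x)))).
  by do 2!(congr cintegral; apply/funext => ?); rewrite /F /=; ring.
rewrite (etrans (cintegral12 IF) (esym (cintegral21 IF))).
transitivity (cintegral leb (fun x => cintegral leb (fun z => (cauchyker z)%:C *
    ((h x)%:C * (f (x + (e / 2) *: z) * conjc (f (x - (e / 2) *: z))))))).
  congr cintegral; apply/funext => x; rewrite /F /=.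
  transitivity ((h x)%:C * cintegral leb (fun v => (expker (e *: v))%:C * wigner f f x v)).
    rewrite -cintegralZl; first by congr cintegral; apply/funext => v; ring.
    under eq_fun do rewrite mulrC.
    apply: (cintegrable_bddM (C := B)) => //.
    apply: (cmeasurable_comp (h := fun v => (x, v)) _ mW).
    exact: pair1_measurable.
  rewrite smoothed_wigner// -cintegralZl.
    by congr cintegral; apply/funext => z; ring.
  apply: (cintegrable_bddM (C := 2 ^+ n)).
  - apply: L2_cintegrableM.
      by apply: L2_affine => //; rewrite mulf_neq0 ?gt_eqF.
    apply: L2_conj; under eq_fun do rewrite -scaleNr.
    by apply: L2_affine => //; rewrite oppr_eq0 mulf_neq0 ?gt_eqF.
  - exact: cmeasurable_real measurable_cauchyker.
  - by move=> z; rewrite cabs_real ger0_norm ?cauchyker_ge0// cauchyker_le.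
pose G (p : V * V) := (cauchyker p.2)%:C * ((h p.1)%:C *
  (f (p.1 + (e / 2) *: p.2) * conjc (f (p.1 - (e / 2) *: p.2)))).
have mG : cmeasurable G.
  apply: cmeasurableM; last exact: m_integrand.
  by apply: cmeasurable_real; exact: (measurableT_comp measurable_cauchyker measurable_snd).
have IG : cintegrable (leb \x leb)%E G.
  apply: cintegrable_tonelli21 => //.
  apply: (@le_lt_trans _ _ (\int[leb]_z ((cauchyker z)%:E * (H * M)%:E))%E).
    apply: ge0_le_integral => //.
    - by move=> z _; apply: integral_ge0 => x _; rewrite lee_fin cabs_ge0.
    - apply: (measurable_fun_fubini_tonelli_G (fun p : V * V => (cabs (G p))%:E)).
        exact: emeasurable_cabs.
      by move=> p; rewrite lee_fin cabs_ge0.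
    - by apply: emeasurable_funM => //; apply/measurable_EFinP; exact: measurable_cauchyker.
    - move=> z _; rewrite /G /=.
      under eq_integral do rewrite cabsM cabs_real ger0_norm ?cauchyker_ge0// EFinM.
      rewrite ge0_integralZl//; last 3 first.
      + apply: emeasurable_cabs.
        apply: (cmeasurable_comp (h := fun x => (x, z)) _ (m_integrand e)).
        exact: pair2_measurable.
      + by move=> x _; rewrite lee_fin cabs_ge0.
      + by rewrite lee_fin cauchyker_ge0.
      by rewrite lee_wpmul2l ?lee_fin ?cauchyker_ge0.
  rewrite ge0_integralZr//; last 3 first.
  - by apply/measurable_EFinP; exact: measurable_cauchyker.
  - by move=> z _; rewrite lee_fin cauchyker_ge0.
  - by rewrite lee_fin mulr_ge0.
  by rewrite integral_cauchyker mul1e ltry.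
transitivity (cintegral leb (fun z => cintegral leb (fun x => G (x, z)))).
  exact: (etrans (cintegral12 IG) (esym (cintegral21 IG))).
congr cintegral; apply/funext => z; rewrite /G /pair_corr -cintegralZl//.
split; last exact: le_lt_trans (corr_le ((e / 2) *: z) (- ((e / 2) *: z))) (ltry _).
apply: (cmeasurable_comp (h := fun x => (x, z)) _ (m_integrand e)).
exact: pair2_measurable.
Qed.

(** The bound is independent of the scale because the kernel has mass 1; with the time decay of the
    weight it becomes the majorant for the limit under the time integral. *)
Lemma smoothed_density_le e :
  cabs (cintegral leb (fun z => (cauchyker z)%:C * pair_corr e z)) <= H * M.
Proof.
apply: cabs_cintegral_le.
  by apply: cmeasurableM; [exact: cmeasurable_real measurable_cauchyker|exact: cmeasurable_pair_corr].
apply: (@le_trans _ _ (\int[leb]_z ((cauchyker z)%:E * (H * M)%:E))%E).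
  apply: ge0_le_integral => //.
  - by move=> z _; rewrite lee_fin cabs_ge0.
  - apply: emeasurable_cabs; apply: cmeasurableM; first exact: cmeasurable_real measurable_cauchyker.
    exact: cmeasurable_pair_corr.
  - by apply: emeasurable_funM => //; apply/measurable_EFinP; exact: measurable_cauchyker.
  - move=> z _; rewrite -EFinM lee_fin cabsM cabs_real ger0_norm ?cauchyker_ge0//.
    by rewrite ler_wpM2l ?cauchyker_ge0// pair_corr_le.
rewrite ge0_integralZr//; last 3 first.
- by apply/measurable_EFinP; exact: measurable_cauchyker.
- by move=> z _; rewrite lee_fin cauchyker_ge0.
- by rewrite lee_fin mulr_ge0.
by rewrite integral_cauchyker mul1e.
Qed.

Let cvg_shift z : sqdist leb (fun x => f (x + (k.+1%:R^-1 / 2) *: z)) f @[k --> \oo] --> 0%E.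
Proof.
have := @cvg_translation _ _ (2^-1 *: z) f Lf.
by under eq_fun do under eq_fun do rewrite scalerA.
Qed.

Lemma cvg_pair_corr z :
  cabs (pair_corr k.+1%:R^-1 z - (\int[leb]_x (h x * sqnormc (f x)))%:C)
    @[k --> \oo] --> (0 : R).
Proof.
have -> : (\int[leb]_x (h x * sqnormc (f x)))%:C =
    cintegral leb (fun x => f x * ((h x)%:C * conjc (f x))).
  rewrite -cintegral_real; congr cintegral; apply/funext => x.
  by rewrite rmorphM/= sqnormcE; ring.
have E k : pair_corr k.+1%:R^-1 z = cintegral leb (fun x => f (x + (k.+1%:R^-1 / 2) *: z) *
    ((h x)%:C * conjc (f (x + (k.+1%:R^-1 / 2) *: (- z))))).
  by congr cintegral; apply/funext => x; rewrite scalerN; ring.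
under eq_fun do rewrite E.
have hC x : sqnormc (h x)%:C <= H ^+ 2.
  by rewrite sqnormc_real -real_normK ?num_real// ler_pXn2r ?nnegrE.
have Lh (g : V -> R[i]) : square_integrable leb g -> square_integrable leb (fun x => (h x)%:C * g x).
  by move=> Lg; apply: (L2_bddM Lg _ hC); exact: cmeasurable_real.
apply: (cvg_cintegralM (u_ := fun k x => f (x + (k.+1%:R^-1 / 2) *: z))
  (v_ := fun k x => (h x)%:C * conjc (f (x + (k.+1%:R^-1 / 2) *: (- z))))) => //.
- by move=> k; apply: Lh; exact: L2_conj.
- by apply: Lh; exact: L2_conj.
- apply: (cvge0_le (r := fun k => ((H ^+ 2)%:E *
    sqdist leb (fun x => f (x + (k.+1%:R^-1 / 2) *: (- z))) f)%E)); last first.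
    by apply: cvge0Zl; exact: cvg_shift.
  move=> k; rewrite sqdist_ge0 /= -ge0_integralZl//; last 3 first.
  + by apply: emeasurable_sqnormc; apply: cmeasurableB => //; exact: (L2_shift _).1.
  + by move=> x _; rewrite lee_fin sqnormc_ge0.
  + by rewrite lee_fin sqr_ge0.
  apply: ge0_le_integral => //.
  + by move=> x _; rewrite lee_fin sqnormc_ge0.
  + apply: emeasurable_sqnormc; apply: cmeasurableB.
      by apply: (Lh _ _).1; exact: L2_conj.
    by apply: (Lh _ _).1; exact: L2_conj.
  + apply: emeasurable_funM => //; apply: emeasurable_sqnormc.
    by apply: cmeasurableB => //; exact: (L2_shift _).1.
  + move=> x _; rewrite -EFinM lee_fin -mulrBr sqnormcM -(rmorphB conjc).
    by rewrite -[X in _ * X]sqr_cabs cabsJ sqr_cabs ler_wpM2r ?sqnormc_ge0.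
Qed.

Lemma cvg_smoothed_density :
  cabs (cintegral leb (fun z => (cauchyker z)%:C * pair_corr k.+1%:R^-1 z) -
    (\int[leb]_x (h x * sqnormc (f x)))%:C) @[k --> \oo] --> (0 : R).
Proof.
set c := (\int[leb]_x _)%:C.
have Ic : cintegrable leb (fun z : V => (cauchyker z)%:C).
  split; first exact: cmeasurable_real measurable_cauchyker.
  under eq_integral do rewrite cabs_real ger0_norm ?cauchyker_ge0//.
  by rewrite integral_cauchyker ltry.
have -> : c = cintegral leb (fun z : V => (cauchyker z)%:C * c).
  under eq_fun do rewrite mulrC.
  rewrite cintegralZl// cintegral_real /Rintegral integral_cauchyker/=.
  by rewrite mulr1.
apply: (@cvg_cintegral _ _ _ leb (fun k z => (cauchyker z)%:C * pair_corr k.+1%:R^-1 z)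
  (fun z => (cauchyker z)%:C * c) (fun z => cauchyker z * (H * M))).
- by move=> k; apply: cmeasurableM; [exact: Ic.1|exact: cmeasurable_pair_corr].
- by apply: cmeasurableM; [exact: Ic.1|exact: cmeasurable_cst].
- by move=> z; apply: cvg_cabsMl; exact: cvg_pair_corr.
- by apply: measurable_funM => //; exact: measurable_cauchyker.
- move=> k z; rewrite cabsM cabs_real ger0_norm ?cauchyker_ge0//.
  by rewrite ler_wpM2l ?cauchyker_ge0// pair_corr_le.
- under eq_integral do rewrite EFinM.
  rewrite ge0_integralZr//; last 3 first.
  + by apply/measurable_EFinP; exact: measurable_cauchyker.
  + by move=> z _; rewrite lee_fin cauchyker_ge0.
  + by rewrite lee_fin mulr_ge0.
  by rewrite integral_cauchyker mul1e ltry.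
Qed.

End regularization.

(** * Weights with product decay in space and time *)

Section decaying_weight.
Context {R : realType} {n : nat}.
Local Notation V := 'rV[R]_n.
Local Notation leb := (lebesgue_rV R n).
Local Notation Leb := (@lebesgue_measure R).
Local Notation T := (measurableTypeR R).
Implicit Types (x v : V) (t : R).

Definition box_decay x : R := \prod_(i < n) (oneDsqr (x 0 i))^-1.

Lemma oneDsqrV_bounds t : 0 < (oneDsqr t)^-1 <= 1.
Proof.
have p : 1 <= oneDsqr t by rewrite /oneDsqr lerDl sqr_ge0.
have p0 : 0 < oneDsqr t by rewrite (lt_le_trans ltr01).
by rewrite invr_gt0 p0 invf_le1.
Qed.

Lemma box_decay_bounds x : 0 < box_decay x <= 1.
Proof.
apply/andP; split.
  by apply: prodr_gt0 => i _; case/andP: (oneDsqrV_bounds (x 0 i)).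
apply: prodr_ile1 => i _.
by case/andP: (oneDsqrV_bounds (x 0 i)) => /ltW -> ->.
Qed.

Lemma measurable_box_decay : measurable_fun setT box_decay.
Proof.
by apply: (measurable_prod_coord (f := fun _ s => (oneDsqr s)^-1)) => i; exact: measurable_oneDsqrV.
Qed.

Lemma integral_box_decay : (\int[leb]_x (box_decay x)%:E < +oo)%E.
Proof.
rewrite (ge0_integral_prod (f := fun _ s => (oneDsqr s)^-1)); last 2 first.
- by move=> i; exact: measurable_oneDsqrV.
- by move=> i t; case/andP: (oneDsqrV_bounds t) => /ltW.
apply: prode_lty => i; rewrite integral_oneDsqrV ?ltry// lee_fin.
exact: pi_ge0.
Qed.

(** The majorant is a product of factors [1 / (1 + s^2)], one per coordinate, so its integral is a
    product. Along a line [(x - t (2 v), t)] the time factor alone gives integrability, uniformly in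
    [x] and [v]. *)
Definition decaying (w : V * R -> R) (C : R) :=
  measurable_fun [set: V * T] w /\
  forall z, `|w z| <= C * ((oneDsqr z.2)^-1 * box_decay z.1).

Variables (w : V * R -> R) (C : R).
Hypothesis Hw : decaying w C.

Let mw : measurable_fun [set: V * T] w. Proof. exact: Hw.1. Qed.

Lemma decaying_ge0 : 0 <= C.
Proof.
have := Hw.2 (0, 0) => /=.
have /andP[a _] := oneDsqrV_bounds 0; have /andP[b _] := box_decay_bounds 0.
move=> /(le_trans (normr_ge0 _)); rewrite pmulr_lge0//; exact: mulr_gt0.
Qed.

Lemma decaying_le_time z : `|w z| <= C * (oneDsqr z.2)^-1.
Proof.
apply: le_trans (Hw.2 z) _; rewrite ler_wpM2l ?decaying_ge0//.
have /andP[a _] := oneDsqrV_bounds z.2; have /andP[_ b] := box_decay_bounds z.1.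
by rewrite -[leRHS]mulr1 ler_wpM2l// ltW.
Qed.

Lemma decaying_slice t :
  measurable_fun setT (fun x => w (x, t)) /\
  (\int[leb]_x (`|w (x, t)|)%:E <=
     (C * (oneDsqr t)^-1)%:E * \int[leb]_x (box_decay x)%:E)%E.
Proof.
have ms : measurable_fun setT (fun x : V => w (x, t)).
  by apply: (measurableT_comp mw (g := fun x : V => (x, t : T))); exact: pair2_measurable.
have /andP[a _] := oneDsqrV_bounds t.
split => //; rewrite -ge0_integralZl//; last 3 first.
- by apply/measurable_EFinP; exact: measurable_box_decay.
- by move=> x _; rewrite lee_fin ltW//; case/andP: (box_decay_bounds x).
- by rewrite lee_fin mulr_ge0 ?decaying_ge0// ltW.
apply: ge0_le_integral => //.
- by apply/measurable_EFinP; exact: measurableT_comp.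
- by apply/measurable_EFinP; apply: measurable_funM => //; exact: measurable_box_decay.
- by move=> x _; rewrite -EFinM lee_fin -mulrA; exact: (Hw.2 (x, t)).
Qed.

Lemma decaying_slice_cintegrable t : cintegrable leb (fun x => (w (x, t))%:C).
Proof.
have [ms le] := decaying_slice t; split; first exact: cmeasurable_real.
under eq_integral do rewrite cabs_real; apply: le_lt_trans le _.
by rewrite lte_mul_pinfty ?integral_box_decay// lee_fin mulr_ge0 ?decaying_ge0.
Qed.

Lemma measurable_line : measurable_fun [set: (V * V) * T]
  (fun p : (V * V) * T => (p.1.1 - p.2 *: (2 *: p.1.2), p.2) : V * T).
Proof.
have m11 : measurable_fun setT (fun z : (V * V) * T => z.1.1).
  exact: (measurableT_comp measurable_fst measurable_fst).
have m12 : measurable_fun setT (fun z : (V * V) * T => z.1.2).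
  exact: (measurableT_comp measurable_snd measurable_fst).
apply/measurable_fun_pairP; split; last exact: measurable_snd.
apply: measurable_rVB => //; apply: (measurable_rVZ (h := fun z : (V * V) * T => z.2)).
  exact: measurable_snd.
exact: measurable_rVZ.
Qed.

Lemma measurable_weight_line : measurable_fun [set: (V * V) * T]
  (fun p : (V * V) * T => w (p.1.1 - p.2 *: (2 *: p.1.2), p.2)).
Proof. exact: (measurableT_comp mw measurable_line). Qed.

Definition rxray (z : V * V) : R := \int[Leb]_t w (z.1 - t *: (2 *: z.2), t).

Lemma integral_time_decay (D : R) : 0 <= D ->
  (\int[Leb]_t (D * (oneDsqr t)^-1)%:E < +oo)%E.
Proof.
move=> D0; under eq_integral do rewrite EFinM.
rewrite ge0_integralZl//; last first.
  by apply/measurable_EFinP; exact: measurable_oneDsqrV.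
by rewrite integral_oneDsqrV -EFinM ltry.
Qed.

Lemma weight_line_cintegrable z : cintegrable Leb (fun t : T => (w (z.1 - t *: (2 *: z.2), t))%:C).
Proof.
apply: (@cintegrable_le _ _ _ Leb _ (fun t => C * (oneDsqr t)^-1)).
- apply: cmeasurable_real.
  apply: (measurableT_comp measurable_weight_line (g := fun t : T => (z, t))).
  exact: pair1_measurable.
- by apply: measurable_funM => //; exact: measurable_oneDsqrV.
- by move=> t; rewrite cabs_real; exact: (decaying_le_time (_, t)).
- exact: integral_time_decay decaying_ge0.
Qed.

Lemma xrayE z : xray w z.1 (2 *: z.2) = (rxray z)%:E.
Proof.
rewrite /xray /rxray /Rintegral fineK//.
have := cintegrable_Re (weight_line_cintegrable z).
by move=> /integrable_fin_num; exact.
Qed.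

Lemma measurable_rxray : measurable_fun setT rxray.
Proof. exact: (measurable_Rintegral2 Leb measurable_weight_line). Qed.

End decaying_weight.

Section pairing.
Context {R : realType} {n : nat}.
Local Notation V := 'rV[R]_n.
Local Notation leb := (lebesgue_rV R n).
Local Notation Leb := (@lebesgue_measure R).
Local Notation T := (measurableTypeR R).
Implicit Types (x v : V) (t : R).

Variables (w : V * R -> R) (C : R).
Hypothesis Hw : decaying w C.
Variable u : V * R -> R[i].
Hypothesis mu : @cmeasurable _ _ (V * T)%type u.
Hypothesis Lu : forall t, square_integrable leb (fun x => u (x, t)).
Hypothesis propagation : forall t x v,
  wigner (fun y => u (y, t)) (fun y => u (y, t)) x v =
  wigner (fun y => u (y, 0)) (fun y => u (y, 0)) (x + (2 * t) *: v) v.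
Variable M : R.
Hypothesis M0 : 0 <= M.
Hypothesis energyM : forall t, (\int[leb]_x (sqnormc (u (x, t)))%:E <= M%:E)%E.

Let W (z : V * V) : R[i] := wigner (fun y => u (y, 0)) (fun y => u (y, 0)) z.1 z.2.

Let mW : cmeasurable W. Proof. exact: cmeasurable_wigner (Lu 0).1. Qed.

Let B : R := `|2^-1| ^- n * fine (\int[leb]_x (sqnormc (u (x, 0)))%:E)%E.

Let WB z : cabs (W z) <= B. Proof. exact: cabs_wigner_le. Qed.

Let B0 : 0 <= B. Proof. exact: le_trans (cabs_ge0 _) (WB (0, 0)). Qed.

Let C0 : 0 <= C. Proof. exact: decaying_ge0 Hw. Qed.

Let X := rxray w.

Section fixed_scale.
Variable e : R.
Hypothesis e0 : 0 < e.

Let Phi (p : (V * V) * T) : R[i] := W p.1 * ((expker (e *: p.1.2))%:C *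
  (w (p.1.1 - p.2 *: (2 *: p.1.2), p.2))%:C).

Let mPhi : cmeasurable Phi.
Proof.
apply: cmeasurableM; first exact: (cmeasurable_comp measurable_fst mW).
apply: cmeasurableM; last exact: cmeasurable_real (measurable_weight_line Hw).
apply: cmeasurable_real; apply: (measurableT_comp measurable_expker).
apply: measurable_rVZ => //; exact: (measurableT_comp measurable_snd measurable_fst).
Qed.

Let Ie : cintegrable leb (fun v => (expker (e *: v))%:C).
Proof. exact: cintegrable_expkerZ. Qed.

Let Kphi := (\int[leb]_v (expker (e *: v))%:E)%E.
Let Kphi_lt : (Kphi < +oo)%E.
Proof.
by have [_] := Ie; under eq_integral do rewrite cabs_real ger0_norm ?expker_ge0//.
Qed.

Let slice t : measurable_fun setT (fun z : V * V => w (z.1 - t *: (2 *: z.2), t)).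
Proof.
apply: (measurableT_comp (measurable_weight_line Hw) (g := fun z : V * V => (z, t : T))).
exact: pair2_measurable.
Qed.

(** Integrating [x] first, translation invariance removes the shift by [t (2 v)] and leaves the mass
    of the time slice of [w]. The factor [expker] is what makes the remaining [v]-integral finite,
    hence Fubini legitimate. *)
Let Phi_le t : (\int[(leb \x leb)%E]_z (cabs (Phi (z, t)))%:E <=
  (C * (oneDsqr t)^-1)%:E * (B%:E * (Kphi * \int[leb]_x (box_decay x)%:E)))%E.
Proof.
pose G (z : V * V) : R := expker (e *: z.2) * `|w (z.1 - t *: (2 *: z.2), t)|.
have mG : measurable_fun setT G.
  apply: measurable_funM; last exact: measurableT_comp.
  by apply: (measurableT_comp measurable_expker); exact: measurable_rVZ.
have G0 z : (0 <= (G z)%:E)%E by rewrite lee_fin mulr_ge0 ?expker_ge0.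
have D0 : (0 <= \int[leb]_x (box_decay x)%:E)%E.
  by apply: integral_ge0 => x _; rewrite lee_fin ltW//; case/andP: (box_decay_bounds x).
have K0 : (0 <= Kphi)%E by apply: integral_ge0 => v _; rewrite lee_fin expker_ge0.
apply: (@le_trans _ _ (\int[(leb \x leb)%E]_z (B%:E * (G z)%:E))%E).
  apply: ge0_le_integral => //.
  - by move=> z _; rewrite lee_fin cabs_ge0.
  - apply: emeasurable_cabs.
    apply: (cmeasurable_comp (h := fun z : V * V => (z, t : T)) _ mPhi).
    exact: pair2_measurable.
  - by apply: emeasurable_funM => //; exact/measurable_EFinP.
  - move=> z _; rewrite -EFinM lee_fin /Phi cabsM /= cabsM !cabs_real.
    by rewrite (ger0_norm (expker_ge0 _)) ler_wpM2r// mulr_ge0 ?expker_ge0.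
rewrite ge0_integralZl//; last exact/measurable_EFinP.
rewrite muleCA lee_wpmul2l//.
rewrite (fubini_tonelli2 (fun z => (G z)%:E))//; last exact/measurable_EFinP.
apply: (@le_trans _ _ (\int[leb]_v ((expker (e *: v))%:E *
    ((C * (oneDsqr t)^-1)%:E * \int[leb]_x (box_decay x)%:E)))%E).
  apply: ge0_le_integral => //.
  - by move=> v _; apply: integral_ge0.
  - by apply: (measurable_fun_fubini_tonelli_G (fun z => (G z)%:E)) => //; exact/measurable_EFinP.
  - apply: emeasurable_funM => //; apply/measurable_EFinP.
    by apply: (measurableT_comp measurable_expker); exact: measurable_rVZ.
  - move=> v _; rewrite /fubini_G /G /=.
    have [mwt wt] := decaying_slice Hw t.
    under eq_integral do rewrite EFinM.
    have mwt' : measurable_fun setT (fun x : V => (`|w (x, t)|)%:E).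
      by apply/measurable_EFinP; exact: measurableT_comp.
    have shift := ge0_integral_rVD (- (t *: (2 *: v))) (f := fun x => (`|w (x, t)|)%:E) mwt'.
    rewrite ge0_integralZl//.
    + by rewrite lee_wpmul2l ?lee_fin ?expker_ge0// shift.
    + by apply: (measurableT_comp mwt'); exact: measurable_rVB.
    + by rewrite lee_fin expker_ge0.
rewrite ge0_integralZr//; last 3 first.
- apply/measurable_EFinP.
  by apply: (measurableT_comp measurable_expker); exact: measurable_rVZ.
- by move=> v _; rewrite lee_fin expker_ge0.
- by rewrite mule_ge0// lee_fin mulr_ge0.
by rewrite muleCA.
Qed.

Let IPhi : cintegrable (sfprod leb leb \x Leb)%E Phi.
Proof.
have D0 : (0 <= \int[leb]_x (box_decay x)%:E)%E.
  by apply: integral_ge0 => x _; rewrite lee_fin ltW//; case/andP: (box_decay_bounds x).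
have K0 : (0 <= Kphi)%E by apply: integral_ge0 => v _; rewrite lee_fin expker_ge0.
set Q := (B%:E * (Kphi * \int[leb]_x (box_decay x)%:E))%E.
have Q0 : (0 <= Q)%E by rewrite !mule_ge0.
have Qf : Q \is a fin_num.
  rewrite !fin_numM// ge0_fin_numE//; exact: integral_box_decay.
apply: cintegrable_tonelli21 => //.
apply: (@le_lt_trans _ _ (\int[Leb]_t ((C * fine Q) * (oneDsqr t)^-1)%:E)%E).
  apply: ge0_le_integral => //.
  - by move=> t _; apply: integral_ge0 => z _; rewrite lee_fin cabs_ge0.
  - apply: (measurable_fun_fubini_tonelli_G (m1 := sfprod leb leb) (fun p : (V * V) * T => (cabs (Phi p))%:E)).
      exact: emeasurable_cabs.
    by move=> p; rewrite lee_fin cabs_ge0.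
  - by apply/measurable_EFinP; apply: measurable_funM => //; exact: measurable_oneDsqrV.
  - move=> t _; apply: le_trans (Phi_le t) _; rewrite -/Q -(fineK Qf) -EFinM lee_fin.
    by rewrite le_eqVlt; apply/orP; left; apply/eqP; ring.
by apply: integral_time_decay; rewrite mulr_ge0// fine_ge0.
Qed.

(** The X-ray transform is unfolded and time becomes the outer variable. At fixed [t] the shift of
    [x] by [2 t v] moves the weight to [(x, t)], and the propagation law identifies the Wigner
    distribution as that of the solution at time [t]. *)
Lemma smoothed_pairing :
  cintegral (leb \x leb)%E (fun z => W z * ((X z)%:C * (expker (e *: z.2))%:C)) =
  cintegral Leb (fun t => cintegral leb (fun z =>
    (cauchyker z)%:C * pair_corr (fun x => u (x, t)) (fun x => w (x, t)) e z)).
Proof.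
transitivity (cintegral (sfprod leb leb) (fun z => cintegral Leb (fun t => Phi (z, t)))).
  congr cintegral; apply/funext => z; rewrite /Phi /X /rxray /=.
  rewrite -cintegral_real.
  transitivity (W z * (expker (e *: z.2))%:C * cintegral Leb (fun t : T => (w (z.1 - t *: (2 *: z.2), t))%:C)).
    by ring.
  rewrite -cintegralZl; last exact: weight_line_cintegrable Hw z.
  by congr cintegral; apply/funext => t; rewrite mulrA.
rewrite (etrans (cintegral12 (m1 := sfprod leb leb) IPhi) (esym (cintegral21 (m1 := sfprod leb leb) IPhi))).
congr cintegral; apply/funext => t.
have It : cintegrable (leb \x leb)%E (fun z => Phi (z, t)).
  split.
    apply: (cmeasurable_comp (h := fun z : V * V => (z, t : T)) _ mPhi).
    exact: pair2_measurable.
  apply: le_lt_trans (Phi_le t) _.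
  rewrite lte_mul_pinfty//.
  - by rewrite lee_fin mulr_ge0.
  - rewrite lte_mul_pinfty// lte_mul_pinfty//.
    + by apply: integral_ge0 => v _; rewrite lee_fin expker_ge0.
    + by rewrite ge0_fin_numE//; apply: integral_ge0 => v _; rewrite lee_fin expker_ge0.
    + exact: integral_box_decay.
have [mwt _] := decaying_slice Hw t.
have hH x : `|w (x, t)| <= C * (oneDsqr t)^-1 := decaying_le_time Hw (x, t).
rewrite -(smoothed_density (Lu t) mwt hH (decaying_slice_cintegrable Hw t) e0).
transitivity (cintegral leb (fun v => cintegral leb (fun y => Phi ((y, v), t)))).
  by rewrite -cintegral21.
congr cintegral; apply/funext => v; rewrite /Phi /=.
(* Substituting [y = x + 2 t v] straightens the line along which the weight is evaluated. *)
rewrite -(cintegral_rVD ((2 * t) *: v) (f := fun y => W (y, v) * ((expker (e *: v))%:C *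
   (w (y - t *: (2 *: v), t))%:C))); last first.
  apply: (cintegrable_bddM (C := B)).
  - apply: cintegrableZl.
    have := cintegrable_rVD (- (t *: (2 *: v))) (decaying_slice_cintegrable Hw t).
    by [].
  - by apply: (cmeasurable_comp (h := fun y : V => (y, v)) _ mW); exact: pair2_measurable.
  - by move=> y; exact: WB.
congr cintegral; apply/funext => x; rewrite propagation /W /=.
have -> : x + (2 * t) *: v - t *: (2 *: v) = x by rewrite scalerA (mulrC t) addrK.
by ring.
Qed.

End fixed_scale.

Let mpair_corr e : cmeasurable (fun p : T * V =>
  pair_corr (fun x => u (x, p.1)) (fun x => w (x, p.1)) e p.2).
Proof.
have m1 : measurable_fun setT (fun q : (T * V) * V => q.1.1).
  exact: (measurableT_comp measurable_fst measurable_fst).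
have m2 : measurable_fun setT (fun q : (T * V) * V => (e / 2) *: q.1.2).
  apply: measurable_rVZ => //; exact: (measurableT_comp measurable_snd measurable_fst).
apply: (cmeasurable_cintegral2 leb (f := fun q : (T * V) * V => (w (q.2, q.1.1))%:C *
  (u (q.2 + (e / 2) *: q.1.2, q.1.1) * conjc (u (q.2 - (e / 2) *: q.1.2, q.1.1))))).
apply: cmeasurableM.
  apply: cmeasurable_real; apply: (measurableT_comp Hw.1 (g := fun q : (T * V) * V => (q.2, q.1.1) : V * T)).
  exact: measurable_fun_pair.
apply: cmeasurableM; last apply: cmeasurable_conj.
  apply: (cmeasurable_comp (h := fun q : (T * V) * V => (q.2 + (e / 2) *: q.1.2, q.1.1) : V * T) _ mu).
  by apply: measurable_fun_pair => //; exact: measurable_rVD.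
apply: (cmeasurable_comp (h := fun q : (T * V) * V => (q.2 - (e / 2) *: q.1.2, q.1.1) : V * T) _ mu).
by apply: measurable_fun_pair => //; exact: measurable_rVB.
Qed.

Let Mt_le t : fine (\int[leb]_x (sqnormc (u (x, t)))%:E)%E <= M.
Proof.
rewrite -lee_fin fineK//; rewrite ge0_fin_numE ?integral_sqnormc_ge0//.
exact: (Lu t).2.
Qed.

Let mwu : measurable_fun [set: V * T] (fun z => w z * sqnormc (u z)).
Proof. by apply: measurable_funM; [exact: Hw.1|exact: measurable_sqnormc]. Qed.

Let Q t := \int[leb]_x (w (x, t) * sqnormc (u (x, t))).

(** At each fixed time this is [cvg_smoothed_density]; the bound of [smoothed_density_le], a
    multiple of [1 / (1 + t^2)], allows the limit under the time integral. *)
Let cvg_time : cabs (cintegral Leb (fun t => cintegral leb (fun z =>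
    (cauchyker z)%:C * pair_corr (fun x => u (x, t)) (fun x => w (x, t)) k.+1%:R^-1 z)) -
  (\int[Leb]_t Q t)%:C) @[k --> \oo] --> (0 : R).
Proof.
rewrite -cintegral_real.
have Ht t x : `|w (x, t)| <= C * (oneDsqr t)^-1 := decaying_le_time Hw (x, t).
apply: (@cvg_cintegral _ _ _ Leb (fun k t => cintegral leb (fun z =>
    (cauchyker z)%:C * pair_corr (fun x => u (x, t)) (fun x => w (x, t)) k.+1%:R^-1 z))
  (fun t => (Q t)%:C) (fun t => C * (oneDsqr t)^-1 * M)).
- move=> k; apply: (cmeasurable_cintegral2 leb (f := fun p : T * V => (cauchyker p.2)%:C *
    pair_corr (fun x => u (x, p.1)) (fun x => w (x, p.1)) k.+1%:R^-1 p.2)).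
  apply: cmeasurableM; last exact: mpair_corr.
  by apply: cmeasurable_real; exact: (measurableT_comp measurable_cauchyker measurable_snd).
- apply: cmeasurable_real.
  exact: (measurable_Rintegral1 leb (r := fun z : V * T => w z * sqnormc (u z)) mwu).
- move=> t; have [mwt _] := decaying_slice Hw t.
  exact: (cvg_smoothed_density (Lu t) mwt (Ht t)).
- by apply: measurable_funM => //; apply: measurable_funM => //; exact: measurable_oneDsqrV.
- move=> k t; have [mwt _] := decaying_slice Hw t.
  apply: le_trans (smoothed_density_le (Lu t) mwt (Ht t) _) _.
  by rewrite ler_wpM2l ?(le_trans _ (Ht t 0)).
- under eq_integral do rewrite mulrAC.
  by apply: integral_time_decay; rewrite mulr_ge0.
Qed.

Hypothesis LW : square_integrable (leb \x leb)%E W.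
Variable N : set (V * V).
Hypothesis mN : measurable N.
Hypothesis WN : forall z, W z != 0 -> N z.
Hypothesis XN : (\int[(leb \x leb)%E]_z ((X z) ^+ 2 * \1_N z)%:E < +oo)%E.

(** Only the restriction of [X] to [N] is assumed square-integrable. As [W] vanishes off [N], the
    product with [W] is that of two L2 functions and is integrable. *)
Let XNE z : W z * (X z)%:C = W z * ((X z * \1_N z)%:C).
Proof.
have [->|/WN Nz] := eqVneq (W z) 0; first by rewrite !mul0r.
by rewrite indicE mem_set ?mulr1.
Qed.

Let mX : measurable_fun setT X. Proof. exact: measurable_rxray Hw. Qed.

Let LX : square_integrable (leb \x leb)%E (fun z => (X z * \1_N z)%:C).
Proof.
split; first by apply: cmeasurable_real; apply: measurable_funM.
under eq_integral do rewrite sqnormc_real exprMn.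
have E z : (\1_N z : R) ^+ 2 = \1_N z.
  by rewrite indicE; case: (_ \in _); rewrite ?expr1n ?expr0n.
by under eq_integral do rewrite E.
Qed.

Lemma cintegrable_pairing : cintegrable (leb \x leb)%E (fun z => W z * (X z)%:C).
Proof. by under eq_fun do rewrite XNE; exact: L2_cintegrableM. Qed.

(** The scale is sent to 0 on both sides of [smoothed_pairing]: on the left [W X] is integrable and
    dominates, on the right [cvg_time] applies. *)
Lemma cintegral_pairing :
  cintegral (leb \x leb)%E (fun z => W z * (X z)%:C) = (\int[Leb]_t Q t)%:C.
Proof.
have [m1 foo] := cintegrable_pairing.
apply: (@cvg_cabs_unique R (fun k => cintegral (leb \x leb)%E
  (fun z => W z * ((X z)%:C * (expker (k.+1%:R^-1 *: z.2))%:C)))).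
  have mek k : measurable_fun setT (fun z : V * V => expker (k.+1%:R^-1 *: z.2)).
    by apply: (measurableT_comp measurable_expker); exact: measurable_rVZ.
  apply: (@cvg_cintegral _ _ _ (leb \x leb)%E
    (fun k z => W z * ((X z)%:C * (expker (k.+1%:R^-1 *: z.2))%:C))
    (fun z => W z * (X z)%:C) (fun z => cabs (W z * (X z)%:C))).
  - move=> k; apply: cmeasurableM => //.
    by apply: cmeasurableM; exact: cmeasurable_real.
  - exact: m1.
  - move=> z; apply: (@cvg_cabsMl R _ _ (fun k => (X z)%:C * (expker (k.+1%:R^-1 *: z.2))%:C)).
    have h : expker (k.+1%:R^-1 *: z.2) - 1 @[k --> \oo] --> (0 : R).
      rewrite -[X in _ --> X](subrr (1 : R)); apply: cvgB; last exact: cvg_cst.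
      exact: cvg_expker.
    have := cvg_norm h; rewrite normr0 => h'.
    have E k : cabs ((expker (k.+1%:R^-1 *: z.2))%:C - 1) = `|expker (k.+1%:R^-1 *: z.2) - 1|.
      by rewrite -cabs_real rmorphB.
    have hE : cabs ((expker (k.+1%:R^-1 *: z.2))%:C - 1) @[k --> \oo] --> (0 : R).
      by under eq_fun do rewrite E; exact: h'.
    have h2 : cabs ((X z)%:C * (expker (k.+1%:R^-1 *: z.2))%:C - (X z)%:C * 1)
        @[k --> \oo] --> (0 : R).
      exact: (@cvg_cabsMl R _ _ (fun k => (expker (k.+1%:R^-1 *: z.2))%:C)).
    by rewrite mulr1 in h2.
  - exact: measurable_cabs.
  - move=> k z; rewrite mulrA [leLHS]cabsM cabs_real ger0_norm ?expker_ge0//.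
    by rewrite ler_piMr ?cabs_ge0// expker_le1.
  - exact: foo.
have E k : cintegral (leb \x leb)%E (fun z => W z * ((X z)%:C * (expker (k.+1%:R^-1 *: z.2))%:C)) =
    cintegral Leb (fun t => cintegral leb (fun z => (cauchyker z)%:C *
      pair_corr (fun x => u (x, t)) (fun x => w (x, t)) k.+1%:R^-1 z)).
  by apply: smoothed_pairing; rewrite invr_gt0.
by under eq_fun do rewrite E; exact: cvg_time.
Qed.

Lemma energy_pairing : exists r : R,
  (\int[(leb \x Leb)%E]_z (sqnormc (u z) * w z)%:E = r%:E)%E /\
  cintegral (leb \x leb)%E (fun z => W z * (X z)%:C) = r%:C.
Proof.
have I : cintegrable (leb \x Leb)%E (fun z => (w z * sqnormc (u z))%:C).
  apply: cintegrable_tonelli21; first exact: cmeasurable_real.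
  apply: (@le_lt_trans _ _ (\int[Leb]_t (C * M * (oneDsqr t)^-1)%:E)%E); last first.
    by apply: integral_time_decay; rewrite mulr_ge0.
  apply: ge0_le_integral => //.
  - by move=> t _; apply: integral_ge0 => x _; rewrite lee_fin cabs_ge0.
  - apply: (measurable_fun_fubini_tonelli_G (fun z : V * T => (cabs (w z * sqnormc (u z))%:C)%:E)).
      by apply: emeasurable_cabs; exact: cmeasurable_real.
    by move=> z; rewrite lee_fin cabs_ge0.
  - by apply/measurable_EFinP; apply: measurable_funM => //; exact: measurable_oneDsqrV.
  - move=> t _; have /andP[a _] := oneDsqrV_bounds t.
    rewrite mulrAC EFinM; apply: le_trans (lee_wpmul2l _ (energyM t)); last first.
      by rewrite lee_fin mulr_ge0// ltW.
    rewrite -ge0_integralZl//; last 3 first.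
    + by apply: emeasurable_sqnormc; exact: (Lu t).1.
    + by move=> x _; rewrite lee_fin sqnormc_ge0.
    + by rewrite lee_fin mulr_ge0// ltW.
    apply: ge0_le_integral => //.
    + by move=> x _; rewrite lee_fin cabs_ge0.
    + apply: emeasurable_cabs; apply: cmeasurable_real.
      by apply: (measurableT_comp mwu (g := fun x : V => (x, t : T))); exact: pair2_measurable.
    + by apply: emeasurable_funM => //; apply: emeasurable_sqnormc; exact: (Lu t).1.
    + move=> x _; rewrite -EFinM lee_fin cabs_real normrM (ger0_norm (sqnormc_ge0 _)).
      by rewrite ler_wpM2r ?sqnormc_ge0//; exact: (decaying_le_time Hw (x, t)).
have I' := cintegrable_Re I.
exists (\int[Leb]_t Q t); split; last exact: cintegral_pairing.
rewrite /Q (Rintegral21 (r := fun z : V * T => w z * sqnormc (u z)))// /Rintegral fineK.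
  by apply: eq_integral => z _; rewrite mulrC.
exact: integrable_fin_num I'.
Qed.

End pairing.

(** * The Bessel inequality for the X-ray transform *)

Section ge0_integral_sets.
Context {R : realType} {d} {T : measurableType d} (mu : {measure set T -> \bar R}).
Import HBNNSimple.

(* No measurability of [f], [g], [A], [B]: the integral of a nonnegative function
   is a supremum over the simple functions below it. *)
Lemma ge0_le_integral_set (A B : set T) (f g : T -> \bar R) : A `<=` B ->
  (forall x, 0 <= f x)%E -> (forall x, f x <= g x)%E ->
  (\int[mu]_(x in A) f x <= \int[mu]_(x in B) g x)%E.
Proof.
move=> AB f0 fg; have g0 x : (0 <= g x)%E by exact: le_trans (f0 x) (fg x).
rewrite integral_mkcond [leRHS]integral_mkcond.
rewrite !ge0_integralTE; last 2 first.
- by move=> x; rewrite patchE; case: ifP.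
- by move=> x; rewrite patchE; case: ifP.
apply: ereal_sup_le => _ [h hf <-]; exists h => // x.
apply: le_trans (hf x) _; rewrite !patchE.
case: (boolP (x \in A)) => [/set_mem /AB xB|_]; last by case: ifP.
by rewrite mem_set.
Qed.

End ge0_integral_sets.

Lemma norm_coord_le (R : realType) n (x : 'rV[R]_n) i : `|x 0 i| <= `|x|.
Proof.
rewrite [leRHS]/Num.norm /= mx_normrE.
by apply/bigmax_geP; right => /=; exists (0, i).
Qed.

Lemma norm_rV_le (R : realType) n (x : 'rV[R]_n) (K : R) : 0 <= K ->
  (`|x| <= K) = `[< forall i, `|x 0 i| <= K >].
Proof.
move=> K0; apply/idP/asboolP => [xK i|xK].
  exact: le_trans (norm_coord_le x i) xK.
rewrite [leLHS]/Num.norm /= mx_normrE; apply/bigmax_leP; split => // -[j i] _ /=.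
by rewrite ord1.
Qed.

Section bessel_xray.
Context {R : realType} {n : nat} {J : choiceType}.
Local Notation V := 'rV[R]_n.
Local Notation leb := (lebesgue_rV R n).
Local Notation Leb := (@lebesgue_measure R).
Local Notation T := (measurableTypeR R).
Implicit Types (x v : V) (t : R).

Variables (u0 : J -> V -> R[i]) (u : J -> V * R -> R[i]).
Hypothesis u0_orthonormal : orthonormal_L2 leb u0.
Hypothesis u_solution : forall j, schrodinger_solution (u0 j) (u j).

Let Lu0 j : square_integrable leb (u0 j). Proof. exact: u0_orthonormal.1. Qed.

Let W j (z : V * V) := wigner (u0 j) (u0 j) z.1 z.2.

Let mW j : cmeasurable (W j). Proof. exact: cmeasurable_wigner (Lu0 j).1. Qed.

Let WE j z : wigner (fun y => u j (y, 0)) (fun y => u j (y, 0)) z.1 z.2 = W j z.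
Proof. by have [_ Lu _ ae _] := u_solution j; apply: wigner_ae_eq. Qed.

Let LW j : square_integrable (leb \x leb)%E (W j).
Proof.
(* The Bessel inequality for a one-element family with coefficient 1. *)
split=> //; apply: (@le_lt_trans _ _ (\sum_(j <- [:: j]) 1 ^+ 2)%:E); last exact: ltry.
apply: le_trans (@bessel_wigner R n J u0 u0_orthonormal [:: j] (fun=> 1) isT).
by under [leRHS]eq_integral do rewrite big_seq1 mul1r.
Qed.

Lemma decaying_bessel (w : V * R -> R) (C : R) (s : seq J) : decaying w C -> uniq s ->
  (\sum_(j <- s) (\int[leb \x Leb]_z (sqnormc (u j z) * w z)%:E) ^+ 2 <=
   \int[leb \x leb]_(z in \bigcup_j [set z | W j z != 0%R])
      `| xray w z.1 (2 *: z.2) | ^+ 2)%E.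
Proof.
move=> Hw us.
(* The union over the finite list is measurable, whereas the union over all of [J] need not be;
   enlarging the domain at the end costs only monotonicity. *)
pose N := [set z | has (fun j => W j z != 0) s].
have mN : measurable N.
  rewrite /N; elim: (s) => [|j s' IH] /=.
    rewrite (_ : [set _ | _] = set0)//.
    by apply/seteqP; split.
  rewrite (_ : [set z | _] = [set z | W j z != 0] `|` [set z | has (fun j => W j z != 0) s']).
    by apply: measurableU => //; exact: cmeasurable_neq0.
  by apply/seteqP; split => z /=; [move/orP|move=> ?; apply/orP].
apply: (@le_trans _ _ (\int[(leb \x leb)%E]_(z in N) (`| xray w z.1 (2 *: z.2) | ^+ 2))%E); last first.
  apply: ge0_le_integral_set => // [z /hasP[j _ Wz]|z]; last exact: sqre_ge0.
  by exists j.
pose X := rxray w.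
have mX : measurable_fun setT X by exact: measurable_rxray Hw.
pose Y := (\int[(leb \x leb)%E]_z ((X z) ^+ 2 * \1_N z)%:E)%E.
have YE : (\int[(leb \x leb)%E]_(z in N) (`| xray w z.1 (2 *: z.2) | ^+ 2) = Y)%E.
  rewrite integral_mkcond; apply: eq_integral => z _; rewrite patchE indicE (xrayE Hw).
  case: ifP => _; last by rewrite mulr0.
  by rewrite mulr1 abse_EFin -EFin_expe real_normK// num_real.
rewrite YE; have [XN|] := boolP (Y < +oo)%E; last first.
  by rewrite -leNgt => /(le_trans _) -> //; exact: leey.
have pair j : j \in s -> exists r : R,
    (\int[(leb \x Leb)%E]_z (sqnormc (u j z) * w z)%:E = r%:E)%E /\
    [/\ cintegral (leb \x leb)%E (fun z => W j z * (X z)%:C) = r%:C,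
        cintegrable (leb \x leb)%E (fun z => W j z * (X z)%:C) &
        forall z, W j z * (X z)%:C = W j z * (X z * \1_N z)%:C].
  move=> js; have [mu Lu cu ae weak] := u_solution j.
  have WN z : wigner (fun y => u j (y, 0)) (fun y => u j (y, 0)) z.1 z.2 != 0 -> N z.
    by rewrite WE => Wz; apply/hasP; exists j.
  have LW' : square_integrable (leb \x leb)%E
      (fun z => wigner (fun y => u j (y, 0)) (fun y => u j (y, 0)) z.1 z.2).
    by under eq_fun do rewrite WE; exact: LW.
  have prop := wigner_propagation mu Lu cu weak.
  have E0f : (\int[leb]_x (sqnormc (u j (x, 0)))%:E)%E \is a fin_num.
    by rewrite ge0_fin_numE ?integral_sqnormc_ge0//; exact: (Lu 0).2.
  pose M := 4 * fine (\int[leb]_x (sqnormc (u j (x, 0)))%:E)%E.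
  have M0 : 0 <= M by rewrite mulr_ge0// fine_ge0// integral_sqnormc_ge0.
  have EM t : (\int[leb]_x (sqnormc (u j (x, t)))%:E <= M%:E)%E.
    by rewrite /M EFinM fineK//; exact: energy_le.
  have [r [r1 r2]] := energy_pairing Hw mu Lu prop M0 EM LW' mN WN XN.
  exists r; split; first exact: r1.
  split.
  - by rewrite -r2; congr cintegral; apply/funext => z; rewrite WE.
  - have := cintegrable_pairing Hw LW' mN WN XN.
    by congr cintegrable; apply/funext => z; rewrite WE.
  - move=> z; have [->|Wz] := eqVneq (W j z) 0; first by rewrite !mul0r.
    by rewrite indicE mem_set ?mulr1//; apply/hasP; exists j.
pose c j : R := fine (\int[(leb \x Leb)%E]_z (sqnormc (u j z) * w z)%:E)%E.
have cE j : j \in s -> (\int[(leb \x Leb)%E]_z (sqnormc (u j z) * w z)%:E = (c j)%:E)%E.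
  by move=> js; have [r [rE _]] := pair j js; rewrite /c rE.
pose S := \sum_(j <- s) c j ^+ 2.
have -> : (\sum_(j <- s) (\int[(leb \x Leb)%E]_z (sqnormc (u j z) * w z)%:E) ^+ 2 = S%:E)%E.
  by rewrite /S -sumEFin big_seq [RHS]big_seq; apply: eq_bigr => j js; rewrite cE// EFin_expe.
have S0 : 0 <= S by apply: sumr_ge0 => j _; exact: sqr_ge0.
pose G z := \sum_(j <- s) (c j)%:C * W j z.
have mG : cmeasurable G.
  by apply: cmeasurable_sum => j; apply: cmeasurableM => //; exact: cmeasurable_cst.
have mXN : cmeasurable (fun z => (X z * \1_N z)%:C).
  by apply: cmeasurable_real; apply: measurable_funM.
have SE : cintegral (leb \x leb)%E (fun z => G z * (X z * \1_N z)%:C) = S%:C.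
  (* The conclusions of [pair] are available for members of [s] only; extending by 0 makes every
     term integrable. *)
  pose g j z := if j \in s then (c j)%:C * (W j z * (X z)%:C) else 0.
  transitivity (cintegral (leb \x leb)%E (fun z => \sum_(j <- s) g j z)).
    congr cintegral; apply/funext => z; rewrite /G big_distrl /=.
    rewrite big_seq [RHS]big_seq; apply: eq_bigr => j js; rewrite /g js -mulrA.
    by have [r [_ [_ _ ->]]] := pair j js.
  have Ig j : cintegrable (leb \x leb)%E (g j).
    rewrite /g; case: (boolP (j \in s)) => [js|_].
      by apply: cintegrableZl; have [r [_ [_ + _]]] := pair j js.
    split; first exact: cmeasurable_cst.
    by under eq_integral do rewrite cabs0; rewrite integral0.
  rewrite cintegral_sum// /S rmorph_sum/= big_seq [RHS]big_seq.
  apply: eq_bigr => j js; rewrite /g js; have [r [r1 [r2 Ir _]]] := pair j js.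
  by rewrite cintegralZl// r2 /c r1 /= rmorphM.
have SY : (S%:E <= (1 / 2)%:E * S%:E + (1 / 2)%:E * Y)%E.
  apply: (@le_trans _ _ (\int[(leb \x leb)%E]_z (cabs (G z * (X z * \1_N z)%:C))%:E)%E).
    have := le_cabs_cintegral (leb \x leb)%E (cmeasurableM mG mXN).
    by rewrite SE cabs_real ger0_norm.
  have := integral_cabsM_le (leb \x leb)%E ltr01 mG mXN; rewrite invr1.
  move=> /le_trans; apply; apply: leeD; rewrite lee_wpmul2l//.
    exact: bessel_wigner.
  rewrite le_eqVlt; apply/orP; left; apply/eqP; apply: eq_integral => z _.
  rewrite sqnormc_real exprMn; congr ((_ * _)%:E).
  by rewrite indicE; case: (_ \in _); rewrite ?expr1n ?expr0n.
have Y0 : (0 <= Y)%E.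
  by apply: integral_ge0 => z _; rewrite lee_fin mulr_ge0 ?sqr_ge0.
(* All the coefficients are finite, so [S] is a real number and half of it can be absorbed. *)
move: SY Y0 XN {YE}; case: (Y) => // y; rewrite -!EFinM -EFinD !lee_fin => ? _ _; lra.
Qed.

(** The weight is truncated at [k] times a positive integrable profile [p], which gives decaying
    weights increasing to [w]. Monotone convergence handles the left side, and the right side for
    each truncation is at most that for [w]; infinite values are allowed throughout. *)
Lemma nonneg_bessel (w : V * R -> R) (s : seq J) :
  measurable_fun [set: V * T] w -> (forall z, 0 <= w z) -> uniq s ->
  (\sum_(j <- s) (\int[leb \x Leb]_z (sqnormc (u j z) * w z)%:E) ^+ 2 <=
   \int[leb \x leb]_(z in \bigcup_j [set z | W j z != 0%R])
      `| xray w z.1 (2 *: z.2) | ^+ 2)%E.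
Proof.
move=> mw w0 us.
pose p (z : V * R) : R := (oneDsqr z.2)^-1 * box_decay z.1.
have p0 z : 0 < p z.
  have /andP[a _] := oneDsqrV_bounds z.2; have /andP[b _] := box_decay_bounds z.1.
  exact: mulr_gt0.
have mp : measurable_fun [set: V * T] p.
  apply: measurable_funM; first exact: (measurableT_comp (@measurable_oneDsqrV R) measurable_snd).
  exact: (measurableT_comp measurable_box_decay measurable_fst).
pose w_ k z : R := Num.min (w z) (k%:R * p z).
have w_0 k z : 0 <= w_ k z by rewrite le_min w0 mulr_ge0// ltW.
have w_le k z : w_ k z <= w z by rewrite ge_min lexx.
have mw_ k : measurable_fun [set: V * T] (w_ k).
  by apply: measurable_minr => //; exact: measurable_funM.
have Hw_ k : decaying (w_ k) k%:R.
  by split=> // z; rewrite ger0_norm// ge_min lexx orbT.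
have mu j : @cmeasurable _ _ (V * T)%type (u j) by case: (u_solution j).
have m1 j k : measurable_fun [set: V * T] (fun z => (sqnormc (u j z) * w_ k z)%:E).
  by apply/measurable_EFinP; apply: measurable_funM => //; exact: measurable_sqnormc.
have c1 j : (\int[leb \x Leb]_z (sqnormc (u j z) * w_ k z)%:E)%E @[k --> \oo] -->
    (\int[leb \x Leb]_z (sqnormc (u j z) * w z)%:E)%E.
  have -> : (\int[leb \x Leb]_z (sqnormc (u j z) * w z)%:E =
      \int[leb \x Leb]_z limn (fun k => (sqnormc (u j z) * w_ k z)%:E))%E.
    apply: eq_integral => z _; apply/esym/cvg_lim => //.
    apply: cvg_near_cst; near=> k; congr ((_ * _)%:E).
    (* As [p z] is positive, the truncation is inactive once [k] exceeds [w z / p z]. *)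
    rewrite /w_ min_l// -ler_pdivrMr//; near: k; exact: nbhs_infty_ger.
  apply: cvg_monotone_convergence => //.
  - by move=> k z _; rewrite lee_fin mulr_ge0 ?sqnormc_ge0.
  - move=> z _ k l kl; rewrite lee_fin ler_wpM2l ?sqnormc_ge0//.
    by rewrite /w_ le_min2// ler_wpM2r ?ler_nat// ltW.
have i0 j k : (0 <= \int[leb \x Leb]_z (sqnormc (u j z) * w_ k z)%:E)%E.
  by apply: integral_ge0 => z _; rewrite lee_fin mulr_ge0 ?sqnormc_ge0.
have i1 j : (0 <= \int[leb \x Leb]_z (sqnormc (u j z) * w z)%:E)%E.
  by apply: integral_ge0 => z _; rewrite lee_fin mulr_ge0 ?sqnormc_ge0.
have c2 : (\sum_(j <- s) (\int[leb \x Leb]_z (sqnormc (u j z) * w_ k z)%:E) ^+ 2)%E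
    @[k --> \oo] --> (\sum_(j <- s) (\int[leb \x Leb]_z (sqnormc (u j z) * w z)%:E) ^+ 2)%E.
  apply: cvg_nnesum => j _; first by apply: nearW => k; exact: sqre_ge0.
  have := i1 j; have := c1 j.
  move: (\int[leb \x Leb]_z (sqnormc (u j z) * w z)%:E)%E => l cl l0.
  apply: (cvgeM _ cl cl); case: l l0 {cl} => [r _|_|//]; first exact: mule_def_fin.
  by [].
apply: cvge_to_le c2 _; apply: nearW => k.
apply: le_trans (decaying_bessel (Hw_ k) us) _.
apply: ge0_le_integral_set => // z; first exact: sqre_ge0.
rewrite /xray !gee0_abs; last 2 first.
- by apply: integral_ge0 => t _; rewrite lee_fin.
- by apply: integral_ge0 => t _; rewrite lee_fin.
have le : (\int[Leb]_t (w_ k (z.1 - t *: (2 *: z.2), t))%:E <=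
    \int[Leb]_t (w (z.1 - t *: (2 *: z.2), t))%:E)%E.
  apply: ge0_le_integral_set => // t; first by rewrite lee_fin.
  by rewrite lee_fin.
rewrite !expe2; apply: lee_pmul => //.
- by apply: integral_ge0 => t _; rewrite lee_fin.
- by apply: integral_ge0 => t _; rewrite lee_fin.
Unshelve. all: by end_near. Qed.

(** The [n + 1] space-time coordinates each require a factor [1 + |z|^2], and the [(n+1)]-th power
    of that is at most [2^(n+1) (1 + |z|^(2(n+1)))]. The Schwartz bounds of orders 0 and [2 (n + 1)]
    on [w] itself therefore suffice. *)
Lemma schwartz_decaying (w : V * R -> R) :
  measurable_fun [set: V * T] w -> schwartz w -> exists C, decaying w C.
Proof.
move=> mw [_ sw].
have [C0 h0] := sw [::] 0; have [C1 h1] := sw [::] (2 * n.+1)%N.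
exists (2 ^+ n.+1 * (C0 + C1)); split => // z.
have /andP[a _] := oneDsqrV_bounds z.2; have /andP[b _] := box_decay_bounds z.1.
have q0 : 0 < (oneDsqr z.2)^-1 * box_decay z.1 by exact: mulr_gt0.
rewrite -ler_pdivrMr//.
have nz2 : `|z.2| <= `|z| by rewrite [`|z|]prod_normE le_max lexx orbT.
have nz1 i : `|z.1 0 i| <= `|z|.
  apply: (@le_trans _ _ `|z.1|); last by rewrite [`|z|]prod_normE le_max lexx.
  exact: norm_coord_le.
have od (s : R) : `|s| <= `|z| -> oneDsqr s <= 1 + `|z| ^+ 2.
  move=> sz; rewrite /oneDsqr lerD2l -real_normK ?num_real//.
  by rewrite ler_pXn2r ?nnegrE.
have invE : ((oneDsqr z.2)^-1 * box_decay z.1)^-1 <= (1 + `|z| ^+ 2) ^+ n.+1.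
  rewrite invfM invrK exprS ler_pM//.
  - by rewrite invr_ge0 ltW.
  - exact: od.
  - rewrite /box_decay -prodfV; under eq_bigr do rewrite invrK.
    rewrite -[n in _ ^+ n]card_ord -prodr_const; apply: ler_prod => i _.
    by rewrite od// andbT ltW// -invr_gt0; case/andP: (oneDsqrV_bounds (z.1 0 i)).
have pw : (1 + `|z| ^+ 2) ^+ n.+1 <= 2 ^+ n.+1 * (1 + `|z| ^+ (2 * n.+1)%N).
  rewrite exprM; set r := `|z| ^+ 2; have r0 : 0 <= r by exact: sqr_ge0.
  have rn0 : 0 <= r ^+ n.+1 by exact: exprn_ge0.
  have [r1|r1] := leP r 1.
    apply: (@le_trans _ _ (2 ^+ n.+1)); last by rewrite ler_peMr ?exprn_ge0// lerDl.
    by rewrite ler_pXn2r ?nnegrE ?addr_ge0//; lra.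
  apply: (@le_trans _ _ ((2 * r) ^+ n.+1)).
    by rewrite ler_pXn2r ?nnegrE ?addr_ge0 ?mulr_ge0//; lra.
  by rewrite exprMn ler_wpM2l ?exprn_ge0// lerDr.
apply: le_trans (_ : `|w z| * (2 ^+ n.+1 * (1 + `|z| ^+ (2 * n.+1)%N)) <= _).
  by rewrite ler_wpM2l// (le_trans invE).
have := h0 z; have := h1 z; rewrite /= expr0 mul1r => h1z h0z.
rewrite mulrCA ler_wpM2l ?exprn_ge0// mulrDr mulr1.
by rewrite lerD// mulrC.
Qed.

Lemma weight_bessel (w : V * R -> R) (s : seq J) : weight w -> uniq s ->
  (\sum_(j <- s) (\int[leb \x Leb]_z (sqnormc (u j z) * w z)%:E) ^+ 2 <=
   \int[leb \x leb]_(z in \bigcup_j [set z | W j z != 0%R])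
      `| xray w z.1 (2 *: z.2) | ^+ 2)%E.
Proof.
move=> [mw _ [w0|sw]] us; first exact: nonneg_bessel.
by have [C Hw] := schwartz_decaying mw sw; exact: decaying_bessel Hw us.
Qed.

(** The sum over [J] is a supremum over finite subsets, and the right-hand side does not depend on
    the subset. *)
Lemma esum_weight_bessel (w : V * R -> R) : weight w ->
  (\esum_(j in [set: J]) (\int[leb \x Leb]_z (sqnormc (u j z) * w z)%:E) ^+ 2 <=
   \int[leb \x leb]_(z in \bigcup_j [set z | W j z != 0%R])
      `| xray w z.1 (2 *: z.2) | ^+ 2)%E.
Proof.
move=> ww; apply: ge_ereal_sup => _ [A [fA _] <-].
rewrite fsbig_finite//=; apply: weight_bessel => //.
Qed.

End bessel_xray.

(** * Supports *)

Section essential_support.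
Context {R : realType} {n : nat}.
Local Notation V := 'rV[R]_n.
Local Notation leb := (lebesgue_rV R n).
Implicit Types (f : V -> R[i]) (x v : V).

(** Balls with rational centre and radius [1 / (m + 1)]: a countable base, indexed by a countable
    type so that it can be enumerated by [pickle]. *)
Let qball (p : 'rV[rat]_n * nat) : set V :=
  ball (map_mx (@ratr R) p.1) p.2.+1%:R^-1.

Let qball_small (x : V) (U : set V) : open U -> U x ->
  exists p, qball p x /\ qball p `<=` U.
Proof.
move=> oU Ux; have /nbhs_ballP[e /= e0 eU] : nbhs x U by exact: open_nbhs_nbhs.
(* Half of [e], because the centre is itself within the radius of [x] and the ball reaches as far
   again. *)
have [m me] : exists m : nat, m.+1%:R^-1 < e / 2.
  have := @cvg_harmonic R; move=> /cvgrPdist_lt /(_ (e / 2)) [|m _ hm].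
    by rewrite divr_gt0.
  exists m; have := hm m (leqnn m).
  by rewrite /= sub0r normrN ger0_norm// invr_ge0.
have m0 : 0 < m.+1%:R^-1 :> R by rewrite invr_gt0.
have qi i : exists q : rat, x 0 i - m.+1%:R^-1 < ratr q < x 0 i + m.+1%:R^-1.
  have [|q] := @rat_in_itvoo R (x 0 i - m.+1%:R^-1) (x 0 i + m.+1%:R^-1).
    by rewrite ltrD2l gt0_cp.
  by rewrite in_itv/= => h; exists q.
pose q := \row_i xchoose (qi i).
have qx : ball x m.+1%:R^-1 (map_mx (@ratr R) q).
  split => // i j; rewrite /ball /= !mxE ord1.
  by rewrite ltr_distlC; exact: xchooseP (qi j).
exists (q, m); split; first by rewrite /qball; exact: ball_sym.
move=> y qy; apply: eU; have := ball_triangle qx qy; apply: le_ball.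
by rewrite /= (splitr e); exact: lerD (ltW me) (ltW me).
Qed.

(** The complement of the essential support is a union of open sets on which [f] vanishes almost
    everywhere. The union may be uncountable, so it is refined to the countably many rational balls
    with this property. *)
Lemma negligible_off_esupp f :
  leb.-negligible (~` esupp f `&` [set y | f y != 0]).
Proof.
pose bad p := qball p `&` [set y | f y != 0].
pose F (k : nat) : set V := if unpickle k is Some p then
  (if `[< leb.-negligible (bad p) >] then bad p else set0) else set0.
have nF : leb.-negligible (\bigcup_k F k).
  apply: negligible_bigcup => k; rewrite /F; case: (unpickle k) => [p|]; last exact: negligible_set0.
  by case: ifPn => [/asboolP//|_]; exact: negligible_set0.
apply: negligibleS nF => x [Ex fx].
have [U [oU Ux nU]] : exists U, [/\ open U, U x &
    leb.-negligible (U `&` [set y | f y != 0])].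
  apply: contrapT => h; apply: Ex => U oU Ux nU; apply: h; by exists U.
have [p [px pU]] := qball_small oU Ux.
exists (pickle p) => //; rewrite /F pickleK ifT; first by split.
by apply/asboolP; apply: negligibleS nU; exact: setSI.
Qed.

(** Changing [f] on a null set to [h] leaves the Wigner distribution unchanged and makes [h] vanish
    at every point off [esupp f]. A nonzero integral needs some [y] with both [x + y/2] and
    [x - y/2] in that set, and [x] is their midpoint. *)
Lemma wigner_esupp f x v : square_integrable leb f -> wigner f f x v != 0 ->
  midpoints (esupp f) x.
Proof.
move=> Lf Wn0; have [N [mN N0 subN]] := negligible_off_esupp f.
pose h y := if y \in N then 0 else f y.
have mh : cmeasurable h.
  have E y : h y = (\1_(~` N) y : R)%:C * f y.
    rewrite /h indicE in_setC; case: (y \in N) => /=; first by rewrite mul0r.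
    by rewrite mul1r.
  rewrite (_ : h = fun y => (\1_(~` N) y : R)%:C * f y); last by apply/funext.
  apply: cmeasurableM; last exact: Lf.1.
  by apply: cmeasurable_real; apply: measurable_indic; exact: measurableC.
have Lh : square_integrable leb h.
  apply: (L2_le (r := fun y => sqnormc (f y))) => //.
  - by apply: measurable_sqnormc; exact: Lf.1.
  - by move=> y; rewrite /h; case: ifP => // _; rewrite sqnormc0 sqnormc_ge0.
  - exact: Lf.2.
have fh : {ae leb, forall y, f y = h y}.
  exists N; split => // y /= fhy; apply: contrapT => Ny; apply: fhy.
  by rewrite /h memNset.
rewrite (wigner_ae_eq x v Lf Lh fh) in Wn0.
have [[y /andP[hy1 hy2]]|none] := pselect (exists y,
    (h (x + 2^-1 *: y) != 0) && (h (x - 2^-1 *: y) != 0)); last first.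
  move/eqP: Wn0; case; rewrite /wigner.
  rewrite (_ : (fun y => _) = fun=> 0); first exact: cintegral0.
  apply/funext => y; apply: contrapT => /eqP; rewrite !mulf_eq0 conjc_eq0 !negb_or.
  by move=> /andP[/andP[h1 h2] _]; apply: none; exists y; rewrite h1 h2.
have ess a : h a != 0 -> esupp f a.
  rewrite /h; case: (boolP (a \in N)) => [_|/negP aN fa]; first by rewrite eqxx.
  apply: contrapT => Ea; apply: aN; rewrite inE; apply: subN; split => //.
exists (x + 2^-1 *: y), (x - 2^-1 *: y); split; [exact: ess|exact: ess|].
by apply/rowP => i; rewrite !mxE; field.
Qed.

Let trunc f (k : nat) x : R[i] := if `|x| <= k%:R then f x else 0.

Let truncE f k x : trunc f k x = (\1_(cube k%:R) x : R)%:C * f x.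
Proof.
rewrite /trunc norm_rV_le// indicE (_ : (x \in cube k%:R) = `[< forall i, `|x 0 i| <= k%:R >]).
  by case: `[< _ >]; rewrite ?mul1r ?mul0r.
by apply/idP/asboolP => [/set_mem//|h]; exact/mem_set.
Qed.

(** The truncations of [f] lie in L1 and L2, where [wigner_fourier] holds. Their transforms tend to
    [g] in L2 by the definition of [fourier_L2], and both sides pass to the limit by continuity of
    the Wigner distribution. *)
Lemma wigner_plancherel f g x v : square_integrable leb f -> fourier_L2 f g ->
  wigner f f x v = wigner g g v (- x).
Proof.
move=> Lf [Lg fg].
have mc (k : nat) : measurable_fun setT (fun x : V => (\1_(cube k%:R) x : R)).
  exact: measurable_indic (measurable_cube _).
have tE k : trunc f k = fun x => (\1_(cube k%:R) x : R)%:C * f x by apply/funext => y; exact: truncE.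
have L1c (k : nat) : square_integrable leb (fun x : V => (\1_(cube k%:R) x : R)%:C).
  apply: (L2_box (C := 1) (A := k%:R)) => // [y|y i ky].
    by rewrite ger0_norm// indicE; case: (_ \in _).
  by rewrite indicE memNset// => /(_ i); rewrite leNgt ky.
have It k : cintegrable leb (trunc f k) by rewrite tE; exact: L2_cintegrableM.
have tle k y : sqnormc (trunc f k y) <= sqnormc (f y).
  by rewrite /trunc; case: ifP => // _; rewrite sqnormc0 sqnormc_ge0.
have Lt k : square_integrable leb (trunc f k).
  apply: (L2_le (r := fun y => sqnormc (f y))) => //; first exact: (It k).1.
    by apply: measurable_sqnormc; exact: Lf.1.
  exact: Lf.2.
have tf : sqdist leb (trunc f k) f @[k --> \oo] --> 0%E.
  apply: (cvg_sqdist (r := fun y => 4 * sqnormc (f y))).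
  - by move=> k; exact: (Lt k).1.
  - exact: Lf.1.
  - apply: aeW => y; apply: cvg_near_cst; near=> k.
    rewrite /trunc ifT ?subrr ?cabs0//; near: k; exact: nbhs_infty_ger.
  - by apply: measurable_funM => //; apply: measurable_sqnormc; exact: Lf.1.
  - move=> k y; apply: le_trans (sqnormcB_le _ _) _.
    by have := tle k y; lra.
  - under eq_integral do rewrite EFinM.
    rewrite ge0_integralZl//.
    + by rewrite lte_mul_pinfty//; exact: Lf.2.
    + by apply: emeasurable_sqnormc; exact: Lf.1.
    + by move=> y _; rewrite lee_fin sqnormc_ge0.
have c1 := cvg_wigner x v Lt Lf tf.
have LF k : square_integrable leb (fourier (trunc f k)) by exact: square_integrable_fourier.
have c2 := cvg_wigner v (- x) LF Lg fg.
have E k : wigner (trunc f k) (trunc f k) x v =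
    wigner (fourier (trunc f k)) (fourier (trunc f k)) v (- x) by exact: wigner_fourier.
apply: (@cvg_cabs_unique R (fun k => wigner (trunc f k) (trunc f k) x v)); first exact: c1.
by under eq_fun do rewrite E; exact: c2.
Unshelve. all: by end_near. Qed.

Lemma wigner_support f g : square_integrable leb f -> fourier_L2 f g ->
  [set z | wigner f f z.1 z.2 != 0] `<=` midpoints (esupp f) `*` midpoints (esupp g).
Proof.
move=> Lf fg [x v] /= Wn0; split; first exact: wigner_esupp Lf Wn0.
by move: Wn0; rewrite (wigner_plancherel x v Lf fg) => /wigner_esupp; apply; case: fg.
Qed.

End essential_support.

Lemma closure_setX (X Y : topologicalType) (A : set X) (B : set Y) :
  closure (A `*` B) `<=` closure A `*` closure B.
Proof.
move=> [x y] cl; split => /= U Uz.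
  have nU : nbhs (x, y) (U `*` setT).
    by exists (U, setT) => //; split => //; exact: filterT.
  by have [[a b] [[Aa _] [/= Ua _]]] := cl _ nU; exists a.
have nU : nbhs (x, y) (setT `*` U).
  by exists (setT, U) => //; split => //; exact: filterT.
by have [[a b] [[_ Bb] [/= _ Ub]]] := cl _ nU; exists b.
Qed.

Theorem theorem1p4 (R : realType) (d : nat) (d_gt0 : (0 < d)%N)
    (J : choiceType) (u0 : J -> 'rV[R]_d -> R[i])
    (u : J -> 'rV[R]_d * R -> R[i]) (w : 'rV[R]_d * R -> R)
    (u0_orthonormal : orthonormal_L2 (lebesgue_rV R d) u0)
    (u_solution : forall j, schrodinger_solution (u0 j) (u j))
    (w_weight : weight w) :
  let W := fun j (z : 'rV[R]_d * 'rV[R]_d) => wigner (u0 j) (u0 j) z.1 z.2 in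
  let M := \bigcup_j closure [set z | W j z != 0] in
  let M' := \bigcup_j [set z | W j z != 0] in
  let lhs := (\esum_(j in [set: J])
    (\int[lebesgue_rV R d \x lebesgue_measure]_z (sqnormc (u j z) * w z)%:E) ^+ 2)%E in
  let rhs := fun A : set ('rV[R]_d * 'rV[R]_d) =>
    (\int[lebesgue_rV R d \x lebesgue_rV R d]_(z in A)
       `| xray w z.1 (2 *: z.2) | ^+ 2)%E in
  [/\ (lhs <= rhs M)%E,
      (lhs <= rhs M')%E &
      forall uhat : J -> 'rV[R]_d -> R[i],
        (forall j, fourier_L2 (u0 j) (uhat j)) ->
        M' `<=` \bigcup_j (midpoints (esupp (u0 j)) `*`
                           midpoints (esupp (uhat j))) /\
        M `<=` \bigcup_j (closure (midpoints (esupp (u0 j))) `*`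
                          closure (midpoints (esupp (uhat j))))].
Proof.
move=> W M M' lhs rhs.
(* The estimate on [M'] is the stronger one; the closures only enlarge the domain of a nonnegative
   integrand. *)
have M'M : M' `<=` M by move=> z [j _ Wz]; exists j => //; exact: subset_closure.
have lhsM' : (lhs <= rhs M')%E by exact: esum_weight_bessel.
split=> //.
  by apply: le_trans lhsM' _; apply: ge0_le_integral_set => // z; exact: sqre_ge0.
move=> uhat uhatP; have supp j := wigner_support (u0_orthonormal.1 j) (uhatP j).
split => z [j _ zj]; exists j => //; first exact: supp.
by apply: closure_setX; apply: closureS zj; exact: supp.
Qed.
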